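(* Let $q\ge 1$ and $t\in\mathbb{R}_+^q$. As $N\to\infty$, the family $(\operatorname{Tr}(w_t^N)-N\varphi_t(w))_{w\in W_q}$ converges (in the sense of finite-dimensional distributions) towards the centered (complex-valued) Gaussian field $(\phi_w)_{w\in W_q}$ such that for any $w,w'\in W_q$, $\operatorname{cov}(\phi_w,\phi_{w'})=\mathbb{E}[\phi_w\phi_{w'}]=\varphi_t(w,w')$.
   Context: Unitary Brownian motion: on the space $\mathfrak{u}(N)$ of skew-Hermitian matrices put $\langle X,Y\rangle=-N\operatorname{Tr}(XY)$, let $(K_t)$ be the standard Brownian motion on $(\mathfrak{u}(N),\langle\cdot,\cdot\rangle)$; the $U(N)$-Brownian motion solves the Itô equation $dU_t=U_t\,dK_t-\frac12U_t\,dt$, $U_0=\mathrm{Id}$. Let $(U_{1,s})_{s\ge0},\dots,(U_{q,s})_{s\ge0}$ be independent $U(N)$-Brownian motions. $W_q$ is the monoid of (unreduced) words in the letters $x_1^{\pm1},\dots,x_q^{\pm1}$. For $w=x_{i_1}^{\epsilon_1}\cdots x_{i_n}^{\epsilon_n}$ and $t\in\mathbb{R}_+^q$, $w_t^N=U_{i_1,t_{i_1}}^{\epsilon_1}\cdots U_{i_n,t_{i_n}}^{\epsilon_n}$. $\varphi_t(w)=\lim_{N\to\infty}\frac1N\mathbb{E}[\operatorname{Tr}(w_t^N)]$ and $\varphi_t(w,w')=\lim_{N\to\infty}\left(\mathbb{E}[\operatorname{Tr}(w_t^N)\operatorname{Tr}(w_t'^N)]-\mathbb{E}[\operatorname{Tr}(w_t^N)]\mathbb{E}[\operatorname{Tr}(w_t'^N)]\right)$;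 these limits exist. Covariances are bilinear (no complex conjugation); note that $\overline{\operatorname{Tr}(w_t^N)}$ is the trace of the word obtained by reversing $w$ and inverting its letters. *)

(* Defs.v *)
From HB Require Import structures.
From mathcomp Require Import all_boot all_order all_algebra.
From mathcomp Require Import all_classical all_reals all_analysis.
From mathcomp Require Import complex.
Set Implicit Arguments.
Unset Strict Implicit.
Unset Printing Implicit Defensive.
Import Order.TTheory GRing.Theory Num.Theory.
Import numFieldNormedType.Exports.
Local Open Scope classical_set_scope.
Local Open Scope ring_scope.
Local Open Scope complex_scope.
Local Open Scope sesquilinear_scope.

(* MathComp-Analysis provides neither a topology nor a measurable structure on
   R[i]: limits, expectations, continuity and measurability of complex
   quantities are expressed through real and imaginary parts. *)

Section Complex.
Context {R : realType}.
Local Notation C := R[i].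

Definition clim (u : nat -> C) : C :=
  lim (complex.Re (u n) @[n --> \oo]) +i* lim (complex.Im (u n) @[n --> \oo]).

Context d (T : measurableType d) (P : probability T R).

Definition Cexp (Z : T -> C) : C :=
  fine ('E_P[fun x => complex.Re (Z x)])%E +i*
  fine ('E_P[fun x => complex.Im (Z x)])%E.

(* bilinear: no conjugation *)
Definition Ccov (Z Z' : T -> C) : C :=
  Cexp (fun x => Z x * Z' x) - Cexp Z * Cexp Z'.

(* the sigma-algebra generated by the complex random variables in D *)
Definition sigma_of (D : set (T -> C)) : set (set T) :=
  <<s [set A | exists (f : T -> C) (B : set R), [/\ D f, measurable B &
        A = [set x | B (complex.Re (f x))] \/
        A = [set x | B (complex.Im (f x))]] ]>>.

Definition entries N (M : T -> 'M[C]_N) : set (T -> C) :=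
  [set f | exists i j, f = fun x => M x i j].

(* X has law N(m, s^2); the library's normal_prob m 0 is not the point mass
   at m, so the degenerate case is separated. *)
Definition gaussian_law (X : T -> R) (m s : R) : Prop :=
  measurable_fun setT X /\
  forall B : set R, measurable B ->
    P (X @^-1` B) = (if s == 0 then \d_m B else normal_prob m s B).

(* Joint Gaussianity of the real and imaginary parts: every real linear
   functional of (Phi_(w 0), ..., Phi_(w n.-1)) is of the form
   Re (\sum_k c_k Phi_(w k)). *)
Definition centered_gaussian_field (J : Type) (Phi : J -> T -> C) : Prop :=
  forall n (w : 'I_n -> J) (c : 'I_n -> C), exists2 s : R, 0 <= s &
    gaussian_law (fun x => complex.Re (\sum_(k < n) c k * Phi (w k) x)) 0 s.

End Complex.

(* Convergence in law of all finite-dimensional marginals, tested against the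
   bounded continuous functions on C^n = R^n x R^n. *)
Definition fdd_cvg {R : realType} (J : Type)
    (d : nat -> measure_display) (T : forall N, measurableType (d N))
    (P : forall N, probability (T N) R) (X : forall N, J -> T N -> R[i])
    (d' : measure_display) (T' : measurableType d') (Q : probability T' R)
    (Phi : J -> T' -> R[i]) : Prop :=
  forall n (w : 'I_n -> J) (f : 'rV[R]_n * 'rV[R]_n -> R),
    continuous f -> (exists M : R, forall z, `|f z| <= M) ->
    ('E_(P N)[fun x => f (\row_k complex.Re (X N (w k) x),
                          \row_k complex.Im (X N (w k) x))])%E @[N --> \oo] -->
    ('E_Q[fun x => f (\row_k complex.Re (Phi (w k) x),
                      \row_k complex.Im (Phi (w k) x))])%E.

Section UnitaryBrownianMotion.
Context {R : realType} d (T : measurableType d) (P : probability T R).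
Variable N : nat.
Local Notation C := R[i].
Local Notation M := 'M[C]_N.

Definition skew_hermitian (X : M) : Prop := X ^t* = - X.

(* - N Tr (X Y); the trace is real when X and Y are skew-Hermitian *)
Definition uN_inner (X Y : M) : R := - N%:R * complex.Re (\tr (X *m Y)).

Definition filtration (F : R -> set (set T)) : Prop :=
  [/\ forall s, 0 <= s -> sigma_algebra setT (F s),
      forall s, 0 <= s -> F s `<=` measurable &
      forall s u, 0 <= s -> s <= u -> F s `<=` F u].

Definition adapted (F : R -> set (set T)) (X : R -> T -> M) : Prop :=
  forall s, 0 <= s -> sigma_of (entries (X s)) `<=` F s.

Definition continuous_paths (X : R -> T -> M) : Prop :=
  forall x i j,
    {within `[0, +oo[, continuous (fun s => complex.Re (X s x i j))} /\
    {within `[0, +oo[, continuous (fun s => complex.Im (X s x i j))}.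

(* Standard F-Brownian motion on the Euclidean space of skew-Hermitian
   matrices: the increment over [s, u] is independent of F_s and centered
   Gaussian with covariance (u - s) times the identity, i.e. its inner product
   with X has variance (u - s) <X, X>. *)
Definition uN_brownian (F : R -> set (set T)) (K : R -> T -> M) : Prop :=
  [/\ forall s x, 0 <= s -> skew_hermitian (K s x),
      forall x, K 0 x = 0,
      continuous_paths K,
      adapted F K &
      forall s u, 0 <= s -> s < u ->
        (forall A B, F s A ->
           sigma_of (entries (fun x => K u x - K s x)) B ->
           P (A `&` B) = (P A * P B)%E) /\
        (forall X, skew_hermitian X ->
           gaussian_law P (fun x => uN_inner X (K u x - K s x)) 0
             (Num.sqrt ((u - s) * uN_inner X X)))].

Definition sqnorm (A : M) : R :=
  \sum_i \sum_j (complex.Re (A i j) ^+ 2 + complex.Im (A i j) ^+ 2).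

(* The elementary process
   \sum_(k < step_size) step_val k * 1_(]step_time k, step_time k.+1]). *)
Record step_process := StepProcess {
  step_size : nat;
  step_time : nat -> R;
  step_val : nat -> T -> M }.

Definition adapted_step (F : R -> set (set T)) (t : R) (H : step_process) :=
  [/\ forall k, (k <= step_size H)%N -> 0 <= step_time H k <= t,
      forall k, (k < step_size H)%N -> step_time H k <= step_time H k.+1,
      forall k, (k < step_size H)%N ->
        sigma_of (entries (step_val H k)) `<=` F (step_time H k) &
      exists c : R, forall k x, (k < step_size H)%N ->
        sqnorm (step_val H k x) <= c].

Definition step_eval (H : step_process) (s : R) (x : T) : M :=
  \sum_(k < step_size H)
    if step_time H k < s <= step_time H k.+1 then step_val H k x else 0.

Definition step_integral (H : step_process) (K : R -> T -> M) (x : T) : M :=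
  \sum_(k < step_size H)
    step_val H k x *m (K (step_time H k.+1) x - K (step_time H k) x).

(* I is (a version of) the Ito integral of H dK over [0, t]: the L^2 limit of
   the integrals of bounded adapted elementary processes that approximate H in
   L^2(ds x P). Meant for H adapted with continuous paths, so that all the
   integrands below are measurable. *)
Definition is_ito_integral (F : R -> set (set T)) (K : R -> T -> M) (t : R)
    (H : R -> T -> M) (I : T -> M) : Prop :=
  exists S : nat -> step_process,
    [/\ forall n, adapted_step F t (S n),
        (\int[@lebesgue_measure R]_(s in `[0%R, t])
           'E_P[fun x => sqnorm (step_eval (S n) s x - H s x)])%E
          @[n --> \oo] --> 0%E &
        ('E_P[fun x => sqnorm (step_integral (S n) K x - I x)])%E
          @[n --> \oo] --> 0%E].

Definition time_integral (X : R -> T -> M) (t : R) (x : T) : M :=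
  \matrix_(i, j)
    ((\int[@lebesgue_measure R]_(s in `[0, t]) complex.Re (X s x i j)) +i*
     (\int[@lebesgue_measure R]_(s in `[0, t]) complex.Im (X s x i j))).

Definition unitary_brownian (U : R -> T -> M) : Prop :=
  exists (F : R -> set (set T)) (K : R -> T -> M),
    [/\ filtration F, uN_brownian F K & adapted F U] /\
    [/\ forall s x, 0 <= s -> U s x \is unitarymx,
        forall x, U 0 x = 1%:M,
        continuous_paths U &
        forall t, 0 <= t ->
          exists2 I : T -> M, is_ito_integral F K t U I &
            {ae P, forall x,
               U t x = 1%:M + I x - 2^-1 *: time_integral U t x}].

Definition independent_processes q (U : 'I_q -> R -> T -> M) : Prop :=
  forall A : 'I_q -> set T,
    (forall i, sigma_of (\bigcup_(s in `[0, +oo[) entries (U i s)) (A i)) ->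
    P (\bigcap_i A i) = (\prod_(i < q) P (A i))%E.

End UnitaryBrownianMotion.

(* (i, true) is the letter x_i and (i, false) the letter x_i^-1 *)
Definition word (q : nat) := seq ('I_q * bool).

Definition word_mx {R : realType} T q N (U : 'I_q -> R -> T -> 'M[R[i]]_N)
    (t : 'I_q -> R) (w : word q) (x : T) : 'M[R[i]]_N :=
  \big[mulmx/1%:M]_(l <- w)
    if l.2 then U l.1 (t l.1) x else invmx (U l.1 (t l.1) x).

Section LimitFunctionals.
Context {R : realType} (q : nat) (d : nat -> measure_display)
  (T : forall N, measurableType (d N)) (P : forall N, probability (T N) R)
  (U : forall N, 'I_q -> R -> T N -> 'M[R[i]]_N) (t : 'I_q -> R).

Definition word_tr (N : nat) (w : word q) (x : T N) : R[i] :=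
  \tr (word_mx (@U N) t w x).

Definition phi1 (w : word q) : R[i] :=
  clim (fun N => N%:R^-1 * Cexp (P N) (@word_tr N w)).

Definition phi2 (w w' : word q) : R[i] :=
  clim (fun N => Ccov (P N) (@word_tr N w) (@word_tr N w')).

End LimitFunctionals.

(* Main.v *)
(* Put a(l, w) = E[N^-1 Tr w] and y_w = Tr w - E[Tr w], the Brownian motions being
   taken at the times l t, 0 <= l <= 1. By Ito's formula the expectations
   E[y_(w_1) ... y_(w_k)] solve in l a system of differential equations: the drift
   of Tr w splits w in two words, and the bracket of Tr w and Tr w' merges them.
   Merged words are longer, but they enter through a, which is bounded by 1, or
   with a factor 1/N that compensates the trivial bound |y_w| <= 2 N. Hence
   Gronwall's lemma on the words of bounded length yields, in turn, that the moments
   are bounded uniformly in N, that the a(l, w) are Cauchy in N at rate N^-2 and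
   the moments at rate N^-1, and that the defect in Wick's recursion,
   E[y_w y_(w_1) ... y_(w_k)] - sum_j E[y_w y_(w_j)] E[prod_(i <> j) y_(w_i)],
   which vanishes at l = 0, is O(1/N). Hence the limits of the moments are
   Gaussian; they give the characteristic functions, and these the convergence in
   law. The limit field is a triangular (Cholesky) combination of independent
   standard Gaussian variables, the increments over [n, n + 1] of a Brownian motion
   driving U(1). *)

Require Import Defs.
From HB Require Import structures.
From mathcomp Require Import all_boot all_order all_algebra.
From mathcomp Require Import all_classical all_reals all_analysis.
From mathcomp Require Import measurable_realfun complex zify ring lra.
Import Order.TTheory GRing.Theory Num.Theory.
Import numFieldNormedType.Exports.
Local Open Scope classical_set_scope.
Local Open Scope ring_scope.
Local Open Scope complex_scope.
Set Implicit Arguments.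
Unset Strict Implicit.
Unset Printing Implicit Defensive.
Local Open Scope sesquilinear_scope.

(** * Complex-valued expectations and independence *)

Section ComplexModulus.
Context {R : realType}.
Local Notation C := R[i].
Implicit Types z w : C.

(** Only expectations are ever differentiated. The stochastic integral is given as an [L^2] limit of
    elementary integrals, so no pathwise calculus is built: over a short interval a functional is
    expanded into a part linear in the noise, a drift, and remainders small in mean square or when
    tested against the past ([jet]). This form survives products, and expectations then satisfy
    Euler equations up to order 3/2 in the step ([euler]), enough for Gronwall.

    The obstacle to uniform bounds is to close the estimates within one word length. The positive
    quantities [E|y_w|^(2k)] are themselves moments of the hierarchy, since conjugating a trace
    flips the word, and they dominate the moments of all lists of at most [2k] words.

    The rate [N^-2] for the normalised means is forced by the centring: the deterministic bias
    [N * (a - phi)] has to vanish. The limits never use [N = 0], where the matrices are empty. As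
    the probability spaces vary with [N], the limit field cannot be a limit of random variables; it
    is rebuilt from its covariance on the space of index 1. *)

Definition cabs z : R := complex.Re `|z|.

Lemma cabsE z : cabs z = Num.sqrt (complex.Re z ^+ 2 + complex.Im z ^+ 2).
Proof. by case: z. Qed.

Lemma cabsC z : (cabs z)%:C = `|z|.
Proof. by case: z. Qed.

Lemma cabs_sq z : cabs z ^+ 2 = complex.Re z ^+ 2 + complex.Im z ^+ 2.
Proof. by rewrite cabsE sqr_sqrtr // addr_ge0 ?sqr_ge0. Qed.

Lemma cabs_ge0 z : 0 <= cabs z.
Proof. by rewrite cabsE sqrtr_ge0. Qed.

Lemma ler_cabsD z w : cabs (z + w) <= cabs z + cabs w.
Proof. by rewrite -lecR rmorphD /= !cabsC ler_normD. Qed.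

Lemma cabsM z w : cabs (z * w) = cabs z * cabs w.
Proof. by apply: complexI; rewrite rmorphM /= !cabsC normrM. Qed.

Lemma cabsN z : cabs (- z) = cabs z.
Proof. by apply: complexI; rewrite !cabsC normrN. Qed.

Lemma cabs0 : cabs 0 = 0.
Proof. by apply: complexI; rewrite cabsC normr0. Qed.

Lemma cabs1 : cabs 1 = 1.
Proof. by apply: complexI; rewrite cabsC normr1. Qed.

Lemma ler_cabsB z w : cabs (z - w) <= cabs z + cabs w.
Proof. by rewrite -(cabsN w) ler_cabsD. Qed.

Lemma cabs_le_dist z w : cabs z <= cabs w + cabs (z - w).
Proof. by have := ler_cabsD w (z - w); rewrite addrC subrK. Qed.

Lemma cabs_real (x : R) : cabs x%:C = `|x|.
Proof. by rewrite cabsE /= expr0n addr0 sqrtr_sqr. Qed.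

Lemma cabs_conj z : cabs (z^*) = cabs z.
Proof. by case: z => a b; rewrite !cabsE /= sqrrN. Qed.

Lemma ler_cabs_sum I (r : seq I) (P : pred I) (F : I -> C) :
  cabs (\sum_(i <- r | P i) F i) <= \sum_(i <- r | P i) cabs (F i).
Proof.
elim/big_rec2 : _ => [|i x y _ H]; first by rewrite cabs0.
by rewrite (le_trans (ler_cabsD _ _))// lerD2l.
Qed.

Lemma cabs_prod I (r : seq I) (P : pred I) (F : I -> C) :
  cabs (\prod_(i <- r | P i) F i) = \prod_(i <- r | P i) cabs (F i).
Proof. by elim/big_rec2 : _ => [|i x y _ <-]; rewrite ?cabs1 ?cabsM. Qed.

Lemma cabsX z n : cabs (z ^+ n) = cabs z ^+ n.
Proof. by elim: n => [|n IH]; rewrite ?expr0 ?cabs1 // !exprS cabsM IH. Qed.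

Lemma ler_Re_cabs z : `|complex.Re z| <= cabs z.
Proof.
by rewrite cabsE -(sqrtr_sqr (complex.Re z)) ler_wsqrtr // lerDl sqr_ge0.
Qed.

Lemma ler_Im_cabs z : `|complex.Im z| <= cabs z.
Proof.
by rewrite cabsE -(sqrtr_sqr (complex.Im z)) ler_wsqrtr // lerDr sqr_ge0.
Qed.

Lemma ler_cabs_ReIm z : cabs z <= `|complex.Re z| + `|complex.Im z|.
Proof.
rewrite -(ler_pXn2r (n := 2)) ?nnegrE ?addr_ge0 ?cabs_ge0 //.
rewrite cabs_sq sqrrD !real_normK ?num_real // lerD2r lerDl.
by rewrite mulrn_wge0 // mulr_ge0.
Qed.

Lemma cabs_eq0 z : cabs z = 0 -> z = 0.
Proof. by move=> /(congr1 (@real_complex_def R (Phant R))); rewrite cabsC => /normr0_eq0. Qed.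

Lemma ReD z w : complex.Re (z + w) = complex.Re z + complex.Re w.
Proof. by case: z w => ? ? []. Qed.
Lemma ImD z w : complex.Im (z + w) = complex.Im z + complex.Im w.
Proof. by case: z w => ? ? []. Qed.
Lemma ReN z : complex.Re (- z) = - complex.Re z.
Proof. by case: z. Qed.
Lemma ImN z : complex.Im (- z) = - complex.Im z.
Proof. by case: z. Qed.
Lemma ReB z w : complex.Re (z - w) = complex.Re z - complex.Re w.
Proof. by rewrite ReD ReN. Qed.
Lemma ImB z w : complex.Im (z - w) = complex.Im z - complex.Im w.
Proof. by rewrite ImD ImN. Qed.
Lemma ReM z w :
  complex.Re (z * w) = complex.Re z * complex.Re w - complex.Im z * complex.Im w.
Proof. by case: z w => ? ? []. Qed.
Lemma ImM z w :
  complex.Im (z * w) = complex.Re z * complex.Im w + complex.Im z * complex.Re w.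
Proof. by case: z w => ? ? [] c d /=. Qed.
Lemma Re_conj z : complex.Re (z^*) = complex.Re z.
Proof. by case: z. Qed.
Lemma Im_conj z : complex.Im (z^*) = - complex.Im z.
Proof. by case: z. Qed.

Lemma Re_sum I (r : seq I) (P : pred I) (F : I -> C) :
  complex.Re (\sum_(i <- r | P i) F i) = \sum_(i <- r | P i) complex.Re (F i).
Proof. by elim/big_rec2 : _ => [//|i x y _ <-]; rewrite ReD. Qed.
Lemma complex_ext z w :
  complex.Re z = complex.Re w -> complex.Im z = complex.Im w -> z = w.
Proof. by case: z w => ? ? [] ? ? /= -> ->. Qed.

Lemma mul_conj_cabs z : z * z^* = (cabs z ^+ 2)%:C.
Proof.
apply: complex_ext; rewrite ?cabs_sq ?ReM ?ImM ?Re_conj ?Im_conj /=; ring.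
Qed.

Lemma sqr_ler_cabsD z w : cabs (z + w) ^+ 2 <= 2 * (cabs z ^+ 2 + cabs w ^+ 2).
Proof.
apply: (@le_trans _ _ ((cabs z + cabs w) ^+ 2)).
  by rewrite ler_pXn2r ?nnegrE ?addr_ge0 ?cabs_ge0 // ler_cabsD.
by have := sqr_ge0 (cabs z - cabs w); nra.
Qed.

Lemma conjCE z : (z^*)%R = z^*%C.
Proof. by []. Qed.

End ComplexModulus.
#[global] Hint Extern 0 (is_true (_ <= cabs _)) => exact: cabs_ge0 : core.

Lemma cvg_sumR {R : realType} I (r : seq I) (f : I -> nat -> R) (l : I -> R) :
  (forall i, f i n @[n --> \oo] --> l i) ->
  (\sum_(i <- r) f i n) @[n --> \oo] --> \sum_(i <- r) l i.
Proof.
move=> H; elim: r => [|i r IH].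
  by under eq_fun do rewrite big_nil; rewrite big_nil; exact: cvg_cst.
by under eq_fun do rewrite big_cons; rewrite big_cons; exact: cvgD.
Qed.

Section RealExpectation.
Context {R : realType} d (T : measurableType d) (P : probability T R).
Implicit Types (X Y : T -> R).

Definition intg X := P.-integrable setT (EFin \o X).
Definition Ex X : R := fine ('E_P[X])%E.

Lemma ExE X : Ex X = fine (\int[P]_x (X x)%:E)%E.
Proof. by rewrite /Ex unlock. Qed.

Lemma intg_meas X : intg X -> measurable_fun setT X.
Proof. by move=> /measurable_int /measurable_EFinP. Qed.

Lemma intg_le X Y : measurable_fun setT X -> (forall x, `|X x| <= Y x) ->
  intg Y -> intg X.
Proof.
move=> mX XY iY; apply: le_integrable iY => //.
  exact/measurable_EFinP.
by move=> x _ /=; rewrite lee_fin (le_trans (XY x)) // ler_norm.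
Qed.

Lemma intg_cst c : intg (fun=> c).
Proof. exact: finite_measure_integrable_cst. Qed.

Lemma intg_bnd X c : measurable_fun setT X -> (forall x, `|X x| <= c) -> intg X.
Proof. by move=> mX Xc; apply: (intg_le mX Xc (intg_cst c)). Qed.

Lemma intgD X Y : intg X -> intg Y -> intg (fun x => X x + Y x).
Proof. by move=> iX iY; have := integrableD measurableT iX iY. Qed.

Lemma intgZ c X : intg X -> intg (fun x => c * X x).
Proof. by move=> iX; have := integrableZl measurableT c iX. Qed.

Lemma intgN X : intg X -> intg (fun x => - X x).
Proof.
by move=> /(intgZ (-1)); apply: eq_integrable => // x _ /=; rewrite mulN1r.
Qed.

Lemma intgB X Y : intg X -> intg Y -> intg (fun x => X x - Y x).
Proof. by move=> iX iY; apply: intgD => //; exact: intgN. Qed.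

Lemma intg_abs X : intg X -> intg (fun x => `|X x|).
Proof. exact: integrable_norm. Qed.

Lemma intg_sum I (r : seq I) (Q : pred I) (F : I -> T -> R) :
  (forall i, Q i -> intg (F i)) -> intg (fun x => \sum_(i <- r | Q i) F i x).
Proof.
move=> iF; elim: r => [|i r IH].
  by under eq_fun do rewrite big_nil; exact: intg_cst.
under eq_fun do rewrite big_cons.
by case: (boolP (Q i)) => // Qi; apply: intgD => //; exact: iF.
Qed.

Lemma Ex_cst c : Ex (fun=> c) = c.
Proof. by rewrite /Ex expectation_cst. Qed.

Lemma ExD X Y : intg X -> intg Y -> Ex (fun x => X x + Y x) = Ex X + Ex Y.
Proof.
move=> iX iY; rewrite !ExE -fineD ?integrable_fin_num //.
by rewrite integralD_EFin.
Qed.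

Lemma ExZ c X : intg X -> Ex (fun x => c * X x) = c * Ex X.
Proof.
move=> iX; rewrite !ExE -[c in RHS]/(fine c%:E) -fineM ?integrable_fin_num //.
by rewrite -integralZl.
Qed.

Lemma ExN X : intg X -> Ex (fun x => - X x) = - Ex X.
Proof. by move=> iX; rewrite -mulN1r -ExZ //; under [in RHS]eq_fun do rewrite mulN1r. Qed.

Lemma ExB X Y : intg X -> intg Y -> Ex (fun x => X x - Y x) = Ex X - Ex Y.
Proof. by move=> iX iY; rewrite ExD ?ExN //; exact: intgN. Qed.

Lemma Ex_sum I (r : seq I) (Q : pred I) (F : I -> T -> R) :
  (forall i, Q i -> intg (F i)) ->
  Ex (fun x => \sum_(i <- r | Q i) F i x) = \sum_(i <- r | Q i) Ex (F i).
Proof.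
move=> iF; elim: r => [|i r IH].
  by under eq_fun do rewrite big_nil; rewrite big_nil Ex_cst.
under eq_fun do rewrite big_cons; rewrite big_cons.
case: (boolP (Q i)) => // Qi; rewrite ExD ?IH //; first exact: iF.
exact: intg_sum.
Qed.

Lemma le_Ex X Y : intg X -> intg Y -> (forall x, X x <= Y x) -> Ex X <= Ex Y.
Proof.
move=> iX iY XY; rewrite !ExE fine_le ?integrable_fin_num //.
by apply: le_integral => // x _; rewrite lee_fin.
Qed.

Lemma Ex_ge0 X : (forall x, 0 <= X x) -> 0 <= Ex X.
Proof. by move=> X0; rewrite /Ex fine_ge0 // expectation_ge0. Qed.

Lemma ler_norm_Ex X : intg X -> `|Ex X| <= Ex (fun x => `|X x|).
Proof.
move=> iX; rewrite ler_norml; apply/andP; split.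
  rewrite lerNl -ExN //; apply: le_Ex => [||x]; [exact: intgN|exact: intg_abs|].
  by rewrite -normrN ler_norm.
by apply: le_Ex => // [|x]; [exact: intg_abs|exact: ler_norm].
Qed.

Lemma Ex_ge_abs X Y : intg X -> intg Y -> (forall x, `|X x| <= Y x) ->
  `|Ex X| <= Ex Y.
Proof.
by move=> iX iY XY; rewrite (le_trans (ler_norm_Ex iX)) // le_Ex //; exact: intg_abs.
Qed.

Lemma eq_Ex X Y : X =1 Y -> Ex X = Ex Y.
Proof. by move=> /funext ->. Qed.

Lemma Ex_le_cst X c : intg X -> (forall x, X x <= c) -> Ex X <= c.
Proof. by move=> iX Xc; rewrite -[leRHS]Ex_cst; apply: le_Ex => //; exact: intg_cst. Qed.

Lemma intgM X Y : measurable_fun setT X -> measurable_fun setT Y ->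
  intg (fun x => X x ^+ 2) -> intg (fun x => Y x ^+ 2) ->
  intg (fun x => X x * Y x).
Proof.
move=> mX mY iX iY; apply: (@intg_le _ (fun x => X x ^+ 2 + Y x ^+ 2)).
- exact: measurable_funM.
- move=> x; rewrite normrM -(real_normK (num_real (X x))) -(real_normK (num_real (Y x))).
  by move: `|X x| `|Y x| => a b; nra.
- exact: intgD.
Qed.

(* Cauchy-Schwarz in the form [2 E|XY| <= l E X^2 + l^-1 E Y^2] optimised over l *)
Lemma Ex_CS X Y : measurable_fun setT X -> measurable_fun setT Y ->
  intg (fun x => X x ^+ 2) -> intg (fun x => Y x ^+ 2) ->
  Ex (fun x => `|X x * Y x|) <=
    Num.sqrt (Ex (fun x => X x ^+ 2)) * Num.sqrt (Ex (fun x => Y x ^+ 2)).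
Proof.
move=> mX mY iX iY.
have iXY := intgM mX mY iX iY.
set a := Ex (fun x => X x ^+ 2); set b := Ex (fun x => Y x ^+ 2).
have a0 : 0 <= a by apply: Ex_ge0 => x; exact: sqr_ge0.
have b0 : 0 <= b by apply: Ex_ge0 => x; exact: sqr_ge0.
have key l : 0 < l -> 2 * Ex (fun x => `|X x * Y x|) <= l * a + l^-1 * b.
  move=> l0; rewrite -ExZ; last exact: intg_abs.
  rewrite /a /b -!ExZ // -ExD; [|exact: intgZ..].
  apply: le_Ex; [exact/intgZ/intg_abs|by apply: intgD; exact: intgZ|].
  move=> x; rewrite normrM -(real_normK (num_real (X x))) -(real_normK (num_real (Y x))).
  have : 0 <= l^-1 * (l * `|X x| - `|Y x|) ^+ 2.
    by rewrite mulr_ge0 ?sqr_ge0 // invr_ge0 ltW.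
  suff -> : l^-1 * (l * `|X x| - `|Y x|) ^+ 2 =
    l * `|X x| ^+ 2 + l^-1 * `|Y x| ^+ 2 - 2 * (`|X x| * `|Y x|) by rewrite subr_ge0.
  by field; rewrite gt_eqF.
set A := Num.sqrt a; set B := Num.sqrt b.
have A0 : 0 <= A by exact: sqrtr_ge0.
have B0 : 0 <= B by exact: sqrtr_ge0.
have AE : a = A * A by rewrite -expr2 sqr_sqrtr.
have BE : b = B * B by rewrite -expr2 sqr_sqrtr.
(* The optimal weight is [B / A]. Shifting both roots by [e'] keeps it positive and finite when a
   second moment vanishes, at a cost below [e]. *)
apply/ler_addgt0Pl => e e0; set e' := e / (A + B + 1).
have AB0 : 0 < A + B + 1 by rewrite ltr_wpDl // addr_ge0.
have e'0 : 0 < e' by rewrite divr_gt0.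
have Ae : 0 < A + e' by rewrite ltr_wpDl.
have Be : 0 < B + e' by rewrite ltr_wpDl.
have /key : 0 < (B + e') / (A + e') by rewrite divr_gt0.
rewrite invf_div AE BE => H.
have H1 : (B + e') / (A + e') * (A * A) <= (B + e') * A.
  rewrite -mulrA ler_pM2l // mulrA ler_piMl // mulrC ler_pdivrMr //.
  by rewrite mul1r lerDl ltW.
have H2 : (A + e') / (B + e') * (B * B) <= (A + e') * B.
  rewrite -mulrA ler_pM2l // mulrA ler_piMl // mulrC ler_pdivrMr //.
  by rewrite mul1r lerDl ltW.
have eE : e = e' * (A + B + 1) by rewrite /e' divfK ?gt_eqF.
by rewrite eE; move: H H1 H2; set u := Ex _; nra.
Qed.

End RealExpectation.

Section ComplexExpectation.
Context {R : realType} d (T : measurableType d) (P : probability T R).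
Local Notation C := R[i].
Implicit Types (Z W : T -> C).

Definition cmeas Z := measurable_fun setT (fun x => complex.Re (Z x)) /\
  measurable_fun setT (fun x => complex.Im (Z x)).
Definition cintg Z := intg P (fun x => complex.Re (Z x)) /\
  intg P (fun x => complex.Im (Z x)).

Lemma cmeas_cst c : cmeas (fun=> c).
Proof. by split; exact: measurable_cst. Qed.

Lemma cmeasD Z W : cmeas Z -> cmeas W -> cmeas (fun x => Z x + W x).
Proof.
move=> [a b] [c e]; split.
  by under eq_fun do rewrite ReD; exact: measurable_funD.
by under eq_fun do rewrite ImD; exact: measurable_funD.
Qed.

Lemma cmeasM Z W : cmeas Z -> cmeas W -> cmeas (fun x => Z x * W x).
Proof.
move=> [a b] [c e]; split.
  by under eq_fun do rewrite ReM; apply: measurable_funB; exact: measurable_funM.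
by under eq_fun do rewrite ImM; apply: measurable_funD; exact: measurable_funM.
Qed.

Lemma cmeasN Z : cmeas Z -> cmeas (fun x => - Z x).
Proof.
move=> [a b]; split.
  by under eq_fun do rewrite ReN; exact: measurableT_comp.
by under eq_fun do rewrite ImN; exact: measurableT_comp.
Qed.

Lemma cmeasB Z W : cmeas Z -> cmeas W -> cmeas (fun x => Z x - W x).
Proof. by move=> mZ mW; apply: cmeasD => //; exact: cmeasN. Qed.

Lemma cmeas_conj Z : cmeas Z -> cmeas (fun x => (Z x)^*).
Proof.
move=> [a b]; split; first by under eq_fun do rewrite Re_conj.
by under eq_fun do rewrite Im_conj; exact: measurableT_comp.
Qed.

Lemma cmeas_sum I (r : seq I) (Q : pred I) (F : I -> T -> C) :
  (forall i, Q i -> cmeas (F i)) -> cmeas (fun x => \sum_(i <- r | Q i) F i x).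
Proof.
move=> mF; elim: r => [|i r IH].
  by under eq_fun do rewrite big_nil; exact: cmeas_cst.
under eq_fun do rewrite big_cons.
by case: (boolP (Q i)) => // Qi; apply: cmeasD => //; exact: mF.
Qed.

Lemma cmeas_prod I (r : seq I) (Q : pred I) (F : I -> T -> C) :
  (forall i, Q i -> cmeas (F i)) -> cmeas (fun x => \prod_(i <- r | Q i) F i x).
Proof.
move=> mF; elim: r => [|i r IH].
  by under eq_fun do rewrite big_nil; exact: cmeas_cst.
under eq_fun do rewrite big_cons.
by case: (boolP (Q i)) => // Qi; apply: cmeasM => //; exact: mF.
Qed.

Lemma cmeas_cabs2 Z : cmeas Z -> measurable_fun setT (fun x => cabs (Z x) ^+ 2).
Proof.
move=> [a b]; under eq_fun do rewrite cabs_sq.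
by apply: measurable_funD; exact: measurable_funX.
Qed.

Lemma cmeas_cabs Z : cmeas Z -> measurable_fun setT (fun x => cabs (Z x)).
Proof.
move=> [a b]; under eq_fun do rewrite cabsE.
apply: (measurableT_comp (f := @Num.sqrt R)).
  exact: continuous_measurable_fun (@sqrt_continuous R).
by apply: measurable_funD; exact: measurable_funX.
Qed.

Lemma cintg_meas Z : cintg Z -> cmeas Z.
Proof. by case=> a b; split; [exact: intg_meas a|exact: intg_meas b]. Qed.

Lemma cintg_le Z (Y : T -> R) : cmeas Z -> (forall x, cabs (Z x) <= Y x) ->
  intg P Y -> cintg Z.
Proof.
move=> [a b] ZY iY; split.
  by apply: intg_le iY => // x; rewrite (le_trans (ler_Re_cabs _)).
by apply: intg_le iY => // x; rewrite (le_trans (ler_Im_cabs _)).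
Qed.

Lemma cintg_bnd Z c : cmeas Z -> (forall x, cabs (Z x) <= c) -> cintg Z.
Proof. by move=> mZ Zc; apply: (cintg_le mZ Zc); exact: intg_cst. Qed.

Lemma intg_cabs Z : cintg Z -> intg P (fun x => cabs (Z x)).
Proof.
move=> iZ; have [a b] := iZ.
apply: (intg_le (Y := fun x => `|complex.Re (Z x)| + `|complex.Im (Z x)|)).
- exact/cmeas_cabs/cintg_meas.
- by move=> x; rewrite (ger0_norm (cabs_ge0 _)) ler_cabs_ReIm.
- by apply: intgD; [exact: intg_abs a|exact: intg_abs b].
Qed.

Lemma cintg_cst c : cintg (fun=> c).
Proof. by split; exact: intg_cst. Qed.

Lemma cintgD Z W : cintg Z -> cintg W -> cintg (fun x => Z x + W x).
Proof.
move=> [a b] [c e]; split.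
  by under eq_fun do rewrite ReD; exact: intgD.
by under eq_fun do rewrite ImD; exact: intgD.
Qed.

Lemma cintgZ c Z : cintg Z -> cintg (fun x => c * Z x).
Proof.
move=> [a b]; split.
  by under eq_fun do rewrite ReM; apply: intgB; exact: intgZ.
by under eq_fun do rewrite ImM; apply: intgD; exact: intgZ.
Qed.

Lemma cintgN Z : cintg Z -> cintg (fun x => - Z x).
Proof. by move=> /(cintgZ (-1)); under eq_fun do rewrite mulN1r. Qed.

Lemma cintgB Z W : cintg Z -> cintg W -> cintg (fun x => Z x - W x).
Proof. by move=> iZ iW; apply: cintgD => //; exact: cintgN. Qed.

Lemma cintg_sum I (r : seq I) (Q : pred I) (F : I -> T -> C) :
  (forall i, Q i -> cintg (F i)) -> cintg (fun x => \sum_(i <- r | Q i) F i x).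
Proof.
move=> iF; elim: r => [|i r IH].
  by under eq_fun do rewrite big_nil; exact: cintg_cst.
under eq_fun do rewrite big_cons.
by case: (boolP (Q i)) => // Qi; apply: cintgD => //; exact: iF.
Qed.

Lemma CexpE Z : Cexp P Z =
  Ex P (fun x => complex.Re (Z x)) +i* Ex P (fun x => complex.Im (Z x)).
Proof. by []. Qed.

Lemma Cexp_cst c : Cexp P (fun=> c) = c.
Proof. by rewrite CexpE !Ex_cst; case: c. Qed.

Lemma CexpD Z W : cintg Z -> cintg W ->
  Cexp P (fun x => Z x + W x) = Cexp P Z + Cexp P W.
Proof.
move=> [a b] [c e]; rewrite !CexpE; apply: complex_ext => /=.
  by under eq_Ex do rewrite ReD; rewrite ExD.
by under eq_Ex do rewrite ImD; rewrite ExD.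
Qed.

Lemma CexpZ c Z : cintg Z -> Cexp P (fun x => c * Z x) = c * Cexp P Z.
Proof.
move=> [a b]; rewrite !CexpE; apply: complex_ext; rewrite ?ReM ?ImM /=.
  by under eq_Ex do rewrite ReM; rewrite ExB ?ExZ //; exact: intgZ.
by under eq_Ex do rewrite ImM; rewrite ExD ?ExZ //; exact: intgZ.
Qed.

Lemma CexpN Z : cintg Z -> Cexp P (fun x => - Z x) = - Cexp P Z.
Proof.
by move=> iZ; rewrite -mulN1r -CexpZ //; congr Cexp; apply/funext => x; rewrite mulN1r.
Qed.

Lemma CexpB Z W : cintg Z -> cintg W ->
  Cexp P (fun x => Z x - W x) = Cexp P Z - Cexp P W.
Proof. by move=> iZ iW; rewrite CexpD ?CexpN //; exact: cintgN. Qed.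

Lemma Cexp_sum I (r : seq I) (Q : pred I) (F : I -> T -> C) :
  (forall i, Q i -> cintg (F i)) ->
  Cexp P (fun x => \sum_(i <- r | Q i) F i x) = \sum_(i <- r | Q i) Cexp P (F i).
Proof.
move=> iF; elim: r => [|i r IH].
  by under eq_fun do rewrite big_nil; rewrite big_nil Cexp_cst.
under eq_fun do rewrite big_cons; rewrite big_cons.
case: (boolP (Q i)) => // Qi; rewrite CexpD ?IH //; first exact: iF.
exact: cintg_sum.
Qed.

Lemma Cexp_conj Z : cintg Z -> Cexp P (fun x => (Z x)^*) = (Cexp P Z)^*.
Proof.
move=> [a b]; rewrite !CexpE; apply: complex_ext => /=.
  by under eq_Ex do rewrite Re_conj.
by under eq_Ex do rewrite Im_conj; rewrite ExN.
Qed.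

(* rotate so that [Cexp P Z] becomes its modulus *)
Lemma cabs_Cexp Z : cintg Z -> cabs (Cexp P Z) <= Ex P (fun x => cabs (Z x)).
Proof.
move=> iZ; set c := Cexp P Z.
have [c0|c0] := eqVneq (cabs c) 0; first by rewrite c0 Ex_ge0.
have cp : 0 < cabs c by rewrite lt_neqAle eq_sym c0 cabs_ge0.
rewrite -(ler_pM2l cp) -expr2 -ExZ; last exact: intg_cabs.
have -> : cabs c ^+ 2 = Ex P (fun x => complex.Re (c^* * Z x)).
  transitivity (complex.Re (Cexp P (fun x => c^* * Z x))); last by [].
  by rewrite CexpZ // mulrC mul_conj_cabs.
apply: le_Ex; [by have [] := cintgZ (c^*) iZ|exact/intgZ/intg_cabs|].
move=> x; rewrite (le_trans (ler_norm _)) // (le_trans (ler_Re_cabs _)) //.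
by rewrite cabsM cabs_conj.
Qed.

Lemma cabs_Cexp_le Z (Y : T -> R) : cintg Z -> intg P Y ->
  (forall x, cabs (Z x) <= Y x) -> cabs (Cexp P Z) <= Ex P Y.
Proof.
move=> iZ iY ZY; rewrite (le_trans (cabs_Cexp iZ)) // le_Ex //; exact: intg_cabs.
Qed.

Lemma cabs_Cexp_cst Z c : cintg Z -> (forall x, cabs (Z x) <= c) ->
  cabs (Cexp P Z) <= c.
Proof. by move=> iZ Zc; rewrite -(Ex_cst P c) cabs_Cexp_le //; exact: intg_cst. Qed.

Lemma eq_Cexp Z W : Z =1 W -> Cexp P Z = Cexp P W.
Proof. by move=> /funext ->. Qed.

Definition cL2 Z := cmeas Z /\ intg P (fun x => cabs (Z x) ^+ 2).

Lemma cL2_cst c : cL2 (fun=> c).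
Proof. by split; [exact: cmeas_cst|exact: intg_cst]. Qed.

Lemma cL2_bnd Z c : cmeas Z -> (forall x, cabs (Z x) <= c) -> cL2 Z.
Proof.
move=> mZ Zc; split => //; apply: (@intg_bnd _ _ _ _ _ (c ^+ 2)).
  exact: cmeas_cabs2.
move=> x; rewrite ger0_norm ?sqr_ge0 // ler_pXn2r ?nnegrE //.
exact: le_trans (cabs_ge0 _) (Zc x).
Qed.

Lemma cL2D Z W : cL2 Z -> cL2 W -> cL2 (fun x => Z x + W x).
Proof.
move=> [a b] [c e]; split; first exact: cmeasD.
apply: (intg_le (Y := fun x => 2 * (cabs (Z x) ^+ 2 + cabs (W x) ^+ 2))).
- exact/cmeas_cabs2/cmeasD.
- by move=> x; rewrite ger0_norm ?sqr_ge0 // sqr_ler_cabsD.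
- exact/intgZ/intgD.
Qed.

Lemma cL2M_bnd Z W c : cmeas Z -> (forall x, cabs (Z x) <= c) -> cL2 W ->
  cL2 (fun x => Z x * W x).
Proof.
move=> mZ Zc [mW iW]; split; first exact: cmeasM.
apply: (intg_le (Y := fun x => c ^+ 2 * (cabs (W x) ^+ 2))).
- exact/cmeas_cabs2/cmeasM.
- move=> x; rewrite ger0_norm ?sqr_ge0 // cabsM exprMn ler_wpM2r ?sqr_ge0 //.
  rewrite ler_pXn2r ?nnegrE //; exact: le_trans (cabs_ge0 _) (Zc x).
- exact: intgZ.
Qed.

Lemma cL2Z c W : cL2 W -> cL2 (fun x => c * W x).
Proof. by apply: (cL2M_bnd (c := cabs c)) => //; exact: cmeas_cst. Qed.

Lemma cL2N Z : cL2 Z -> cL2 (fun x => - Z x).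
Proof. by move=> /(cL2Z (-1)); under eq_fun do rewrite mulN1r. Qed.

Lemma cL2B Z W : cL2 Z -> cL2 W -> cL2 (fun x => Z x - W x).
Proof. by move=> iZ iW; apply: cL2D => //; exact: cL2N. Qed.

Lemma cL2_sum I (r : seq I) (Q : pred I) (F : I -> T -> C) :
  (forall i, Q i -> cL2 (F i)) -> cL2 (fun x => \sum_(i <- r | Q i) F i x).
Proof.
move=> iF; elim: r => [|i r IH].
  by under eq_fun do rewrite big_nil; exact: cL2_cst.
under eq_fun do rewrite big_cons.
by case: (boolP (Q i)) => // Qi; apply: cL2D => //; exact: iF.
Qed.

Lemma cL2M Z W : cL2 Z -> cL2 W -> cintg (fun x => Z x * W x).
Proof.
move=> [a b] [c e]; apply: (cintg_le (Y := fun x => cabs (Z x) ^+ 2 + cabs (W x) ^+ 2)).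
- exact: cmeasM.
- move=> x; rewrite cabsM; have := cabs_ge0 (Z x); have := cabs_ge0 (W x).
  by move: (cabs _) (cabs _) => u v; nra.
- exact: intgD.
Qed.

Lemma cL2_cintg Z : cL2 Z -> cintg Z.
Proof. by move=> iZ; have := cL2M iZ (cL2_cst 1); under eq_fun do rewrite mulr1. Qed.

Lemma Cexp_L1_L2 Z : cL2 Z ->
  Ex P (fun x => cabs (Z x)) <= Num.sqrt (Ex P (fun x => cabs (Z x) ^+ 2)).
Proof.
move=> [mZ iZ]; have := Ex_CS (cmeas_cabs mZ) (measurable_cst (1 : R)) iZ.
rewrite (_ : (fun x => _ ^+ 2) = (fun=> 1)); last by apply/funext => x; rewrite expr1n.
move=> /(_ (intg_cst _ _)); rewrite Ex_cst sqrtr1 mulr1.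
rewrite (_ : (fun x => `|_|) = (fun x => cabs (Z x))) //.
by apply/funext => x; rewrite mulr1 ger0_norm.
Qed.

End ComplexExpectation.

(** * Factorisation of expectations under independence *)

Section SubSigmaAlgebra.
Context {R : realType} d (T : measurableType d) (P : probability T R).
Local Notation C := R[i].
Variable G : set (set T).
Hypothesis Gm : <<s G >> `<=` measurable.
Local Notation GT := (g_sigma_algebraType G).

Lemma gmeas_meas (f : T -> R) :
  measurable_fun setT (f : GT -> R) -> measurable_fun setT f.
Proof. by move=> mf _ B mB; apply: Gm; exact: mf. Qed.

Lemma cmeas_sub (Z : T -> C) : @cmeas R _ GT Z -> cmeas Z.
Proof. by case=> a b; split; exact: gmeas_meas. Qed.

Lemma intgM_indic (X : T -> R) A : measurable A -> intg P X ->
  intg P (fun x => X x * \1_A x).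
Proof.
move=> mA iX; apply: (intg_le (Y := fun x => `|X x|)).
- by apply: measurable_funM; [exact: intg_meas iX|exact: measurable_indic].
- move=> x; rewrite normrM indicE; case: (_ \in _); first by rewrite normr1 mulr1.
  by rewrite normr0 mulr0.
- exact: intg_abs.
Qed.

(** The dyadic approximations of [f] are formed on the type [GT], so their level sets lie in
    [<<s G >>] and the hypothesis on indicators applies to each of them. Dominated convergence, once
    with the factor [Y] and once with the factor 1, passes to [f]. *)
Lemma ind_ext_ge0 (Y f : T -> R) :
  (forall x, 0 <= f x) ->
  measurable_fun setT (f : GT -> R) ->
  intg P Y -> intg P f -> intg P (fun x => Y x * f x) ->
  (forall A, <<s G >> A -> Ex P (fun x => Y x * \1_A x) = Ex P Y * fine (P A)) ->
  Ex P (fun x => Y x * f x) = Ex P Y * Ex P f.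
Proof.
move=> f0 mf iY iF iYf H.
pose g n := @approx _ GT R setT (EFin \o f) n.
have mB n : <<s G >> (@integer_approx _ GT R setT (EFin \o f) n).
  rewrite /integer_approx (_ : _ `&` _ = setT `&` f @^-1` `[n%:R, +oo[%classic).
    exact: mf.
  by apply/seteqP; split=> x /= [_]; rewrite ?in_itv /= ?andbT lee_fin.
have mA n k : <<s G >> (@dyadic_approx _ GT R setT (EFin \o f) n k).
  rewrite /dyadic_approx; case: ifP => _; last exact: sigma_algebra0.
  have mE : @measurable_fun _ _ GT _ setT (EFin \o f) by exact/measurable_EFinP.
  rewrite -preimage_comp; apply: mE => //.
  by apply/measurable_image_EFin; exact: measurable_itv.
have gE n (X : T -> R) : intg P X ->
   Ex P (fun x => X x * g n x) =
   \sum_(k < n * 2 ^ n) k%:R * 2 ^- n *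
     Ex P (fun x => X x * \1_(@dyadic_approx _ GT R setT (EFin \o f) n k) x) +
   n%:R * Ex P (fun x => X x * \1_(@integer_approx _ GT R setT (EFin \o f) n) x).
  move=> iX.
  have -> : (fun x => X x * g n x) = (fun x => (\sum_(k < n * 2 ^ n)
      k%:R * 2 ^- n * (X x * \1_(@dyadic_approx _ GT R setT (EFin \o f) n k) x))
      + n%:R * (X x * \1_(@integer_approx _ GT R setT (EFin \o f) n) x)).
    apply/funext => x; rewrite /g /approx mulrDr mulr_sumr; congr (_ + _).
      by apply: eq_bigr => k _; rewrite mulrCA.
    by rewrite mulrCA.
  have iA k : intg P (fun x => X x * \1_(@dyadic_approx _ GT R setT (EFin \o f) n k) x).
    exact/intgM_indic/iX/Gm.
  have iB : intg P (fun x => X x * \1_(@integer_approx _ GT R setT (EFin \o f) n) x).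
    exact/intgM_indic/iX/Gm.
  rewrite ExD; last 2 first.
    by apply: intg_sum => k _; exact: intgZ.
    exact: intgZ.
  rewrite Ex_sum; last by move=> k _; exact: intgZ.
  rewrite ExZ //; congr (_ + _).
  by apply: eq_bigr => k _; rewrite ExZ.
have g0 n x : 0 <= g n x.
  rewrite /g /approx addr_ge0 ?mulr_ge0 //.
  by rewrite sumr_ge0 // => k _; rewrite !mulr_ge0 // invr_ge0 exprn_ge0.
have gf n x : g n x <= f x.
  have := @le_approx _ GT R setT (EFin \o f) n x.
  by rewrite /= lee_fin; apply => // y _; rewrite lee_fin.
have cg x : g n x @[n --> \oo] --> f x.
  have := @cvg_approx _ GT R setT (EFin \o f) x.
  by apply => //=; [move=> y _; rewrite lee_fin|exact: ltry].
have mg n : measurable_fun setT (g n : T -> R).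
  apply: measurable_funD.
    apply: measurable_sum => k; apply: measurable_funM => //.
    exact/measurable_indic/Gm.
  by apply: measurable_funM => //; exact/measurable_indic/Gm.
have dom (X : T -> R) : measurable_fun setT X -> intg P (fun x => X x * f x) ->
    Ex P (fun x => X x * g n x) @[n --> \oo] --> Ex P (fun x => X x * f x).
  move=> mX iXf; rewrite /= [X in _ --> X]ExE.
  under eq_fun do rewrite ExE.
  apply: fine_cvg; rewrite fineK; last exact: integrable_fin_num.
  apply: (@dominated_cvg _ _ _ P setT measurableT
    (fun n x => (X x * g n x)%:E) (fun x => (X x * f x)%:E)
    (fun x => (`|X x * f x|)%:E)) => //.
  - by move=> n; apply/measurable_EFinP/measurable_funM.
  - by move=> x _; apply: cvg_EFin; [exact: nearW|]; apply: cvgMr; exact: cg.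
  - exact: intg_abs.
  - move=> n x _; rewrite lee_fin !normrM ler_wpM2l // !ger0_norm //.
have ex1 A : measurable A -> Ex P (fun x => 1 * \1_A x) = fine (P A).
  by move=> mA1; under eq_Ex do rewrite mul1r; rewrite /Ex expectation_indic.
have c1 := dom Y (intg_meas iY) iYf.
have c2 : Ex P (fun x => Y x * g n x) @[n --> \oo] --> Ex P Y * Ex P f.
  have E1 n : Ex P (fun x => Y x * g n x) = Ex P Y * Ex P (fun x => 1 * g n x).
    rewrite (gE n Y iY) (gE n (fun=> 1) (intg_cst _ _)) mulrDr mulr_sumr; congr (_ + _).
      by apply: eq_bigr => k _; rewrite H // ex1 //; [rewrite mulrCA|exact: Gm].
    by rewrite H // ex1 //; [rewrite mulrCA|exact: Gm].
  under eq_fun do rewrite E1.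
  apply: cvgMr.
  have := dom (fun=> 1) (measurable_cst _).
  under [in X in X -> _]eq_fun do rewrite mul1r.
  under [Ex P f]eq_Ex do rewrite -[f _]mul1r.
  by apply.
by have := cvg_unique _ c1 c2; apply.
Qed.

Lemma ind_ext (Y f : T -> R) :
  measurable_fun setT (f : GT -> R) ->
  intg P Y -> intg P f -> intg P (fun x => Y x * f x) ->
  (forall A, <<s G >> A -> Ex P (fun x => Y x * \1_A x) = Ex P Y * fine (P A)) ->
  Ex P (fun x => Y x * f x) = Ex P Y * Ex P f.
Proof.
move=> mf iY iF iYf H.
have mp : measurable_fun setT (f^\+ : GT -> R) by exact: measurable_funrpos.
have mn : measurable_fun setT (f^\- : GT -> R) by exact: measurable_funrneg.
have fE x : f x = f^\+ x - f^\- x by rewrite -{1}(funrposBneg f).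
have fp x : `|f^\+ x| <= `|f x|.
  by rewrite ger0_norm ?funrpos_ge0 // /funrpos ge_max ler_norm normr_ge0.
have fn x : `|f^\- x| <= `|f x|.
  by rewrite ger0_norm ?funrneg_ge0 // /funrneg ge_max -normrN ler_norm normr_ge0.
have ip : intg P f^\+ by apply: intg_le (intg_abs iF) => //; exact: gmeas_meas.
have in_ : intg P f^\- by apply: intg_le (intg_abs iF) => //; exact: gmeas_meas.
have mY := intg_meas iY.
have iYp : intg P (fun x => Y x * f^\+ x).
  apply: intg_le (intg_abs iYf); first by apply: measurable_funM => //; exact: gmeas_meas.
  by move=> x; rewrite !normrM ler_wpM2l.
have iYn : intg P (fun x => Y x * f^\- x).
  apply: intg_le (intg_abs iYf); first by apply: measurable_funM => //; exact: gmeas_meas.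
  by move=> x; rewrite !normrM ler_wpM2l.
under eq_Ex do rewrite fE mulrBr; rewrite ExB //.
under [Ex P f]eq_Ex do rewrite fE; rewrite ExB // mulrBr.
by congr (_ - _); exact: ind_ext_ge0.
Qed.

(** Integrability of [|Z| |W|] is a hypothesis of its own because factors met later may be merely
    square integrable; it dominates the four real products of real and imaginary parts at once. *)
Lemma Cind_ext (Z W : T -> C) :
  @cmeas R _ GT W -> cintg P Z -> cintg P W ->
  intg P (fun x => cabs (Z x) * cabs (W x)) ->
  (forall A, <<s G >> A ->
    Cexp P (fun x => Z x * (\1_A x)%:C) = Cexp P Z * (fine (P A))%:C) ->
  Cexp P (fun x => Z x * W x) = Cexp P Z * Cexp P W.
Proof.
move=> [mr mi] iZ [ir ii] iZW H.
have [zr zi] := iZ.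
have [mzr mzi] := cintg_meas iZ.
have HR A : <<s G >> A -> Ex P (fun x => complex.Re (Z x) * \1_A x) =
    Ex P (fun x => complex.Re (Z x)) * fine (P A).
  move=> /H /(congr1 (@complex.Re R)); rewrite ReM /= mulr0 subr0 => <-.
  by apply: eq_Ex => x; rewrite ReM /= mulr0 subr0.
have HI A : <<s G >> A -> Ex P (fun x => complex.Im (Z x) * \1_A x) =
    Ex P (fun x => complex.Im (Z x)) * fine (P A).
  move=> /H /(congr1 (@complex.Im R)); rewrite ImM /= mulr0 add0r => <-.
  by apply: eq_Ex => x; rewrite ImM /= mulr0 add0r.
have dom (X Y : T -> R) : measurable_fun setT X -> measurable_fun setT Y ->
    (forall x, `|X x| <= cabs (Z x)) -> (forall x, `|Y x| <= cabs (W x)) ->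
    intg P (fun x => X x * Y x).
  move=> mX mY XZ YW; apply: intg_le iZW; first exact: measurable_funM.
  by move=> x; rewrite normrM ler_pM.
have irr := dom _ _ mzr (gmeas_meas mr) (fun=> ler_Re_cabs _) (fun=> ler_Re_cabs _).
have iri := dom _ _ mzr (gmeas_meas mi) (fun=> ler_Re_cabs _) (fun=> ler_Im_cabs _).
have iir := dom _ _ mzi (gmeas_meas mr) (fun=> ler_Im_cabs _) (fun=> ler_Re_cabs _).
have iii := dom _ _ mzi (gmeas_meas mi) (fun=> ler_Im_cabs _) (fun=> ler_Im_cabs _).
rewrite !CexpE; apply: complex_ext; rewrite ?ReM ?ImM /=.
  by under eq_Ex do rewrite ReM; rewrite ExB // !ind_ext.
by under eq_Ex do rewrite ImM; rewrite ExD // !ind_ext.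
Qed.

End SubSigmaAlgebra.

Section Independence.
Context {R : realType} d (T : measurableType d) (P : probability T R).
Local Notation C := R[i].

Lemma Cexp_indic A : measurable A -> Cexp P (fun x => (\1_A x)%:C) = (fine (P A))%:C.
Proof.
move=> mA; rewrite CexpE; apply: complex_ext => /=; last exact: Ex_cst.
by rewrite /Ex expectation_indic.
Qed.

Lemma cintg_indic A : measurable A -> cintg P (fun x => (\1_A x)%:C).
Proof.
move=> mA; split => /=; last exact: intg_cst.
apply: (@intg_bnd _ _ _ _ _ 1); first exact: measurable_indic.
by move=> x; rewrite indicE; case: (_ \in _); rewrite ?normr1 ?normr0.
Qed.

Lemma cmeas_indic A : measurable A -> cmeas (fun x : T => (\1_A x)%:C : C).
Proof. by move=> mA; split => /=; [exact: measurable_indic|exact: measurable_cst]. Qed.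

Lemma cabs_indic (A : set T) x : cabs ((\1_A x)%:C : C) <= 1.
Proof. by rewrite cabs_real indicE; case: (_ \in _); rewrite ?normr1 ?normr0. Qed.

(** [Cind_ext] is used twice: it reduces [Z] to an indicator of [G1], then [W] to an indicator of
    [G2], where the product formula for events concludes. *)
Lemma Cexp_indep (G1 G2 : set (set T)) (Z W : T -> C) :
  <<s G1 >> `<=` measurable -> <<s G2 >> `<=` measurable ->
  (forall A B, <<s G1 >> A -> <<s G2 >> B -> P (A `&` B) = (P A * P B)%E) ->
  @cmeas R _ (g_sigma_algebraType G1) Z -> @cmeas R _ (g_sigma_algebraType G2) W ->
  cintg P Z -> cintg P W -> intg P (fun x => cabs (Z x) * cabs (W x)) ->
  Cexp P (fun x => Z x * W x) = Cexp P Z * Cexp P W.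
Proof.
move=> s1 s2 ind mZ mW iZ iW iZW.
rewrite mulrC; under eq_Cexp do rewrite mulrC.
apply: (Cind_ext s1) => //; first by under eq_fun do rewrite mulrC.
move=> A GA; rewrite mulrC; under eq_Cexp do rewrite mulrC.
have mA := s1 _ GA.
rewrite -Cexp_indic //; apply: (Cind_ext s2) => //.
- exact: cintg_indic.
- apply: intg_le (intg_cabs iW).
    apply: measurable_funM; last exact/cmeas_cabs/cintg_meas/iW.
    exact/cmeas_cabs/cmeas_indic.
  move=> x; rewrite ger0_norm ?mulr_ge0 // -[leRHS]mul1r ler_wpM2r //.
  exact: cabs_indic.
move=> B GB; have mB := s2 _ GB.
transitivity (Cexp P (fun x => (\1_(A `&` B) x)%:C)).
  by apply: eq_Cexp => x; rewrite indicI /= rmorphM.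
rewrite !Cexp_indic //; last exact: measurableI.
by rewrite ind // fineM ?rmorphM // fin_num_measure.
Qed.

Lemma indic_bigcap q (A : 'I_q -> set T) x :
  (\1_(\bigcap_i A i) x)%:C = \prod_(i < q) (\1_(A i) x)%:C :> C.
Proof.
rewrite indicE; have [|H] := boolP (x \in _).
  rewrite inE => H; rewrite big1 // => i _; rewrite indicE mem_set //; exact: H.
have [i Hi] : exists i, ~ A i x.
  by apply/existsNP => HA; move/negP: H; apply; rewrite inE => i _; exact: HA.
by rewrite (bigD1 i) //= indicE memNset // mul0r.
Qed.

Lemma cabs_prod_bnd q (f : 'I_q -> T -> C) (Q : pred 'I_q) :
  (forall i, exists c, forall x, cabs (f i x) <= c) ->
  exists c, forall x, cabs (\prod_(i < q | Q i) f i x) <= c.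
Proof.
move=> /choice[c Hc]; exists (\prod_(i < q | Q i) c i) => x.
by rewrite cabs_prod ler_prod // => i _; rewrite cabs_ge0 Hc.
Qed.

(** A hybrid argument: starting from indicators in all places, where the claim is the hypothesis on
    events, the indicators are replaced by the functions [f i] one index at a time. *)
Lemma Cexp_prod_indep q (G : 'I_q -> set (set T)) (f : 'I_q -> T -> C) :
  (forall i, <<s G i >> `<=` measurable) ->
  (forall A : 'I_q -> set T, (forall i, <<s G i >> (A i)) ->
     P (\bigcap_i A i) = (\prod_(i < q) P (A i))%E) ->
  (forall i, @cmeas R _ (g_sigma_algebraType (G i)) (f i)) ->
  (forall i, exists c, forall x, cabs (f i x) <= c) ->
  Cexp P (fun x => \prod_i f i x) = \prod_i Cexp P (f i).
Proof.
move=> Gm ind mf bf.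
suff H k (A : 'I_q -> set T) : (forall i, <<s G i >> (A i)) ->
   Cexp P (fun x => \prod_(i < q) (if (i < k)%N then f i x else (\1_(A i) x)%:C)) =
   \prod_(i < q) (if (i < k)%N then Cexp P (f i) else (fine (P (A i)))%:C).
  have := H q (fun=> setT) (fun i => ltac:(exact: (@measurableT _ (g_sigma_algebraType (G i))))).
  under eq_Cexp do under eq_bigr do rewrite ltn_ord.
  by under [in RHS]eq_bigr do rewrite ltn_ord.
elim: k A => [|k IH] A GA.
  under eq_Cexp do rewrite -indic_bigcap.
  rewrite Cexp_indic; last first.
    by apply: fin_bigcap_measurable => // i _; exact/Gm.
  rewrite ind // -rmorph_prod /=; congr (_ %:C).
  rewrite (eq_bigr (fun i => (fine (P (A i)))%:E)) ?prodEFin // => i _.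
  by rewrite fineK // fin_num_measure //; exact/Gm.
have [kq|qk] := ltnP k q; last first.
  have E (i : 'I_q) : (i < k.+1)%N = (i < k)%N.
    by rewrite (leq_trans (ltn_ord i) qk) (leq_trans (ltn_ord i) (leqW qk)).
  under eq_Cexp do under eq_bigr do rewrite E.
  by rewrite IH //; under [in RHS]eq_bigr do rewrite E.
pose i0 := Ordinal kq.
pose g (i : 'I_q) (x : T) := if (i < k)%N then f i x else (\1_(A i) x)%:C.
have E i : i != i0 -> (i < k.+1)%N = (i < k)%N.
  move=> ii0; rewrite ltnS leq_eqVlt; case: eqP => // ik.
  by case/eqP: ii0; exact: val_inj.
have bg i : exists c, forall x, cabs (g i x) <= c.
  rewrite /g; case: (boolP (i < k)%N) => _; first exact: bf.
  by exists 1 => x; exact: cabs_indic.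
have mg i : cmeas (g i).
  rewrite /g; case: (boolP (i < k)%N) => _; first exact/(cmeas_sub (Gm i))/mf.
  exact/cmeas_indic/Gm.
pose Z x := \prod_(i < q | i != i0) g i x.
have [c bZ] : exists c, forall x, cabs (Z x) <= c by exact: cabs_prod_bnd.
have mZ : cmeas Z by apply: cmeas_prod => i _.
have iZ : cintg P Z by exact: cintg_bnd bZ.
(* The induction hypothesis for the family with [B] put in place [i0]. Taking [B = setT] below
   yields the expectation of the remaining product, so [Cind_ext] can trade [B] for [f i0]. *)
have key B : <<s G i0 >> B -> Cexp P (fun x => Z x * (\1_B x)%:C) =
   (fine (P B))%:C * \prod_(i < q | i != i0)
     (if (i < k)%N then Cexp P (f i) else (fine (P (A i)))%:C).
  move=> GB; pose A' i := if i == i0 then B else A i.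
  have GA' i : <<s G i >> (A' i).
    by rewrite /A'; case: eqP => [->//|_]; exact: GA.
  have := IH A' GA'; rewrite (bigD1 i0) //= ltnn /A' eqxx.
  under [X in _ = _ * X]eq_bigr => i ii0 do rewrite (negbTE ii0).
  move=> <-; apply: eq_Cexp => x; rewrite (bigD1 i0) //= ltnn eqxx mulrC.
  by congr (_ * _); apply: eq_bigr => i ii0; rewrite /g (negbTE ii0).
have EZ : Cexp P Z = \prod_(i < q | i != i0)
     (if (i < k)%N then Cexp P (f i) else (fine (P (A i)))%:C).
  have := key setT (@measurableT _ (g_sigma_algebraType (G i0))).
  rewrite probability_setT mul1r => <-; apply: eq_Cexp => x.
  by rewrite indicT mulr1.
rewrite [RHS](bigD1 i0) //= ltnSn.
under [X in _ = _ * X]eq_bigr => i ii0 do rewrite (E i ii0).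
rewrite -EZ mulrC -(Cind_ext (Gm i0) (mf i0) iZ).
- apply: eq_Cexp => x; rewrite (bigD1 i0) //= ltnSn mulrC; congr (_ * _).
  by apply: eq_bigr => i ii0; rewrite (E i ii0).
- have [c' bf0] := bf i0; apply: cintg_bnd bf0; exact/(cmeas_sub (Gm i0))/mf.
- have [c' bf0] := bf i0; apply: (@intg_bnd _ _ _ _ _ (c * c')).
    by apply: measurable_funM; apply: cmeas_cabs => //; exact/(cmeas_sub (Gm i0))/mf.
  by move=> x; rewrite ger0_norm ?mulr_ge0 // ler_pM.
- by move=> B GB; rewrite key // -EZ mulrC.
Qed.

End Independence.

(** * Gaussian laws and characteristic functions *)

Section GaussianMoments.
Context {R : realType} d (T : measurableType d) (P : probability T R).
Variables (X : T -> R) (s : R).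
Hypothesis s_ge0 : 0 <= s.
Hypothesis GX : gaussian_law P X 0 s.
Local Notation mu := (@lebesgue_measure R).

(** Change of variables holds for the Radon-Nikodym derivative of [normal_prob], which agrees with
    [normal_pdf] only almost everywhere; the two are exchanged under the integral. *)
Lemma integral_normal_prob (m : R) (f : R -> \bar R) :
  measurable_fun setT f -> (forall x, 0 <= f x)%E ->
  (\int[normal_prob m s]_x f x = \int[mu]_x (f x * (normal_pdf m s x)%:E))%E.
Proof.
move=> mf f0.
have dom := normal_prob_dominates m s.
rewrite -(Radon_Nikodym_SigmaFinite.change_of_variables dom) //.
apply: ge0_ae_eq_integral => //.
- apply: emeasurable_funM => //; apply: measurable_int.
  exact: Radon_Nikodym_SigmaFinite.f_integrable.
- apply: emeasurable_funM => //; apply/measurable_EFinP.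
  exact: measurable_normal_pdf.
- by move=> x _; rewrite mule_ge0 // Radon_Nikodym_SigmaFinite.f_ge0.
- by move=> x _; rewrite mule_ge0 // lee_fin normal_pdf_ge0.
apply: ae_eqe_mul2l; apply: integral_ae_eq => //.
- exact: Radon_Nikodym_SigmaFinite.f_integrable.
- by apply/measurable_EFinP; exact: measurable_normal_pdf.
- by move=> E _ mE; rewrite -Radon_Nikodym_SigmaFinite.f_integral.
Qed.

(** Completing the square: an exponential weight moves the mean to [t * s ^+ 2], so the moment
    generating function is read off from the total mass of a shifted density. *)
Lemma normal_pdf_tilt (t x : R) : s != 0 ->
  expR (t * x) * normal_pdf 0 s x =
  expR (t ^+ 2 * s ^+ 2 / 2) * normal_pdf (t * s ^+ 2) s x.
Proof.
move=> s0; rewrite /normal_pdf (negbTE s0) mulrCA [RHS]mulrCA; congr (_ * _).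
rewrite /normal_fun -!expRD; congr expR; field.
by rewrite s0.
Qed.

Lemma gaussian_mgf_integral (t : R) :
  (\int[P]_x (expR (t * X x))%:E = (expR (t ^+ 2 * s ^+ 2 / 2))%:E)%E.
Proof.
have [mX law] := GX.
have mE : measurable_fun setT (fun y : R => (expR (t * y))%:E).
  apply/measurable_EFinP; apply: (@measurableT_comp _ _ _ _ _ _ expR _ (fun y : R => t * y)) => //.
  exact: mulrl_measurable.
have [s0|s0] := eqVneq s 0.
  transitivity (\int[pushforward P X]_y (expR (t * y))%:E)%E.
    by rewrite ge0_integral_pushforward.
  rewrite (eq_measure_integral \d_(0 : R)); last first.
    by move=> A mA _; have := law A mA; rewrite s0 eqxx.
  rewrite integral_dirac // diracT mul1e mulr0 expR0.
  by rewrite s0 expr0n mulr0 mul0r expR0.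
transitivity (\int[normal_prob 0 s]_y (expR (t * y))%:E)%E.
  have mX' : measurable_fun setT (X : T -> measurableTypeR R) := mX.
  rewrite -[LHS](@ge0_integral_pushforward _ _ _ _ _ _ mX' P setT
    (fun y => (expR (t * y))%:E)) //.
  by apply: eq_measure_integral => A mA _; have := law A mA; rewrite (negbTE s0).
rewrite integral_normal_prob //.
under eq_integral => x _ do rewrite -EFinM normal_pdf_tilt // EFinM.
rewrite integralZl //; last exact: integrable_normal_pdf.
by rewrite integral_normal_pdf mule1.
Qed.

Lemma intg_expRX (t : R) : intg P (fun x => expR (t * X x)).
Proof.
have [mX law] := GX.
have mE : measurable_fun setT (fun y => expR (t * X y)).
  by apply: (measurableT_comp (f := expR)) => //; exact: measurable_funM.
apply/integrableP; split; first exact/measurable_EFinP.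
under eq_integral do rewrite /= ger0_norm ?expR_ge0 //.
by rewrite gaussian_mgf_integral ltry.
Qed.

Lemma Ex_expRX (t : R) : Ex P (fun x => expR (t * X x)) = expR (t ^+ 2 * s ^+ 2 / 2).
Proof. by rewrite ExE gaussian_mgf_integral. Qed.

(** A single term of the exponential series at [|y|]. It lets exponential moments dominate every
    polynomial moment. *)
Lemma normX_le_expR (y : R) k : `|y| ^+ k <= k`!%:R * (expR y + expR (- y)).
Proof.
have H (z : R) : 0 <= z -> z ^+ k <= k`!%:R * expR z.
  case: k => [|k] z0; first by rewrite expr0 mul1r (le_trans _ (expR_ge1Dx z)) // lerDl.
  rewrite mulrC -ler_pdivrMr ?ltr0n ?fact_gt0 //.
  by apply: le_trans (expR_ge1Dxn k z0); rewrite lerDr.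
apply: (le_trans (H _ (normr_ge0 y))); rewrite ler_wpM2l //.
by have [y0|y0] := leP 0 y; rewrite ?(ger0_norm y0) ?(ltr0_norm y0) ?lerDl ?lerDr expR_ge0.
Qed.

Lemma intg_powX_expR k (t : R) : intg P (fun x => `|X x| ^+ k * expR (t * X x)).
Proof.
have [mX law] := GX.
have mE : measurable_fun setT (fun y => expR (t * X y)).
  by apply: (measurableT_comp (f := expR)) => //; exact: measurable_funM.
apply: (intg_le (Y := fun x => k`!%:R * (expR ((t + 1) * X x) + expR ((t - 1) * X x)))).
- apply: measurable_funM => //; apply: measurable_funX.
  exact: measurableT_comp.
- move=> x; rewrite ger0_norm ?mulr_ge0 ?exprn_ge0 ?expR_ge0 //.
  rewrite !mulrDl mul1r mulN1r !expRD -mulrDr mulrCA mulrC.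
  by rewrite ler_wpM2l ?expR_ge0 // normX_le_expR.
- by apply: intgZ; apply: intgD; exact: intg_expRX.
Qed.

Let m k (t : R) : R := Ex P (fun x => X x ^+ k * expR (t * X x)).

Lemma gmom_meas k (t : R) : measurable_fun setT (fun x => X x ^+ k * expR (t * X x)).
Proof.
have [mX law] := GX.
apply: measurable_funM; first exact: measurable_funX.
by apply: (measurableT_comp (f := expR)) => //; exact: measurable_funM.
Qed.

Lemma gmom_intg k (t : R) : intg P (fun x => X x ^+ k * expR (t * X x)).
Proof.
apply: intg_le (intg_powX_expR k t) => [|x]; first exact: gmom_meas.
by rewrite normrM normrX [`|expR _|]ger0_norm ?expR_ge0.
Qed.

(** Differentiation under the integral sign: [m k] is the [k]-th derivative of the moment generating
    function. *)
Lemma gmom_derive k (t : R) : is_derive t 1 (m k) (m k.+1 t).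
Proof.
pose f (u : R) (x : T) := X x ^+ k * expR (u * X x).
have df (u : R) (x : T) : is_derive u (1 : R) (fun v : R => f v x) (X x ^+ k.+1 * expR (u * X x)).
  apply: is_derive_eq; rewrite /= !scaler1 scaler0 add0r exprSr.
  by rewrite /GRing.scale /=; ring.
have pE (u : R) x : partial1of2 f u x = X x ^+ k.+1 * expR (u * X x).
  by rewrite partial1of2E derive_val.
have mE : m k = (fun u => \int[P]_(x in setT) f u x).
  by apply/funext => u; rewrite /m ExE.
(* For [u] within 1 of [t], the exponential is at most its value at [t + 1] when [X x >= 0] and at
   [t - 1] otherwise; the sum dominates both cases. *)
pose G x := `|X x| ^+ k.+1 * expR ((t + 1) * X x) + `|X x| ^+ k.+1 * expR ((t - 1) * X x).
have G0 x : 0 <= G x by rewrite addr_ge0 // mulr_ge0 ?exprn_ge0 ?expR_ge0.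
have iG : intg P G by apply: intgD; exact: intg_powX_expR.
have I0 : `]t - 1, t + 1[%classic t by rewrite /= in_itv /= ltrBlDr !ltrDl ltr01.
have bd (u : R) x : `]t - 1, t + 1[%classic u -> setT x -> `|partial1of2 f u x| <= G x.
  rewrite /= in_itv /= => /andP[/ltW u1 /ltW u2] _.
  rewrite pE normrM normrX [`|expR _|]ger0_norm ?expR_ge0 // /G -mulrDr.
  rewrite ler_wpM2l ?exprn_ge0 //; have [x0|x0] := leP 0 (X x).
    by rewrite (le_trans (y := expR ((t + 1) * X x))) ?ler_expR ?ler_wpM2r ?lerDl ?expR_ge0.
  rewrite (le_trans (y := expR ((t - 1) * X x))) ?lerDr ?expR_ge0 // ler_expR.
  by rewrite ler_wnM2r // ltW.
have iF (u : R) : `]t - 1, t + 1[%classic u -> P.-integrable setT (EFin \o f u).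
  by move=> _; exact: gmom_intg.
have dF (u : R) x : `]t - 1, t + 1[%classic u -> setT x -> derivable (f^~ x) u 1.
  by move=> _ _; exact: (@ex_derive _ _ _ _ _ _ _ (df u x)).
rewrite mE; apply: DeriveDef.
  exact: (derivable_under_integral measurableT I0 iF dF G0 iG bd).
rewrite -derive1E (differentiation_under_integral measurableT I0 iF dF G0 iG bd).
by rewrite /m ExE; congr fine; apply: eq_integral => x _; rewrite pE.
Qed.

Lemma gaussian_intgX k : intg P (fun x => X x ^+ k).
Proof. by have := gmom_intg k 0; under eq_fun do rewrite mul0r expR0 mulr1. Qed.

(** The generating function satisfies [m' = t * s^2 * m]; differentiating this identity [k] times
    gives the recursion, and at [t = 0] that of the Gaussian moments. *)
Lemma gmom_rec k : m k.+1 = fun t => t * (s ^+ 2 * m k t) + k%:R * s ^+ 2 * m k.-1 t.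
Proof.
elim: k => [|k IH].
  apply/funext => t; rewrite mul0r mul0r addr0.
  have m0E : m 0%N = fun u => expR (u ^+ 2 * s ^+ 2 / 2).
    by apply/funext => u; rewrite /m; under eq_Ex do rewrite expr0 mul1r; exact: Ex_expRX.
  have m0E' : m 0%N = fun u => expR (u * (u * (s ^+ 2 / 2))).
    by rewrite m0E; apply/funext => u; rewrite expr2 !mulrA.
  have [_ <-] := gmom_derive 0 t.
  rewrite m0E'.
  have dg : is_derive t (1 : R) (fun u : R => expR (u * (u * (s ^+ 2 / 2))))
      (t * (s ^+ 2 * expR (t * (t * (s ^+ 2 / 2))))).
    by apply: is_derive_eq; rewrite /GRing.scale /=; field.
  by have [_ <-] := dg.
apply/funext => t; have [_ <-] := gmom_derive k.+1 t.
rewrite [in LHS]IH.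
have dk := gmom_derive k t; have dk1 := gmom_derive k.-1 t.
have dg : is_derive t (1 : R) (fun u : R => u * (s ^+ 2 * m k u) + k%:R * s ^+ 2 * m k.-1 u)
    (t * (s ^+ 2 * m k.+1 t) + s ^+ 2 * m k t + k%:R * s ^+ 2 * m k.-1.+1 t).
  apply: is_derive_eq; rewrite /GRing.scale /=; ring.
have [_ ->] := dg; rewrite /= -addrA; congr (_ + _).
case: (k) => [|j] /=; first by rewrite mul0r mul0r addr0 mul1r.
by rewrite [in RHS]mulrS; ring.
Qed.

Lemma gaussian_mom_rec k :
  Ex P (fun x => X x ^+ k.+2) = k.+1%:R * s ^+ 2 * Ex P (fun x => X x ^+ k).
Proof.
have mE j : Ex P (fun x => X x ^+ j) = m j 0.
  by rewrite /m; apply: eq_Ex => x; rewrite mul0r expR0 mulr1.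
by rewrite !mE gmom_rec /= mul0r add0r.
Qed.

Lemma gaussian_mean : Ex P X = 0.
Proof.
have mE j : Ex P (fun x => X x ^+ j) = m j 0.
  by rewrite /m; apply: eq_Ex => x; rewrite mul0r expR0 mulr1.
have := mE 1%N; rewrite gmom_rec !mul0r addr0 => <-.
by apply: eq_Ex.
Qed.

Lemma gaussian_var : Ex P (fun x => X x ^+ 2) = s ^+ 2.
Proof.
rewrite gaussian_mom_rec mul1r (_ : (fun x => X x ^+ 0) = fun=> 1) ?Ex_cst ?mulr1 //.
Qed.

Lemma gaussian_mom4 : Ex P (fun x => X x ^+ 4) = 3 * s ^+ 4.
Proof. by rewrite gaussian_mom_rec gaussian_var -mulrA -exprD. Qed.

End GaussianMoments.

(** * Characteristic functions from converging moments *)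

Section CosSinTaylor.
Context {R : realType}.

(** With [p] the monomial [x^(n+1) / (n+1)!], both [p + f] and [p - f] have nonnegative derivative
    and vanish at 0. *)
Lemma norm_le_of_derive (f g : R -> R) n :
  (forall x, is_derive x (1 : R) f (g x)) -> f 0 = 0 ->
  (forall x, 0 <= x -> `|g x| <= x ^+ n / n`!%:R) ->
  forall x, 0 <= x -> `|f x| <= x ^+ n.+1 / n.+1`!%:R.
Proof.
move=> df f0 gb x x0.
have [->|xn0] := eqVneq x 0; first by rewrite f0 normr0 expr0n mul0r.
pose p : R -> R := horner ((n.+1`!%:R^-1)%:P * 'X^(n.+1)).
have pE (y : R) : p y = y ^+ n.+1 / n.+1`!%:R.
  by rewrite /p hornerM hornerC hornerXn mulrC.
have dp (y : R) : is_derive y (1 : R) p (y ^+ n / n`!%:R).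
  have dE : ((n.+1`!%:R^-1)%:P * 'X^(n.+1))^`().[y] = y ^+ n / n`!%:R :> R.
    rewrite derivM derivC mul0r add0r derivXn !hornerE hornerMn hornerXn factS natrM /= -mulr_natr.
    by field; rewrite ?nat1r !pnatr_eq0 -lt0n fact_gt0.
  by rewrite -dE; exact: is_derive_poly.
have mono (h : R -> R) (k : R -> R) : (forall y, is_derive y (1 : R) h (k y)) ->
    (forall y, 0 <= y -> 0 <= k y) -> h 0 <= h x.
  move=> dh k0; apply: (@ger0_derive1_le _ h 0 x _ _ true false) => //.
  - move=> y; rewrite in_itv /= => /andP[/ltW y0 _].
    by rewrite derive1E (@derive_val _ _ _ _ _ _ _ (dh y)) k0.
  - apply: continuous_subspaceT => y.
    apply: differentiable_continuous; apply/derivable1_diffP.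
    exact: (@ex_derive _ _ _ _ _ _ _ (dh y)).
  - by rewrite in_itv /= lexx x0.
  - by rewrite in_itv /= x0 lexx.
rewrite -pE; have p0 : p 0 = 0 by rewrite pE expr0n mul0r.
rewrite ler_norml; apply/andP; split.
  have dh y : is_derive y (1 : R) (fun z => p z + f z) (y ^+ n / n`!%:R + g y).
    by have ? := dp y; have ? := df y; apply: is_derive_eq.
  have := mono _ _ dh; rewrite p0 f0 addr0 => H.
  rewrite -subr_ge0 opprK addrC; apply: H => y y0.
  by have := gb y y0; rewrite ler_norml => /andP[]; rewrite -subr_ge0 opprK addrC.
have dh y : is_derive y (1 : R) (fun z => p z - f z) (y ^+ n / n`!%:R - g y).
  by have ? := dp y; have ? := df y; apply: is_derive_eq.
have := mono _ _ dh; rewrite p0 f0 subr0 => H.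
rewrite -subr_ge0; apply: H => y y0; rewrite subr_ge0.
exact: le_trans (ler_norm _) (gb y y0).
Qed.

(** The real part of [i^k]; [rs] below is the imaginary part. *)
Let rc k : R := if odd k then 0 else (-1) ^+ k./2.
Let rs k : R := if odd k then (-1) ^+ k./2 else 0.

Lemma trig_rc k : rc k.+1 = - rs k.
Proof.
rewrite /rc /rs /=; case: (boolP (odd k)) => ko /=; last by rewrite oppr0.
by rewrite -[k in LHS]odd_double_half ko /= doubleK exprS mulN1r.
Qed.

Lemma trig_rs k : rs k.+1 = rc k.
Proof.
rewrite /rc /rs /=; case: (boolP (odd k)) => ko //=.
by rewrite -[k in LHS]odd_double_half (negbTE ko) /= uphalf_double.
Qed.

Definition cos_poly n : {poly R} := \poly_(k < n) (rc k / k`!%:R).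
Definition sin_poly n : {poly R} := \poly_(k < n) (rs k / k`!%:R).

Lemma fact_quot k (x : R) : x / k.+1`!%:R *+ k.+1 = x / k`!%:R.
Proof.
rewrite factS natrM invfM -mulr_natr; field.
by rewrite nat1r !pnatr_eq0 -lt0n fact_gt0.
Qed.

Lemma deriv_cos_poly n : (cos_poly n.+1)^`() = - sin_poly n.
Proof.
apply/polyP => k; rewrite coef_deriv coefN !coef_poly ltnS.
by case: ifP => _; rewrite ?mul0rn ?oppr0 // fact_quot trig_rc mulNr.
Qed.

Lemma deriv_sin_poly n : (sin_poly n.+1)^`() = cos_poly n.
Proof.
apply/polyP => k; rewrite coef_deriv !coef_poly ltnS.
by case: ifP => _; rewrite ?mul0rn // fact_quot trig_rs.
Qed.

(** Both functions go through one induction since each is, up to sign, the derivative of the other;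
    degree 0 is the bound by 1. *)
Lemma cos_sin_taylor_ge0 n (x : R) : 0 <= x ->
  `|cos x - (cos_poly n).[x]| <= x ^+ n / n`!%:R /\
  `|sin x - (sin_poly n).[x]| <= x ^+ n / n`!%:R.
Proof.
elim: n x => [|n IH] x x0.
  rewrite /cos_poly /sin_poly !poly_def !big_ord0 !horner0 !subr0 expr0 fact0 divr1.
  by rewrite !ler_norml cos_geN1 cos_le1 sin_geN1 sin_le1.
split.
  apply: (@norm_le_of_derive (fun y => cos y - (cos_poly n.+1).[y])
    (fun y => - (sin y - (sin_poly n).[y]))) => //.
  - move=> y; have ? := is_derive_poly (cos_poly n.+1) y.
    by apply: is_derive_eq; rewrite deriv_cos_poly hornerN opprB opprK addrC.
  - by rewrite cos0 horner_coef0 coef_poly /= divr1 subrr.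
  - by move=> y y0; rewrite normrN; have [] := IH y y0.
apply: (@norm_le_of_derive (fun y => sin y - (sin_poly n.+1).[y])
    (fun y => cos y - (cos_poly n).[y])) => //.
- move=> y; have ? := is_derive_poly (sin_poly n.+1) y.
  by apply: is_derive_eq; rewrite deriv_sin_poly.
- by rewrite sin0 horner_coef0 coef_poly /= mul0r subrr.
- by move=> y y0; have [] := IH y y0.
Qed.

Lemma cos_sin_taylor n (x : R) :
  `|cos x - (cos_poly n).[x]| <= `|x| ^+ n / n`!%:R /\
  `|sin x - (sin_poly n).[x]| <= `|x| ^+ n / n`!%:R.
Proof.
have [x0|x0] := leP 0 x; first by rewrite (ger0_norm x0); exact: cos_sin_taylor_ge0.
rewrite (ltr0_norm x0).
have -> : (cos_poly n).[x] = (cos_poly n).[- x].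
  rewrite /cos_poly !horner_poly; apply: eq_bigr => k _.
  rewrite /rc; case: (boolP (odd k)) => ko; first by rewrite !mul0r.
  by rewrite (exprNn x) -(signr_odd _ k) (negbTE ko) mul1r.
have -> : (sin_poly n).[x] = - (sin_poly n).[- x].
  rewrite /sin_poly !horner_poly -sumrN; apply: eq_bigr => k _.
  rewrite /rs; case: (boolP (odd k)) => ko; last by rewrite !mul0r oppr0.
  by rewrite (exprNn x) -(signr_odd _ k) ko expr1 mulN1r mulrN opprK.
rewrite -(cosN x) -[sin x]opprK -(sinN x) -opprD normrN.
by apply: cos_sin_taylor_ge0; rewrite oppr_ge0 ltW.
Qed.

(** The recursion solves to [mu (2j) / (2j)! = (v/2)^j / j!], so integrating the cosine polynomial
    produces a partial sum of [exp (- v/2)]. The last conclusion is the size of the Taylor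
    remainder; the order [m.*2] is even so that this remainder is a moment. *)
Lemma cos_poly_moment (v : R) (mu : nat -> R) m :
  mu 0%N = 1 -> mu 1%N = 0 -> (forall k, mu k.+2 = k.+1%:R * v * mu k) ->
  \sum_(k < m.*2) (rc k / k`!%:R) * mu k = series (exp_coeff (- v / 2)) m /\
  \sum_(k < m.*2) (rs k / k`!%:R) * mu k = 0 /\
  mu m.*2 / m.*2`!%:R = exp_coeff (v / 2) m.
Proof.
move=> mu0 mu1 mu2.
have ev j : mu j.*2 / j.*2`!%:R = exp_coeff (v / 2) j.
  elim: j => [|j IH]; first by rewrite mu0 /exp_coeff /= expr0.
  rewrite doubleS mu2 /exp_coeff /= exprS !factS !natrM !invfM.
  transitivity (v / 2 * j.+1%:R^-1 * (mu j.*2 / j.*2`!%:R)); last first.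
    by rewrite IH /exp_coeff /=; ring.
  have -> : (j.*2.+2)%:R = 2 * j.+1%:R :> R by rewrite -doubleS -muln2 natrM mulrC.
  by field; rewrite !nat1r !pnatr_eq0 -lt0n fact_gt0.
have odd0 i : mu i.*2.+1 = 0.
  by elim: i => [|i IHi]; rewrite ?mu1 // doubleS mu2 IHi mulr0.
split; last split => //.
  elim: m => [|m IHm]; first by rewrite big_ord0 /series /= big_geq.
  rewrite doubleS !big_ord_recr /= IHm odd0 mulr0 addr0 seriesSr; congr (_ + _).
  rewrite /rc odd_double doubleK -mulrA [_^-1 * _]mulrC ev /exp_coeff /=.
  by rewrite mulNr [in RHS]exprNn mulrA.
elim: m => [|m IHm]; first by rewrite big_ord0.
by rewrite doubleS !big_ord_recr /= IHm odd0 mulr0 addr0 /rs odd_double !mul0r addr0.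
Qed.

(** For a fixed Taylor order only finitely many moments occur, so the limit in [N] is harmless. The
    remainder tends in [N] to [(v/2)^m / m!], which is made small first by the choice of [m]; no
    series is exchanged with a limit. *)
Lemma charfun_of_moments (v : R) (mu : nat -> R)
    (d : nat -> measure_display) (T : forall N, measurableType (d N))
    (P : forall N, probability (T N) R) (Z : forall N, T N -> R) :
  mu 0%N = 1 -> mu 1%N = 0 -> (forall k, mu k.+2 = k.+1%:R * v * mu k) ->
  0 <= v ->
  (forall N k, intg (P N) (fun x => Z N x ^+ k)) ->
  (forall k, Ex (P N) (fun x => Z N x ^+ k) @[N --> \oo] --> mu k) ->
  Ex (P N) (fun x => cos (Z N x)) @[N --> \oo] --> expR (- v / 2) /\
  Ex (P N) (fun x => sin (Z N x)) @[N --> \oo] --> 0.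
Proof.
move=> mu0 mu1 mu2 v0 iZ cZ.
have mZ N : measurable_fun setT (Z N) by have := intg_meas (iZ N 1%N).
(* The four shares of [e]: the limit polynomial against [l], the convergence of its moments, the
   limit of the Taylor remainder, and the convergence of that remainder. *)
have general (F : R -> R) (p : {poly R}) (l : R) m e : 0 < e ->
    continuous F -> (forall x, `|F x| <= 1) ->
    (forall x, `|F x - p.[x]| <= `|x| ^+ m.*2 / m.*2`!%:R) ->
    `|\sum_(k < size p) p`_k * mu k - l| < e -> exp_coeff (v / 2) m < e ->
    \forall N \near \oo, `|Ex (P N) (fun x => F (Z N x)) - l| < 4 * e.
  move=> e0 cF F1 HF Hl Hm.
  have mF N : measurable_fun setT (fun x => F (Z N x)).
    by apply: measurableT_comp => //; exact: continuous_measurable_fun.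
  have iF N : intg (P N) (fun x => F (Z N x)) by exact: intg_bnd.
  have pE N x : p.[Z N x] = \sum_(k < size p) p`_k * Z N x ^+ k by rewrite horner_coef.
  have ip N : intg (P N) (fun x => p.[Z N x]).
    by under eq_fun do rewrite pE; apply: intg_sum => k _; apply: intgZ; exact: iZ.
  have Epoly N : Ex (P N) (fun x => p.[Z N x]) =
      \sum_(k < size p) p`_k * Ex (P N) (fun x => Z N x ^+ k).
    under eq_Ex do rewrite pE; rewrite Ex_sum; last by move=> k _; apply: intgZ; exact: iZ.
    by apply: eq_bigr => k _; rewrite ExZ.
  have c1 : \forall N \near \oo, `|\sum_(k < size p) p`_k * mu k -
      Ex (P N) (fun x => p.[Z N x])| < e.
    have /cvgrPdist_lt /(_ _ e0) : Ex (P N) (fun x => p.[Z N x]) @[N --> \oo] -->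
        \sum_(k < size p) p`_k * mu k.
      under eq_fun do rewrite Epoly.
      by apply: cvg_sumR => k; apply: cvgMr; exact: cZ.
    by [].
  have [_ [_ muE]] := cos_poly_moment m mu0 mu1 mu2.
  have c2 : \forall N \near \oo, `|mu m.*2 / m.*2`!%:R -
      Ex (P N) (fun x => Z N x ^+ m.*2) / m.*2`!%:R| < e.
    have /cvgrPdist_lt /(_ _ e0) : Ex (P N) (fun x => Z N x ^+ m.*2) / m.*2`!%:R
        @[N --> \oo] --> mu m.*2 / m.*2`!%:R by apply: cvgMl; exact: cZ.
    by [].
  near=> N.
  have h1 : `|\sum_(k < size p) p`_k * mu k - Ex (P N) (fun x => p.[Z N x])| < e by near: N.
  have h2 : `|mu m.*2 / m.*2`!%:R - Ex (P N) (fun x => Z N x ^+ m.*2) / m.*2`!%:R| < e.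
    by near: N.
  have h3 : `|Ex (P N) (fun x => F (Z N x)) - Ex (P N) (fun x => p.[Z N x])| <=
      Ex (P N) (fun x => Z N x ^+ m.*2) / m.*2`!%:R.
    rewrite -ExB // mulrC -ExZ; last exact: iZ.
    apply: Ex_ge_abs; [exact: intgB|exact/intgZ/iZ|move=> x].
    rewrite (le_trans (HF _)) // mulrC ler_wpM2l ?invr_ge0 //.
    by rewrite -mul2n !exprM real_normK ?num_real.
  move: h1 h2 h3 Hl Hm; rewrite -muE.
  set A := \sum_(_ < _) _; set B := Ex _ (fun _ => p.[_]); set D := Ex _ (fun _ => F _);
  set E := _ / _; set G := _ / _.
  move=> h1 h2 h3 Hl Hm.
  have -> : D - l = (D - B) + ((A - l) - (A - B)) by ring.
  apply: le_lt_trans (ler_normD _ _) _.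
  have h4 : `|(A - l) - (A - B)| < e + e by rewrite (le_lt_trans (ler_normB _ _)) ?ltrD.
  have h5 : G < e + e.
    have : `|G| <= `|E| + `|E - G| by have := ler_normB E (E - G); rewrite subKr.
    have G0 : 0 <= G.
      by rewrite divr_ge0 // Ex_ge0 // => x; rewrite -mul2n exprM exprn_ge0 // sqr_ge0.
    have E0 : 0 <= E by rewrite /E muE exp_coeff_ge0 // divr_ge0.
    rewrite (ger0_norm G0) (ger0_norm E0) => /le_lt_trans; apply.
    by rewrite ltrD.
  by lra.
have [H1 H2] : (exp_coeff (v / 2) m @[m --> \oo] --> (0 : R)) /\
    (series (exp_coeff (- v / 2)) m @[m --> \oo] --> expR (- v / 2)).
  by split; [exact: cvg_exp_coeff|exact: is_cvg_series_exp_coeff].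
have size_sum (p : {poly R}) n : (size p <= n)%N ->
    \sum_(k < size p) p`_k * mu k = \sum_(k < n) p`_k * mu k.
  move=> pn; rewrite (big_ord_widen n (fun k => p`_k * mu k) pn) big_mkcond /=.
  apply: eq_bigr => k _; case: ltnP => // kp; by rewrite nth_default ?mul0r.
split; apply/cvgrPdist_lt => e e0.
  have e4 : 0 < e / 4 by rewrite divr_gt0.
  have [m [Hm1 Hm2]] : exists m, exp_coeff (v / 2) m < e / 4 /\
     `|series (exp_coeff (- v / 2)) m - expR (- v / 2)| < e / 4.
    move/cvgrPdist_lt : H1 => /(_ _ e4) H1; move/cvgrPdist_lt : H2 => /(_ _ e4) H2.
    have [m _ Hm] : \forall m \near \oo, `|0 - exp_coeff (v / 2) m| < e / 4 /\
      `|expR (- v / 2) - series (exp_coeff (- v / 2)) m| < e / 4.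
      by near=> m; split; near: m.
    have [h1 h2] := Hm m (leqnn m); exists m; split; last by rewrite distrC.
    by apply: le_lt_trans h1; rewrite sub0r normrN ler_norm.
  have := general (@cos R) (cos_poly m.*2) (expR (- v / 2)) m _ e4.
  move=> /(_ (@continuous_cos R) (fun x => _)).
  have [P1 [P2 P3]] := cos_poly_moment m mu0 mu1 mu2.
  have c1 x : `|cos x| <= 1 :> R by rewrite ler_norml cos_geN1 cos_le1.
  move=> /(_ (fun x => c1 x)) /(_ (fun x => proj1 (cos_sin_taylor _ x))).
  rewrite (size_sum _ m.*2) ?size_poly //.
  under eq_bigr do rewrite coef_poly ltn_ord.
  rewrite P1 => /(_ Hm2 Hm1) [n _ Hn]; exists n => // N /= nN.
  rewrite distrC; have -> : e = 4 * (e / 4) by field.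
exact: Hn.
have e4 : 0 < e / 4 by rewrite divr_gt0.
have [m Hm1] : exists m, exp_coeff (v / 2) m < e / 4.
  move/cvgrPdist_lt : H1 => /(_ _ e4) [m _ Hm]; exists m.
  have := Hm m (leqnn m); apply: le_lt_trans.
  by rewrite sub0r normrN ler_norm.
have := general (@sin R) (sin_poly m.*2) 0 m _ e4 (@continuous_sin R).
have [P1 [P2 P3]] := cos_poly_moment m mu0 mu1 mu2.
have c1 (x : R) : `|sin x| <= 1 by rewrite ler_norml sin_geN1 sin_le1.
move=> /(_ c1 (fun x => proj2 (cos_sin_taylor _ x))).
rewrite (size_sum _ m.*2) ?size_poly //.
under eq_bigr do rewrite coef_poly ltn_ord.
rewrite P2 subrr normr0 => /(_ e4 Hm1) [n _ Hn]; exists n => // N /= nN.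
rewrite distrC; have -> : e = 4 * (e / 4) by field.
exact: Hn.
Unshelve. all: by end_near.
Qed.

End CosSinTaylor.

(** * Convergence in law *)

Section TrigPolynomials.
Context {R : realType} (I : finType).
Local Notation V := (I -> R).

Definition dotp (l x : V) : R := \sum_i l i * x i.

(** Trigonometric polynomials as an inductive predicate, so that measurability, boundedness and
    convergence of expectations pass from single waves to all of them by induction. *)
Inductive trig : (V -> R) -> Prop :=
| trig_cos l : trig (fun x => cos (dotp l x))
| trig_sin l : trig (fun x => sin (dotp l x))
| trig_add f g : trig f -> trig g -> trig (fun x => f x + g x)
| trig_scale c f : trig f -> trig (fun x => c * f x).

Lemma dotpD l m x : dotp (fun i => l i + m i) x = dotp l x + dotp m x.
Proof. by rewrite /dotp -big_split /=; apply: eq_bigr => i _; rewrite mulrDl. Qed.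

Lemma dotpB l m x : dotp (fun i => l i - m i) x = dotp l x - dotp m x.
Proof. by rewrite /dotp -sumrB; apply: eq_bigr => i _; rewrite mulrBl. Qed.

Lemma trig_ext f g : f =1 g -> trig f -> trig g.
Proof. by move=> /funext ->. Qed.

Lemma trig_cst c : trig (fun=> c).
Proof.
apply: (trig_ext _ (trig_scale c (trig_cos (fun=> 0)))) => x /=.
by rewrite /dotp big1 ?cos0 ?mulr1 // => i _; rewrite mul0r.
Qed.

(** Product-to-sum formulas on waves, then bilinearity. This makes [trig] an algebra, as Bernstein
    polynomials in sines require. *)
Lemma trig_mul f g : trig f -> trig g -> trig (fun x => f x * g x).
Proof.
move=> tf tg; elim: tf => {f} [l|l|f1 f2 _ IH1 _ IH2|c f _ IH].
- elim: tg => {g} [m|m|g1 g2 _ IH1 _ IH2|c g _ IH].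
  + apply: (trig_ext _ (trig_scale 2^-1 (trig_add
      (trig_cos (fun i => l i + m i)) (trig_cos (fun i => l i - m i))))) => x.
    by rewrite dotpD dotpB cosD cosB; field.
  + apply: (trig_ext _ (trig_scale 2^-1 (trig_add
      (trig_sin (fun i => l i + m i)) (trig_scale (-1) (trig_sin (fun i => l i - m i)))))) => x.
    by rewrite dotpD dotpB sinD sinB; field.
  + by apply: (trig_ext _ (trig_add IH1 IH2)) => x; rewrite mulrDr.
  + by apply: (trig_ext _ (trig_scale c IH)) => x; rewrite mulrCA.
- elim: tg => {g} [m|m|g1 g2 _ IH1 _ IH2|c g _ IH].
  + apply: (trig_ext _ (trig_scale 2^-1 (trig_add
      (trig_sin (fun i => l i + m i)) (trig_sin (fun i => l i - m i))))) => x.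
    by rewrite dotpD dotpB sinD sinB; field.
  + apply: (trig_ext _ (trig_scale 2^-1 (trig_add
      (trig_cos (fun i => l i - m i)) (trig_scale (-1) (trig_cos (fun i => l i + m i)))))) => x.
    by rewrite (dotpB l m) (dotpD l m) cosB cosD; field.
  + by apply: (trig_ext _ (trig_add IH1 IH2)) => x; rewrite mulrDr.
  + by apply: (trig_ext _ (trig_scale c IH)) => x; rewrite mulrCA.
- by apply: (trig_ext _ (trig_add IH1 IH2)) => x; rewrite mulrDl.
- by apply: (trig_ext _ (trig_scale c IH)) => x; rewrite mulrA.
Qed.

Lemma trig_sum J (r : seq J) (F : J -> V -> R) :
  (forall j, trig (F j)) -> trig (fun x => \sum_(j <- r) F j x).
Proof.
move=> tF; elim: r => [|j r IH].
  by apply: (trig_ext _ (trig_cst 0)) => x; rewrite big_nil.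
by apply: (trig_ext _ (trig_add (tF j) IH)) => x; rewrite big_cons.
Qed.

Lemma trig_prod J (r : seq J) (F : J -> V -> R) :
  (forall j, trig (F j)) -> trig (fun x => \prod_(j <- r) F j x).
Proof.
move=> tF; elim: r => [|j r IH].
  by apply: (trig_ext _ (trig_cst 1)) => x; rewrite big_nil.
by apply: (trig_ext _ (trig_mul (tF j) IH)) => x; rewrite big_cons.
Qed.

Lemma trig_exp f n : trig f -> trig (fun x => f x ^+ n).
Proof.
move=> tf; elim: n => [|n IH].
  by apply: (trig_ext _ (trig_cst 1)) => x; rewrite expr0.
by apply: (trig_ext _ (trig_mul tf IH)) => x; rewrite exprS.
Qed.

(** Binomial weights: Bernstein approximation averages [f] over a binomial variable [k / n], which
    concentrates at [p] with the variance bound [bern_var_le]. *)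
Definition bern n (p : R) (k : nat) : R := 'C(n, k)%:R * p ^+ k * (1 - p) ^+ (n - k).

Lemma bern_ge0 n p k : 0 <= p <= 1 -> 0 <= bern n p k.
Proof.
by case/andP=> p0 p1; rewrite /bern !mulr_ge0 // exprn_ge0 // subr_ge0.
Qed.

Lemma bern_sum n p : \sum_(k < n.+1) bern n p k = 1.
Proof.
have := exprDn (1 - p) p n; rewrite subrK expr1n => ->.
by apply: eq_bigr => k _; rewrite /bern -mulr_natl; ring.
Qed.

(** The absorption identity [k C(n+1,k) = (n+1) C(n,k-1)]. Applied to constant and linear [g] it
    gives the first two moments of the binomial law. *)
Lemma bern_shift n p (g : nat -> R) :
  \sum_(k < n.+2) bern n.+1 p k * (k%:R * g k) =
  n.+1%:R * p * \sum_(k < n.+1) bern n p k * g k.+1.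
Proof.
rewrite big_ord_recl /= mul0r mulr0 add0r mulr_sumr; apply: eq_bigr => k _.
rewrite /bump /= add1n /bern subSS exprS.
have := congr1 (fun m => m%:R : R) (mul_bin_diag n.+1 k); rewrite !natrM /= => H.
have -> : 'C(n.+1, k.+1)%:R * (p * p ^+ k) * (1 - p) ^+ (n - k) * (k.+1%:R * g k.+1) =
  (k.+1%:R * 'C(n.+1, k.+1)%:R) * (p * p ^+ k) * (1 - p) ^+ (n - k) * g k.+1 by ring.
by rewrite -H; ring.
Qed.

Lemma bern_var n p :
  \sum_(k < n.+1) bern n p k * (k%:R - n%:R * p) ^+ 2 = n%:R * p * (1 - p).
Proof.
case: n => [|n]; first by rewrite big_ord1 !mul0r subrr expr0n mulr0.
have -> : \sum_(k < n.+2) bern n.+1 p k * (k%:R - n.+1%:R * p) ^+ 2 =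
  \sum_(k < n.+2) bern n.+1 p k * (k%:R * k%:R) -
  2 * (n.+1%:R * p) * (\sum_(k < n.+2) bern n.+1 p k * (k%:R * 1)) +
  (n.+1%:R * p) ^+ 2 * (\sum_(k < n.+2) bern n.+1 p k).
  rewrite !mulr_sumr -sumrB -big_split /=; apply: eq_bigr => k _; ring.
rewrite (bern_shift n p (fun k => k%:R)) (bern_shift n p (fun=> 1)) bern_sum.
under [X in _ - _ * (_ * X)]eq_bigr do rewrite mulr1.
rewrite bern_sum.
have -> : \sum_(k < n.+1) bern n p k * k.+1%:R = 1 + n%:R * p.
  under eq_bigr do rewrite -natr1 mulrDr mulr1.
  rewrite big_split /= bern_sum addrC; congr (_ + _).
  case: (n) => [|m]; first by rewrite big_ord1 mulr0 mul0r.
  under eq_bigr do rewrite -[X in _ * X]mulr1.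
  rewrite (bern_shift m p (fun=> 1)); under eq_bigr do rewrite mulr1.
  by rewrite bern_sum mulr1.
by rewrite -!natr1; ring.
Qed.

Lemma bern_var_le n p : 0 <= p <= 1 -> (0 < n)%N ->
  \sum_(k < n.+1) bern n p k * (k%:R / n%:R - p) ^+ 2 <= n%:R^-1.
Proof.
move=> /andP[p0 p1] n0.
have nn0 : n%:R != 0 :> R by rewrite pnatr_eq0 -lt0n.
have -> : \sum_(k < n.+1) bern n p k * (k%:R / n%:R - p) ^+ 2 =
   n%:R ^- 2 * \sum_(k < n.+1) bern n p k * (k%:R - n%:R * p) ^+ 2.
  by rewrite mulr_sumr; apply: eq_bigr => k _; field.
rewrite bern_var.
have -> : n%:R ^- 2 * (n%:R * p * (1 - p)) = n%:R^-1 * (p * (1 - p)) by field.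
by rewrite -[leRHS]mulr1 ler_wpM2l ?invr_ge0 // mulr_ile1 // ?subr_ge0 // gerBl.
Qed.

Lemma cos_ge_cos1 (c : R) : `|c| <= 1 -> cos 1 <= cos c.
Proof.
move=> c1; have pi1 : 1 <= pi :> R by rewrite (le_trans _ (pi_ge2 R)) // ler1n.
have -> : cos c = cos `|c|.
  by have [c0|c0] := leP 0 c; rewrite ?(ger0_norm c0) // (ltr0_norm c0) cosN.
rewrite leNgt; apply/negP => H.
have : `|c| \in `[0, pi] by rewrite in_itv /= normr_ge0 (le_trans c1).
have : (1 : R) \in `[0, pi] by rewrite in_itv /= ler01.
by move=> h1 h2; move: H; rewrite ltr_cos // ltNge c1.
Qed.

Lemma sin_expand (a b : R) : -1 <= a -> a <= b -> b <= 1 ->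
  cos 1 * (b - a) <= sin b - sin a.
Proof.
move=> a1 ab b1; have [->|anb] := eqVneq a b; first by rewrite !subrr mulr0.
have ltab : a < b by rewrite lt_neqAle anb.
have [|c cab ->] := @MVT R sin cos a b ltab (fun x _ => is_derive_sin x).
  by apply: continuous_subspaceT => x; exact: continuous_sin.
rewrite ler_wpM2r ?subr_ge0 // cos_ge_cos1 // ler_norml.
by move: cab; rewrite in_itv /= => /andP[/ltW h1 /ltW h2]; rewrite (le_trans a1) //= (le_trans h2).
Qed.

Lemma sin_expand_abs (a b : R) : `|a| <= 1 -> `|b| <= 1 ->
  cos 1 * `|b - a| <= `|sin b - sin a|.
Proof.
rewrite !ler_norml => /andP[a1 a2] /andP[b1 b2].
have [ab|/ltW ab] := leP a b.
  rewrite (ger0_norm (_ : 0 <= b - a)) ?subr_ge0 //.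
  by apply: le_trans (sin_expand a1 ab b2) _; exact: ler_norm.
rewrite distrC (ger0_norm (_ : 0 <= a - b)) ?subr_ge0 // [leRHS]distrC.
by apply: le_trans (sin_expand b1 ab a2) _; exact: ler_norm.
Qed.

(** An inverse of sine on [[- sin 1, sin 1]], made total: the bound [|y u| <= 1] holds for every
    [u], so all Bernstein nodes stay in one box. *)
Lemma sin_preimage : exists y : R -> R, forall u,
  `|y u| <= 1 /\ (`|u| <= sin 1 -> sin (y u) = u).
Proof.
suff H : forall u, exists y : R, `|y| <= 1 /\ (`|u| <= sin 1 -> sin y = u).
  by have [y Hy] := choice H; exists y.
move=> u.
have [u1|u1] := leP `|u| (sin 1); last by exists 0; rewrite normr0.
have [|||y] := @IVT R sin (-1) 1 u.
- by rewrite -subr_ge0 opprK addr_ge0.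
- by apply: continuous_subspaceT => x; exact: continuous_sin.
- have s0 : 0 <= sin 1 :> R by exact: le_trans u1.
  move: u1; rewrite sinN ler_norml ge_min le_max => /andP[u1 u2].
  by rewrite u1 /= u2 orbT.
by rewrite in_itv /= => /andP[y1 y2] <-; exists y; rewrite ler_norml y1 y2.
Qed.

(** Uniform continuity on bounded boxes, the only regularity of test functions that is needed;
    stated coordinatewise, it asks for no topology on [I -> R]. *)
Definition box_unif (f : V -> R) := forall B e : R, 0 < B -> 0 < e ->
  exists2 del : R, 0 < del & forall x y : V,
    (forall i, `|x i| <= B) -> (forall i, `|y i| <= B) ->
    (forall i, `|x i - y i| < del) -> `|f x - f y| < e.

(* Bernstein approximation in the variables (1 + sin (x_i / L)) / 2 *)
Lemma trig_approx (f : V -> R) (M B e : R) : 0 < B -> 0 < e ->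
  (forall x, `|f x| <= M) -> box_unif f ->
  exists h : V -> R, [/\ trig h,
    forall x, (forall i, `|x i| <= B) -> `|f x - h x| <= e &
    forall x, `|h x| <= M].
Proof.
move=> B0 e0 fM uf.
have M0 : 0 <= M by apply: le_trans (fM (fun=> 0)).
(* Doubling puts [x / L] in [[-1/2, 1/2]], away from the ends of [[-1, 1]] where the inverse of sine
   stops. *)
pose L := 2 * B; have L0 : 0 < L by rewrite mulr_gt0.
have c1 : 0 < cos 1 :> R by exact: cos1_gt0.
have [del del0 Hdel] := uf L (e / 2) L0 (ltac:(by rewrite divr_gt0)).
(* The first bound keeps [2 * u - 1] within [[- sin 1, sin 1]]; the second, through the slope
   [cos 1] of sine on [[-1, 1]], makes the node fall within [del] of [x]. *)
pose eta := Num.min (cos 1 / 4) (del * cos 1 / (2 * L)).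
have eta0 : 0 < eta by rewrite lt_min !divr_gt0 ?mulr_gt0.
have [y Hy] := sin_preimage.
pose p (z : R) := (1 + sin (z / L)) / 2.
have p01 z : 0 <= p z <= 1.
  have := sin_geN1 (z / L); have := sin_le1 (z / L); rewrite /p => h1 h2.
  by apply/andP; split; lra.
have near_node (x u : R) : `|x| <= B -> `|u - p x| < eta -> `|x - L * y (2 * u - 1)| < del.
  move=> xB; rewrite lt_min => /andP[u1 u2].
  have xL : `|x / L| <= 1 / 2.
    rewrite normrM normfV (gtr0_norm L0) ler_pdivrMr // /L mulrA mulfVK //.
    by rewrite mul1r.
  have xL1 : `|x / L| <= 1 by lra.
  have e1 : 2 * u - 1 = sin (x / L) + 2 * (u - p x) by rewrite /p; field.
  have u3 : `|2 * u - 1| <= sin 1.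
    move: xL; rewrite ler_norml => /andP[x1 x2].
    have s1 : cos 1 * (1 - x / L) <= sin 1 - sin (x / L) by apply: sin_expand => //; lra.
    have s2 : cos 1 * (x / L - -1) <= sin (x / L) - sin (-1) by apply: sin_expand => //; lra.
    rewrite sinN in s2.
    have t1 : cos 1 * (1 / 2) <= cos 1 * (1 - x / L) :> R by rewrite ler_wpM2l //; lra.
    have t2 : cos 1 * (1 / 2) <= cos 1 * (x / L - -1) :> R by rewrite ler_wpM2l //; lra.
    move: u1; rewrite e1 ltr_norml ler_norml => /andP[v1 v2].
    by apply/andP; split; lra.
  have [y1 /(_ u3) y2] := Hy (2 * u - 1).
  have H : cos 1 * `|x / L - y (2 * u - 1)| <= `|2 * (u - p x)|.
    have := sin_expand_abs y1 xL1; rewrite y2.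
    have -> : sin (x / L) - (2 * u - 1) = - (2 * (u - p x)) by rewrite [in LHS]e1; ring.
    by rewrite normrN.
  have -> : x - L * y (2 * u - 1) = L * (x / L - y (2 * u - 1)).
    by field; rewrite gt_eqF.
  rewrite normrM (gtr0_norm L0).
  have H2 : cos 1 * `|x / L - y (2 * u - 1)| < cos 1 * (del / L).
    apply: le_lt_trans H _; rewrite normrM (@ger0_norm _ 2) //.
    rewrite -ltr_pdivlMl //; apply: lt_le_trans u2 _.
    rewrite le_eqVlt; apply/orP; left; apply/eqP; field.
    by rewrite gt_eqF.
  by move: H2; rewrite ltr_pM2l // ltr_pdivlMr // mulrC.
(* Chebyshev: a node with some coordinate further than [eta] from [p] is paid for by [2 * M] times
   the squared deviation over [eta ^+ 2], and the variance is at most [1 / n] in each coordinate. *)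
pose c0 := 2 * M * (#|I|%:R) / (eta ^+ 2).
have c00 : 0 <= c0 by rewrite divr_ge0 ?sqr_ge0 // !mulr_ge0.
have cM : 0 <= 2 * M / eta ^+ 2 by apply: divr_ge0; [apply: mulr_ge0|apply: sqr_ge0].
pose n := (Num.bound (c0 / (e / 2))).+1.
have nP : c0 / n%:R <= e / 2.
  rewrite ler_pdivrMr ?ltr0n // mulrC -ler_pdivrMr ?divr_gt0 //.
  apply: ltW; apply: lt_le_trans (archi_boundP _) _; first by rewrite divr_ge0 // ltW // divr_gt0.
  by rewrite ler_nat leqnSn.
pose node (k : {ffun I -> 'I_n.+1}) : V := fun i => L * y (2 * ((k i)%:R / n%:R) - 1).
pose W (k : {ffun I -> 'I_n.+1}) (x : V) := \prod_i bern n (p (x i)) (k i).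
have W0 k x : 0 <= W k x by apply: prodr_ge0 => i _; exact: bern_ge0.
have W1 x : \sum_k W k x = 1.
  rewrite /W -(bigA_distr_bigA (fun i (j : 'I_n.+1) => bern n (p (x i)) j)) /=.
  by rewrite big1 // => i _; exact: bern_sum.
have WV x i : \sum_k W k x * ((k i)%:R / n%:R - p (x i)) ^+ 2 <= n%:R^-1.
  pose F i' (j : 'I_n.+1) := bern n (p (x i')) j *
    (if i' == i then (j%:R / n%:R - p (x i)) ^+ 2 else 1).
  have -> : \sum_k W k x * ((k i)%:R / n%:R - p (x i)) ^+ 2 =
      \sum_(k : {ffun I -> 'I_n.+1}) \prod_i' F i' (k i').
    apply: eq_bigr => k _; rewrite /W (bigD1 i) //= [RHS](bigD1 i) //= {1}/F eqxx.
    rewrite mulrAC; congr (_ * _ * _); apply: eq_bigr => i' ii'.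
    by rewrite /F (negbTE ii') mulr1.
  rewrite -(bigA_distr_bigA F) (bigD1 i) //= [X in _ * X]big1 ?mulr1; last first.
    move=> i' ii'; rewrite /F (negbTE ii'); under eq_bigr do rewrite mulr1.
    exact: bern_sum.
  by under eq_bigr do rewrite /F eqxx; exact: bern_var_le.
exists (fun x => \sum_k f (node k) * W k x); split.
- apply: trig_sum => k; apply: trig_scale; apply: trig_prod => i.
  have tp : trig (fun x => p (x i)).
    apply: (trig_ext _ (trig_add (trig_cst (2^-1)) (trig_scale (2^-1)
      (trig_sin (fun j => if j == i then L^-1 else 0))))) => x.
    rewrite /p /dotp (bigD1 i) //= eqxx big1 ?addr0 => [|j ji]; last by rewrite (negbTE ji) mul0r.
    by rewrite (mulrC (x i)); field.
  rewrite /bern; apply: trig_mul; last apply: trig_exp.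
    by apply: trig_scale; exact: trig_exp.
  by apply: (trig_ext _ (trig_add (trig_cst 1) (trig_scale (-1) tp))) => x; rewrite mulN1r.
- move=> x xB.
  have -> : f x - \sum_k f (node k) * W k x = \sum_k W k x * (f x - f (node k)).
    under [RHS]eq_bigr do rewrite mulrBr [X in _ - X]mulrC.
    by rewrite sumrB -mulr_suml W1 mul1r.
  apply: (le_trans (ler_norm_sum _ _ _)).
  apply: (@le_trans _ _ (\sum_k W k x * (e / 2 + \sum_i 2 * M / (eta ^+ 2) *
      ((k i)%:R / n%:R - p (x i)) ^+ 2))).
    apply: ler_sum => k _; rewrite normrM (ger0_norm (W0 _ _)) ler_wpM2l //.
    have sum0 : 0 <= \sum_i 2 * M / (eta ^+ 2) * ((k i)%:R / n%:R - p (x i)) ^+ 2.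
      apply: sumr_ge0 => i _; exact: mulr_ge0 cM (sqr_ge0 _).
    have [Hall|/existsNP[i /negP]] := pselect (forall i, `|(k i)%:R / n%:R - p (x i)| < eta).
      have : `|f x - f (node k)| < e / 2.
        apply: Hdel => i.
        - by apply: le_trans (xB i) _; rewrite /L; lra.
        - rewrite /node normrM (gtr0_norm L0) -[leRHS]mulr1 ler_pM2l //.
          by have [] := Hy (2 * ((k i)%:R / n%:R) - 1).
        - by apply: near_node => //; exact: Hall.
      by move=> /ltW h; rewrite -[leLHS]addr0 lerD.
    rewrite -leNgt => Hi.
    apply: (@le_trans _ _ (2 * M)).
      apply: le_trans (ler_normB _ _) _; have := fM x; have := fM (node k); lra.
    rewrite -[leLHS]add0r lerD //; first by rewrite divr_ge0 // ltW.
    rewrite (bigD1 i) //= -[leLHS]addr0 lerD //; last first.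
      apply: sumr_ge0 => j _; exact: mulr_ge0 cM (sqr_ge0 _).
    rewrite -mulrA ler_peMr ?mulr_ge0 // mulrC ler_pdivlMr ?exprn_gt0 // mul1r.
    by rewrite -(real_normK (num_real (_ - _))) ler_pXn2r ?nnegrE // ltW.
  under eq_bigr do rewrite mulrDr mulr_sumr.
  rewrite big_split /= -mulr_suml W1 mul1r exchange_big /=.
  have : \sum_i \sum_k W k x * (2 * M / eta ^+ 2 * ((k i)%:R / n%:R - p (x i)) ^+ 2) <= e / 2.
    apply: le_trans nP.
    apply: (@le_trans _ _ (\sum_(i : I) 2 * M / eta ^+ 2 * n%:R^-1)).
      apply: ler_sum => i _; under eq_bigr do rewrite mulrCA.
      by rewrite -mulr_sumr ler_wpM2l // bern_var_le.
    rewrite sumr_const /c0 -mulr_natl le_eqVlt; apply/orP; left; apply/eqP.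
    by field; rewrite ?pnatr_eq0 ?gt_eqF.
  by move=> h; lra.
- move=> x; apply: (le_trans (ler_norm_sum _ _ _)).
  apply: (@le_trans _ _ (\sum_k M * W k x)).
    by apply: ler_sum => k _; rewrite normrM (ger0_norm (W0 _ _)) ler_wpM2r.
  by rewrite -mulr_sumr W1 mulr1.
Qed.

Lemma trig_meas d (T : measurableType d) (X : T -> V) h : trig h ->
  (forall i, measurable_fun setT (fun x => X x i)) ->
  measurable_fun setT (fun x => h (X x)).
Proof.
move=> th mX.
have ml l : measurable_fun setT (fun x => dotp l (X x)).
  by apply: measurable_sum => i; apply: measurable_funM.
elim: th => [l|l|f g _ IH1 _ IH2|c f _ IH].
- by apply: (measurableT_comp (f := @cos R)) => //; exact: continuous_measurable_fun (@continuous_cos R).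
- by apply: (measurableT_comp (f := @sin R)) => //; exact: continuous_measurable_fun (@continuous_sin R).
- exact: measurable_funD.
- exact: measurable_funM.
Qed.

Lemma trig_bounded h : trig h -> exists c, forall x, `|h x| <= c.
Proof.
elim=> [l|l|f g _ [a Ha] _ [b Hb]|c f _ [a Ha]].
- by exists 1 => x; rewrite ler_norml cos_geN1 cos_le1.
- by exists 1 => x; rewrite ler_norml sin_geN1 sin_le1.
- by exists (a + b) => x; rewrite (le_trans (ler_normD _ _)) // lerD.
- by exists (`|c| * a) => x; rewrite normrM ler_wpM2l.
Qed.

Lemma trig_intg d (T : measurableType d) (P : probability T R) (X : T -> V) h : trig h ->
  (forall i, measurable_fun setT (fun x => X x i)) -> intg P (fun x => h (X x)).
Proof.
move=> th mX; have [c Hc] := trig_bounded th.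
by apply: (@intg_bnd _ _ _ _ _ c); [exact: trig_meas|move=> x; exact: Hc].
Qed.

(** A trigonometric polynomial [h] replaces [f]. Inside a box it is uniformly close; outside, both
    are bounded by the same [M] and the second moments make the box likely. Expectations of [h]
    converge by linearity. *)
Lemma weak_cvg_of_charfun (d : nat -> measure_display)
    (T : forall N, measurableType (d N)) (P : forall N, probability (T N) R)
    (X : forall N, T N -> V) (d' : measure_display) (T' : measurableType d')
    (Q : probability T' R) (Y : T' -> V) (K : R) (f : V -> R) (M : R) :
  (forall N i, measurable_fun setT (fun x => X N x i)) ->
  (forall i, measurable_fun setT (fun x => Y x i)) ->
  (forall N i, intg (P N) (fun x => X N x i ^+ 2)) ->
  (forall i, intg Q (fun x => Y x i ^+ 2)) ->
  (\forall N \near \oo, forall i, Ex (P N) (fun x => X N x i ^+ 2) <= K) ->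
  (forall i, Ex Q (fun x => Y x i ^+ 2) <= K) ->
  (forall l, Ex (P N) (fun x => cos (dotp l (X N x))) @[N --> \oo] -->
     Ex Q (fun x => cos (dotp l (Y x)))) ->
  (forall l, Ex (P N) (fun x => sin (dotp l (X N x))) @[N --> \oo] -->
     Ex Q (fun x => sin (dotp l (Y x)))) ->
  (forall x, `|f x| <= M) -> box_unif f ->
  (forall N, measurable_fun setT (fun x => f (X N x))) ->
  measurable_fun setT (fun x => f (Y x)) ->
  Ex (P N) (fun x => f (X N x)) @[N --> \oo] --> Ex Q (fun x => f (Y x)).
Proof.
move=> mX mY iX iY KX KY cc cs fM uf mfX mfY.
have M0 : 0 <= M by apply: le_trans (fM (fun=> 0)).
have ctrig h : trig h ->
    Ex (P N) (fun x => h (X N x)) @[N --> \oo] --> Ex Q (fun x => h (Y x)).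
  elim=> [l|l|g h' tg IH1 th IH2|c g tg IH].
  - exact: cc.
  - exact: cs.
  - under eq_fun do rewrite (ExD (trig_intg _ tg (mX _)) (trig_intg _ th (mX _))).
    by rewrite (ExD (trig_intg _ tg mY) (trig_intg _ th mY)); exact: cvgD.
  - under eq_fun do rewrite (ExZ _ (trig_intg _ tg (mX _))).
    by rewrite (ExZ _ (trig_intg _ tg mY)); exact: cvgMr.
apply/cvgrPdist_lt => e e0.
(* The box size [B] below is chosen with [B ^+ 2 = K' / (e / 8)], so that the tail costs at most
   [e / 8]; the added 1 keeps [K'] positive. *)
pose K' := 2 * M * (#|I|%:R * (`|K| + 1)) + 1.
have K'0 : 0 < K' by rewrite ltr_wpDl // !mulr_ge0 // addr_ge0.
pose B := Num.sqrt (K' / (e / 8)).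
have B0 : 0 < B by rewrite sqrtr_gt0 !divr_gt0.
have BE : B ^+ 2 = K' / (e / 8) by rewrite sqr_sqrtr // ltW // !divr_gt0.
have e8 : 0 < e / 8 by rewrite divr_gt0.
have [h [th fh hM]] := trig_approx B0 e8 fM uf.
have dev dd (S : measurableType dd) (PP : probability S R) (Z : S -> V) :
    (forall i, measurable_fun setT (fun x => Z x i)) ->
    (forall i, intg PP (fun x => Z x i ^+ 2)) ->
    (forall i, Ex PP (fun x => Z x i ^+ 2) <= K) ->
    measurable_fun setT (fun x => f (Z x)) ->
    `|Ex PP (fun x => f (Z x)) - Ex PP (fun x => h (Z x))| <= e / 4.
  move=> mZ iZ KZ mfZ.
  have ifZ : intg PP (fun x => f (Z x)) by apply: (@intg_bnd _ _ _ _ _ M) => // x; exact: fM.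
  have ihZ := trig_intg PP th mZ.
  have pw x : `|f (Z x) - h (Z x)| <= e / 8 + (2 * M / B ^+ 2) * \sum_i Z x i ^+ 2.
    have s0 : 0 <= \sum_i Z x i ^+ 2 by apply: sumr_ge0 => i _; exact: sqr_ge0.
    have c0 : 0 <= 2 * M / B ^+ 2.
      by apply: divr_ge0; [apply: mulr_ge0|apply: sqr_ge0].
    have [Hall|/existsNP[i /negP]] := pselect (forall i, `|Z x i| <= B).
      by rewrite -[leLHS]addr0; apply: lerD; [exact: fh|exact: mulr_ge0].
    rewrite -ltNge => Hi.
    rewrite -[leLHS]add0r lerD //; first by rewrite divr_ge0 // ltW.
    apply: (@le_trans _ _ (2 * M)).
      apply: le_trans (ler_normB _ _) _; have := fM (Z x); have := hM (Z x); lra.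
    rewrite -mulrA ler_peMr ?mulr_ge0 // mulrC ler_pdivlMr ?exprn_gt0 // mul1r.
    rewrite (bigD1 i) //= -[leLHS]addr0 lerD //; last by apply: sumr_ge0 => j _; exact: sqr_ge0.
    by rewrite -(real_normK (num_real (Z x i))) ler_pXn2r ?nnegrE // ltW.
  rewrite -ExB //.
  have iS : intg PP (fun x => \sum_i Z x i ^+ 2) by apply: intg_sum.
  apply: (le_trans (Ex_ge_abs (intgB ifZ ihZ) (intgD (intg_cst _ _) (intgZ _ iS)) pw)).
  rewrite (ExD (intg_cst _ _) (intgZ _ iS)) (ExZ _ iS) Ex_cst Ex_sum //.
  have : \sum_i Ex PP (fun x => Z x i ^+ 2) <= #|I|%:R * (`|K| + 1).
    apply: (@le_trans _ _ (\sum_(i : I) (`|K| + 1))).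
      by apply: ler_sum => i _; apply: le_trans (KZ i) _; rewrite (le_trans (ler_norm K)) // lerDl.
    by rewrite sumr_const mulr_natl.
  move=> hs; have : 2 * M / B ^+ 2 * (\sum_i Ex PP (fun x => Z x i ^+ 2)) <= e / 8.
    rewrite BE; apply: (@le_trans _ _ (2 * M / (K' / (e / 8)) * (#|I|%:R * (`|K| + 1)))).
      have KE : 0 <= K' / (e / 8) by apply/ltW/divr_gt0 => //; exact: divr_gt0.
      by apply: ler_wpM2l => //; apply: divr_ge0 => //; exact: mulr_ge0.
    have -> : 2 * M / (K' / (e / 8)) * (#|I|%:R * (`|K| + 1)) = (e / 8) * ((K' - 1) / K').
      by rewrite /K'; field; rewrite !gt_eqF.
    rewrite ler_piMr //; first by rewrite divr_ge0 // ltW.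
    by rewrite ler_pdivrMr // mul1r gerBl.
  by move=> h2; lra.
have e4 : 0 < e / 4 by rewrite divr_gt0.
have /cvgrPdist_lt /(_ _ e4) cth := ctrig h th.
near=> N.
have h1 : `|Ex Q (fun x => h (Y x)) - Ex (P N) (fun x => h (X N x))| < e / 4 by near: N.
have h2 : forall i, Ex (P N) (fun x => X N x i ^+ 2) <= K by near: N.
have h3 := dev _ _ (P N) (X N) (mX N) (iX N) h2 (mfX N).
have h4 := dev _ _ Q Y mY iY KY mfY.
move: h1 h3 h4; set a := Ex Q (fun x => f _); set b := Ex Q _; set c := Ex (P N) (fun x => h _).
set g := Ex (P N) _ => h1 h3 h4.
have -> : a - g = (a - b) + ((b - c) - (g - c)) by ring.
apply: le_lt_trans (ler_normD _ _) _.
have := ler_normB (b - c) (g - c); lra.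
Unshelve. all: by end_near.
Qed.

End TrigPolynomials.

(** * Laws determined by characteristic functions *)

Section LawOfCharfun.
Context {R : realType}.

Lemma law_unique d d' (T : measurableType d) (T' : measurableType d')
    (P : probability T R) (Q : probability T' R) (X : T -> R) (Y : T' -> R) :
  measurable_fun setT X -> measurable_fun setT Y ->
  (forall a, P (X @^-1` `]a, +oo[) = Q (Y @^-1` `]a, +oo[)) ->
  forall B : set R, measurable B -> P (X @^-1` B) = Q (Y @^-1` B).
Proof.
move=> mX mY H B mB.
have mX' : measurable_fun setT (X : T -> measurableTypeR R) := mX.
have mY' : measurable_fun setT (Y : T' -> measurableTypeR R) := mY.
apply: (@measure_unique _ (measurableTypeR R) R (RGenOInfty.G (R := R))
  (fun k => `]- k%:R, +oo[%classic) _ _ _ _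
  (distribution P (mfun_Sub (mem_set mX')))
  (distribution Q (mfun_Sub (mem_set mY')))) => //.
- exact: RGenOInfty.measurableE.
- move=> A A' [a ->] [b ->]; exists (Num.max a b).
  by apply/seteqP; split=> x /=; rewrite !in_itv /= !andbT gt_max => /andP.
- by move=> k; exists (- k%:R).
- apply/seteqP; split=> // x _; exists (Num.bound `|x|) => //=.
  rewrite in_itv /= andbT ltrNl; apply: le_lt_trans (archi_boundP (normr_ge0 x)).
  by rewrite -normrN ler_norm.
- by move=> A [a ->]; exact: H.
- by move=> k; apply: le_lt_trans (probability_le1 _ _) (ltry _); exact: measurable_itv.
Qed.

(** The convergence criterion is applied to a constant sequence, which yields equality of
    expectations of bounded Lipschitz functions; ramps then recover the half-lines. *)
Lemma law_of_charfun d d' (T : measurableType d) (T' : measurableType d')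
    (P : probability T R) (Q : probability T' R) (X : T -> R) (Y : T' -> R) :
  measurable_fun setT X -> measurable_fun setT Y ->
  intg P (fun x => X x ^+ 2) -> intg Q (fun x => Y x ^+ 2) ->
  (forall t, Ex P (fun x => cos (t * X x)) = Ex Q (fun x => cos (t * Y x))) ->
  (forall t, Ex P (fun x => sin (t * X x)) = Ex Q (fun x => sin (t * Y x))) ->
  forall B : set R, measurable B -> P (X @^-1` B) = Q (Y @^-1` B).
Proof.
move=> mX mY iX iY Hc Hs; apply: law_unique => // a.
(* A ramp of slope [n] starting at [a]; it converges pointwise to the indicator of the open
   half-line. *)
pose phi n (x : R) : R := Num.max 0 (Num.min 1 (n%:R * (x - a))).
have phi01 n x : `|phi n x| <= 1.
  rewrite ger0_norm ?le_max ?lexx // /phi ge_max ler01 /= ge_min lexx //.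
have philip n x y : `|phi n x - phi n y| <= n%:R * `|x - y|.
  have lip (u v : R) : `|Num.max 0 (Num.min 1 u) - Num.max 0 (Num.min 1 v)| <= `|u - v|.
    have := ler_norm (u - v); have := ler_norm (v - u); rewrite (distrC v u) => h1 h2.
    have mn : `|Num.min 1 u - Num.min 1 v| <= `|u - v|.
      by rewrite ler_norml; case: (leP 1 u); case: (leP 1 v) => ? ?; apply/andP; split; lra.
    apply: le_trans mn; move: (Num.min 1 u) (Num.min 1 v) => w z.
    have := ler_norm (w - z); have := ler_norm (z - w); rewrite (distrC z w) => h3 h4.
    by rewrite ler_norml; case: (leP 0 w); case: (leP 0 z) => ? ?; apply/andP; split; lra.
  apply: le_trans (lip _ _) _; rewrite -mulrBr opprB addrA subrK normrM.
  by rewrite (@ger0_norm _ n%:R).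
have mphi n : measurable_fun setT (phi n).
  apply: measurable_maxr => //; apply: measurable_minr => //.
  by apply: measurable_funM => //; exact: measurable_funB.
have Ephi n : Ex P (fun x => phi n (X x)) = Ex Q (fun x => phi n (Y x)).
  have := @weak_cvg_of_charfun R 'I_1 (fun=> d) (fun=> T) (fun=> P) (fun _ x _ => X x)
    d' T' Q (fun x _ => Y x)
    (Num.max (Ex P (fun x => X x ^+ 2)) (Ex Q (fun x => Y x ^+ 2)))
    (fun v => phi n (v ord0)) 1.
  have E1 l (z : R) : dotp l (fun _ : 'I_1 => z) = l ord0 * z.
    by rewrite /dotp big_ord1.
  have Ef dd (S : measurableType dd) (PP : probability S R) (Z : S -> R) (F : R -> R) l :
      Ex PP (fun x => F (dotp l (fun _ : 'I_1 => Z x))) = Ex PP (fun x => F (l ord0 * Z x)).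
    by apply: eq_Ex => x; rewrite E1.
  move=> /(_ (fun _ _ => mX) (fun _ => mY) (fun _ _ => iX) (fun _ => iY)).
  have h1 : \forall N \near \oo, forall i : 'I_1, Ex P (fun x => X x ^+ 2) <=
      Num.max (Ex P (fun x => X x ^+ 2)) (Ex Q (fun x => Y x ^+ 2)).
    by apply: nearW => _ _; rewrite le_max lexx.
  have h2 : forall i : 'I_1, Ex Q (fun x => Y x ^+ 2) <=
      Num.max (Ex P (fun x => X x ^+ 2)) (Ex Q (fun x => Y x ^+ 2)).
    by move=> _; rewrite le_max lexx orbT.
  move=> /(_ h1 h2) H.
  have /cvg_lim <- // : Ex P (fun x => phi n (X x)) @[N --> \oo] --> Ex Q (fun x => phi n (Y x)).
    apply: H.
    - by move=> l; rewrite (Ef _ T P X cos l) (Ef _ T' Q Y cos l) Hc; exact: cvg_cst.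
    - by move=> l; rewrite (Ef _ T P X sin l) (Ef _ T' Q Y sin l) Hs; exact: cvg_cst.
    - by move=> v; exact: phi01.
    - move=> B e B0 e0; exists (e / n.+1%:R); first by rewrite divr_gt0.
      move=> u v _ _ /(_ ord0) uv; apply: le_lt_trans (philip _ _ _) _.
      move: uv; rewrite ltr_pdivlMr // => uv; apply: le_lt_trans uv.
      by rewrite mulrC ler_wpM2l // ler_nat.
    - by move=> _; exact: measurableT_comp.
    - exact: measurableT_comp.
  by apply/esym/cvg_lim => //; exact: cvg_cst.
have lim dd (S : measurableType dd) (PP : probability S R) (Z : S -> R) :
    measurable_fun setT Z ->
    (Ex PP (fun x => phi n (Z x)))%:E @[n --> \oo] --> PP (Z @^-1` `]a, +oo[).
  move=> mZ.
  have mA : measurable (Z @^-1` `]a, +oo[) by rewrite -[X in measurable X]setTI; exact: mZ.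
  have -> : PP (Z @^-1` `]a, +oo[) = (\int[PP]_x (\1_(Z @^-1` `]a, +oo[) x)%:E)%E.
    by rewrite integral_indic // setIT.
  have iphi n : intg PP (fun x => phi n (Z x)).
    by apply: (@intg_bnd _ _ _ _ _ 1) => //; exact: measurableT_comp.
  have -> : (fun n => (Ex PP (fun x => phi n (Z x)))%:E) =
      (fun n => \int[PP]_x (phi n (Z x))%:E)%E.
    by apply/funext => n; rewrite ExE fineK //; exact: (integrable_fin_num _ (iphi n)).
  apply: (@dominated_cvg _ _ _ PP setT measurableT _ _ (fun=> 1%E)) => //.
  - by move=> n; apply/measurable_EFinP; exact: measurableT_comp.
  - move=> x _; apply: cvg_EFin; first exact: nearW.
    rewrite indicE; have [xA|xA] := ltP a (Z x).
      rewrite mem_set /=; last by rewrite in_itv /= xA.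
      apply: cvg_near_cst; exists (Num.bound (Z x - a)^-1) => // n /= nN.
      rewrite /phi /Num.max /Num.min.
      have z0 : 0 < Z x - a by rewrite subr_gt0.
      have : 1 < n%:R * (Z x - a).
        rewrite -ltr_pdivrMr // div1r.
        apply: (lt_le_trans (archi_boundP _)); first by rewrite invr_ge0 ltW.
        by rewrite ler_nat.
      by move=> h; rewrite h ltr01.
    rewrite memNset /=; last by rewrite in_itv /= andbT => /lt_geF; rewrite xA.
    apply: cvg_near_cst; apply: nearW => n; rewrite /phi.
    apply/eqP; rewrite eq_le le_max lexx ge_max lexx /= andbT ge_min.
    by rewrite mulr_ge0_le0 ?orbT // subr_le0.
  - exact: finite_measure_integrable_cst.
  - by move=> n x _; rewrite lee_fin.
apply: cvg_unique (lim _ _ P X mX) _ => //=.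
have -> : (fun n => (Ex P (fun x => phi n (X x)))%:E) =
    (fun n => (Ex Q (fun x => phi n (Y x)))%:E) by apply/funext => n; rewrite Ephi.
exact: lim.
Qed.

(** The moments of a Gaussian variable satisfy the recursion of [charfun_of_moments], so the
    constant sequence already gives the value. *)
Lemma gaussian_charfun d (T : measurableType d) (P : probability T R) (X : T -> R) s t :
  0 <= s -> gaussian_law P X 0 s ->
  Ex P (fun x => cos (t * X x)) = expR (- (t * s) ^+ 2 / 2) /\
  Ex P (fun x => sin (t * X x)) = 0.
Proof.
move=> s0 gX.
have H := @charfun_of_moments R ((t * s) ^+ 2) (fun k => Ex P (fun x => (t * X x) ^+ k))
  (fun=> d) (fun=> T) (fun=> P) (fun _ x => t * X x).
have ME k : Ex P (fun x => (t * X x) ^+ k) = t ^+ k * Ex P (fun x => X x ^+ k).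
  under eq_Ex do rewrite exprMn; rewrite ExZ //; exact: gaussian_intgX gX k.
have [||k||N k|k|h1 h2] := H.
- by under eq_Ex do rewrite expr0; rewrite Ex_cst.
- by rewrite ME expr1; under eq_Ex do rewrite expr1; rewrite (gaussian_mean gX) mulr0.
- by rewrite !ME (gaussian_mom_rec gX) !exprS exprMn; ring.
- exact: sqr_ge0.
- under eq_fun do rewrite exprMn; apply: intgZ; exact: gaussian_intgX gX k.
- exact: cvg_cst.
split; [have /cvg_lim <- // := h1|have /cvg_lim <- // := h2];
  by apply/esym/cvg_lim => //; exact: cvg_cst.
Qed.

(** Comparison with a reference variable of the right law: the constant 0 when [s = 0], otherwise
    the identity on the line under [normal_prob]. *)
Lemma gaussian_of_charfun d (T : measurableType d) (P : probability T R) (X : T -> R) s :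
  0 <= s -> measurable_fun setT X -> intg P (fun x => X x ^+ 2) ->
  (forall t, Ex P (fun x => cos (t * X x)) = expR (- (t * s) ^+ 2 / 2)) ->
  (forall t, Ex P (fun x => sin (t * X x)) = 0) ->
  gaussian_law P X 0 s.
Proof.
move=> s0 mX iX Hc Hs; split=> // B mB.
have [sz|sn] := eqVneq s 0.
  have -> : P (X @^-1` B) = P ((fun=> (0 : R)) @^-1` B).
    apply: (law_of_charfun mX (measurable_cst _) iX) => // [|t|t].
    - exact: (@intg_cst _ _ _ _ (0 ^+ 2)).
    - under [RHS]eq_Ex do rewrite /= mulr0 cos0.
      by rewrite Hc Ex_cst sz mulr0 expr0n oppr0 mul0r expR0.
    - by under [RHS]eq_Ex do rewrite /= mulr0 sin0; rewrite Hs Ex_cst.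
  rewrite preimage_cst diracE; case: ifP => _; first exact: probability_setT.
  exact: measure0.
have mid : measurable_fun setT (fun x : measurableTypeR R => x : R) by [].
have gid : gaussian_law (normal_prob 0 s) (fun x : measurableTypeR R => x : R) 0 s.
  by split=> // B' mB'; rewrite (negbTE sn).
have -> : P (X @^-1` B) = normal_prob 0 s ((fun x : measurableTypeR R => x : R) @^-1` B).
  apply: (law_of_charfun mX mid iX) => // [|t|t].
  - exact: gaussian_intgX gid 2.
  - by rewrite Hc; have [-> _] := gaussian_charfun t s0 gid.
  - by rewrite Hs; have [_ ->] := gaussian_charfun t s0 gid.
by [].
Qed.

End LawOfCharfun.

Section BoxUniform.
Context {R : realType}.

Lemma compact_unif (Z : pseudoMetricType R) (K : set Z) (f : Z -> R) e :
  compact K -> continuous f -> 0 < e ->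
  exists2 del : R, 0 < del & forall x y, K x -> ball x del y -> `|f x - f y| < e.
Proof.
move=> /compact_near_coveringP cK cf e0.
have [|del /= del0 Hdel] := cK R (0 : R)^'+
    (fun del x => forall y, ball x del y -> `|f x - f y| < e) _; last first.
  exists (del / 2); first by rewrite divr_gt0.
  move=> x y Kx xy; apply: (Hdel (del / 2)) => //=; last by rewrite divr_gt0.
  rewrite sub0r normrN gtr0_norm ?divr_gt0 // gtr_pMr // invf_lt1 //; lra.
move=> x Kx; have e2 : 0 < e / 2 by rewrite divr_gt0.
have /cvgrPdist_lt /(_ _ e2) /nbhs_ballP[r /= r0 Hr] := cf x.
have r2 : 0 < r / 2 by rewrite divr_gt0.
exists (ball x (r / 2), [set del : R | del < r / 2]) => /=.
  by split; [exact: nbhsx_ballx|exact: nbhs_right_lt].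
case=> x' del /= [xx' delr] y x'y.
have h1 : `|f x - f x'| < e / 2 by apply: Hr; apply: le_ball xx'; lra.
have h2 : `|f x - f y| < e / 2.
  apply: Hr; rewrite (_ : r = r / 2 + r / 2); last by field.
  by apply: ball_triangle xx' _; apply: le_ball x'y; exact: ltW.
have -> : f x' - f y = (f x - f y) - (f x - f x') by ring.
apply: le_lt_trans (ler_normB _ _) _; lra.
Qed.

Lemma continuous_box_unif n (f : 'rV[R]_n * 'rV[R]_n -> R) : continuous f ->
  box_unif (fun v : 'I_n * bool -> R => f (\row_k v (k, true), \row_k v (k, false))).
Proof.
move=> cf B e B0 e0.
pose K : set ('rV[R]_n) := [set v : 'rV[R]_n | forall i, `[- B, B]%classic (v ord0 i)].
have cK : compact (K `*` K) by apply: compact_setX; apply: (@rV_compact R n (fun=> `[- B, B]%classic)) => i;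
  exact: segment_compact.
have [del del0 H] := compact_unif cK cf e0.
exists del => // x y xB yB xy; apply: H.
  by split => i /=; rewrite mxE in_itv /= -ler_norml.
by split; split=> // i j /=; rewrite !mxE; exact: xy.
Qed.

(** The composite is a pointwise limit of trigonometric polynomials of the coordinates, taken on
    boxes of growing size, so no Borel structure on [I -> R] is called for. *)
Lemma box_unif_meas (I : finType) d (T : measurableType d) (X : T -> I -> R)
    (f : (I -> R) -> R) M :
  (forall i, measurable_fun setT (fun x => X x i)) ->
  (forall x, `|f x| <= M) -> box_unif f -> measurable_fun setT (fun x => f (X x)).
Proof.
move=> mX fM uf.
have H m : exists h : (I -> R) -> R, trig h /\
    forall x, (forall i, `|x i| <= m.+1%:R) -> `|f x - h x| <= m.+1%:R^-1.
  by have [//|//|h [h1 h2 _]] := trig_approx (_ : 0 < m.+1%:R) (_ : 0 < m.+1%:R^-1) fM uf; exists h.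
have [h Hh] := choice H.
apply: (@measurable_fun_cvg _ _ _ _ (fun m x => h m (X x))).
  by move=> m; apply: trig_meas => //; have [] := Hh m.
move=> x _; apply/cvgrPdist_lt => e e0.
pose B := \sum_i `|X x i|.
exists (maxn (Num.bound B) (Num.bound e^-1)) => // m /= mN.
have mB : B <= m.+1%:R.
  apply: ltW; apply: lt_le_trans (archi_boundP (sumr_ge0 _ (fun i _ => normr_ge0 _))) _.
  by rewrite ler_nat; apply: leqW; apply: leq_trans mN; exact: leq_maxl.
have me : m.+1%:R^-1 < e.
  rewrite invf_plt ?posrE //; apply: lt_le_trans (archi_boundP _) _; first by rewrite invr_ge0 ltW.
  by rewrite ler_nat; apply: leqW; apply: leq_trans mN; exact: leq_maxr.
apply: le_lt_trans me; have [_] := Hh m; apply => i.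
by apply: le_trans mB; rewrite /B (bigD1 i) //= lerDl sumr_ge0.
Qed.
End BoxUniform.

(** * Stochastic integration on u(N) *)

Section MatrixFacts.
Context {R : realType} (N : nat).
Local Notation C := R[i].
Local Notation M := 'M[C]_N.

Lemma tcE (X : M) i j : (X ^t*) i j = (X j i)^*%C.
Proof. by rewrite !mxE. Qed.

Lemma tc_mul (X Y : M) : (X *m Y) ^t* = Y ^t* *m X ^t*.
Proof. by rewrite trmx_mul map_mxM. Qed.

Lemma tcK (X : M) : (X ^t*) ^t* = X.
Proof. by apply/matrixP => i j; rewrite !tcE conjcK. Qed.

Lemma tr_tc (X : M) : \tr (X ^t*) = (\tr X)^*%C.
Proof. by rewrite /mxtrace rmorph_sum; apply: eq_bigr => i _; rewrite tcE. Qed.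

Lemma mxtrN (X : M) : \tr (- X) = - \tr X.
Proof. by rewrite raddfN. Qed.

Lemma mxtrB (X Y : M) : \tr (X - Y) = \tr X - \tr Y.
Proof. by rewrite raddfB. Qed.

Lemma tr_delta (Y : M) i j : \tr (delta_mx j i *m Y) = Y i j.
Proof.
rewrite /mxtrace (bigD1 j) //= big1 ?addr0 => [|k kj].
  rewrite mxE (bigD1 i) //= mxE !eqxx mul1r big1 ?addr0 // => l li.
  by rewrite mxE (negbTE li) andbF mul0r.
by rewrite mxE big1 // => l _; rewrite mxE (negbTE kj) mul0r.
Qed.

Lemma tr_mulE (A B : M) : \tr (A *m B) = \sum_i \sum_j A i j * B j i.
Proof. by apply: eq_bigr => i _; rewrite mxE. Qed.

Lemma sqnormE (A : M) : sqnorm A = \sum_i \sum_j cabs (A i j) ^+ 2.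
Proof. by apply: eq_bigr => i _; apply: eq_bigr => j _; rewrite cabs_sq. Qed.

Lemma sqnorm_ge0 (A : M) : 0 <= sqnorm A.
Proof. by rewrite sqnormE; apply: sumr_ge0 => i _; apply: sumr_ge0 => j _; exact: sqr_ge0. Qed.

Lemma entry_le_sqnorm (A : M) i j : cabs (A i j) ^+ 2 <= sqnorm A.
Proof.
rewrite sqnormE (bigD1 i) //= (bigD1 j) //= -addrA lerDl addr_ge0 //.
  by apply: sumr_ge0 => k _; exact: sqr_ge0.
by apply: sumr_ge0 => k _; apply: sumr_ge0 => l _; exact: sqr_ge0.
Qed.

Lemma sqnormN (A : M) : sqnorm (- A) = sqnorm A.
Proof. by rewrite !sqnormE; apply: eq_bigr => i _; apply: eq_bigr => j _; rewrite mxE cabsN. Qed.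

Lemma sqnormD (A B : M) : sqnorm (A + B) <= 2 * sqnorm A + 2 * sqnorm B.
Proof.
rewrite !sqnormE !mulr_sumr -big_split; apply: ler_sum => i _ /=.
rewrite !mulr_sumr -big_split; apply: ler_sum => j _ /=.
by rewrite mxE -mulrDr sqr_ler_cabsD.
Qed.

Lemma sqnormB (A B : M) : sqnorm (A - B) <= 2 * sqnorm A + 2 * sqnorm B.
Proof. by rewrite -(sqnormN B) sqnormD. Qed.

Lemma sqnorm_tr (A : M) : sqnorm A = complex.Re (\tr (A *m A ^t*)).
Proof.
rewrite tr_mulE Re_sum sqnormE; apply: eq_bigr => i _; rewrite Re_sum.
by apply: eq_bigr => j _; rewrite tcE mul_conj_cabs.
Qed.

Lemma unitary_sqnorm (A : M) : A \is unitarymx -> sqnorm A = N%:R.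
Proof. by move=> /unitarymxP uA; rewrite sqnorm_tr uA mxtrace1 -(rmorph_nat (real_complex R)). Qed.

Lemma unitary_entry (A : M) i j : A \is unitarymx -> cabs (A i j) <= 1.
Proof.
move=> uA; have /matrixP/(_ i i) := unitarymxP uA.
rewrite mxE mxE eqxx => H.
have : \sum_k cabs (A i k) ^+ 2 = 1.
  apply: complexI; rewrite rmorph_sum /= -[RHS]H; apply: eq_bigr => k _.
  by rewrite tcE mul_conj_cabs.
rewrite (bigD1 j) //= => h1.
have : cabs (A i j) ^+ 2 <= 1 by rewrite -h1 lerDl sumr_ge0 // => k _; exact: sqr_ge0.
by rewrite -[X in _ <= X](expr1n _ 2) ler_pXn2r // nnegrE.
Qed.

End MatrixFacts.

Section GeneratedSigma.
Context {R : realType} d (T : measurableType d).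
Local Notation C := R[i].

Lemma sigma_of_cmeas (D : set (T -> C)) (G : set (set T)) (f : T -> C) :
  sigma_of D `<=` <<s G >> -> D f -> @cmeas R _ (g_sigma_algebraType G) f.
Proof.
move=> DG Df; split=> _ B mB; rewrite setTI; apply: DG; apply: sub_sigma_algebra.
  by exists f, B; split => //; left.
by exists f, B; split => //; right.
Qed.

Lemma sigma_of_cmeas_self (D : set (T -> C)) (f : T -> C) :
  D f -> @cmeas R _ (g_sigma_algebraType (sigma_of D)) f.
Proof. by apply: sigma_of_cmeas; exact: sub_sigma_algebra. Qed.

Lemma sigma_of_id (D : set (T -> C)) : <<s sigma_of D >> = sigma_of D.
Proof. by rewrite sigma_algebra_id //; exact: smallest_sigma_algebra. Qed.

Lemma sigma_of_sub (D : set (T -> C)) :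
  (forall f, D f -> cmeas f) -> sigma_of D `<=` measurable.
Proof.
move=> H; apply: smallest_sub; first exact: sigma_algebra_measurable.
move=> A [f [B [Df mB [->|->]]]]; have [h1 h2] := H f Df.
  by have := h1 measurableT B mB; rewrite setTI.
by have := h2 measurableT B mB; rewrite setTI.
Qed.

Lemma cmeas_mono (G1 G2 : set (set T)) (f : T -> C) : <<s G1 >> `<=` <<s G2 >> ->
  @cmeas R _ (g_sigma_algebraType G1) f -> @cmeas R _ (g_sigma_algebraType G2) f.
Proof.
move=> H [h1 h2]; split=> m B mB; apply: H; [exact: h1|exact: h2].
Qed.

End GeneratedSigma.

(** * Moments of Brownian increments on u(N) *)

Section BrownianIncrements.
Context {R : realType} d (T : measurableType d) (P : probability T R).
Variable N : nat.
Hypothesis N0 : (0 < N)%N.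
Local Notation C := R[i].
Local Notation M := 'M[C]_N.
Variables (F : R -> set (set T)) (K : R -> T -> M).
Hypothesis flt : filtration F.
Hypothesis bm : uN_brownian P F K.

Definition Fmeas s (Z : T -> C) := @cmeas R _ (g_sigma_algebraType (F s)) Z.

Lemma F_id s : 0 <= s -> <<s F s >> = F s.
Proof. by move=> s0; rewrite sigma_algebra_id //; have [H _ _] := flt; exact: H. Qed.

Lemma F_sub s : 0 <= s -> <<s F s >> `<=` measurable.
Proof. by move=> s0; rewrite F_id //; have [_ H _] := flt; exact: H. Qed.

Lemma Fmeas_meas s Z : 0 <= s -> Fmeas s Z -> cmeas Z.
Proof. by move=> s0; exact: (@cmeas_sub R _ T (F s) (F_sub s0) Z). Qed.

Lemma Fmeas_mono s u Z : 0 <= s -> s <= u -> Fmeas s Z -> Fmeas u Z.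
Proof.
move=> s0 su; apply: cmeas_mono; rewrite !F_id ?(le_trans s0) //.
by have [_ _ H] := flt; exact: H.
Qed.

Lemma adapted_Fmeas (X : R -> T -> M) s i j : 0 <= s -> adapted F X ->
  Fmeas s (fun x => X s x i j).
Proof.
move=> s0 aX; apply: (@sigma_of_cmeas _ _ _ (entries (X s))).
  by rewrite F_id //; exact: aX.
by exists i, j.
Qed.

Lemma K_Fmeas s i j : 0 <= s -> Fmeas s (fun x => K s x i j).
Proof. by move=> s0; apply: adapted_Fmeas => //; have [] := bm. Qed.

Lemma dK_meas s u i j : 0 <= s -> s <= u ->
  cmeas (fun x => (K u x - K s x) i j).
Proof.
move=> s0 su; under eq_fun do rewrite !mxE.
apply: cmeasB; apply: Fmeas_meas (K_Fmeas _ _ _) => //; exact: le_trans su.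
Qed.

(** Variance per unit time of [Re tr (Z dK)]: the squared norm of the skew-Hermitian matrix
    representing this functional, see [skewpart_sqnorm]. *)
Definition dKvar (Z : M) : R :=
  (complex.Re (\tr (Z *m Z ^t*)) - complex.Re (\tr (Z *m Z))) / (2 * N%:R).

Let NR0 : N%:R != 0 :> R. Proof. by rewrite pnatr_eq0 -lt0n. Qed.

(** On skew-Hermitian [D] the Hermitian part of [Z] contributes nothing to the real part of the
    trace, so every functional [Re tr (Z D)] is an inner product and its law is given by the
    definition of the motion. *)
Lemma uN_inner_skewpart (Z D : M) : skew_hermitian D ->
  uN_inner ((- (2 * N%:R)^-1)%:C *: (Z - Z ^t*)) D = complex.Re (\tr (Z *m D)).
Proof.
move=> sD; have H : complex.Re (\tr (Z ^t* *m D)) = - complex.Re (\tr (Z *m D)).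
  by rewrite -[in LHS](opprK D) -sD mulmxN mxtrN ReN -tc_mul tr_tc Re_conj mxtrace_mulC.
rewrite /uN_inner -scalemxAl mxtraceZ mulmxBl mxtrB ReM /= mul0r subr0 ReB H.
by field.
Qed.

Lemma skewpart_skew (Z : M) (r : R) : skew_hermitian (r%:C *: (Z - Z ^t*)).
Proof.
apply/matrixP => i j; rewrite tcE !mxE !conjCE; apply: complex_ext;
  rewrite ?ReN ?ImN ?Re_conj ?Im_conj ?ReM ?ImM ?ReB ?ImB ?Re_conj ?Im_conj /=; ring.
Qed.

Lemma skewpart_sqnorm (Z : M) (r := - (2 * N%:R)^-1) :
  uN_inner (r%:C *: (Z - Z ^t*)) (r%:C *: (Z - Z ^t*)) = dKvar Z.
Proof.
rewrite uN_inner_skewpart; last exact: skewpart_skew.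
rewrite -scalemxAr mxtraceZ mulmxBr mxtrB ReM /= mul0r subr0 ReB /dKvar /r.
by field.
Qed.

Lemma dKvar_ge0 (Z : M) : 0 <= dKvar Z.
Proof.
rewrite -skewpart_sqnorm; set X := _ *: _.
have sX : skew_hermitian X by exact: skewpart_skew.
rewrite /uN_inner -{2}(opprK X) -sX mulmxN mxtrN ReN mulrNN -sqnorm_tr.
by apply: mulr_ge0 => //; exact: sqnorm_ge0.
Qed.

Lemma dK_gauss s u (Z : M) : 0 <= s -> s < u ->
  gaussian_law P (fun x => complex.Re (\tr (Z *m (K u x - K s x)))) 0
    (Num.sqrt ((u - s) * dKvar Z)).
Proof.
move=> s0 su; have [sk _ _ _ /(_ s u s0 su) [_ g]] := bm.
have u0 : 0 <= u by rewrite (le_trans s0) // ltW.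
rewrite -skewpart_sqnorm.
have := g _ (skewpart_skew Z (- (2 * N%:R)^-1)).
rewrite (_ : (fun x => uN_inner _ _) = (fun x => complex.Re (\tr (Z *m (K u x - K s x))))) //.
apply/funext => x; apply: uN_inner_skewpart.
have := sk u x u0; have := sk s x s0; rewrite /skew_hermitian => h1 h2.
apply/matrixP => i j; move/matrixP/(_ i j): h1; move/matrixP/(_ i j): h2.
by rewrite !tcE !mxE rmorphB /= => -> ->; rewrite opprB opprK addrC.
Qed.

Lemma dKvarZ (c : C) (Z : M) : dKvar (c *: Z) =
  (cabs c ^+ 2 * complex.Re (\tr (Z *m Z ^t*)) - complex.Re (c ^+ 2 * \tr (Z *m Z))) / (2 * N%:R).
Proof.
rewrite /dKvar; congr ((_ - _) / _).
  rewrite -!sqnorm_tr !sqnormE mulr_sumr; apply: eq_bigr => i _; rewrite mulr_sumr.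
  by apply: eq_bigr => j _; rewrite mxE cabsM exprMn.
by rewrite -scalemxAl -scalemxAr !mxtraceZ mulrA expr2.
Qed.

Definition trdK s u (Z : M) x : C := \tr (Z *m (K u x - K s x)).

Lemma trdKZ s u c Z x : trdK s u (c *: Z) x = c * trdK s u Z x.
Proof. by rewrite /trdK -scalemxAl mxtraceZ. Qed.

Lemma trdKD s u Z W x : trdK s u (Z + W) x = trdK s u Z x + trdK s u W x.
Proof. by rewrite /trdK mulmxDl mxtraceD. Qed.

Lemma trdK_delta s u i j x : trdK s u (delta_mx j i) x = (K u x - K s x) i j.
Proof. exact: tr_delta. Qed.

Lemma trdK_Im s u Z x : complex.Im (trdK s u Z x) = complex.Re (trdK s u (- 'i *: Z) x).
Proof. by rewrite trdKZ ReM ReN ImN /=; ring. Qed.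

Section Moments.
Variables (s u : R).
Hypotheses (s0 : 0 <= s) (su : s < u).

Lemma trdK_var Z : intg P (fun x => complex.Re (trdK s u Z x) ^+ 2) /\
  Ex P (fun x => complex.Re (trdK s u Z x) ^+ 2) = (u - s) * dKvar Z.
Proof.
have g := dK_gauss Z s0 su; split; first exact: (gaussian_intgX g 2).
rewrite (gaussian_var g) sqr_sqrtr //.
by apply: mulr_ge0 (dKvar_ge0 Z); rewrite subr_ge0 ltW.
Qed.

Lemma trdK_var4 Z : intg P (fun x => complex.Re (trdK s u Z x) ^+ 4) /\
  Ex P (fun x => complex.Re (trdK s u Z x) ^+ 4) = 3 * (u - s) ^+ 2 * dKvar Z ^+ 2.
Proof.
have g := dK_gauss Z s0 su; split; first exact: (gaussian_intgX g 4).
rewrite (gaussian_mom4 g) (exprM _ 2 2) sqr_sqrtr; first by rewrite exprMn mulrA.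
by apply: mulr_ge0 (dKvar_ge0 Z); rewrite subr_ge0 ltW.
Qed.

Lemma trdK_meas Z : cmeas (trdK s u Z).
Proof.
split; first by have [] := dK_gauss Z s0 su.
by under eq_fun do rewrite trdK_Im; have [] := dK_gauss (- 'i *: Z) s0 su.
Qed.

Lemma trdK_L2 Z : cL2 P (trdK s u Z).
Proof.
split; first exact: trdK_meas.
under eq_fun do rewrite cabs_sq trdK_Im.
by apply: intgD; [have [] := trdK_var Z|have [] := trdK_var (- 'i *: Z)].
Qed.

Lemma trdK_mean Z : Cexp P (trdK s u Z) = 0.
Proof.
rewrite CexpE; apply: complex_ext => /=; first exact: (gaussian_mean (dK_gauss Z s0 su)).
under eq_Ex do rewrite trdK_Im.
exact: (gaussian_mean (dK_gauss (- 'i *: Z) s0 su)).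
Qed.

Lemma Im_sqr_polar (z : C) (r p : R) : complex.Im z = r -> p = complex.Re z + r ->
  complex.Im (z * z) = p ^+ 2 - complex.Re z ^+ 2 - r ^+ 2.
Proof. by move=> <- ->; rewrite ImM; ring. Qed.

(** The law is known for real functionals only. The matrices [Z], [- 'i *: Z] and [(1 - 'i) *: Z]
    give the real part, the imaginary part and their sum, and polarisation recovers the mixed
    term. *)
Lemma trdK_sq Z : Cexp P (fun x => trdK s u Z x * trdK s u Z x) =
  - ((u - s) / N%:R)%:C * \tr (Z *m Z).
Proof.
have [i1 e1] := trdK_var Z; have [i2 e2] := trdK_var (- 'i *: Z).
have [i3 e3] := trdK_var ((1 - 'i) *: Z).
have ab x : complex.Re (trdK s u ((1 - 'i) *: Z) x) =
    complex.Re (trdK s u Z x) + complex.Re (trdK s u (- 'i *: Z) x).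
  by rewrite !trdKZ mulrBl mul1r mulNr ReD.
rewrite CexpE; apply: complex_ext => /=.
  under eq_Ex do rewrite ReM -!expr2 trdK_Im.
  rewrite ExB // e1 e2 dKvarZ sqrrN (sqr_i R) cabsN cabs_sq !ReM !ReN !ImN /= /dKvar.
  by field.
have -> : (fun x => complex.Im (trdK s u Z x * trdK s u Z x)) =
    (fun x => complex.Re (trdK s u ((1 - 'i) *: Z) x) ^+ 2 -
      complex.Re (trdK s u Z x) ^+ 2 - complex.Re (trdK s u (- 'i *: Z) x) ^+ 2).
  by apply/funext => x; exact: Im_sqr_polar (trdK_Im s u Z x) (ab x).
rewrite ExB //; last exact: intgB.
rewrite dKvarZ in e2; rewrite dKvarZ in e3.
transitivity (Ex P (fun x => complex.Re (trdK s u ((1 - 'i) *: Z) x) ^+ 2) -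
  Ex P (fun x => complex.Re (trdK s u Z x) ^+ 2) -
  Ex P (fun x => complex.Re (trdK s u (- 'i *: Z) x) ^+ 2)); first by congr (_ - _); exact: ExB.
transitivity ((u - s) * ((cabs (1 - 'i) ^+ 2 * complex.Re (\tr (Z *m Z ^t*)) -
      complex.Re ((1 - 'i) ^+ 2 * \tr (Z *m Z))) / (2 * N%:R)) - (u - s) * dKvar Z -
    (u - s) * ((cabs (- 'i) ^+ 2 * complex.Re (\tr (Z *m Z ^t*)) -
      complex.Re ((- 'i) ^+ 2 * \tr (Z *m Z))) / (2 * N%:R))).
  by congr (_ - _); [congr (_ - _)|]; [exact: e3|exact: e1|exact: e2].
have -> : (1 - 'i) ^+ 2 = (- 2)%:C * 'i :> C by apply: complex_ext; rewrite /=; ring.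
have -> : (- 'i) ^+ 2 = - 1 :> C by apply: complex_ext; rewrite /=; ring.
rewrite !cabs_sq ImM !ReM /dKvar /=.
by field.
Qed.

(** Complex bilinear polarisation of [trdK_sq]. This contraction is the source of all splittings and
    mergings of words. *)
Lemma trdK_cov Z W : Cexp P (fun x => trdK s u Z x * trdK s u W x) =
  - ((u - s) / N%:R)%:C * \tr (Z *m W).
Proof.
have iZZ A B : cintg P (fun x => trdK s u A x * trdK s u B x) by apply: cL2M; exact: trdK_L2.
have := trdK_sq (Z + W); rewrite mulmxDl !mulmxDr !mxtraceD (mxtrace_mulC W Z).
have -> : (fun x => trdK s u (Z + W) x * trdK s u (Z + W) x) = (fun x =>
   (trdK s u Z x * trdK s u Z x + trdK s u W x * trdK s u W x) + 2%:R * (trdK s u Z x * trdK s u W x)).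
  by apply/funext => x; rewrite trdKD; move: (trdK _ _ Z x) (trdK _ _ W x) => y z; ring.
rewrite CexpD; last 2 first. by apply: cintgD. by apply: cintgZ.
rewrite CexpD // CexpZ // !trdK_sq => H.
apply: (@mulfI _ (2%:R : C)); first by rewrite pnatr_eq0.
move/(canRL (addKr _)): H => ->; ring.
Qed.

Lemma trdK_L4 Z : intg P (fun x => cabs (trdK s u Z x) ^+ 4) /\
  Ex P (fun x => cabs (trdK s u Z x) ^+ 4) <=
    6 * (u - s) ^+ 2 * (dKvar Z ^+ 2 + dKvar (- 'i *: Z) ^+ 2).
Proof.
have [i1 e1] := trdK_var4 Z; have [i2 e2] := trdK_var4 (- 'i *: Z).
pose Y x := 2 * (complex.Re (trdK s u Z x) ^+ 4 + complex.Re (trdK s u (- 'i *: Z) x) ^+ 4).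
have iY : intg P Y by apply: intgZ; apply: intgD.
have H x : cabs (trdK s u Z x) ^+ 4 <= Y x.
  rewrite (exprM _ 2 2) cabs_sq trdK_Im /Y !(exprM _ 2 2).
  move: (complex.Re (trdK s u Z x) ^+ 2) (complex.Re (trdK s u (- 'i *: Z) x) ^+ 2) => a b; rewrite -subr_ge0.
  by rewrite (_ : _ - _ = (a - b) ^+ 2) ?sqr_ge0 //; ring.
have iL : intg P (fun x => cabs (trdK s u Z x) ^+ 4).
  apply: intg_le iY => [|x]; last by rewrite ger0_norm ?exprn_ge0.
  by apply: measurable_funX; apply: cmeas_cabs; exact: trdK_meas.
split => //; apply: (le_trans (le_Ex iL iY H)).
rewrite /Y ExZ; last exact: intgD.
rewrite ExD // e1 e2 le_eqVlt; apply/orP; left; apply/eqP; ring.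
Qed.

End Moments.

(** Either alternative makes the product integrable: bounded [A] serves for quadratic functions of
    the increment, square integrable pairs for an [A] that already contains earlier increments. *)
Lemma dK_indep s u (A W : T -> C) : 0 <= s -> s < u -> Fmeas s A -> cL2 P A ->
  cintg P W -> (exists c, forall x, cabs (A x) <= c) \/ cL2 P W ->
  @cmeas R _ (g_sigma_algebraType (sigma_of (entries (fun x => K u x - K s x)))) W ->
  Cexp P (fun x => A x * W x) = Cexp P A * Cexp P W.
Proof.
move=> s0 su FA LA iW H gW.
have [_ _ _ _ /(_ s u s0 su) [ind _]] := bm.
have dm f : entries (fun x => K u x - K s x) f -> cmeas f.
  by move=> [i [j ->]]; apply: dK_meas => //; exact: ltW.
have mA : measurable_fun setT (fun x => cabs (A x)) by case: LA => + _; exact: cmeas_cabs.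
have mW : measurable_fun setT (fun x => cabs (W x)) by apply: cmeas_cabs; exact: cintg_meas iW.
apply: (@Cexp_indep R _ T P (F s) (sigma_of (entries (fun x => K u x - K s x)))) => //.
- exact: F_sub.
- by rewrite sigma_of_id; apply: sigma_of_sub.
- by move=> B1 B2; rewrite sigma_of_id F_id // => h1 h2; exact: ind.
- exact: cL2_cintg.
- case: H => [[c Ac]|[_ iW2]].
    apply: (intg_le (Y := fun x => c * cabs (W x))).
    + exact: measurable_funM.
    + by move=> x; rewrite ger0_norm ?ler_wpM2r //; apply: mulr_ge0.
    + by apply: intgZ; exact: intg_cabs.
  by apply: intgM => //; case: LA.
Qed.

Lemma dKent_sigma s u i j :
  @cmeas R _ (g_sigma_algebraType (sigma_of (entries (fun x => K u x - K s x))))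
    (fun x => (K u x - K s x) i j).
Proof. by apply: sigma_of_cmeas_self; exists i, j. Qed.

Lemma dKent_L2 s u i j : 0 <= s -> s <= u -> cL2 P (fun x => (K u x - K s x) i j).
Proof.
move=> s0; rewrite le_eqVlt => /orP[/eqP <-|su].
  by under eq_fun do rewrite subrr mxE; exact: cL2_cst.
by under eq_fun do rewrite -trdK_delta; exact: trdK_L2.
Qed.

(* [A] is merely square integrable: it will itself contain earlier increments. *)
Lemma dK_mean s u (A : T -> C) i j : 0 <= s -> s <= u -> Fmeas s A -> cL2 P A ->
  Cexp P (fun x => A x * (K u x - K s x) i j) = 0.
Proof.
move=> s0; rewrite le_eqVlt => /orP[/eqP <- _ _|su FA LA].
  by under eq_Cexp do rewrite subrr mxE mulr0; exact: Cexp_cst.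
have L := dKent_L2 i j s0 (ltW su).
rewrite (dK_indep s0 su FA LA) //.
- under [X in _ * X]eq_Cexp do rewrite -trdK_delta.
  by rewrite trdK_mean // mulr0.
- exact: cL2_cintg.
- by right.
- exact: dKent_sigma.
Qed.

Lemma dK_cov s u (A : T -> C) c i j k l : 0 <= s -> s <= u -> Fmeas s A ->
  (forall x, cabs (A x) <= c) ->
  Cexp P (fun x => A x * ((K u x - K s x) i j * (K u x - K s x) k l)) =
    - ((u - s) / N%:R)%:C * (i == l)%:R * (j == k)%:R * Cexp P A.
Proof.
move=> s0; rewrite le_eqVlt => /orP[/eqP <- _ _|su FA bA].
  under eq_Cexp do rewrite subrr !mxE mul0r mulr0.
  by rewrite Cexp_cst subrr mul0r oppr0 !mul0r.
have Li i' j' := dKent_L2 i' j' s0 (ltW su).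
have LA : cL2 P A by apply: cL2_bnd bA; apply: Fmeas_meas FA.
rewrite (dK_indep s0 su FA LA) //.
- under [X in _ * X]eq_Cexp do rewrite -!trdK_delta.
  rewrite trdK_cov // tr_delta mxE mulrC -!mulrA.
  by case: (i == l); case: (j == k); rewrite ?mulr0 ?mul0r ?mulr1 ?mul1r.
- exact: cL2M.
- by left; exists c.
- by apply: cmeasM; exact: dKent_sigma.
Qed.

End BrownianIncrements.

(** * The Ito isometry for elementary processes *)

Section StepIsometry.
Context {R : realType} d (T : measurableType d) (P : probability T R).
Variable N : nat.
Hypothesis N0 : (0 < N)%N.
Local Notation C := R[i].
Local Notation M := 'M[C]_N.
Variables (F : R -> set (set T)) (K : R -> T -> M).
Hypothesis flt : filtration F.
Hypothesis bm : uN_brownian P F K.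

Let D a b x i j : C := (K b x - K a x) i j.

Lemma dK_L2 a b i j : 0 <= a -> a <= b -> cL2 P (fun x => D a b x i j).
Proof. by move=> a0 ab; have := dKent_L2 N0 bm i j a0 ab. Qed.

Lemma dK_Fmeas a b i j : 0 <= a -> a <= b -> Fmeas F b (fun x => D a b x i j).
Proof.
move=> a0 ab; rewrite /D; under eq_fun do rewrite !mxE.
have b0 := le_trans a0 ab.
apply: cmeasB; first exact: (K_Fmeas flt bm i j b0).
exact: (Fmeas_mono flt a0 ab (K_Fmeas flt bm i j a0)).
Qed.

Lemma dK_chasles a c b x i j : D a b x i j = D a c x i j + D c b x i j.
Proof. by rewrite /D !mxE; ring. Qed.

Lemma dK_disjoint a b c e (g : T -> C) m i j k l : 0 <= a -> a <= b -> b <= c -> c <= e ->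
  Fmeas F c g -> (forall x, cabs (g x) <= m) ->
  Cexp P (fun x => g x * (D a b x i j * D c e x k l)) = 0.
Proof.
move=> a0 ab bc ce Fg bg; have b0 := le_trans a0 ab; have c0 := le_trans b0 bc.
under eq_Cexp do rewrite mulrA.
apply: (dK_mean N0 flt bm k l c0 ce).
  apply: cmeasM => //; apply: (Fmeas_mono flt b0 bc); exact: dK_Fmeas.
exact: cL2M_bnd (Fmeas_meas flt c0 Fg) bg (dK_L2 i j a0 ab).
Qed.

Lemma dK_intg a b c e (g : T -> C) m i j k l : 0 <= a -> a <= b -> 0 <= c -> c <= e ->
  cmeas g -> (forall x, cabs (g x) <= m) ->
  cintg P (fun x => g x * (D a b x i j * D c e x k l)).
Proof.
move=> a0 ab c0 ce mg bg; under eq_fun do rewrite mulrA.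
by apply: cL2M; [exact: (cL2M_bnd mg bg (dK_L2 i j a0 ab))|exact: dK_L2].
Qed.

Lemma dK_nested c b e (g : T -> C) m i j k l : 0 <= c -> c <= b -> b <= e ->
  Fmeas F c g -> (forall x, cabs (g x) <= m) ->
  Cexp P (fun x => g x * (D c b x i j * D c e x k l)) =
    - ((b - c) / N%:R)%:C * (i == l)%:R * (j == k)%:R * Cexp P g.
Proof.
move=> c0 cb be Fg bg; have b0 := le_trans c0 cb; have mg := Fmeas_meas flt c0 Fg.
rewrite -(dK_cov N0 flt bm i j k l c0 cb Fg bg).
transitivity (Cexp P (fun x => g x * (D c b x i j * D c b x k l)) +
  Cexp P (fun x => g x * (D c b x i j * D b e x k l))); last first.
  by rewrite (@dK_disjoint c b b e g m) ?addr0 //; exact: (Fmeas_mono flt c0 cb).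
rewrite -CexpD; [|exact: dK_intg|exact: (@dK_intg _ _ _ _ _ m)].
by apply: eq_Cexp => x; rewrite (dK_chasles c b e) !mulrDr.
Qed.

Definition overlap (a b c e : R) : R := Num.max 0 (Num.min b e - Num.max a c).

Lemma overlapC a b c e : overlap a b c e = overlap c e a b.
Proof. by rewrite /overlap (minC b) (maxC a). Qed.

(** The first increment is cut at the later start [c]. Its part before [c] has zero covariance with
    what follows, and the nested remainder leaves the variance of the shorter interval. *)
Lemma dK_pair_le a b c e (g : T -> C) m i j k l : 0 <= a -> a <= b -> c <= e -> a <= c ->
  Fmeas F c g -> (forall x, cabs (g x) <= m) ->
  Cexp P (fun x => g x * (D a b x i j * D c e x k l)) =
    - (overlap a b c e / N%:R)%:C * (i == l)%:R * (j == k)%:R * Cexp P g.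
Proof.
move=> a0 ab ce ac Fg bg; have c0 := le_trans a0 ac; have mg := Fmeas_meas flt c0 Fg.
have [bc|cb] := leP b c.
  rewrite (@dK_disjoint a b c e g m) // /overlap max_l ?mul0r ?oppr0 ?mul0r //.
  by rewrite subr_le0 (max_r ac) (le_trans _ bc) // ge_min lexx.
have {}cb := ltW cb.
transitivity (Cexp P (fun x => g x * (D a c x i j * D c e x k l)) +
  Cexp P (fun x => g x * (D c b x i j * D c e x k l))).
  rewrite -CexpD; [|exact: (@dK_intg _ _ _ _ _ m)|exact: (@dK_intg _ _ _ _ _ m)].
  by apply: eq_Cexp => x; rewrite (dK_chasles a c b) mulrDl !mulrDr.
rewrite (@dK_disjoint a c c e g m) // add0r /overlap (max_r ac).
have [be|eb] := leP b e.
  by rewrite (dK_nested i j k l c0 cb be Fg bg) max_r // subr_ge0.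
have {}eb := ltW eb.
transitivity (Cexp P (fun x => g x * (D c e x k l * D c b x i j))).
  by apply: eq_Cexp => x; congr (_ * _); exact: mulrC.
rewrite (dK_nested k l i j c0 ce eb Fg bg) max_r ?subr_ge0 //.
by rewrite (eq_sym k) (eq_sym l) -!mulrA; congr (_ * _); rewrite mulrCA.
Qed.

Lemma dK_pair a b c e (f g : T -> C) m m' i j k l : 0 <= a -> a <= b -> 0 <= c -> c <= e ->
  Fmeas F a f -> Fmeas F c g -> (forall x, cabs (f x) <= m) -> (forall x, cabs (g x) <= m') ->
  Cexp P (fun x => f x * g x * (D a b x i j * D c e x k l)) =
    - (overlap a b c e / N%:R)%:C * (i == l)%:R * (j == k)%:R * Cexp P (fun x => f x * g x).
Proof.
move=> a0 ab c0 ce Ff Fg bf bg.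
have bfg x : cabs (f x * g x) <= m * m' by rewrite cabsM ler_pM.
have [ac|ca] := leP a c.
  apply: (@dK_pair_le a b c e _ (m * m')) => //; apply: cmeasM => //.
  exact: (Fmeas_mono flt a0 ac).
have {}ca := ltW ca.
have Ffg : Fmeas F a (fun x => f x * g x).
  by apply: cmeasM => //; exact: (Fmeas_mono flt c0 ca).
transitivity (Cexp P (fun x => f x * g x * (D c e x k l * D a b x i j))).
  by apply: eq_Cexp => x; congr (_ * _); exact: mulrC.
rewrite (@dK_pair_le c e a b _ (m * m') k l i j c0 ce ab ca Ffg bfg) overlapC.
by rewrite (eq_sym k) (eq_sym l) -!mulrA; congr (_ * _); rewrite mulrCA.
Qed.

(* [(a, b, A)] stands for the elementary process [A * 1_(]a, b])]. *)
Definition cell := (R * R * (T -> M))%type.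

Definition good_cell (e : cell) : Prop :=
  [/\ 0 <= e.1.1, e.1.1 <= e.1.2, forall i j, Fmeas F e.1.1 (fun x => e.2 x i j) &
      exists c, forall i j x, cabs (e.2 x i j) <= c].

Definition cells_integral (I : finType) (l : I -> cell) (x : T) : M :=
  \sum_k (l k).2 x *m (K (l k).1.2 x - K (l k).1.1 x).

Definition cells_eval (I : finType) (l : I -> cell) (s : R) (x : T) : M :=
  \sum_k if (l k).1.1 < s <= (l k).1.2 then (l k).2 x else 0.

Definition hs (A B : M) : C := \sum_i \sum_j A i j * (B i j)^*.

Lemma hs_sqnorm A : hs A A = (sqnorm A)%:C.
Proof.
rewrite sqnormE /hs rmorph_sum; apply: eq_bigr => i _; rewrite rmorph_sum.
by apply: eq_bigr => j _; rewrite mul_conj_cabs.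
Qed.

Lemma hs_suml (I : finType) (f : I -> M) B : hs (\sum_k f k) B = \sum_k hs (f k) B.
Proof.
rewrite /hs [RHS]exchange_big; apply: eq_bigr => i _; rewrite [RHS]exchange_big.
by apply: eq_bigr => j _; rewrite summxE mulr_suml.
Qed.

Lemma hs_sumr (I : finType) (f : I -> M) B : hs B (\sum_k f k) = \sum_k hs B (f k).
Proof.
rewrite /hs [RHS]exchange_big; apply: eq_bigr => i _; rewrite [RHS]exchange_big.
by apply: eq_bigr => j _; rewrite summxE rmorph_sum mulr_sumr.
Qed.

(** Entry covariances carry [1 / N], and the sum over the middle index has [N] equal terms, so the
    isometry is exact with constant 1. *)
Lemma cell_pair (e e' : cell) : good_cell e -> good_cell e' ->
  cintg P (fun x => hs (e.2 x *m (K e.1.2 x - K e.1.1 x)) (e'.2 x *m (K e'.1.2 x - K e'.1.1 x))) /\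
  Cexp P (fun x => hs (e.2 x *m (K e.1.2 x - K e.1.1 x)) (e'.2 x *m (K e'.1.2 x - K e'.1.1 x))) =
  (overlap e.1.1 e.1.2 e'.1.1 e'.1.2)%:C * Cexp P (fun x => hs (e.2 x) (e'.2 x)).
Proof.
case: e e' => [[a b] A] [[c e] B] [/= a0 ab FA [m bA]] [/= c0 ce FB [m' bB]].
have mA i j : cmeas (fun x => A x i j) by apply: (Fmeas_meas flt a0); exact: FA.
have mB i j : cmeas (fun x => B x i j) by apply: (Fmeas_meas flt c0); exact: FB.
(* Skew-Hermitian increments: the conjugate in [hs] becomes a transposition with a sign, so the
   bilinear formula [dK_pair] applies. *)
have skD x i j : (D c e x i j)^* = - D c e x j i.
  have [sk _ _ _ _] := bm; have /matrixP/(_ j i) := sk c x c0.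
  have /matrixP/(_ j i) := sk e x (le_trans c0 ce).
  by rewrite !tcE /D !mxE rmorphB /= => -> ->; ring.
have hsE x : hs (A x *m (K b x - K a x)) (B x *m (K e x - K c x)) =
   \sum_i \sum_j \sum_k \sum_l - (A x i k * (B x i l)^* * (D a b x k j * D c e x j l)).
  apply: eq_bigr => i _; apply: eq_bigr => j _.
  rewrite [(A x *m _) i j]mxE [(B x *m _) i j]mxE mulr_suml; apply: eq_bigr => k _.
  rewrite rmorph_sum mulr_sumr; apply: eq_bigr => l _.
  transitivity (A x i k * D a b x k j * ((B x i l)^* * - D c e x j l)); last by ring.
  by congr (_ * _); rewrite -skD; exact: rmorphM.
have im i j k l : cintg P (fun x => - (A x i k * (B x i l)^* * (D a b x k j * D c e x j l))).
  apply: cintgN; apply: (@dK_intg a b c e _ (m * m')) => //.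
    by apply: cmeasM => //; exact: cmeas_conj.
  by move=> x; rewrite cabsM cabs_conj ler_pM.
have i1 i j k : cintg P (fun x => \sum_l - (A x i k * (B x i l)^* * (D a b x k j * D c e x j l))).
  by apply: cintg_sum => l _.
have i2 i j : cintg P (fun x => \sum_k \sum_l - (A x i k * (B x i l)^* * (D a b x k j * D c e x j l))).
  by apply: cintg_sum => k _.
have i3 i : cintg P (fun x => \sum_j \sum_k \sum_l - (A x i k * (B x i l)^* * (D a b x k j * D c e x j l))).
  by apply: cintg_sum => j _.
under eq_fun do rewrite hsE; split; first by apply: cintg_sum => i _.
have iAB i k : cintg P (fun x => A x i k * (B x i k)^*).
  apply: (@cintg_bnd _ _ _ _ _ (m * m')); first by apply: cmeasM => //; exact: cmeas_conj.
  by move=> x; rewrite cabsM cabs_conj ler_pM.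
rewrite Cexp_sum // /hs Cexp_sum; last by move=> i _; apply: cintg_sum => j _.
rewrite mulr_sumr; apply: eq_bigr => i _; rewrite Cexp_sum // Cexp_sum // mulr_sumr.
transitivity (\sum_(j < N) \sum_(k < N) ((overlap a b c e / N%:R)%:C * Cexp P (fun x => A x i k * (B x i k)^*))).
  apply: eq_bigr => j _; rewrite Cexp_sum //; apply: eq_bigr => k _; rewrite Cexp_sum //.
  rewrite (bigD1 k) //= big1 ?addr0 => [|l lk].
    rewrite CexpN; last first.
      apply: (@dK_intg a b c e _ (m * m')) => //.
        by apply: cmeasM => //; exact: cmeas_conj.
      by move=> x; rewrite cabsM cabs_conj ler_pM.
    rewrite (@dK_pair a b c e _ _ m m') //.
    + by rewrite !eqxx !mulr1 mulNr opprK.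
    + exact: (cmeas_conj (FB i k)).
    + by move=> x; rewrite cabs_conj.
  rewrite CexpN; last first.
    apply: (@dK_intg a b c e _ (m * m')) => //.
      by apply: cmeasM => //; exact: cmeas_conj.
    by move=> x; rewrite cabsM cabs_conj ler_pM.
  rewrite (@dK_pair a b c e _ _ m m') //.
  + by rewrite eq_sym (negbTE lk) !mulr0 !mul0r oppr0.
  + exact: (cmeas_conj (FB i l)).
  + by move=> x; rewrite cabs_conj.
rewrite exchange_big; apply: eq_bigr => k _; rewrite sumr_const card_ord -mulrnAl; congr (_ * _).
rewrite -mulr_natr -(rmorph_nat (real_complex R)) -rmorphM /= divfK //.
by rewrite pnatr_eq0 -lt0n.
Qed.

Let mu := @lebesgue_measure R.

Definition ocind (a b s : R) : R := (a < s <= b)%R%:R.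

Lemma overlap_integral (a b c e : R) : a <= b -> c <= e ->
  (\int[mu]_(s in setT) (ocind a b s * ocind c e s)%:E)%E = (overlap a b c e)%:E /\
  mu.-integrable setT (fun s => (ocind a b s * ocind c e s)%:E).
Proof.
move=> ab ce.
have -> : (fun s => (ocind a b s * ocind c e s)%:E) =
    EFin \o (\1_(`]Num.max a c, Num.min b e] : set R)).
  apply/funext => s /=; congr EFin.
  rewrite /ocind indicE mem_setE in_itv /= gt_max le_min -natrM mulnb; congr (_ %:R); congr nat_of_bool.
  by rewrite andbACA.
have E : mu (`]Num.max a c, Num.min b e]%classic : set R) = (overlap a b c e)%:E.
  rewrite /mu lebesgue_measure_itv /= lte_fin /overlap.
  case: ifPn => [lt|]; first by rewrite -EFinD; congr EFin; apply/esym/max_r; rewrite subr_ge0 ltW.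
  by rewrite -leNgt => le; congr EFin; apply/esym/max_l; rewrite subr_le0.
split; first by rewrite integral_indic ?setIT.
by apply: integrable_indic_itv.
Qed.

Lemma integral_fin_sum (I : finType) (f : I -> R -> R) (v : I -> R) :
  (forall i, mu.-integrable setT (fun s => (f i s)%:E)) ->
  (forall i, (\int[mu]_s (f i s)%:E)%E = (v i)%:E) ->
  mu.-integrable setT (fun s => (\sum_i f i s)%:E) /\
  (\int[mu]_s (\sum_i f i s)%:E)%E = (\sum_i v i)%:E.
Proof.
move=> If Ef; have E s : (\sum_i f i s)%:E = (\sum_i (f i s)%:E)%E by rewrite sumEFin.
have -> : (fun s => (\sum_i f i s)%:E) = (fun s => \sum_i (f i s)%:E)%E by apply/funext.
split.
  exact: integrable_sum.
by rewrite integral_sum // -sumEFin; apply: eq_bigr => i _; exact: Ef.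
Qed.

(** The cells may overlap in any way: the formula is summed over pairs, and the overlap length is
    the integral of the product of the two indicators. Differences of elementary processes thus need
    no common refinement. *)
Lemma cells_isometry (I : finType) (l : I -> cell) : (forall k, good_cell (l k)) ->
  [/\ intg P (fun x => sqnorm (cells_integral l x)),
      forall s, intg P (fun x => sqnorm (cells_eval l s x)),
      measurable_fun setT (fun s => Ex P (fun x => sqnorm (cells_eval l s x))) &
      (\int[mu]_s (Ex P (fun x => sqnorm (cells_eval l s x)))%:E)%E =
      (Ex P (fun x => sqnorm (cells_integral l x)))%:E].
Proof.
move=> Gl.
pose c k k' := Cexp P (fun x => hs ((l k).2 x) ((l k').2 x)).
have ic k k' : cintg P (fun x => hs ((l k).2 x) ((l k').2 x)).
  have [a0 ab FA [m bA]] := Gl k; have [b0 cb FB [m' bB]] := Gl k'.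
  apply: cintg_sum => i _; apply: cintg_sum => j _.
  apply: (@cintg_bnd _ _ _ _ _ (m * m')).
    apply: cmeasM; first exact: (Fmeas_meas flt a0 (FA i j)).
    exact: cmeas_conj (Fmeas_meas flt b0 (FB i j)).
  by move=> x; rewrite cabsM cabs_conj ler_pM.
have sqE (X : T -> M) : cintg P (fun x => hs (X x) (X x)) -> intg P (fun x => sqnorm (X x)) /\
    Ex P (fun x => sqnorm (X x)) = complex.Re (Cexp P (fun x => hs (X x) (X x))).
  have -> : (fun x => hs (X x) (X x)) = (fun x => (sqnorm (X x))%:C).
    by apply/funext => x; exact: hs_sqnorm.
  by case.
have SI x : hs (cells_integral l x) (cells_integral l x) = \sum_k \sum_k'
    hs ((l k).2 x *m (K (l k).1.2 x - K (l k).1.1 x)) ((l k').2 x *m (K (l k').1.2 x - K (l k').1.1 x)).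
  by rewrite hs_suml; apply: eq_bigr => k _; rewrite hs_sumr.
pose w k s : R := ocind (l k).1.1 (l k).1.2 s.
have SE s x : hs (cells_eval l s x) (cells_eval l s x) = \sum_k \sum_k'
    (w k s * w k' s)%:C * hs ((l k).2 x) ((l k').2 x).
  rewrite hs_suml; apply: eq_bigr => k _; rewrite hs_sumr; apply: eq_bigr => k' _.
  have hs0 A : hs 0 A = 0 by rewrite /hs big1 // => i _; rewrite big1 // => j _; rewrite mxE mul0r.
  have hs0' A : hs A 0 = 0 by rewrite /hs big1 // => i _; rewrite big1 // => j _; rewrite mxE rmorph0 mulr0.
  rewrite /w /ocind; case: (_ < s <= _); case: (_ < s <= _); rewrite ?hs0 ?hs0' ?mulr1 ?mulr0 ?mul0r ?rmorph1 ?rmorph0 ?mul1r ?mul0r //.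
have i1 : cintg P (fun x => hs (cells_integral l x) (cells_integral l x)).
  under eq_fun do rewrite SI; apply: cintg_sum => k _; apply: cintg_sum => k' _.
  by have [] := cell_pair (Gl k) (Gl k').
have i2 s : cintg P (fun x => hs (cells_eval l s x) (cells_eval l s x)).
  by under eq_fun do rewrite SE; apply: cintg_sum => k _; apply: cintg_sum => k' _; exact: cintgZ.
have E1 : Ex P (fun x => sqnorm (cells_integral l x)) = \sum_k \sum_k'
    overlap (l k).1.1 (l k).1.2 (l k').1.1 (l k').1.2 * complex.Re (c k k').
  have [_ ->] := sqE _ i1; under eq_Cexp do rewrite SI.
  rewrite Cexp_sum => [|k _]; last first.
    by apply: cintg_sum => k' _; have [] := cell_pair (Gl k) (Gl k').
  rewrite Re_sum; apply: eq_bigr => k _.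
  rewrite Cexp_sum => [|k' _]; last by have [] := cell_pair (Gl k) (Gl k').
  rewrite Re_sum; apply: eq_bigr => k' _; have [_ ->] := cell_pair (Gl k) (Gl k').
  by rewrite ReM /= mul0r subr0.
have E2 s : Ex P (fun x => sqnorm (cells_eval l s x)) = \sum_k \sum_k'
    w k s * w k' s * complex.Re (c k k').
  have [_ ->] := sqE _ (i2 s); under eq_Cexp do rewrite SE.
  rewrite Cexp_sum => [|k _]; last by apply: cintg_sum => k' _; exact: cintgZ.
  rewrite Re_sum; apply: eq_bigr => k _.
  rewrite Cexp_sum => [|k' _]; last exact: cintgZ.
  rewrite Re_sum; apply: eq_bigr => k' _; rewrite CexpZ //.
  by rewrite ReM /= mul0r subr0.
have [I1 I2] : mu.-integrable setT (fun s => (\sum_k \sum_k' w k s * w k' s * complex.Re (c k k'))%:E) /\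
  (\int[mu]_s (\sum_k \sum_k' w k s * w k' s * complex.Re (c k k'))%:E)%E =
  (\sum_k \sum_k' overlap (l k).1.1 (l k).1.2 (l k').1.1 (l k').1.2 * complex.Re (c k k'))%:E.
  have H k k' : mu.-integrable setT (fun s => (w k s * w k' s * complex.Re (c k k'))%:E) /\
     (\int[mu]_s (w k s * w k' s * complex.Re (c k k'))%:E)%E =
     (overlap (l k).1.1 (l k).1.2 (l k').1.1 (l k').1.2 * complex.Re (c k k'))%:E.
    have [_ ab _ _] := Gl k; have [_ ab' _ _] := Gl k'.
    have [e1 e2] := overlap_integral ab ab'.
    have -> : (fun s => (w k s * w k' s * complex.Re (c k k'))%:E) =
       (fun s => (complex.Re (c k k'))%:E * (w k s * w k' s)%:E)%E.
      by apply/funext => s; rewrite -EFinM mulrC.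
    split; first exact: integrableZl.
    by rewrite integralZl // e1 -EFinM mulrC.
  apply: integral_fin_sum => k.
    by have [] := @integral_fin_sum _ _ _ (fun k' => (H k k').1) (fun k' => (H k k').2).
  by have [] := @integral_fin_sum _ _ _ (fun k' => (H k k').1) (fun k' => (H k k').2).
split; first by have [] := sqE _ i1.
- by move=> s; have [] := sqE _ (i2 s).
- by under eq_fun do rewrite E2; apply/measurable_EFinP; exact: measurable_int I1.
- by under eq_integral do rewrite E2; rewrite I2 E1.
Qed.

End StepIsometry.

(** * Joint measurability and time integrals *)

Section JointMeasurability.
Context {R : realType} d (T : measurableType d) (P : probability T R).
Local Notation mu := (@lebesgue_measure R).

Lemma lower_integral_le (f g : T -> \bar R) : (forall x, (0 <= f x)%E) ->
  (forall x, (f x <= g x)%E) -> (\int[P]_x f x <= \int[P]_x g x)%E.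
Proof.
move=> f0 fg; rewrite !ge0_integralE //; last by move=> x _; exact: le_trans (fg x).
apply: ge_ereal_sup => _ [h /= hf <-]; apply: ereal_sup_ubound; exists h => //= x.
by rewrite (le_trans (hf x)) // !patch_setT.
Qed.

(** Serves a [g] that is not known to be measurable: the integral of a nonnegative function is a
    supremum over simple functions below it, and [f] is set to 0 on the null set where the two may
    differ. *)
Lemma lower_integral_ae (f g : T -> \bar R) : measurable_fun setT f -> (forall x, (0 <= f x)%E) ->
  (forall x, (0 <= g x)%E) -> {ae P, forall x, f x = g x} ->
  (\int[P]_x f x <= \int[P]_x g x)%E.
Proof.
move=> mf f0 g0 [A [mA A0 HA]].
pose f' x := (f x * (\1_(~` A) x)%:E)%E.
have mf' : measurable_fun setT f'.
  by apply: emeasurable_funM => //; apply/measurable_EFinP; apply: measurable_indic; exact: measurableC.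
have f'0 x : (0 <= f' x)%E by rewrite mule_ge0 // lee_fin.
rewrite (@ge0_ae_eq_integral _ _ _ P setT f f') //.
  apply: lower_integral_le => // x; rewrite /f' indicE.
  have [xA|xA] := boolP (x \in ~` A); last by rewrite mule0.
  rewrite mule1; have [-> //|fg] := pselect (f x = g x).
  by move: xA; rewrite inE; case; apply: HA.
exists A; split => // x /=; apply: contra_notP => xA _.
by rewrite /f' indicE mem_set // mule1.
Qed.

(** Processes are constrained on nonnegative times only; freezing time at 0 extends them to the
    whole line, where products with [T] are formed. *)
Definition clamp (s : R) : R := Num.max 0 s.

Lemma clamp_ge0 s : 0 <= clamp s.
Proof. by rewrite /clamp le_max lexx. Qed.

Lemma clamp_id s : 0 <= s -> clamp s = s.
Proof. by move=> s0; rewrite /clamp max_r. Qed.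

Lemma meas_clamp : measurable_fun setT clamp.
Proof. exact: measurable_maxr. Qed.

Section Process.
Variable f : R -> T -> R.
Hypothesis mf : forall s, 0 <= s -> measurable_fun setT (f s).
Hypothesis cf : forall x, {within `[0, +oo[, continuous (f^~ x)}.

Let g n (z : R * T) : R := f ((Num.truncn (clamp z.1 * n.+1%:R))%:R / n.+1%:R) z.2.

(** Sampled at multiples of [1 / (n + 1)], a process is a countable union of measurable rectangles;
    continuity of paths then gives joint measurability in the limit. *)
Lemma meas_grid n : measurable_fun setT (g n).
Proof.
move=> _ B mB; rewrite setTI.
pose A m : set R := clamp @^-1` `[m%:R / n.+1%:R, m.+1%:R / n.+1%:R[%classic.
have mA m : measurable (A m).
  by rewrite -[A m]setTI; apply: meas_clamp.
have -> : g n @^-1` B = \bigcup_m (A m `*` (f (m%:R / n.+1%:R) @^-1` B)).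
  apply/seteqP; split=> [[s x] /= gB|[s x] [m _ [/= Am fB]]].
    exists (Num.truncn (clamp s * n.+1%:R)) => //; split => //=.
    rewrite /A /= in_itv /= ler_pdivrMr ?ltr_pdivlMr ?ltr0n //.
    by apply: truncn_itv; rewrite mulr_ge0 ?clamp_ge0.
  rewrite /preimage /= /g /=; have -> // : Num.truncn (clamp s * n.+1%:R) = m.
  apply: truncn_def; move: Am; rewrite /A /= in_itv /=.
  by rewrite ler_pdivrMr ?ltr_pdivlMr ?ltr0n.
apply: bigcup_measurable => m _; apply: measurableX => //.
by rewrite -[_ @^-1` _]setTI; apply: mf => //; rewrite divr_ge0.
Qed.

Lemma grid_cvg (s : R) x : g n (s, x) @[n --> \oo] --> f (clamp s) x.
Proof.
pose q n : R := (Num.truncn (clamp s * n.+1%:R))%:R / n.+1%:R.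
have q0 n : 0 <= q n by rewrite divr_ge0.
have qs : q n @[n --> \oo] --> clamp s.
  apply/cvgrPdist_lt => e e0; near=> n.
  have /andP[h1 h2] : (Num.truncn (clamp s * n.+1%:R))%:R <= clamp s * n.+1%:R <
    (Num.truncn (clamp s * n.+1%:R)).+1%:R.
    by apply: truncn_itv; rewrite mulr_ge0 ?clamp_ge0.
  have ne : n.+1%:R^-1 < e by near: n; exact: near_infty_natSinv_lt (PosNum e0).
  rewrite ger0_norm; last by rewrite subr_ge0 /q ler_pdivrMr.
  apply: lt_trans ne; rewrite ltrBlDr /q -[X in X + _]mul1r -mulrDl ltr_pdivlMr //.
  by rewrite addrC natr1.
have sc : `[0, +oo[%classic (clamp s) by rewrite /= in_itv /= clamp_ge0.
have [/(_ (@cf x) _ sc) cs _] := @subspace_continuousP _ (`[0, +oo[%classic : set R) _ (f^~ x).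
rewrite /g /=; apply: (cvg_comp q (f^~ x)) cs => A.
rewrite /within /= => /qs H; change (\forall n \near \oo, A (q n)).
apply: (filterS _ (H : \forall n \near \oo, q n \in `[0, +oo[ -> A (q n))) => n; apply.
by rewrite in_itv /= q0.
Unshelve. all: by end_near.
Qed.

Lemma meas_process : measurable_fun setT (fun z : R * T => f (clamp z.1) z.2).
Proof.
apply: (measurable_fun_cvg (h := g)) => [n|[s x] _]; first exact: meas_grid.
exact: grid_cvg.
Qed.

End Process.

Lemma meas_indic_fst (D : set R) : measurable D ->
  measurable_fun setT (fun z : R * T => \1_D z.1 : R).
Proof.
move=> mD; rewrite (_ : (fun z => _) = \1_(D `*` [set: T])); last first.
  by apply/funext => -[s x]; rewrite !indicE; congr (_%:R); congr nat_of_bool;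
    apply/idP/idP; rewrite !inE => // -[].
by apply: measurable_indic; exact: measurableX.
Qed.

Lemma meas_Rint (f : R * T -> R) (D : set R) : measurable D -> measurable_fun setT f ->
  measurable_fun setT (fun x => \int[mu]_(s in D) f (s, x)).
Proof.
move=> mD mf; rewrite /Rintegral; apply: (measurableT_comp (f := fine)) => //.
have H (h : R * T -> \bar R) : measurable_fun setT h -> (forall z, (0 <= h z)%E) ->
    measurable_fun setT (fun x => \int[mu]_(s in D) h (s, x))%E.
  move=> mh h0.
  pose k (z : R * T) : \bar R := (h z * (\1_D z.1)%:E)%E.
  have mk : measurable_fun setT k.
    apply: emeasurable_funM => //; apply/measurable_EFinP.
    exact: meas_indic_fst.
  have k0 z : (0 <= k z)%E by rewrite /k mule_ge0 // lee_fin indicE.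
  have := @measurable_fun_fubini_tonelli_G _ _ _ _ _ mu k mk k0.
  congr (measurable_fun setT _); apply/funext => x; rewrite /fubini_G [RHS]integral_mkcond.
  by apply: eq_integral => s _; rewrite /k /= patchE indicE; case: (s \in D); rewrite ?mule1 ?mule0.
under eq_fun do rewrite integralE.
have mE : measurable_fun setT (EFin \o f) by exact/measurable_EFinP.
apply: emeasurable_funB.
  have := H _ (measurable_funepos mE) (funepos_ge0 _); congr (measurable_fun _ _).
  by apply/funext => x; apply: eq_integral => s _; rewrite !funeposE.
have := H _ (measurable_funeneg mE) (funeneg_ge0 _); congr (measurable_fun _ _).
by apply/funext => x; apply: eq_integral => s _; rewrite !funenegE.
Qed.

Lemma bounded_itv_integrable (f : R -> R) (a b m : R) : measurable_fun setT f ->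
  (forall s, a <= s <= b -> `|f s| <= m) -> mu.-integrable `[a, b] (EFin \o f).
Proof.
move=> mf fm; apply: measurable_bounded_integrable => //.
- have : (mu (`[a, b]%classic : set R) < +oo)%E.
    by rewrite lebesgue_measure_itv; case: ifP => // _; rewrite -EFinD ltry.
  exact.
- exact: measurable_funTS.
- exists m; split; first by rewrite num_real.
  by move=> x mx s /= sab; rewrite (le_trans (fm s _)) ?(ltW mx) //; move: sab; rewrite in_itv.
Qed.

(** Tonelli. The pointwise bound [c] only secures integrability and leaves no trace in the
    estimate. *)
Lemma Ex_time_integral_le (f : R * T -> R) (a b m c : R) : a <= b -> measurable_fun setT f ->
  (forall s x, a <= s <= b -> `|f (s, x)| <= c) ->
  (forall s, a <= s <= b -> Ex P (fun x => `|f (s, x)|) <= m) ->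
  intg P (fun x => `|\int[mu]_(s in `[a, b]) f (s, x)|) /\
  Ex P (fun x => `|\int[mu]_(s in `[a, b]) f (s, x)|) <= (b - a) * m.
Proof.
move=> ab mf fc fm.
have mfx x : measurable_fun setT (fun s => f (s, x)).
  exact: (measurableT_comp mf (measurable_pair2 x)).
have mfs s : measurable_fun setT (fun x => f (s, x)).
  exact: (measurableT_comp mf (measurable_pair1 s)).
have lab : mu (`[a, b]%classic : set R) = (b - a)%:E.
  rewrite lebesgue_measure_itv /= lte_fin; case: ifPn => [_|]; first by rewrite EFinB.
  by rewrite -leNgt => ba; congr EFin; apply/eqP; rewrite eq_sym subr_eq0 eq_le ab ba.
have iab x : mu.-integrable `[a, b] (EFin \o (fun s => f (s, x))).
  by apply: (@bounded_itv_integrable _ _ _ c) => // s sab; exact: fc.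
have ian x : mu.-integrable `[a, b] (EFin \o (fun s => `|f (s, x)|)).
  apply: (@bounded_itv_integrable _ _ _ c) => [|s sab]; first exact: measurableT_comp.
  by rewrite normr_id; exact: fc.
pose k (z : R * T) : \bar R := (`|f z|%:E * (\1_(`[a, b]%classic) z.1)%:E)%E.
have mk : measurable_fun setT k.
  apply: emeasurable_funM; first by apply/measurable_EFinP; exact: measurableT_comp.
  by apply/measurable_EFinP; exact: meas_indic_fst.
have k0 z : (0 <= k z)%E by rewrite /k mule_ge0 // lee_fin ?indicE.
have kE x : fubini_G mu k x = (\int[mu]_(s in `[a, b]) `|f (s, x)|)%:E.
  rewrite /fubini_G /Rintegral fineK; last exact: integrable_fin_num (ian x).
  rewrite [RHS]integral_mkcond; apply: eq_integral => s _.
  by rewrite /k /= patchE indicE; case: (s \in _); rewrite ?mule1 ?mule0.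
have le x : `|\int[mu]_(s in `[a, b]) f (s, x)| <= \int[mu]_(s in `[a, b]) `|f (s, x)|.
  exact: le_normr_Rintegral.
have lec x : \int[mu]_(s in `[a, b]) `|f (s, x)| <= c * (b - a).
  rewrite -(_ : \int[mu]_(s in `[a, b]) (cst c s) = c * (b - a)); last first.
    by rewrite Rintegral_cst //; congr (_ * _); exact: (congr1 fine lab).
  apply: le_Rintegral => //.
    apply: (@bounded_itv_integrable _ _ _ `|c|) => //.
  by move=> s sab; apply: fc; move: sab; rewrite /= in_itv.
have i1 : intg P (fun x => \int[mu]_(s in `[a, b]) `|f (s, x)|).
  apply: (@intg_bnd _ _ _ _ _ (c * (b - a))).
    by apply: (@meas_Rint (fun z => `|f z|)) => //; exact: measurableT_comp.
  by move=> x; rewrite ger0_norm ?lec // (le_trans _ (le x)).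
have i2 : intg P (fun x => `|\int[mu]_(s in `[a, b]) f (s, x)|).
  apply: intg_le i1 => [|x]; last by rewrite normr_id.
  by apply: measurableT_comp => //; exact: meas_Rint.
split => //; apply: (le_trans (le_Ex i2 i1 le)).
rewrite -lee_fin ExE fineK; last exact: integrable_fin_num i1.
under eq_integral do rewrite -kE.
rewrite -fubini_tonelli2 // fubini_tonelli1 // mulrC.
have -> : ((m * (b - a))%:E = \int[mu]_(s in `[a, b]) m%:E)%E.
  by rewrite integral_cst // EFinM; congr (_ * _)%E; apply/esym; exact: lab.
rewrite [leRHS]integral_mkcond; apply: ge0_le_integral => //.
- by move=> s _; exact: integral_ge0.
- exact: measurable_fun_fubini_tonelli_F.
- by apply/measurable_restrict => //; exact: measurable_cst.
- move=> s _; rewrite /fubini_F /k /= patchE indicE; case: ifPn => sab; last first.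
    by under eq_integral do rewrite mule0; rewrite integral0.
  under eq_integral do rewrite mule1.
  have {}sab : a <= s <= b by move: sab; rewrite inE /= in_itv.
  have iS : intg P (fun x => `|f (s, x)|).
    apply: (@intg_bnd _ _ _ _ _ c) => [|x]; first exact: measurableT_comp.
    by rewrite normr_id; exact: fc.
  by have := fm s sab; rewrite ExE -lee_fin fineK //; exact: integrable_fin_num iS.
Qed.

End JointMeasurability.

(* [lra] would compare the integrands, in the goal and in the context, up to
   conversion. *)
Ltac gen_lra :=
  repeat match goal with |- context [Ex ?P ?f] => generalize (Ex P f) end;
  repeat match goal with H : is_true ?A |- _ =>
    match A with context [Ex ?P ?f] => clear H end end;
  intros; lra.

Section SquareNorm.
Context {R : realType} d (T : measurableType d) (P : probability T R).
Variable N : nat.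
Local Notation C := R[i].
Local Notation M := 'M[C]_N.

Lemma mxsubE (A B : M) i j : (A - B) i j = A i j - B i j.
Proof. by rewrite !mxE. Qed.

Lemma mxaddE (A B : M) i j : (A + B) i j = A i j + B i j.
Proof. by rewrite mxE. Qed.

Lemma mxscaleE (c : C) (A : M) i j : (c *: A) i j = c * A i j.
Proof. by rewrite mxE. Qed.

Lemma sqnorm_meas (A : T -> M) : (forall i j, cmeas (fun x => A x i j)) ->
  measurable_fun setT (fun x => sqnorm (A x)).
Proof.
move=> mA; under eq_fun do rewrite sqnormE.
apply: measurable_sum => i; apply: measurable_sum => j.
exact: cmeas_cabs2.
Qed.

Lemma sqnorm_L2 (A : T -> M) : (forall i j, cmeas (fun x => A x i j)) ->
  intg P (fun x => sqnorm (A x)) -> forall i j, cL2 P (fun x => A x i j).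
Proof.
move=> mA iA i j; split => //; apply: intg_le iA => [|x]; first exact: cmeas_cabs2.
by rewrite ger0_norm ?sqr_ge0 // entry_le_sqnorm.
Qed.

(* The sum is passed as a function, so that syntactically different instances of
   the addition of matrices never have to be compared. *)
Lemma sqnorm_intgD (A B D : T -> M) : (forall x, D x = A x + B x) ->
  (forall i j, cmeas (fun x => A x i j)) ->
  (forall i j, cmeas (fun x => B x i j)) ->
  intg P (fun x => sqnorm (A x)) -> intg P (fun x => sqnorm (B x)) ->
  intg P (fun x => sqnorm (D x)) /\
  Ex P (fun x => sqnorm (D x)) <= 2 * Ex P (fun x => sqnorm (A x)) + 2 * Ex P (fun x => sqnorm (B x)).
Proof.
move=> DE mA mB iA iB; have -> : D = (fun x => A x + B x) by apply/funext.
have i2 : intg P (fun x => 2 * sqnorm (A x) + 2 * sqnorm (B x)) by apply: intgD; exact: intgZ.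
have iAB : intg P (fun x => sqnorm (A x + B x)).
  apply: intg_le i2 => [|x]; last by rewrite ger0_norm ?sqnorm_ge0 // sqnormD.
  by apply: sqnorm_meas => i j; under eq_fun do rewrite mxE; exact: cmeasD.
split => //; rewrite -!ExZ // -ExD; [|exact: intgZ..].
by apply: le_Ex => // x; exact: sqnormD.
Qed.

Lemma sqnorm_intgB (A B D : T -> M) : (forall x, D x = A x - B x) ->
  (forall i j, cmeas (fun x => A x i j)) ->
  (forall i j, cmeas (fun x => B x i j)) ->
  intg P (fun x => sqnorm (A x)) -> intg P (fun x => sqnorm (B x)) ->
  intg P (fun x => sqnorm (D x)) /\
  Ex P (fun x => sqnorm (D x)) <= 2 * Ex P (fun x => sqnorm (A x)) + 2 * Ex P (fun x => sqnorm (B x)).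
Proof.
move=> DE mA mB iA iB.
have EN : (fun x => sqnorm (- B x)) = (fun x => sqnorm (B x)) by apply/funext => x; rewrite sqnormN.
rewrite -EN; rewrite -EN in iB; apply: sqnorm_intgD => // i j.
by under eq_fun do rewrite mxE; exact: cmeasN.
Qed.

Lemma sqnorm_le_entries (A : M) c : (forall i j, cabs (A i j) <= c) -> sqnorm A <= (N * N)%:R * c ^+ 2.
Proof.
move=> Ac; rewrite sqnormE; apply: (@le_trans _ _ (\sum_(i < N) \sum_(j < N) c ^+ 2)).
  apply: ler_sum => i _; apply: ler_sum => j _.
  by rewrite ler_pXn2r ?nnegrE // (le_trans _ (Ac i j)).
by rewrite !sumr_const !card_ord -mulrnA mulr_natl.
Qed.

End SquareNorm.

(** * Increments of the unitary Brownian motion *)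

Section ItoSolution.
Context {R : realType} d (T : measurableType d) (P : probability T R).
Variable N : nat.
Hypothesis N0 : (0 < N)%N.
Local Notation C := R[i].
Local Notation M := 'M[C]_N.
Local Notation mu := (@lebesgue_measure R).
Variables (F : R -> set (set T)) (K U : R -> T -> M).
Hypothesis flt : filtration F.
Hypothesis bm : uN_brownian P F K.
Hypothesis adU : adapted F U.
Hypothesis unU : forall s x, 0 <= s -> U s x \is unitarymx.
Hypothesis cU : continuous_paths U.
Hypothesis itoU : forall t, 0 <= t ->
  exists2 I : T -> M, is_ito_integral P F K t U I &
    {ae P, forall x, U t x = 1%:M + I x - 2^-1 *: time_integral U t x}.

Lemma U_Fmeas s i j : 0 <= s -> Fmeas F s (fun x => U s x i j).
Proof. by move=> s0; exact: adapted_Fmeas. Qed.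

Lemma U_meas s i j : 0 <= s -> cmeas (fun x => U s x i j).
Proof. by move=> s0; apply: (Fmeas_meas flt s0); exact: U_Fmeas. Qed.

Lemma U_le1 s x i j : 0 <= s -> cabs (U s x i j) <= 1.
Proof. by move=> s0; apply: unitary_entry; exact: unU. Qed.

Lemma U_joint i j : cmeas (fun z : R * T => U (clamp z.1) z.2 i j).
Proof.
split.
  apply: (@meas_process R d T (fun s x => complex.Re (U s x i j))) => [s s0|x].
    by have [] := U_meas i j s0.
  by have [] := cU x i j.
apply: (@meas_process R d T (fun s x => complex.Im (U s x i j))) => [s s0|x].
  by have [] := U_meas i j s0.
by have [] := cU x i j.
Qed.

Definition intU a b x : M := \matrix_(i, j)
  ((\int[mu]_(s in `[a, b]) complex.Re (U s x i j)) +i*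
   (\int[mu]_(s in `[a, b]) complex.Im (U s x i j))).

Lemma clamp_Rint a b (f : R -> R) : 0 <= a ->
  \int[mu]_(s in `[a, b]) f s = \int[mu]_(s in `[a, b]) f (clamp s).
Proof.
move=> a0; apply: eq_Rintegral => s; rewrite inE /= in_itv => /andP[sa _].
by rewrite clamp_id // (le_trans a0).
Qed.

Lemma intU_meas a b i j : 0 <= a -> cmeas (fun x => intU a b x i j).
Proof.
move=> a0; under eq_fun do rewrite mxE; have [h1 h2] := U_joint i j; split => /=.
  under eq_fun do rewrite clamp_Rint //; exact: meas_Rint h1.
under eq_fun do rewrite clamp_Rint //; exact: meas_Rint h2.
Qed.

Lemma U_integrable a b x i j : 0 <= a ->
  mu.-integrable `[a, b] (EFin \o (fun s => complex.Re (U s x i j))) /\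
  mu.-integrable `[a, b] (EFin \o (fun s => complex.Im (U s x i j))).
Proof.
move=> a0; have [h1 h2] := U_joint i j; split.
  apply: (@eq_integrable _ _ _ mu `[a, b] _ (EFin \o (fun s => complex.Re (U (clamp s) x i j)))) => //.
    move=> s; rewrite inE /= in_itv => /andP[sa _].
    by rewrite clamp_id // (le_trans a0).
  apply: (@bounded_itv_integrable _ _ _ _ 1); first exact: (measurableT_comp h1 (measurable_pair2 x)).
  by move=> s _; rewrite (le_trans (ler_Re_cabs _)) // U_le1 // clamp_ge0.
apply: (@eq_integrable _ _ _ mu `[a, b] _ (EFin \o (fun s => complex.Im (U (clamp s) x i j)))) => //.
  move=> s; rewrite inE /= in_itv => /andP[sa _].
  by rewrite clamp_id // (le_trans a0).
apply: (@bounded_itv_integrable _ _ _ _ 1); first exact: (measurableT_comp h2 (measurable_pair2 x)).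
by move=> s _; rewrite (le_trans (ler_Im_cabs _)) // U_le1 // clamp_ge0.
Qed.

Lemma time_integralB a b x : 0 <= a -> a <= b ->
  time_integral U b x - time_integral U a x = intU a b x.
Proof.
move=> a0 ab; apply/matrixP => i j; rewrite !mxE.
have [h1 h2] := @U_integrable 0 b x i j (lexx _).
have i1 : mu.-integrable `]a, b] (EFin \o (fun s => complex.Re (U s x i j))).
  by apply: integrableS h1 => //; apply: subset_itvr; rewrite bnd_simp.
have i2 : mu.-integrable `]a, b] (EFin \o (fun s => complex.Im (U s x i j))).
  by apply: integrableS h2 => //; apply: subset_itvr; rewrite bnd_simp.
apply: complex_ext; rewrite ?ReB ?ImB /=.
  by rewrite Rintegral_itvB ?bnd_simp // Rintegral_itv_obnd_cbnd.
by rewrite Rintegral_itvB ?bnd_simp // Rintegral_itv_obnd_cbnd.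
Qed.

Lemma itv_measure (a b : R) : a <= b -> mu (`[a, b]%classic : set R) = (b - a)%:E.
Proof.
move=> ab; rewrite lebesgue_measure_itv /= lte_fin; case: ifPn => [_|]; first by rewrite EFinB.
by rewrite -leNgt => ba; congr EFin; apply/eqP; rewrite eq_sym subr_eq0 eq_le ab ba.
Qed.

Lemma intU_le a b x i j : 0 <= a -> a <= b -> cabs (intU a b x i j) <= 2 * (b - a).
Proof.
move=> a0 ab; rewrite mxE (le_trans (ler_cabs_ReIm _)) //= [leRHS]mulrDl mul1r.
have c1 : \int[mu]_(s in `[a, b]) (cst (1 : R) s) = b - a.
  by rewrite Rintegral_cst // mul1r; exact: (congr1 fine (itv_measure ab)).
have i1 : mu.-integrable `[a, b] (EFin \o cst (1 : R)).
  by apply: (@bounded_itv_integrable _ _ _ _ 1) => // s _; rewrite normr1.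
have ab0 s : `[a, b]%classic s -> 0 <= s by rewrite /= in_itv /= => /andP[+ _]; exact: le_trans.
have [h1 h2] := @U_integrable a b x i j a0.
apply: lerD; rewrite -c1.
  apply: (le_trans (le_normr_Rintegral _ h1)) => //; apply: le_Rintegral => //.
    exact: integrable_norm.
  by move=> s /ab0 s0; rewrite (le_trans (ler_Re_cabs _)) // U_le1.
apply: (le_trans (le_normr_Rintegral _ h2)) => //; apply: le_Rintegral => //.
  exact: integrable_norm.
by move=> s /ab0 s0; rewrite (le_trans (ler_Im_cabs _)) // U_le1.
Qed.

(** The stochastic integral solved for in the equation. It agrees almost surely with the given
    version [I], but is measurable and square integrable by construction from [U]. *)
Definition Ipart t x : M := U t x - 1%:M + 2^-1 *: time_integral U t x.

Lemma IpartE t x i j :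
  Ipart t x i j = U t x i j - (i == j)%:R + 2^-1 * time_integral U t x i j.
Proof. by rewrite !mxE. Qed.

Lemma Ipart_meas t i j : 0 <= t -> cmeas (fun x => Ipart t x i j).
Proof.
move=> t0; under eq_fun do rewrite IpartE.
apply: cmeasD; first by apply: cmeasB; [exact: U_meas|exact: cmeas_cst].
by apply: cmeasM; [exact: cmeas_cst|exact: (@intU_meas 0 t)].
Qed.

Lemma Ipart_L2 t : 0 <= t -> intg P (fun x => sqnorm (Ipart t x)).
Proof.
move=> t0; apply: (@intg_bnd _ _ _ _ _ ((N * N)%:R * (1 + cabs 1 + cabs 2^-1 * (2 * t)) ^+ 2)).
  by apply: sqnorm_meas => i j; exact: Ipart_meas.
move=> x; rewrite ger0_norm ?sqnorm_ge0 //; apply: sqnorm_le_entries => i j.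
rewrite IpartE.
apply: (le_trans (ler_cabsD _ _)); apply: lerD.
  apply: (le_trans (ler_cabsB _ _)); apply: lerD; first exact: U_le1.
  by case: (i == j); rewrite ?cabs1 // cabs0.
rewrite cabsM ler_wpM2l //; have := @intU_le 0 t x i j (lexx _) t0.
by rewrite subr0.
Qed.

Section Cells.
Variables (I : finType) (l : I -> @cell R d T N).
Hypothesis Gl : forall k, good_cell F (l k).

Lemma cell_val_meas k i j : cmeas (fun x => (l k).2 x i j).
Proof. by have [a0 _ FA _] := Gl k; exact: (Fmeas_meas flt a0). Qed.

Lemma cells_eval_joint i j : cmeas (fun z : R * T => cells_eval l z.1 z.2 i j).
Proof.
under eq_fun do rewrite summxE.
apply: cmeas_sum => k _.
have -> : (fun z : R * T => (if (l k).1.1 < z.1 <= (l k).1.2 then (l k).2 z.2 else 0) i j) =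
   (fun z => (\1_(`](l k).1.1, (l k).1.2]%classic : set R) z.1)%:C * (l k).2 z.2 i j).
  apply/funext => z; rewrite indicE mem_setE in_itv /=; case: ifP => _ /=; rewrite ?mul1r //.
  by rewrite mul0r mxE.
apply: cmeasM.
  split => /=; last exact: measurable_cst.
  by apply: meas_indic_fst.
have [h1 h2] := cell_val_meas k i j.
by split; [exact: (measurableT_comp h1 measurable_snd)|exact: (measurableT_comp h2 measurable_snd)].
Qed.

Lemma cells_eval_meas s i j : cmeas (fun x => cells_eval l s x i j).
Proof.
have [h1 h2] := cells_eval_joint i j.
by split; [exact: (measurableT_comp h1 (measurable_pair1 s))|
  exact: (measurableT_comp h2 (measurable_pair1 s))].
Qed.

Lemma cells_integral_meas i j : cmeas (fun x => cells_integral K l x i j).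
Proof.
under eq_fun do rewrite summxE.
apply: cmeas_sum => k _; under eq_fun do rewrite mxE; apply: cmeas_sum => n _.
apply: cmeasM; first exact: cell_val_meas.
by have [a0 ab _ _] := Gl k; exact: (dK_meas flt bm).
Qed.

Definition cerr s := Ex P (fun x => sqnorm (cells_eval l s x - U (clamp s) x)).

Lemma U_L2 s : 0 <= s -> intg P (fun x => sqnorm (U s x)) /\ Ex P (fun x => sqnorm (U s x)) = N%:R.
Proof.
move=> s0; have -> : (fun x => sqnorm (U s x)) = fun=> N%:R.
  by apply/funext => x; apply: unitary_sqnorm; exact: unU.
by split; [exact: intg_cst|exact: Ex_cst].
Qed.

Lemma cerr_intg s : intg P (fun x => sqnorm (cells_eval l s x - U (clamp s) x)).
Proof.
have [_ iL _ _] := cells_isometry N0 flt bm Gl.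
have [iU _] := U_L2 (clamp_ge0 s).
apply: (sqnorm_intgB (fun=> erefl) _ _ (iL s) iU).1 => i j; first exact: cells_eval_meas.
apply: U_meas; exact: clamp_ge0.
Qed.

Lemma cerr_ge0 s : 0 <= cerr s.
Proof. by apply: Ex_ge0 => x; exact: sqnorm_ge0. Qed.

Lemma cerr_meas : measurable_fun setT cerr.
Proof.
rewrite /cerr; under eq_fun do rewrite ExE.
apply: (measurableT_comp (f := fine)) => //.
pose k (z : R * T) := (sqnorm (cells_eval l z.1 z.2 - U (clamp z.1) z.2))%:E.
apply: (@measurable_fun_fubini_tonelli_F _ _ _ _ _ P k) => [|z].
  apply/measurable_EFinP; apply: (@sqnorm_meas R _ (R * T)%type N) => i j.
  under eq_fun do rewrite mxsubE; apply: cmeasB; first exact: cells_eval_joint.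
  exact: U_joint.
by rewrite lee_fin sqnorm_ge0.
Qed.

(** The isometry for a family living on []p, q]]. The pointwise mean square is allowed two parts:
    [psi], small only after integration (approximation error), and the uniform [m]. *)
Lemma cells_integral_le (p q : R) (psi : R -> R) (m e : R) : p <= q ->
  measurable_fun setT psi -> (forall s, 0 <= psi s) -> 0 <= m ->
  (\int[mu]_(s in `]p, q]) (psi s)%:E <= e%:E)%E ->
  (forall s, p < s <= q -> Ex P (fun x => sqnorm (cells_eval l s x)) <= psi s + m) ->
  (forall s x, ~~ (p < s <= q) -> cells_eval l s x = 0) ->
  Ex P (fun x => sqnorm (cells_integral K l x)) <= e + m * (q - p).
Proof.
move=> pq mpsi psi0 m0 pe H H0; have [_ iL mL E] := cells_isometry N0 flt bm Gl.
rewrite -lee_fin -E.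
have -> : (\int[mu]_s (Ex P (fun x => sqnorm (cells_eval l s x)))%:E =
    \int[mu]_(s in `]p, q]) (Ex P (fun x => sqnorm (cells_eval l s x)))%:E)%E.
  rewrite [RHS]integral_mkcond; apply: eq_integral => s _; rewrite patchE mem_setE in_itv /=.
  case: ifPn => // ns; congr EFin.
  rewrite -[RHS](Ex_cst P); apply: eq_Ex => x; rewrite H0 // sqnormE big1 // => i _.
  by rewrite big1 // => j _; rewrite mxE cabs0 expr0n.
apply: (@le_trans _ _ (\int[mu]_(s in `]p, q]) ((psi s)%:E + m%:E))%E).
  have h1 s : `]p, q]%classic s -> (0 <= (Ex P (fun x => sqnorm (cells_eval l s x)))%:E)%E.
    by move=> _; rewrite lee_fin Ex_ge0 // => x; exact: sqnorm_ge0.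
  have h2 : measurable_fun (`]p, q]%classic : set R)
      (fun s => (Ex P (fun x => sqnorm (cells_eval l s x)))%:E).
    by apply/measurable_EFinP; exact: measurable_funTS mL.
  have h3 : measurable_fun (`]p, q]%classic : set R) (fun s => (psi s)%:E + m%:E)%E.
    by apply: emeasurable_funD => //; apply/measurable_EFinP; exact: measurable_funTS.
  have mD : measurable (`]p, q]%classic : set R) by exact: measurable_itv.
  apply: (@ge0_le_integral _ _ _ mu _ mD _ _ h1 h2 h3) => s.
  by rewrite /= in_itv /= => ps; rewrite lee_fin H.
rewrite ge0_integralD //; last 2 first.
- by move=> s _; rewrite lee_fin.
- by apply/measurable_EFinP; exact: measurable_funTS.
rewrite EFinD EFinM; apply: leeD => //.
rewrite integral_cst // le_eqVlt; apply/orP; left; apply/eqP; congr (_ * _)%E.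
transitivity (mu (`]p, q]%classic : set R)) => //.
rewrite lebesgue_measure_itv /= lte_fin; case: ifPn => [_|]; first by rewrite EFinB.
by rewrite -leNgt => ba; congr EFin; apply/eqP; rewrite eq_sym subr_eq0 eq_le pq ba.
Qed.

End Cells.

Lemma intg_expectation (X : T -> R) : intg P X -> 'E_P[X]%E = (Ex P X)%:E.
Proof. by move=> iX; rewrite /Ex fineK // unlock; exact: integrable_fin_num. Qed.

Lemma cvg0_le (f : nat -> \bar R) (e : R) : 0 < e -> f n @[n --> \oo] --> 0%E ->
  \forall n \near \oo, (f n <= e%:E)%E.
Proof.
move=> e0 /fine_cvgP[fin /cvgrPdist_lt/(_ e e0) H]; near=> n.
have fn : f n \is a fin_num by near: n.
rewrite -(fineK fn) lee_fin (le_trans (ler_norm _)) // -normrN -sub0r ltW //.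
by near: n.
Unshelve. all: by end_near.
Qed.

(** Puts the definition of the integral in terms of cells, with errors that are finite real numbers
    and with [Ipart] in place of [I]. *)
Lemma ito_approx t e : 0 <= t -> 0 < e -> exists n (l : 'I_n -> @cell R d T N),
  [/\ forall k, good_cell F (l k), forall k, (l k).1.2 <= t,
      (\int[mu]_(s in `[0%R, t]) (cerr l s)%:E <= e%:E)%E &
      Ex P (fun x => sqnorm (cells_integral K l x - Ipart t x)) <= e].
Proof.
move=> t0 e0; have [I [S [adS c1 c2]] aeI] := itoU t0.
have [n1 _ H1] := cvg0_le e0 c1; have [n2 _ H2] := cvg0_le e0 c2.
pose n := maxn n1 n2; have h1 := H1 n (leq_maxl _ _); have h2 := H2 n (leq_maxr _ _).
have [st0 stm stF [c stc]] := adS n.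
pose l (k : 'I_(step_size (S n))) : @cell R d T N :=
  (step_time (S n) k, step_time (S n) k.+1, step_val (S n) k).
have Gl k : good_cell F (l k).
  have /andP[a0 _] := st0 k (ltnW (ltn_ord k)).
  split => //=; first exact: stm.
    move=> i j; apply: (@sigma_of_cmeas _ _ _ (entries (step_val (S n) k))).
      by rewrite (F_id flt a0); exact: stF.
    by exists i, j.
  exists (Num.sqrt `|c|) => i j x; rewrite -(ger0_norm (cabs_ge0 _)) -sqrtr_sqr ler_wsqrtr //.
  apply: (le_trans (entry_le_sqnorm _ _ _)); apply: (le_trans (stc _ _ (ltn_ord k))).
  exact: ler_norm.
exists (step_size (S n)), l; split => //.
- by move=> k; have /andP[] := st0 k.+1 (ltn_ord k).
- rewrite (le_trans _ h1) // le_eqVlt; apply/orP; left; apply/eqP.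
  apply: eq_integral => s; rewrite inE /= in_itv /= => /andP[s0 _].
  have := cerr_intg Gl s; rewrite /cerr clamp_id // => iS.
  by rewrite -intg_expectation.
- rewrite -lee_fin -intg_expectation; last first.
    have [iL _ _ _] := cells_isometry N0 flt bm Gl.
    apply: (sqnorm_intgB (fun=> erefl) _ _ iL (Ipart_L2 t0)).1 => i j; first exact: cells_integral_meas.
    exact: Ipart_meas.
  (* The bound available is for [I], whose measurability is unknown; hence the one-sided comparison
     of integrals. *)
  rewrite (le_trans _ h2) // unlock; apply: lower_integral_ae => //.
  + apply/measurable_EFinP; apply: sqnorm_meas => i j.
    under eq_fun do rewrite mxsubE; apply: cmeasB; first exact: cells_integral_meas.
    exact: Ipart_meas.
  + by move=> x; rewrite lee_fin sqnorm_ge0.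
  + by move=> x; rewrite lee_fin sqnorm_ge0.
  + apply: filterS aeI => x E.
    by have -> : Ipart t x = I x by rewrite /Ipart E; apply/matrixP => i j; rewrite !mxE; ring.
Qed.

Definition Jn a b x : M := Ipart b x - Ipart a x.

Lemma Jn_meas a b i j : 0 <= a -> a <= b -> cmeas (fun x => Jn a b x i j).
Proof.
move=> a0 ab; under eq_fun do rewrite mxsubE.
by apply: cmeasB; apply: Ipart_meas => //; exact: le_trans ab.
Qed.

(** Intersection with []a, +oo[]: a cell ending before [a] degenerates to the empty interval []a,
    a]], which keeps the family indexed as before. *)
Definition restrict_cell a (c : @cell R d T N) : @cell R d T N :=
  (Num.max a c.1.1, Num.max a c.1.2, c.2).

Definition opp_cell (c : @cell R d T N) : @cell R d T N := (c.1, fun x => - c.2 x).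

Lemma restrict_good a c : 0 <= a -> good_cell F c -> good_cell F (restrict_cell a c).
Proof.
case: c => [[p q] A] a0 [/= p0 pq FA bA]; split => //=.
- by rewrite le_max a0.
- by rewrite ge_max !le_max lexx pq orbT.
- by move=> i j; apply: (Fmeas_mono flt p0 _ (FA i j)); rewrite le_max lexx orbT.
Qed.

Lemma opp_good c : good_cell F c -> good_cell F (opp_cell c).
Proof.
case: c => [[p q] A] [/= p0 pq FA [m bA]]; split => //=.
  by move=> i j; under eq_fun do rewrite mxE; apply: cmeasN; exact: FA.
by exists m => i j x; rewrite mxE cabsN.
Qed.

Lemma restrict_eval (I : finType) (l : I -> @cell R d T N) a s x :
  cells_eval (fun k => restrict_cell a (l k)) s x = if a < s then cells_eval l s x else 0.
Proof.
rewrite /cells_eval /restrict_cell /=; case: ltP => h.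
  apply: eq_bigr => k _; rewrite gt_max h le_max (leNgt s a) h /=.
  by [].
by rewrite big1 // => k _; rewrite gt_max (ltNge a) h.
Qed.

Lemma opp_eval (I : finType) (l : I -> @cell R d T N) s x :
  cells_eval (fun k => opp_cell (l k)) s x = - cells_eval l s x.
Proof.
rewrite /cells_eval -sumrN; apply: eq_bigr => k _ /=.
by case: ifP; rewrite ?oppr0.
Qed.

Lemma opp_integral (I : finType) (l : I -> @cell R d T N) x :
  cells_integral K (fun k => opp_cell (l k)) x = - cells_integral K l x.
Proof.
by rewrite /cells_integral -sumrN; apply: eq_bigr => k _ /=; rewrite mulNmx.
Qed.

Definition sum_cells (I J : finType) (l : I -> @cell R d T N) (l' : J -> @cell R d T N)
  (k : I + J) : @cell R d T N := match k with inl k => l k | inr k => l' k end.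

Lemma sum_eval (I J : finType) (l : I -> @cell R d T N) (l' : J -> @cell R d T N) s x :
  cells_eval (sum_cells l l') s x = cells_eval l s x + cells_eval l' s x.
Proof. by rewrite /cells_eval big_sumType. Qed.

Lemma sum_integral (I J : finType) (l : I -> @cell R d T N) (l' : J -> @cell R d T N) x :
  cells_integral K (sum_cells l l') x = cells_integral K l x + cells_integral K l' x.
Proof. by rewrite /cells_integral big_sumType. Qed.

Lemma eval_off (I : finType) (l : I -> @cell R d T N) p q s x :
  (forall k, p <= (l k).1.1) -> (forall k, (l k).1.2 <= q) -> ~~ (p < s <= q) ->
  cells_eval l s x = 0.
Proof.
move=> hp hq ns; rewrite /cells_eval big1 // => k _; case: ifP => // /andP[h1 h2].
by case/negP: ns; rewrite (le_lt_trans (hp k) h1) (le_trans h2).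
Qed.

Lemma cerr_sub (I : finType) (l : I -> @cell R d T N) p q a b :
  (forall k, good_cell F (l k)) -> a <= p -> q <= b ->
  (\int[mu]_(s in `]p, q]) (cerr l s)%:E <= \int[mu]_(s in `[a, b]) (cerr l s)%:E)%E.
Proof.
move=> Gl ap qb; apply: ge0_subset_integral => //.
- by apply/measurable_EFinP; apply: measurable_funTS; exact: cerr_meas.
- by move=> s _; rewrite lee_fin cerr_ge0.
- by apply: subset_itv; rewrite bnd_simp.
Qed.

(** Approximants up to [b] and up to [a] are unrelated, so their difference need not live on []a,
    b]]. Restricting the first one to that interval changes the difference by an integral over []0,
    a]] of two processes both close to [U], hence small by the isometry. *)
Lemma ito_increment a b e : 0 <= a -> a <= b -> 0 < e ->
  exists n (l : 'I_n -> @cell R d T N),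
  [/\ forall k, good_cell F (l k), forall k, a <= (l k).1.1, forall k, (l k).1.2 <= b,
      (\int[mu]_(s in `]a, b]) (cerr l s)%:E <= e%:E)%E &
      intg P (fun x => sqnorm (Jn a b x - cells_integral K l x)) /\
      Ex P (fun x => sqnorm (Jn a b x - cells_integral K l x)) <= 16 * e].
Proof.
move=> a0 ab e0; have b0 := le_trans a0 ab.
have [n [l [Gl lb el il]]] := ito_approx b0 e0.
have [m [l' [Gl' lb' el' il']]] := ito_approx a0 e0.
pose r k := restrict_cell a (l k).
have Gr k : good_cell F (r k) by exact: restrict_good.
have lo k : 0 <= (l k).1.1 by have [] := Gl k.
have lo' k : 0 <= (l' k).1.1 by have [] := Gl' k.
exists n, r; split; first exact: Gr.
- by move=> k; rewrite /r /= le_max lexx.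
- by move=> k; rewrite /r /= ge_max ab lb.
- apply: le_trans el; apply: le_trans (cerr_sub Gl a0 (lexx b)).
  rewrite le_eqVlt; apply/orP; left; apply/eqP; apply: eq_integral => s.
  rewrite inE /= in_itv /= => /andP[as_ _]; congr EFin.
  by apply: eq_Ex => x; rewrite restrict_eval as_.
(* This family vanishes off []0, a]], where it equals the difference of the two approximants. Both
   [h] and the two errors contribute [4 * e], doubled when added: 16 in total. *)
pose h := sum_cells (sum_cells l (fun k => opp_cell (l' k))) (fun k => opp_cell (r k)).
have Gh k : good_cell F (h k).
  by case: k => [[k|k]|k] /=; [exact: Gl|apply: opp_good; exact: Gl'|apply: opp_good; exact: Gr].
have hE s x : cells_eval h s x = cells_eval l s x - cells_eval l' s x - cells_eval r s x.
  by rewrite /h !sum_eval !opp_eval.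
have hI x : cells_integral K h x = cells_integral K l x - cells_integral K l' x - cells_integral K r x.
  by rewrite /h !sum_integral !opp_integral.
have Eh : Ex P (fun x => sqnorm (cells_integral K h x)) <= 4 * e + 0 * (a - 0).
  apply: (@cells_integral_le _ h Gh 0 a (fun s => 2 * cerr l s + 2 * cerr l' s) 0 (4 * e)) => //.
  - by apply: measurable_funD; apply: measurable_funM => //; exact: cerr_meas.
  - by move=> s; rewrite addr_ge0 // mulr_ge0 // cerr_ge0.
  - under eq_integral do rewrite EFinD !EFinM.
    have mc (J : finType) (c : J -> @cell R d T N) : (forall k, good_cell F (c k)) ->
        measurable_fun `]0, a] (fun s => (cerr c s)%:E).
      by move=> Gc; apply/measurable_EFinP; apply: measurable_funTS; exact: cerr_meas.
    have m2 (J : finType) (c : J -> @cell R d T N) : (forall k, good_cell F (c k)) ->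
        measurable_fun `]0, a] (fun s => 2%:E * (cerr c s)%:E)%E.
      by move=> Gc; apply: emeasurable_funM => //; exact: mc.
    rewrite ge0_integralD //; last 4 first.
    + by move=> s _; rewrite mule_ge0 // lee_fin cerr_ge0.
    + exact: m2.
    + by move=> s _; rewrite mule_ge0 // lee_fin cerr_ge0.
    + exact: m2.
    rewrite !ge0_integralZl_EFin //; last 4 first.
    + by move=> s _; rewrite lee_fin cerr_ge0.
    + exact: mc.
    + by move=> s _; rewrite lee_fin cerr_ge0.
    + exact: mc.
    have -> : ((4 * e)%:E = 2%:E * e%:E + 2%:E * e%:E)%E.
      by rewrite -EFinM -EFinD; congr EFin; ring.
    apply: leeD; (apply: lee_wpmul2l; first by rewrite lee_fin).
      by apply: le_trans el; exact: cerr_sub.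
    by apply: le_trans el'; exact: cerr_sub.
  - move=> s /andP[s0 sa]; rewrite addr0.
    have HE x : cells_eval h s x = (cells_eval l s x - U (clamp s) x) +
        - (cells_eval l' s x - U (clamp s) x).
      rewrite hE restrict_eval ltNge sa /= subr0.
      by apply/matrixP => i j; rewrite !mxE; ring.
    have mm (J : finType) (c : J -> @cell R d T N) : (forall k, good_cell F (c k)) ->
        forall i j, cmeas (fun x => (cells_eval c s x - U (clamp s) x) i j).
      move=> Gc i j; under eq_fun do rewrite mxsubE; apply: cmeasB.
        exact: cells_eval_meas.
      by apply: U_meas; exact: clamp_ge0.
    have HE' x : cells_eval h s x = (cells_eval l s x - U (clamp s) x) -
        (cells_eval l' s x - U (clamp s) x) by rewrite HE.
    by have [_] := sqnorm_intgB HE' (mm _ _ Gl) (mm _ _ Gl') (cerr_intg Gl s) (cerr_intg Gl' s).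
  - move=> s x ns; rewrite hE restrict_eval; case: ltP => as_.
      by rewrite (@eval_off _ l' 0 a s x) // subr0 subrr.
    have s0 : s <= 0 by rewrite leNgt; apply/negP => s0; case/negP: ns; rewrite s0 as_.
    rewrite (@eval_off _ l' 0 a s x) // (@eval_off _ l 0 b s x) ?subr0 //.
    by rewrite negb_and -leNgt s0.
have [iH _ _ _] := cells_isometry N0 flt bm Gh.
have ci (J : finType) (c : J -> @cell R d T N) t (D : T -> M) : (forall k, good_cell F (c k)) ->
    0 <= t -> (forall x, D x = cells_integral K c x - Ipart t x) ->
    (forall i j, cmeas (fun x => D x i j)) /\ intg P (fun x => sqnorm (D x)).
  move=> Gc t0 DE; have [iL _ _ _] := cells_isometry N0 flt bm Gc; split.
    move=> i j; under eq_fun do rewrite DE mxsubE; apply: cmeasB; last exact: Ipart_meas.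
    exact: cells_integral_meas.
  apply: (sqnorm_intgB DE _ _ iL (Ipart_L2 t0)).1 => i j; first exact: cells_integral_meas.
  exact: Ipart_meas.
pose X x : M := cells_integral K l x - Ipart b x.
pose Y x : M := cells_integral K l' x - Ipart a x.
pose Z x : M := Y x - X x.
have [m1 i1] := @ci _ l b X Gl b0 (fun=> erefl).
have [m2 i2] := @ci _ l' a Y Gl' a0 (fun=> erefl).
have [i3 E3] := sqnorm_intgB (A := Y) (B := X) (D := Z) (fun=> erefl) m2 m1 i2 i1.
have m3 i j : cmeas (fun x => Z x i j).
  by under eq_fun do rewrite mxsubE; apply: cmeasB; [exact: m2|exact: m1].
have HE x : Jn a b x - cells_integral K r x = Z x + cells_integral K h x.
  rewrite hI /Z /X /Y /Jn; move: (Ipart b x) (Ipart a x) (cells_integral K l x) (cells_integral K l' x).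
  move: (cells_integral K r x) => A1 A2 A3 A4 A5.
  by apply/matrixP => i j; rewrite !mxE; ring.
have [i4 E4] := sqnorm_intgD HE m3 (fun i j => cells_integral_meas Gh i j) i3 iH.
split => //.
have ilX : Ex P (fun x => sqnorm (X x)) <= e := il.
have ilY : Ex P (fun x => sqnorm (Y x)) <= e := il'.
by apply: (le_trans E4); move: E3 Eh ilX ilY; gen_lra.
Qed.

Let J := Jn.

Lemma J_meas a b i j : 0 <= a -> a <= b -> cmeas (fun x => J a b x i j).
Proof. by move=> a0 ab; exact: (Jn_meas i j a0 ab). Qed.

Lemma J_intg a b : 0 <= a -> a <= b -> intg P (fun x => sqnorm (J a b x)).
Proof.
move=> a0 ab; have b0 := le_trans a0 ab.
by apply: (sqnorm_intgB (fun=> erefl) _ _ (Ipart_L2 b0) (Ipart_L2 a0)).1 => i j; exact: Ipart_meas.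
Qed.

Section Approximant.
Variables (a b e : R) (n : nat) (l : 'I_n -> @cell R d T N).
Hypotheses (a0 : 0 <= a) (ab : a <= b) (e0 : 0 < e).
Hypothesis Gl : forall k, good_cell F (l k).
Hypothesis la : forall k, a <= (l k).1.1.
Hypothesis lb : forall k, (l k).1.2 <= b.
Hypothesis le : (\int[mu]_(s in `]a, b]) (cerr l s)%:E <= e%:E)%E.

Lemma approx_psi : (\int[mu]_(s in `]a, b]) (2 * cerr l s)%:E <= (2 * e)%:E)%E.
Proof.
under eq_integral do rewrite EFinM.
rewrite ge0_integralZl_EFin //; last 2 first.
- by move=> s _; rewrite lee_fin cerr_ge0.
- apply/measurable_EFinP; apply: measurable_funTS.
  by apply: (cerr_meas Gl).
by rewrite EFinM; apply: lee_wpmul2l; rewrite ?lee_fin.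
Qed.

Lemma approx_psi_meas : measurable_fun setT (fun s => 2 * cerr l s).
Proof. by apply: measurable_funM => //; exact: (cerr_meas Gl). Qed.

Lemma approx_psi_ge0 s : 0 <= 2 * cerr l s.
Proof. by rewrite mulr_ge0 // cerr_ge0. Qed.

Lemma approx_dist s (A : T -> M) : (forall i j, cmeas (fun x => A x i j)) ->
  intg P (fun x => sqnorm (U (clamp s) x - A x)) ->
  Ex P (fun x => sqnorm (cells_eval l s x - A x)) <=
    2 * cerr l s + 2 * Ex P (fun x => sqnorm (U (clamp s) x - A x)).
Proof.
move=> mA iA; have iL := cerr_intg Gl s.
have mUA i j : cmeas (fun x => (U (clamp s) x - A x) i j).
  by under eq_fun do rewrite mxsubE; apply: cmeasB => //; apply: U_meas; exact: clamp_ge0.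
have mL i j : cmeas (fun x => (cells_eval l s x - U (clamp s) x) i j).
  under eq_fun do rewrite mxsubE; apply: cmeasB; first exact: (cells_eval_meas Gl).
  by apply: U_meas; exact: clamp_ge0.
have HE x : cells_eval l s x - A x = (cells_eval l s x - U (clamp s) x) + (U (clamp s) x - A x).
  by move: (cells_eval l s x) (U (clamp s) x) (A x) => A1 A2 A3; apply/matrixP => i j; rewrite !mxE; ring.
by have [_] := sqnorm_intgD HE mL mUA iL iA.
Qed.

Lemma approx_sq : Ex P (fun x => sqnorm (cells_integral K l x)) <= 2 * e + 2 * N%:R * (b - a).
Proof.
apply: (cells_integral_le Gl ab approx_psi_meas approx_psi_ge0) approx_psi _ _.
- exact: mulr_ge0.
- move=> s _; have [iU EU] := U_L2 (clamp_ge0 s).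
  rewrite -EU; have := @approx_dist s (fun=> 0).
  under eq_fun do rewrite subr0; under [X in _ -> _ -> X <= _]eq_Ex do rewrite subr0.
  by apply => // i j; under eq_fun do rewrite mxE; exact: cmeas_cst.
- by move=> s x ns; apply: (eval_off x la lb).
Qed.

End Approximant.

Lemma J_sq a b : 0 <= a -> a <= b -> Ex P (fun x => sqnorm (J a b x)) <= 4 * N%:R * (b - a).
Proof.
move=> a0 ab; apply/ler_addgt0Pr => e e0.
(* Twice the error [16 * e1] of [ito_increment] plus twice the [2 * e1] of [approx_sq] makes 36. *)
have e1 : 0 < e / 36 by rewrite divr_gt0.
have [n [l [Gl la lb le [iJ EJ]]]] := ito_increment a0 ab e1.
have [iL _ _ _] := cells_isometry N0 flt bm Gl.
have mL i j := cells_integral_meas Gl i j.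
have mJ i j : cmeas (fun x => (Jn a b x - cells_integral K l x) i j).
  by under eq_fun do rewrite mxsubE; apply: cmeasB => //; exact: J_meas.
have := approx_sq ab Gl la lb le.
have HE x : J a b x = (Jn a b x - cells_integral K l x) + cells_integral K l x by rewrite subrK.
have [_ H] := sqnorm_intgD HE mJ mL iJ iL.
by move: EJ H; gen_lra.
Qed.

Definition Cstep : R := 8 * N%:R + 2 * (N * N)%:R.

Lemma Cstep_ge0 : 0 <= Cstep.
Proof. by apply: addr_ge0; apply: mulr_ge0. Qed.

Lemma dUE a b x : 0 <= a -> a <= b ->
  U b x - U a x = J a b x - 2^-1 *: intU a b x.
Proof.
move=> a0 ab; rewrite -(time_integralB x a0 ab) /J /Jn /Ipart.
move: (U b x) (U a x) (time_integral U b x) (time_integral U a x) => A1 A2 A3 A4.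
by apply/matrixP => i j; rewrite !mxE; ring.
Qed.

Lemma half_intU_le a b x : 0 <= a -> a <= b ->
  sqnorm (2^-1 *: intU a b x) <= (N * N)%:R * (b - a) ^+ 2.
Proof.
move=> a0 ab; apply: sqnorm_le_entries => i j; rewrite [_ i j]mxE cabsM.
have := intU_le x i j a0 ab.
have -> : cabs (2^-1 : C) = 2^-1.
  by rewrite (_ : 2^-1 = (2^-1)%:C :> C) ?cabs_real ?ger0_norm // fmorphV rmorph_nat.
by move=> h; rewrite -[leRHS](mulKf (_ : 2 != 0 :> R)) // ler_wpM2l.
Qed.

Lemma half_intU_meas a b i j : 0 <= a -> cmeas (fun x => (- (2^-1 *: intU a b x)) i j).
Proof.
move=> a0; under eq_fun do rewrite mxE; apply: cmeasN; under eq_fun do rewrite mxE.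
apply: cmeasM; first exact: cmeas_cst.
exact: (intU_meas).
Qed.

Lemma half_intU_Ex a b : 0 <= a -> a <= b ->
  intg P (fun x => sqnorm (- (2^-1 *: intU a b x))) /\
  Ex P (fun x => sqnorm (- (2^-1 *: intU a b x))) <= (N * N)%:R * (b - a) ^+ 2.
Proof.
move=> a0 ab.
have h x : sqnorm (- (2^-1 *: intU a b x)) <= (N * N)%:R * (b - a) ^+ 2.
  by rewrite sqnormN half_intU_le.
have i : intg P (fun x => sqnorm (- (2^-1 *: intU a b x))).
  apply: (@intg_bnd _ _ _ _ _ ((N * N)%:R * (b - a) ^+ 2)) => [|x].
    by apply: sqnorm_meas => i j; exact: half_intU_meas.
  by rewrite ger0_norm ?sqnorm_ge0.
by split => //; apply: Ex_le_cst.
Qed.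

Lemma dU_meas a b i j : 0 <= a -> a <= b -> cmeas (fun x => (U b x - U a x) i j).
Proof.
move=> a0 ab; under eq_fun do rewrite mxsubE.
by apply: cmeasB; apply: U_meas => //; exact: le_trans ab.
Qed.

(** The stochastic part is linear in the step and the drift quadratic. For steps longer than 1 the
    quadratic term is useless and unitarity gives the trivial bound [4 * N], which [Cstep] also
    covers. *)
Lemma dU_sq a b : 0 <= a -> a <= b ->
  intg P (fun x => sqnorm (U b x - U a x)) /\
  Ex P (fun x => sqnorm (U b x - U a x)) <= Cstep * (b - a).
Proof.
move=> a0 ab; have b0 := le_trans a0 ab; have h0 : 0 <= b - a by rewrite subr_ge0.
have [iI EI] := half_intU_Ex a0 ab.
have [i E] := sqnorm_intgD (fun x => dUE x a0 ab) (fun i j => J_meas i j a0 ab)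
  (fun i j => half_intU_meas b i j a0) (J_intg a0 ab) iI.
split => //; have [h1|h1] := leP (b - a) 1.
  apply: (le_trans E); have := J_sq a0 ab.
  have : (N * N)%:R * (b - a) ^+ 2 <= (N * N)%:R * (b - a).
    by rewrite ler_wpM2l // expr2 ler_piMr.
  by rewrite /Cstep; move: EI; gen_lra.
apply: (@le_trans _ _ (4 * N%:R)).
  apply: Ex_le_cst => // x; rewrite (le_trans (sqnormB _ _)) //.
  by rewrite !unitary_sqnorm ?unU // -mulrDl (_ : 2 + 2 = 4) //; ring.
apply: (@le_trans _ _ (Cstep * 1)); last by rewrite ler_wpM2l ?Cstep_ge0 // ltW.
have : 0 <= (N * N)%:R :> R by []; have : 0 <= N%:R :> R by [].
rewrite /Cstep; lra.
Qed.

Definition rem a b x : M := U b x - U a x - U a x *m (K b x - K a x).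

Lemma UdK_meas a b i j : 0 <= a -> a <= b ->
  cmeas (fun x => (U a x *m (K b x - K a x)) i j).
Proof.
move=> a0 ab; under eq_fun do rewrite mxE; apply: cmeas_sum => k _.
by apply: cmeasM; [exact: U_meas|exact: (dK_meas flt bm)].
Qed.

Lemma UdK_good a b : 0 <= a -> a <= b -> good_cell F (a, b, U a : T -> M).
Proof.
move=> a0 ab; split => //= [i j|]; first exact: (U_Fmeas).
by exists 1 => i j x; exact: U_le1.
Qed.

(** The constant process [U a] on []a, b]] is itself one cell. Subtracting it leaves the integral of
    [U s - U a], whose mean square is at most linear in the step by [dU_sq]; the isometry gains one
    more power. *)
Lemma J_lin a b : 0 <= a -> a <= b ->
  intg P (fun x => sqnorm (J a b x - U a x *m (K b x - K a x))) /\
  Ex P (fun x => sqnorm (J a b x - U a x *m (K b x - K a x))) <= 4 * Cstep * (b - a) ^+ 2.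
Proof.
move=> a0 ab; have h0 : 0 <= b - a by rewrite subr_ge0.
pose c (k : unit) : @cell R d T N := (a, b, U a).
have Gc k : good_cell F (c k) by exact: UdK_good.
have cI x : cells_integral K (fun k => opp_cell (c k)) x = - (U a x *m (K b x - K a x)).
  by rewrite opp_integral /cells_integral (big_pred1 tt) //= => -[].
have cE s x : a < s <= b -> cells_eval (fun k => opp_cell (c k)) s x = - U a x.
  by move=> sab; rewrite opp_eval /cells_eval (big_pred1 tt) /= ?sab // => -[].
have Gn k : good_cell F (opp_cell (c k)) by exact: opp_good.
have mJ i j : cmeas (fun x => (J a b x - U a x *m (K b x - K a x)) i j).
  by under eq_fun do rewrite mxsubE; apply: cmeasB; [exact: J_meas|exact: UdK_meas].
have [iC _ _ _] := cells_isometry N0 flt bm Gn.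
have mC i j := cells_integral_meas Gn i j.
have iJ : intg P (fun x => sqnorm (J a b x - U a x *m (K b x - K a x))).
  have HE x : J a b x - U a x *m (K b x - K a x) = J a b x + cells_integral K (fun k => opp_cell (c k)) x.
    by rewrite cI.
  exact: (sqnorm_intgD HE (fun i j => J_meas i j a0 ab) mC (J_intg a0 ab) iC).1.
split => //; apply/ler_addgt0Pr => e e0.
have e1 : 0 < e / 36 by rewrite divr_gt0.
have [n [l [Gl la lb le [iJl EJl]]]] := ito_increment a0 ab e1.
pose h := sum_cells l (fun k => opp_cell (c k)).
have Gh k : good_cell F (h k) by case: k => k /=; [exact: Gl|exact: Gn].
have Eh : Ex P (fun x => sqnorm (cells_integral K h x)) <=
    2 * (e / 36) + 2 * (Cstep * (b - a)) * (b - a).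
  apply: (cells_integral_le Gh ab (approx_psi_meas Gl) (approx_psi_ge0 l)) (approx_psi Gl le) _ _.
  - by rewrite mulr_ge0 // mulr_ge0 // Cstep_ge0.
  - move=> s sab; have /andP[s1 s2] := sab; have s0 : 0 <= s := le_trans a0 (ltW s1).
    have [iU EU] := dU_sq a0 (ltW s1).
    have mUa i j : cmeas (fun x => U a x i j) by exact: U_meas.
    have := @approx_dist n l Gl s (U a) mUa; rewrite clamp_id // => /(_ iU) H.
    have -> : Ex P (fun x => sqnorm (cells_eval h s x)) = Ex P (fun x => sqnorm (cells_eval l s x - U a x)).
      by apply: eq_Ex => x; rewrite sum_eval cE.
    apply: (le_trans H); rewrite lerD2l ler_wpM2l // (le_trans EU) //.
    by rewrite ler_wpM2l ?Cstep_ge0 // lerD2r.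
  - move=> s x ns; rewrite sum_eval (eval_off x la lb) // add0r opp_eval.
    by rewrite (eval_off (l := c) x (fun=> lexx a) (fun=> lexx b) ns) oppr0.
have [iH _ _ _] := cells_isometry N0 flt bm Gh.
have mJl i j : cmeas (fun x => (Jn a b x - cells_integral K l x) i j).
  under eq_fun do rewrite mxsubE; apply: cmeasB; first exact: J_meas.
  exact: (cells_integral_meas Gl).
have HE x : J a b x - U a x *m (K b x - K a x) =
    (Jn a b x - cells_integral K l x) + cells_integral K h x.
  by rewrite sum_integral cI -/(J a b x) addrA subrK.
have [_ H] := sqnorm_intgD HE mJl (fun i j => cells_integral_meas Gh i j) iJl iH.
by apply: (le_trans H); move: Eh EJl; rewrite expr2; gen_lra.
Qed.

Lemma rem_meas a b i j : 0 <= a -> a <= b -> cmeas (fun x => rem a b x i j).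
Proof.
by move=> a0 ab; under eq_fun do rewrite mxsubE; apply: cmeasB; [exact: dU_meas|exact: UdK_meas].
Qed.

Lemma rem_sq a b : 0 <= a -> a <= b ->
  intg P (fun x => sqnorm (rem a b x)) /\
  Ex P (fun x => sqnorm (rem a b x)) <= (8 * Cstep + 2 * (N * N)%:R) * (b - a) ^+ 2.
Proof.
move=> a0 ab; have [iI EI] := half_intU_Ex a0 ab; have [iL EL] := J_lin a0 ab.
have mJ i j : cmeas (fun x => (J a b x - U a x *m (K b x - K a x)) i j).
  by under eq_fun do rewrite mxsubE; apply: cmeasB; [exact: J_meas|exact: UdK_meas].
have HE x : rem a b x = (J a b x - U a x *m (K b x - K a x)) + - (2^-1 *: intU a b x).
  rewrite /rem dUE //; move: (J a b x) (U a x *m _) (_ *: _) => A1 A2 A3.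
  by apply/matrixP => i j; rewrite !mxE; ring.
have [i E] := sqnorm_intgD HE mJ (fun i j => half_intU_meas b i j a0) iL iI.
by split => //; apply: (le_trans E); move: EI EL; gen_lra.
Qed.

(** The martingale property. It is exact for approximants, since each cell starts at or after [a]
    and its increment is independent of [Z] times its value; [L^2] approximation passes it on. *)
Lemma J_mean a b (Z : T -> C) c i j : 0 <= a -> a <= b -> 0 <= c -> Fmeas F a Z ->
  (forall x, cabs (Z x) <= c) -> Cexp P (fun x => Z x * J a b x i j) = 0.
Proof.
move=> a0 ab c0 FZ bZ; have mZ := Fmeas_meas flt a0 FZ.
have LJ := sqnorm_L2 (fun i j => J_meas i j a0 ab) (J_intg a0 ab) i j.
apply: cabs_eq0; apply/eqP; rewrite eq_le cabs_ge0 andbT; apply/ler_addgt0Pr => e e0.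
(* Tolerance [q ^+ 2 / 16] makes the mean square error at most [q ^+ 2], hence the [L^1] error at
   most [q], and [c * q <= e]; the added 1 allows [c = 0]. *)
rewrite add0r; pose q := e / (c + 1).
have q0 : 0 < q by rewrite divr_gt0 // ltr_pwDr.
have q1 : 0 < q ^+ 2 / 16 by rewrite divr_gt0 // exprn_gt0.
have [n [l [Gl la lb le [iJl EJl]]]] := ito_increment a0 ab q1.
have [iL _ _ _] := cells_isometry N0 flt bm Gl.
have mL i j := cells_integral_meas Gl i j.
have LL := sqnorm_L2 mL iL i j.
have mJl i' j' : cmeas (fun x => (Jn a b x - cells_integral K l x) i' j').
  by under eq_fun do rewrite mxsubE; apply: cmeasB => //; exact: J_meas.
have LD := sqnorm_L2 mJl iJl i j.
have LZ : cL2 P Z := cL2_bnd P mZ bZ.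
have E0 : Cexp P (fun x => Z x * cells_integral K l x i j) = 0.
  have H k m : cintg P (fun x => (Z x * (l k).2 x i m) * (K (l k).1.2 x - K (l k).1.1 x) m j) /\
    Cexp P (fun x => (Z x * (l k).2 x i m) * (K (l k).1.2 x - K (l k).1.1 x) m j) = 0.
    have [p0 pq FA [c' bA]] := Gl k.
    have FZA : Fmeas F (l k).1.1 (fun x => Z x * (l k).2 x i m).
      by apply: cmeasM; [exact: (Fmeas_mono flt a0 (la k))|exact: FA].
    have LZA : cL2 P (fun x => Z x * (l k).2 x i m).
      apply: (cL2M_bnd mZ bZ); apply: (cL2_bnd P (c := c')); last by move=> x; exact: bA.
      exact: (cell_val_meas Gl).
    split; first by apply: cL2M => //; exact: (dKent_L2 N0 bm).
    exact: (dK_mean N0 flt bm).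
  have -> : (fun x => Z x * cells_integral K l x i j) = (fun x => \sum_k \sum_m
      (Z x * (l k).2 x i m) * (K (l k).1.2 x - K (l k).1.1 x) m j).
    apply/funext => x; rewrite summxE mulr_sumr; apply: eq_bigr => k _.
    by rewrite mxE mulr_sumr; apply: eq_bigr => m _; rewrite mulrA.
  rewrite Cexp_sum => [|k _]; last by apply: cintg_sum => m _; have [] := H k m.
  rewrite big1 // => k _; rewrite Cexp_sum => [|m _]; last by have [] := H k m.
  by rewrite big1 // => m _; have [] := H k m.
have -> : Cexp P (fun x => Z x * J a b x i j) =
    Cexp P (fun x => Z x * (Jn a b x - cells_integral K l x) i j).
  rewrite -[RHS]addr0 -E0 -CexpD; [|exact: cL2M|exact: cL2M].
  by apply: eq_Cexp => x; rewrite mxsubE mulrBr subrK.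
apply: (le_trans (cabs_Cexp_le (Y := fun x => c * cabs ((Jn a b x - cells_integral K l x) i j)) _ _ _)).
- exact: cL2M.
- by apply: intgZ; apply: intg_cabs; exact: cL2_cintg.
- by move=> x; rewrite cabsM ler_wpM2r.
rewrite ExZ; last by apply: intg_cabs; exact: cL2_cintg.
have c1 : 0 < c + 1 by rewrite ltr_pwDr.
have cq : c * q <= e by rewrite /q mulrA ler_pdivrMr // mulrC ler_wpM2l ?(ltW e0) // lerDl.
apply: le_trans cq.
rewrite ler_wpM2l // (le_trans (Cexp_L1_L2 LD)) // -(ger0_norm (ltW q0)) -sqrtr_sqr ler_wsqrtr //.
apply: le_trans (_ : Ex P (fun x => sqnorm (Jn a b x - cells_integral K l x)) <= _).
  by apply: le_Ex => //; [case: LD|move=> x; exact: entry_le_sqnorm].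
by apply: (le_trans EJl); rewrite mulrC divfK.
Qed.

(** Freezing [U] at the left end costs the square root of the step by [dU_sq], once for the real and
    once for the imaginary part. *)
Lemma intU_lin a b i j : 0 <= a -> a <= b ->
  cL2 P (fun x => intU a b x i j - (b - a)%:C * U a x i j) /\
  Ex P (fun x => cabs (intU a b x i j - (b - a)%:C * U a x i j)) <=
    2 * ((b - a) * Num.sqrt (Cstep * (b - a))).
Proof.
move=> a0 ab; have h0 : 0 <= b - a by rewrite subr_ge0.
have m : cmeas (fun x => intU a b x i j - (b - a)%:C * U a x i j).
  apply: cmeasB; first exact: (intU_meas).
  by apply: cmeasM; [exact: cmeas_cst|exact: U_meas].
have L : cL2 P (fun x => intU a b x i j - (b - a)%:C * U a x i j).
  apply: (cL2_bnd P m (c := 2 * (b - a) + (b - a) * 1)) => x.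
  apply: (le_trans (ler_cabsB _ _)); apply: lerD; first exact: (intU_le).
  by rewrite cabsM cabs_real ger0_norm // ler_wpM2l // U_le1.
split => //; pose m0 := Num.sqrt (Cstep * (b - a)).
have [j1 j2] := U_joint i j.
have c1 (c : R) : \int[mu]_(s in `[a, b]) (cst c s) = (b - a) * c.
  by rewrite Rintegral_cst // mulrC; congr (_ * _); exact: (congr1 fine (itv_measure ab)).
have ic (c : R) : mu.-integrable `[a, b] (EFin \o cst c).
  by apply: (@bounded_itv_integrable _ _ _ _ `|c|).
pose fr (z : R * T) := complex.Re (U (clamp z.1) z.2 i j) - complex.Re (U a z.2 i j).
pose fi (z : R * T) := complex.Im (U (clamp z.1) z.2 i j) - complex.Im (U a z.2 i j).
have [u1 u2] := U_meas i j a0.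
have mr : measurable_fun setT fr.
  by apply: measurable_funB => //; exact: (measurableT_comp u1 measurable_snd).
have mi : measurable_fun setT fi.
  by apply: measurable_funB => //; exact: (measurableT_comp u2 measurable_snd).
have E1 s : a <= s <= b -> Ex P (fun x => cabs ((U s x - U a x) i j)) <= m0.
  move=> /andP[s1 s2]; have [iS ES] := dU_sq a0 s1.
  have LS := sqnorm_L2 (fun i j => dU_meas i j a0 s1) iS i j.
  apply: (le_trans (Cexp_L1_L2 LS)); rewrite ler_wsqrtr //.
  apply: le_trans (_ : Ex P (fun x => sqnorm (U s x - U a x)) <= _).
    by apply: le_Ex => //; [case: LS|move=> x; exact: entry_le_sqnorm].
  by apply: (le_trans ES); rewrite ler_wpM2l ?Cstep_ge0 // lerD2r.
have LS s : a <= s <= b -> intg P (fun x => cabs ((U s x - U a x) i j)).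
  move=> /andP[s1 s2]; have [iS ES] := dU_sq a0 s1.
  by apply: intg_cabs; apply: cL2_cintg; exact: (sqnorm_L2 (fun i j => dU_meas i j a0 s1) iS i j).
have [r1 r2] : intg P (fun x => `|\int[mu]_(s in `[a, b]) fr (s, x)|) /\
  Ex P (fun x => `|\int[mu]_(s in `[a, b]) fr (s, x)|) <= (b - a) * m0.
  apply: (@Ex_time_integral_le _ _ _ P fr a b m0 2) => // [s x sab|s sab].
    apply: (le_trans (ler_normB _ _)); rewrite -[2]/(1 + 1) lerD //.
      by rewrite (le_trans (ler_Re_cabs _)) // U_le1 // clamp_ge0.
    by rewrite (le_trans (ler_Re_cabs _)) // U_le1.
  have s0 : 0 <= s by case/andP: sab => s1 _; exact: le_trans s1.
  have H x : `|fr (s, x)| <= cabs ((U s x - U a x) i j).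
    by rewrite /fr /= clamp_id // -ReB mxsubE ler_Re_cabs.
  apply: le_trans (E1 s sab); apply: le_Ex => //; last exact: LS.
  apply: intg_le (LS s sab) => [|x]; last by rewrite normr_id.
  apply: measurableT_comp => //; exact: (measurableT_comp mr (measurable_pair1 s)).
have [i1 i2] : intg P (fun x => `|\int[mu]_(s in `[a, b]) fi (s, x)|) /\
  Ex P (fun x => `|\int[mu]_(s in `[a, b]) fi (s, x)|) <= (b - a) * m0.
  apply: (@Ex_time_integral_le _ _ _ P fi a b m0 2) => // [s x sab|s sab].
    apply: (le_trans (ler_normB _ _)); rewrite -[2]/(1 + 1) lerD //.
      by rewrite (le_trans (ler_Im_cabs _)) // U_le1 // clamp_ge0.
    by rewrite (le_trans (ler_Im_cabs _)) // U_le1.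
  have s0 : 0 <= s by case/andP: sab => s1 _; exact: le_trans s1.
  have H x : `|fi (s, x)| <= cabs ((U s x - U a x) i j).
    by rewrite /fi /= clamp_id // -ImB mxsubE ler_Im_cabs.
  apply: le_trans (E1 s sab); apply: le_Ex => //; last exact: LS.
  apply: intg_le (LS s sab) => [|x]; last by rewrite normr_id.
  apply: measurableT_comp => //; exact: (measurableT_comp mi (measurable_pair1 s)).
have H x : cabs (intU a b x i j - (b - a)%:C * U a x i j) <=
    `|\int[mu]_(s in `[a, b]) fr (s, x)| + `|\int[mu]_(s in `[a, b]) fi (s, x)|.
  apply: (le_trans (ler_cabs_ReIm _)).
  have [g1 g2] := U_integrable b x i j a0.
  rewrite ReB ImB ReM ImM /= !mul0r subr0 addr0 mxE /= -!c1.
  rewrite -RintegralB // -RintegralB // le_eqVlt; apply/orP; left; apply/eqP.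
  apply: (f_equal2 +%R); apply: f_equal; apply: eq_Rintegral => s; rewrite inE /= in_itv /= => /andP[sa _].
    by rewrite /fr /= clamp_id // (le_trans a0).
  by rewrite /fi /= clamp_id // (le_trans a0).
apply: (le_trans (le_Ex _ (intgD r1 i1) H)).
  by apply: intg_cabs; exact: cL2_cintg.
by rewrite ExD // mulrDl mul1r lerD.
Qed.

(** The stochastic part drops out by [J_mean]; in the remaining drift the factor 1/2 of the equation
    cancels the 2 of [intU_lin]. *)
Lemma dU_mean a b (Z : T -> C) c i j : 0 <= a -> a <= b -> 0 <= c -> Fmeas F a Z ->
  (forall x, cabs (Z x) <= c) ->
  cabs (Cexp P (fun x => Z x * ((U b x - U a x) i j + ((b - a) / 2)%:C * U a x i j))) <=
    c * ((b - a) * Num.sqrt (Cstep * (b - a))).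
Proof.
move=> a0 ab c0 FZ bZ; have mZ := Fmeas_meas flt a0 FZ.
have LJ := sqnorm_L2 (fun i j => J_meas i j a0 ab) (J_intg a0 ab) i j.
have LZ : cL2 P Z := cL2_bnd P mZ bZ.
have [LI EI] := intU_lin i j a0 ab.
have -> : Cexp P (fun x => Z x * ((U b x - U a x) i j + ((b - a) / 2)%:C * U a x i j)) =
   - 2^-1 * Cexp P (fun x => Z x * (intU a b x i j - (b - a)%:C * U a x i j)).
  rewrite -[RHS]add0r -(J_mean i j a0 ab c0 FZ bZ) -CexpZ; last exact: cL2M.
  rewrite -CexpD; [|exact: cL2M|by apply: cintgZ; exact: cL2M].
  apply: eq_Cexp => x; rewrite dUE // mxsubE mxscaleE rmorphM /= fmorphV rmorph_nat.
  by move: (intU a b x i j) (U a x i j) => A1 A2; ring.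
rewrite cabsM cabsN.
have -> : cabs (2^-1 : C) = 2^-1.
  by rewrite (_ : 2^-1 = (2^-1)%:C :> C) ?cabs_real ?ger0_norm // fmorphV rmorph_nat.
rewrite ler_pdivrMl //.
have iI : intg P (fun x => cabs (intU a b x i j - (b - a)%:C * U a x i j)).
  by apply: intg_cabs; exact: cL2_cintg.
apply: (le_trans (cabs_Cexp_le (Y := fun x => c * cabs (intU a b x i j - (b - a)%:C * U a x i j)) _ _ _)).
- exact: cL2M.
- exact: intgZ.
- by move=> x; rewrite cabsM ler_wpM2r.
by rewrite ExZ // mulrCA ler_wpM2l.
Qed.

End ItoSolution.

(** * Ito's formula *)

Section PowerSums.
Context {R : realType}.

(** The constant is crude on purpose: only the power of the time step will count, not the dependence
    on [N]. *)
Lemma sum_pow2 (I : Type) (s : seq I) (x : I -> R) :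
  (\sum_(i <- s) x i) ^+ 2 <= 2 ^+ size s * \sum_(i <- s) x i ^+ 2.
Proof.
elim: s => [|i s IH]; first by rewrite !big_nil expr0n mulr0.
rewrite !big_cons /= (exprS 2); set S := \sum_(j <- s) x j in IH *.
have h : (x i + S) ^+ 2 <= 2 * (x i ^+ 2 + S ^+ 2).
  by rewrite -subr_ge0 (_ : _ - _ = (x i - S) ^+ 2) ?sqr_ge0 //; ring.
apply: (le_trans h); rewrite -mulrA ler_wpM2l // mulrDr lerD //.
by rewrite ler_peMl ?sqr_ge0 // exprn_ege1 // ler1n.
Qed.

Lemma sum_pow4 (I : Type) (s : seq I) (x : I -> R) :
  (\sum_(i <- s) x i) ^+ 4 <= 8 ^+ size s * \sum_(i <- s) x i ^+ 4.
Proof.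
elim: s => [|i s IH]; first by rewrite !big_nil expr0n mulr0.
rewrite !big_cons /= (exprS 8); set S := \sum_(j <- s) x j in IH *.
have h2 (a b : R) : (a + b) ^+ 2 <= 2 * (a ^+ 2 + b ^+ 2).
  by rewrite -subr_ge0 (_ : _ - _ = (a - b) ^+ 2) ?sqr_ge0 //; ring.
have h : (x i + S) ^+ 4 <= 8 * (x i ^+ 4 + S ^+ 4).
  rewrite (exprM _ 2 2) (le_trans (y := (2 * (x i ^+ 2 + S ^+ 2)) ^+ 2)) //.
    by rewrite ler_pXn2r ?nnegrE ?sqr_ge0 //; apply: mulr_ge0 => //; apply: addr_ge0; exact: sqr_ge0.
  rewrite exprMn (_ : 8 = 2 ^+ 2 * 2) -?mulrA; last by ring.
  have e4 (y : R) : y ^+ 4 = (y ^+ 2) ^+ 2 by rewrite -exprM.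
  by rewrite !e4 ler_wpM2l // ler_wpM2l.
apply: (le_trans h); rewrite -mulrA ler_wpM2l // mulrDr lerD //.
by rewrite ler_peMl ?exprn_ege1 ?ler1n // (exprM _ 2 2) sqr_ge0.
Qed.

End PowerSums.

(** * Jets: expansions along the noise and the product rule *)

Section Jets.
Context {R : realType} d (T : measurableType d) (P : probability T R).
Variable N : nat.
Hypothesis N0 : (0 < N)%N.
Local Notation C := R[i].
Local Notation M := 'M[C]_N.
Variables (F : R -> set (set T)) (K : R -> T -> M).
Hypothesis flt : filtration F.
Hypothesis bm : uN_brownian P F K.

Let DK a b x : M := K b x - K a x.
Definition lin (g : T -> M) a b x : C := \tr (g x *m DK a b x).

(** Drift errors are of order 3/2 for short steps; the square is added because products of
    remainders produce it and no upper limit is put on the step here. *)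
Definition rate (h : R) : R := h * Num.sqrt h + h ^+ 2.

Lemma rate_ge0 h : 0 <= h -> 0 <= rate h.
Proof. by move=> h0; rewrite addr_ge0 ?mulr_ge0 ?sqr_ge0. Qed.

Definition K2 : R := \sum_(p : 'I_N * 'I_N)
  (dKvar (delta_mx p.2 p.1 : M) + dKvar (- 'i *: delta_mx p.2 p.1 : M)).
Definition K4 : R := \sum_(p : 'I_N * 'I_N)
  6 * (dKvar (delta_mx p.2 p.1 : M) ^+ 2 + dKvar (- 'i *: delta_mx p.2 p.1 : M) ^+ 2).

Lemma dK_sum2 a b : 0 <= a -> a <= b ->
  intg P (fun x => \sum_(p : 'I_N * 'I_N) cabs (DK a b x p.1 p.2) ^+ 2) /\
  Ex P (fun x => \sum_(p : 'I_N * 'I_N) cabs (DK a b x p.1 p.2) ^+ 2) <= K2 * (b - a).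
Proof.
move=> a0; rewrite le_eqVlt => /orP[/eqP <-|ab].
  have E : (fun x => \sum_(p : 'I_N * 'I_N) cabs (DK a a x p.1 p.2) ^+ 2) = fun=> 0.
    by apply/funext => x; rewrite big1 // => p _; rewrite /DK subrr mxE cabs0 expr0n.
  by rewrite E; split; [exact: intg_cst|rewrite Ex_cst subrr mulr0].
have H (p : 'I_N * 'I_N) : intg P (fun x => cabs (DK a b x p.1 p.2) ^+ 2) /\
   Ex P (fun x => cabs (DK a b x p.1 p.2) ^+ 2) =
   (b - a) * (dKvar (delta_mx p.2 p.1 : M) + dKvar (- 'i *: delta_mx p.2 p.1 : M)).
  have [i1 e1] := trdK_var N0 bm a0 ab (delta_mx p.2 p.1 : M).
  have [i2 e2] := trdK_var N0 bm a0 ab (- 'i *: delta_mx p.2 p.1 : M).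
  have -> : (fun x => cabs (DK a b x p.1 p.2) ^+ 2) = (fun x =>
      complex.Re (trdK K a b (delta_mx p.2 p.1) x) ^+ 2 +
      complex.Re (trdK K a b (- 'i *: delta_mx p.2 p.1) x) ^+ 2).
    by apply/funext => x; rewrite -trdK_Im -cabs_sq trdK_delta.
  by split; [exact: intgD|rewrite ExD // e1 e2 mulrDr].
split; first by apply: intg_sum => p _; have [] := H p.
rewrite Ex_sum => [|p _]; last by have [] := H p.
by rewrite /K2 mulr_suml ler_sum // => p _; have [_ ->] := H p; rewrite mulrC.
Qed.

Lemma dK_sum4 a b : 0 <= a -> a <= b ->
  intg P (fun x => \sum_(p : 'I_N * 'I_N) cabs (DK a b x p.1 p.2) ^+ 4) /\
  Ex P (fun x => \sum_(p : 'I_N * 'I_N) cabs (DK a b x p.1 p.2) ^+ 4) <= K4 * (b - a) ^+ 2.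
Proof.
move=> a0; rewrite le_eqVlt => /orP[/eqP <-|ab].
  have E : (fun x => \sum_(p : 'I_N * 'I_N) cabs (DK a a x p.1 p.2) ^+ 4) = fun=> 0.
    by apply/funext => x; rewrite big1 // => p _; rewrite /DK subrr mxE cabs0 expr0n.
  by rewrite E; split; [exact: intg_cst|rewrite Ex_cst subrr expr0n mulr0].
have H (p : 'I_N * 'I_N) : intg P (fun x => cabs (DK a b x p.1 p.2) ^+ 4) /\
   Ex P (fun x => cabs (DK a b x p.1 p.2) ^+ 4) <=
   6 * (dKvar (delta_mx p.2 p.1 : M) ^+ 2 + dKvar (- 'i *: delta_mx p.2 p.1 : M) ^+ 2) * (b - a) ^+ 2.
  have [i1 e1] := trdK_L4 N0 bm a0 ab (delta_mx p.2 p.1 : M).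
  have E : (fun x => cabs (trdK K a b (delta_mx p.2 p.1) x) ^+ 4) =
      (fun x => cabs (DK a b x p.1 p.2) ^+ 4) by apply/funext => x; rewrite trdK_delta.
  by rewrite -E; split => //; rewrite mulrAC.
split; first by apply: intg_sum => p _; have [] := H p.
rewrite Ex_sum => [|p _]; last by have [] := H p.
by rewrite /K4 mulr_suml ler_sum // => p _; have [] := H p.
Qed.

Lemma K2_ge0 : 0 <= K2.
Proof. by apply: sumr_ge0 => p _; apply: addr_ge0; exact: dKvar_ge0. Qed.

Lemma K4_ge0 : 0 <= K4.
Proof. by apply: sumr_ge0 => p _; apply: mulr_ge0 => //; apply: addr_ge0; exact: sqr_ge0. Qed.

Section Linear.
Variables (g : T -> M) (a b c : R).
Hypotheses (a0 : 0 <= a) (ab : a <= b) (c0 : 0 <= c).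
Hypothesis Fg : forall i j, Fmeas F a (fun x => g x i j).
Hypothesis bg : forall x i j, cabs (g x i j) <= c.

Lemma linE x : lin g a b x = \sum_i \sum_j g x i j * DK a b x j i.
Proof. by rewrite /lin tr_mulE. Qed.

Lemma lin_L2 : cL2 P (lin g a b).
Proof.
have -> : lin g a b = (fun x => \sum_i \sum_j g x i j * DK a b x j i).
  by apply/funext => x; exact: linE.
apply: cL2_sum => i _; apply: cL2_sum => j _.
apply: (cL2M_bnd (c := c)) => [|x|]; [exact: (Fmeas_meas flt a0)|exact: bg|].
exact: (dKent_L2 N0 bm).
Qed.

Lemma lin_le x : cabs (lin g a b x) <= c * \sum_(p : 'I_N * 'I_N) cabs (DK a b x p.1 p.2).
Proof.
rewrite linE -(pair_bigA _ (fun i j => cabs (DK a b x i j))) /= exchange_big mulr_sumr.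
rewrite (le_trans (ler_cabs_sum _ _ _)) // ler_sum // => i _; rewrite mulr_sumr.
rewrite (le_trans (ler_cabs_sum _ _ _)) // ler_sum // => j _.
by rewrite cabsM ler_wpM2r.
Qed.

Definition n2 : nat := size (index_enum ('I_N * 'I_N)%type).

Lemma lin_sq : Ex P (fun x => cabs (lin g a b x) ^+ 2) <= c ^+ 2 * 2 ^+ n2 * K2 * (b - a).
Proof.
have [i2 e2] := dK_sum2 a0 ab.
apply: (@le_trans _ _ (Ex P (fun x => c ^+ 2 * 2 ^+ n2 * \sum_(p : 'I_N * 'I_N) cabs (DK a b x p.1 p.2) ^+ 2))).
  apply: le_Ex; [by case: lin_L2|exact: intgZ|move=> x].
  apply: (@le_trans _ _ ((c * \sum_(p : 'I_N * 'I_N) cabs (DK a b x p.1 p.2)) ^+ 2)).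
    by rewrite ler_pXn2r ?nnegrE // ?lin_le //; apply: mulr_ge0 => //; apply: sumr_ge0.
  by rewrite exprMn -mulrA ler_wpM2l ?sqr_ge0 // sum_pow2.
rewrite ExZ // -(mulrA (c ^+ 2 * 2 ^+ n2)) ler_wpM2l //.
by apply: mulr_ge0; [exact: sqr_ge0|exact: exprn_ge0].
Qed.

Lemma lin_4 : intg P (fun x => cabs (lin g a b x) ^+ 4) /\
  Ex P (fun x => cabs (lin g a b x) ^+ 4) <= c ^+ 4 * 8 ^+ n2 * K4 * (b - a) ^+ 2.
Proof.
have [i4 e4] := dK_sum4 a0 ab.
have H x : cabs (lin g a b x) ^+ 4 <= c ^+ 4 * 8 ^+ n2 * \sum_(p : 'I_N * 'I_N) cabs (DK a b x p.1 p.2) ^+ 4.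
  apply: (@le_trans _ _ ((c * \sum_(p : 'I_N * 'I_N) cabs (DK a b x p.1 p.2)) ^+ 4)).
    by rewrite ler_pXn2r ?nnegrE // ?lin_le //; apply: mulr_ge0 => //; apply: sumr_ge0.
  by rewrite exprMn -mulrA ler_wpM2l ?exprn_ge0 // sum_pow4.
have i : intg P (fun x => cabs (lin g a b x) ^+ 4).
  apply: (intg_le (Y := fun x => c ^+ 4 * 8 ^+ n2 * \sum_(p : 'I_N * 'I_N) cabs (DK a b x p.1 p.2) ^+ 4)).
  - by apply: measurable_funX; apply: cmeas_cabs; case: lin_L2.
  - by move=> x; rewrite ger0_norm ?exprn_ge0.
  - exact: intgZ.
split => //; apply: (le_trans (le_Ex i (intgZ _ i4) H)).
rewrite ExZ // -(mulrA (c ^+ 4 * 8 ^+ n2)) ler_wpM2l //.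
by apply: mulr_ge0; exact: exprn_ge0.
Qed.

End Linear.

Lemma lin_cov (g g' : T -> M) (Z : T -> C) a b c : 0 <= a -> a <= b -> 0 <= c ->
  (forall i j, Fmeas F a (fun x => g x i j)) -> (forall i j, Fmeas F a (fun x => g' x i j)) ->
  Fmeas F a Z -> (forall x i j, cabs (g x i j) <= c) -> (forall x i j, cabs (g' x i j) <= c) ->
  (forall x, cabs (Z x) <= c) ->
  Cexp P (fun x => Z x * (lin g a b x * lin g' a b x)) =
  Cexp P (fun x => Z x * (- ((b - a) / N%:R)%:C * \tr (g x *m g' x))).
Proof.
move=> a0 ab c0 Fg Fg' FZ bg bg' bZ.
pose W i j k l x := Z x * (g x i j * g' x k l).
have FW i j k l : Fmeas F a (W i j k l) by apply: cmeasM; [exact: FZ|apply: cmeasM; [exact: Fg|exact: Fg']].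
have bW i j k l x : cabs (W i j k l x) <= c * (c * c).
  by rewrite !cabsM; apply: ler_pM => //; [exact: mulr_ge0|exact: ler_pM].
have LD i j := dKent_L2 N0 bm i j a0 ab.
have mW i j k l := Fmeas_meas flt a0 (FW i j k l).
have LHS x : Z x * (lin g a b x * lin g' a b x) =
   \sum_i \sum_j \sum_k \sum_l W i j k l x * (DK a b x j i * DK a b x l k).
  rewrite !linE mulr_suml mulr_sumr; apply: eq_bigr => i _.
  rewrite mulr_suml mulr_sumr; apply: eq_bigr => j _.
  rewrite mulr_sumr mulr_sumr; apply: eq_bigr => k _.
  rewrite mulr_sumr mulr_sumr; apply: eq_bigr => l _; rewrite /W; ring.
have RHS x : Z x * (- ((b - a) / N%:R)%:C * \tr (g x *m g' x)) =
   \sum_i \sum_j - ((b - a) / N%:R)%:C * W i j j i x.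
  rewrite tr_mulE mulr_sumr mulr_sumr; apply: eq_bigr => i _.
  rewrite mulr_sumr mulr_sumr; apply: eq_bigr => j _; rewrite /W; ring.
under eq_Cexp do rewrite LHS.
transitivity (Cexp P (fun x => \sum_i \sum_j - ((b - a) / N%:R)%:C * W i j j i x)); last first.
  by apply: eq_Cexp => x; rewrite RHS.
have iD i j k l : cintg P (fun x => W i j k l x * (DK a b x j i * DK a b x l k)).
  under eq_fun do rewrite mulrA; apply: cL2M => //.
  exact: (cL2M_bnd (mW i j k l) (bW i j k l) (LD j i)).
have iW i j k l : cintg P (W i j k l) by exact: cintg_bnd (mW i j k l) (bW i j k l).
rewrite Cexp_sum => [|i _]; last by do 3!(apply: cintg_sum => ? _).
rewrite Cexp_sum => [|i _]; last by apply: cintg_sum => j _; exact: cintgZ.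
apply: eq_bigr => i _.
rewrite Cexp_sum => [|j _]; last by do 2!(apply: cintg_sum => ? _).
rewrite Cexp_sum => [|j _]; last exact: cintgZ.
apply: eq_bigr => j _.
rewrite Cexp_sum => [|k _]; last by apply: cintg_sum => l _.
rewrite CexpZ // (bigD1 j) //= big1 ?addr0 => [|k kj].
  rewrite Cexp_sum // (bigD1 i) //= big1 ?addr0 => [|l li].
    by rewrite (dK_cov N0 flt bm j i i j a0 ab (FW i j j i) (bW i j j i)) !eqxx !mulr1.
  by rewrite (dK_cov N0 flt bm j i l j a0 ab (FW i j j l) (bW i j j l)) (eq_sym i) (negbTE li) mulr0 mul0r.
rewrite Cexp_sum // big1 // => l _.
by rewrite (dK_cov N0 flt bm j i l k a0 ab (FW i j k l) (bW i j k l)) (eq_sym j) (negbTE kj) mulr0 !mul0r.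
Qed.

(** No conditional expectation is formed: the last clause tests against every bounded [Z] known at
    time [a]. In mean square the remainder is only of order one in the step; the extra half power is
    asked of the mean alone, where cancellation occurs. *)
Definition jetc (c : R) (f : R -> T -> C) (g : R -> T -> M) (h : R -> T -> C) : Prop :=
  [/\ forall s, 0 <= s -> [/\ Fmeas F s (f s), (forall i j, Fmeas F s (fun x => g s x i j)) & Fmeas F s (h s)],
      forall s x, 0 <= s -> [/\ cabs (f s x) <= c, (forall i j, cabs (g s x i j) <= c) & cabs (h s x) <= c],
      forall a b, 0 <= a -> a <= b ->
        Ex P (fun x => cabs (f b x - f a x - lin (g a) a b x) ^+ 2) <= c * (b - a) ^+ 2 &
      forall a b Z m, 0 <= a -> a <= b -> 0 <= m -> Fmeas F a Z -> (forall x, cabs (Z x) <= m) ->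
        cabs (Cexp P (fun x => Z x * (f b x - f a x - (b - a)%:C * h a x))) <= m * (c * rate (b - a))].

(* [g] is the gradient of [f] along the noise and [h] its drift. *)
Definition jet f g h : Prop := exists2 c : R, 1 <= c & jetc c f g h.

Lemma jetc_mono c c' f g h : c <= c' -> jetc c f g h -> jetc c' f g h.
Proof.
move=> cc [h1 h2 h3 h4]; split => // [s x s0|a b a0 ab|a b Z m a0 ab m0 FZ bZ].
- have [k1 k2 k3] := h2 s x s0.
  by split=> [|i j|]; [exact: le_trans cc|exact: le_trans (k2 i j) cc|exact: le_trans cc].
- by apply: (le_trans (h3 a b a0 ab)); rewrite ler_wpM2r // sqr_ge0.
- apply: (le_trans (h4 a b Z m a0 ab m0 FZ bZ)); rewrite ler_wpM2l // ler_wpM2r //.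
  by apply: rate_ge0; rewrite subr_ge0.
Qed.

Lemma jet_cst (z : C) : jet (fun _ _ => z) (fun _ _ => 0) (fun _ _ => 0).
Proof.
exists (1 + cabs z); first by rewrite lerDl.
split=> [s s0|s x s0|a b a0 ab|a b Z m a0 ab m0 FZ bZ].
- split; [exact: cmeas_cst|move=> i j|exact: cmeas_cst].
  by under eq_fun do rewrite mxE; exact: cmeas_cst.
- by split=> [|i j|]; rewrite ?mxE ?cabs0 ?lerDr // addr_ge0.
- have -> : (fun x => cabs (z - z - lin (fun=> 0) a b x) ^+ 2) = fun=> 0.
    by apply/funext => x; rewrite /lin mul0mx mxtrace0 subrr subr0 cabs0 expr0n.
  by rewrite Ex_cst mulr_ge0 ?sqr_ge0 // addr_ge0.
- have -> : (fun x => Z x * (z - z - (b - a)%:C * 0)) = fun=> 0.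
    by apply/funext => x; rewrite subrr mulr0 subr0 mulr0.
  rewrite Cexp_cst cabs0; apply: mulr_ge0 => //; apply: mulr_ge0; first exact: addr_ge0.
  by apply: rate_ge0; rewrite subr_ge0.
Qed.

(** On skew-Hermitian increments the conjugate of a trace functional is again complex linear, so
    conjugates of jets are jets of the same kind. *)
Lemma skew_tr_conj (g D : M) : skew_hermitian D -> (\tr (g *m D))^*%C = \tr (- g ^t* *m D).
Proof.
move=> sD; rewrite -tr_tc tc_mul sD mulNmx mxtrN mulNmx mxtrN; congr (- _).
exact: mxtrace_mulC.
Qed.

Lemma DK_skew a b x : 0 <= a -> a <= b -> skew_hermitian (DK a b x).
Proof.
move=> a0 ab; have [sk _ _ _ _] := bm.
have := sk b x (le_trans a0 ab); have := sk a x a0; rewrite /skew_hermitian => h1 h2.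
apply/matrixP => i j; move/matrixP/(_ i j): h1; move/matrixP/(_ i j): h2.
by rewrite !tcE !mxE rmorphB /= => -> ->; rewrite opprB opprK addrC.
Qed.

Lemma cintg_bndL2 Z m W : cmeas Z -> (forall x, cabs (Z x) <= m) -> cL2 P W ->
  cintg P (fun x => Z x * W x).
Proof. by move=> mZ bZ LW; apply: cL2M => //; exact: cL2_bnd bZ. Qed.

Lemma conj_drift (z u v w : C) (r : R) :
  (z^*%C * (u - v - r%:C * w))^*%C = z * (u^*%C - v^*%C - r%:C * w^*%C).
Proof.
by case: z u v w => [z1 z2] [u1 u2] [v1 v2] [w1 w2]; apply: complex_ext; rewrite /=; ring.
Qed.

Lemma jet_conj f g h : jet f g h ->
  jet (fun s x => (f s x)^*%C) (fun s x => - (g s x) ^t*) (fun s x => (h s x)^*%C).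
Proof.
case=> c c1 [mj bj j3 j4]; exists c => //; split=> [s s0|s x s0|a b a0 ab|a b Z m a0 ab m0 FZ bZ].
- have [h1 h2 h3] := mj s s0; split; [exact: cmeas_conj|move=> i j|exact: cmeas_conj].
  by under eq_fun do rewrite mxE tcE; apply: cmeasN; apply: cmeas_conj; exact: h2.
- have [h1 h2 h3] := bj s x s0; split=> [|i j|]; rewrite ?cabs_conj //.
  by rewrite mxE cabsN tcE cabs_conj.
- apply: le_trans (j3 a b a0 ab); rewrite le_eqVlt; apply/orP; left; apply/eqP.
  apply: eq_Ex => x; rewrite /lin -skew_tr_conj; last exact: DK_skew.
  by rewrite -!rmorphB cabs_conj.
- have [fa ga ha] := mj a a0; have [fb _ _] := mj b (le_trans a0 ab).
  have FZ' : Fmeas F a (fun x => (Z x)^*%C) by exact: cmeas_conj.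
  have bZ' x : cabs ((Z x)^*%C) <= m by rewrite cabs_conj.
  have := j4 a b _ m a0 ab m0 FZ' bZ'.
  have i : cintg P (fun x => (Z x)^*%C * (f b x - f a x - (b - a)%:C * h a x)).
    apply: (@cintg_bnd _ _ _ _ _ (m * (c + c + `|b - a| * c))).
      apply: cmeasM; first exact: (Fmeas_meas flt a0).
      apply: cmeasB; last by apply: cmeasM; [exact: cmeas_cst|exact: (Fmeas_meas flt a0)].
      by apply: cmeasB; [exact: (Fmeas_meas flt (le_trans a0 ab))|exact: (Fmeas_meas flt a0)].
    move=> x; rewrite cabsM; apply: ler_pM => //.
    have [b1 _ b3] := bj a x a0; have [b4 _ _] := bj b x (le_trans a0 ab).
    rewrite (le_trans (ler_cabsB _ _)) // lerD //.
      by rewrite (le_trans (ler_cabsB _ _)) // lerD.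
    by rewrite cabsM cabs_real ler_wpM2l.
  rewrite -cabs_conj -Cexp_conj //; congr (_ <= _); congr cabs; apply: eq_Cexp => x.
  exact: conj_drift.
Qed.

Section Two.
Variable c : R.
Hypothesis c1 : 1 <= c.
Let c0 : 0 <= c. Proof. exact: le_trans c1. Qed.
Let jc := jetc c.

Section Step.
Variables (a b : R).
Hypotheses (a0 : 0 <= a) (ab : a <= b).
Let b0 := le_trans a0 ab.

Definition jrem (f : R -> T -> C) (g : R -> T -> M) x := f b x - f a x - lin (g a) a b x.

Lemma jc_meas f1 g1 h1 : jc f1 g1 h1 -> forall s, 0 <= s ->
  [/\ cmeas (f1 s), (forall i j, cmeas (fun x => g1 s x i j)) & cmeas (h1 s)].
Proof.
case=> mj _ _ _ s s0; have [m1 m2 m3] := mj s s0.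
by split=> [|i j|]; exact: (Fmeas_meas flt s0).
Qed.

Lemma jc_lin_L2 f1 g1 h1 : jc f1 g1 h1 -> cL2 P (lin (g1 a) a b).
Proof.
case=> mj bj _ _; have [_ m2 _] := mj a a0.
by apply: (@lin_L2 (g1 a) a b c) => // x i j; have [_ + _] := bj a x a0.
Qed.

Lemma jc_delta_L2 f1 g1 h1 : jc f1 g1 h1 -> cL2 P (fun x => f1 b x - f1 a x).
Proof.
move=> H; have [m1 _ _] := jc_meas H a0; have [m2 _ _] := jc_meas H b0.
case: H => _ bj _ _; apply: (cL2_bnd P (c := c + c)) => [|x]; first exact: cmeasB.
have [h1' _ _] := bj a x a0; have [h2' _ _] := bj b x b0.
by rewrite (le_trans (ler_cabsB _ _)) // lerD.
Qed.

Lemma jc_rem_L2 f1 g1 h1 : jc f1 g1 h1 -> cL2 P (jrem f1 g1).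
Proof. by move=> H; apply: cL2B; [exact: jc_delta_L2 H|exact: jc_lin_L2 H]. Qed.

(* Boundedness of the increment replaces a fourth moment of the remainder: if the
   remainder is at most the linear part use [|D| <= 2|l|], otherwise
   [|D|^4 <= (2c)^2 (2|r|)^2]. *)
Lemma jc_delta4 f1 g1 h1 : jc f1 g1 h1 ->
  intg P (fun x => cabs (f1 b x - f1 a x) ^+ 4) /\
  Ex P (fun x => cabs (f1 b x - f1 a x) ^+ 4) <= 16 * (c ^+ 4 * 8 ^+ n2 * K4 + c ^+ 3) * (b - a) ^+ 2.
Proof.
move=> H; have LD := jc_delta_L2 H; have [_ ir] := jc_rem_L2 H.
case: (H) => mj bj j3 _; have [_ m2 _] := mj a a0.
have [i4 e4] : intg P (fun x => cabs (lin (g1 a) a b x) ^+ 4) /\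
    Ex P (fun x => cabs (lin (g1 a) a b x) ^+ 4) <= c ^+ 4 * 8 ^+ n2 * K4 * (b - a) ^+ 2.
  by apply: lin_4 => // x i j; have [_ + _] := bj a x a0.
have i2 : intg P (fun x => 16 * cabs (lin (g1 a) a b x) ^+ 4 + 16 * c ^+ 2 * cabs (jrem f1 g1 x) ^+ 2).
  by apply: intgD; exact: intgZ.
have le x : cabs (f1 b x - f1 a x) ^+ 4 <=
    16 * cabs (lin (g1 a) a b x) ^+ 4 + 16 * c ^+ 2 * cabs (jrem f1 g1 x) ^+ 2.
  have [h1' _ _] := bj a x a0; have [h2' _ _] := bj b x b0.
  have D2c : cabs (f1 b x - f1 a x) <= 2 * c.
    by rewrite (le_trans (ler_cabsB _ _)) // mulrDl mul1r lerD.
  have Dlr : cabs (f1 b x - f1 a x) <= cabs (lin (g1 a) a b x) + cabs (jrem f1 g1 x) by exact: cabs_le_dist.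
  move: D2c Dlr (cabs_ge0 (f1 b x - f1 a x)) (cabs_ge0 (lin (g1 a) a b x)) (cabs_ge0 (jrem f1 g1 x)).
  move: (cabs (f1 b x - f1 a x)) (cabs (lin (g1 a) a b x)) (cabs (jrem f1 g1 x)) => D l r D2c Dlr D0 l0 r0.
  have [rl|lr] := leP r l.
    have h : D ^+ 4 <= (2 * l) ^+ 4 by rewrite ler_pXn2r ?nnegrE ?mulr_ge0 //; lra.
    apply: (le_trans h); rewrite exprMn (_ : 2 ^+ 4 = 16); last by ring.
    rewrite lerDl; apply: mulr_ge0; last exact: sqr_ge0.
    by apply: mulr_ge0 => //; exact: sqr_ge0.
  have k1 : D ^+ 2 <= (2 * r) ^+ 2 by rewrite ler_pXn2r ?nnegrE ?mulr_ge0 //; lra.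
  have k2 : D ^+ 2 <= (2 * c) ^+ 2 by rewrite ler_pXn2r ?nnegrE ?mulr_ge0.
  rewrite (exprM _ 2 2) expr2 (le_trans (ler_pM (sqr_ge0 D) (sqr_ge0 D) k2 k1)) //.
  rewrite (_ : (2 * c) ^+ 2 * (2 * r) ^+ 2 = 16 * c ^+ 2 * r ^+ 2); last by ring.
  by rewrite lerDr mulr_ge0 ?exprn_ge0.
have i : intg P (fun x => cabs (f1 b x - f1 a x) ^+ 4).
  apply: intg_le i2 => [|x]; last by rewrite ger0_norm ?exprn_ge0.
  by apply: measurable_funX; apply: cmeas_cabs; case: LD.
split => //; apply: (le_trans (le_Ex i i2 le)); rewrite ExD; [|exact: intgZ..].
rewrite !ExZ // [leRHS]mulrAC [leRHS]mulrDr; apply: lerD.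
  by rewrite -(mulrA 16) ler_wpM2l // mulrC.
apply: (@le_trans _ _ (16 * c ^+ 2 * (c * (b - a) ^+ 2))).
  by apply: ler_wpM2l; [apply: mulr_ge0 => //; exact: sqr_ge0|exact: j3].
by rewrite le_eqVlt; apply/orP; left; apply/eqP; ring.
Qed.

Lemma jc_lin2 f1 g1 h1 : jc f1 g1 h1 ->
  Ex P (fun x => cabs (lin (g1 a) a b x) ^+ 2) <= c ^+ 2 * 2 ^+ n2 * K2 * (b - a).
Proof.
case=> mj bj _ _; have [_ m2 _] := mj a a0.
by apply: lin_sq => // x i j; have [_ + _] := bj a x a0.
Qed.

Lemma jc_delta2 f1 g1 h1 : jc f1 g1 h1 ->
  Ex P (fun x => cabs (f1 b x - f1 a x) ^+ 2) <=
    2 * (c ^+ 2 * 2 ^+ n2 * K2 * (b - a)) + 2 * (c * (b - a) ^+ 2).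
Proof.
move=> H; have [_ iD] := jc_delta_L2 H; have [_ ir] := jc_rem_L2 H; have [_ il] := jc_lin_L2 H.
have e1 := jc_lin2 H; have [_ _ e2 _] := H; have {}e2 := e2 a b a0 ab.
have i : intg P (fun x => 2 * cabs (lin (g1 a) a b x) ^+ 2 + 2 * cabs (jrem f1 g1 x) ^+ 2).
  by apply: intgD; exact: intgZ.
have le x : cabs (f1 b x - f1 a x) ^+ 2 <= 2 * cabs (lin (g1 a) a b x) ^+ 2 + 2 * cabs (jrem f1 g1 x) ^+ 2.
  have -> : f1 b x - f1 a x = lin (g1 a) a b x + jrem f1 g1 x by rewrite /jrem [RHS]addrC subrK.
  by rewrite -mulrDr sqr_ler_cabsD.
apply: (le_trans (le_Ex iD i le)); rewrite ExD; [|exact: intgZ..].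
by rewrite !ExZ // lerD // ler_wpM2l.
Qed.

End Step.

Variables (f f' : R -> T -> C) (g g' : R -> T -> M) (h h' : R -> T -> C).
Hypothesis J : jc f g h.
Hypothesis J' : jc f' g' h'.

Definition mulc : R := 2 * c ^+ 2 + (N * N)%:R * c ^+ 2 + 8 * c ^+ 3 +
  32 * (c ^+ 4 * 8 ^+ n2 * K4 + c ^+ 3) + 3 * (c + c ^+ 2 * 2 ^+ n2 * K2).

Definition mulg (f f' : R -> T -> C) (g g' : R -> T -> M) s x : M := f s x *: g' s x + f' s x *: g s x.
(** Ito's product rule: the last term is the bracket of the two linear parts, as computed in
    [lin_cov]. *)
Definition mulh (f f' : R -> T -> C) (g g' : R -> T -> M) (h h' : R -> T -> C) s x : C :=
  f s x * h' s x + f' s x * h s x - N%:R^-1 * \tr (g s x *m g' s x).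

(** Beyond the cross terms there is the product of the two increments; its mean square calls for
    fourth moments of increments, supplied by [jc_delta4]. *)
Lemma jetc_mul_rem a b : 0 <= a -> a <= b ->
  Ex P (fun x => cabs (f b x * f' b x - f a x * f' a x - lin (mulg f f' g g' a) a b x) ^+ 2) <=
   (8 * c ^+ 3 + 32 * (c ^+ 4 * 8 ^+ n2 * K4 + c ^+ 3)) * (b - a) ^+ 2.
Proof.
move=> a0 ab; have [mj bj j3 j4] := J; have [mj' bj' j3' j4'] := J'.
have [r1 i1] := jc_rem_L2 a0 ab J; have [r2 i2] := jc_rem_L2 a0 ab J'.
have [id ed] := jc_delta4 a0 ab J; have [id' ed'] := jc_delta4 a0 ab J'.
have [mf _ _] := jc_meas J a0; have [mf' _ _] := jc_meas J' a0.
have [mfb _ _] := jc_meas J (le_trans a0 ab); have [mfb' _ _] := jc_meas J' (le_trans a0 ab).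
pose Y x := 4 * c ^+ 2 * cabs (jrem a b f' g' x) ^+ 2 + 4 * c ^+ 2 * cabs (jrem a b f g x) ^+ 2 +
  (cabs (f b x - f a x) ^+ 4 + cabs (f' b x - f' a x) ^+ 4).
have iY : intg P Y by apply: intgD; apply: intgD => //; exact: intgZ.
have E x : f b x * f' b x - f a x * f' a x - lin (mulg f f' g g' a) a b x =
   f a x * jrem a b f' g' x + f' a x * jrem a b f g x + (f b x - f a x) * (f' b x - f' a x).
  have -> : lin (mulg f f' g g' a) a b x = f a x * lin (g' a) a b x + f' a x * lin (g a) a b x.
    by rewrite /lin /mulg mulmxDl -!scalemxAl mxtraceD !mxtraceZ.
  rewrite /jrem; move: (lin _ _ _ _) (lin _ _ _ _) => l1 l2; ring.
have le x : cabs (f b x * f' b x - f a x * f' a x - lin (mulg f f' g g' a) a b x) ^+ 2 <= Y x.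
  rewrite E; have [k1 _ _] := bj a x a0; have [k1' _ _] := bj' a x a0.
  apply: (le_trans (sqr_ler_cabsD _ _)); rewrite mulrDr; apply: lerD.
    apply: (@le_trans _ _ (2 * (2 * (cabs (f a x * jrem a b f' g' x) ^+ 2 + cabs (f' a x * jrem a b f g x) ^+ 2)))).
      by rewrite ler_wpM2l // sqr_ler_cabsD.
    rewrite !cabsM !exprMn mulrDr mulrDr.
    have q (u v : R) : 0 <= u -> u <= c -> 2 * (2 * (u ^+ 2 * v ^+ 2)) <= 4 * c ^+ 2 * v ^+ 2.
      move=> u0 uc; rewrite mulrA (_ : 2 * 2 = 4 :> R); last by ring.
      by rewrite -mulrA ler_wpM2l // ler_wpM2r ?sqr_ge0 // ler_pXn2r ?nnegrE.
    by apply: lerD; exact: q.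
  rewrite cabsM exprMn; move: (cabs (f b x - f a x)) (cabs (f' b x - f' a x)) => u v.
  by rewrite -subr_ge0 (_ : _ - _ = (u ^+ 2 - v ^+ 2) ^+ 2) ?sqr_ge0 //; ring.
have mE : cmeas (fun x => f a x * jrem a b f' g' x + f' a x * jrem a b f g x + (f b x - f a x) * (f' b x - f' a x)).
  apply: cmeasD; first by apply: cmeasD; exact: cmeasM.
  by apply: cmeasM; exact: cmeasB.
have iL : intg P (fun x => cabs (f b x * f' b x - f a x * f' a x - lin (mulg f f' g g' a) a b x) ^+ 2).
  apply: intg_le iY => [|x]; last by rewrite ger0_norm ?sqr_ge0.
  by apply: cmeas_cabs2; under eq_fun do rewrite E.
apply: (le_trans (le_Ex iL iY le)); rewrite /Y.
rewrite ExD; [|by apply: intgD; exact: intgZ|exact: intgD].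
rewrite ExD; [|exact: intgZ..]; rewrite ExD // !ExZ //.
have e1 := j3 a b a0 ab; have e2 := j3' a b a0 ab.
apply: (@le_trans _ _ (4 * c ^+ 2 * (c * (b - a) ^+ 2) + 4 * c ^+ 2 * (c * (b - a) ^+ 2) +
   (16 * (c ^+ 4 * 8 ^+ n2 * K4 + c ^+ 3) * (b - a) ^+ 2 + 16 * (c ^+ 4 * 8 ^+ n2 * K4 + c ^+ 3) * (b - a) ^+ 2))).
  apply: lerD; last exact: lerD.
  have c2 : 0 <= 4 * c ^+ 2 by apply: mulr_ge0 => //; exact: sqr_ge0.
  by apply: lerD; apply: ler_wpM2l.
rewrite le_eqVlt; apply/orP; left; apply/eqP; ring.
Qed.

(** The cross terms are drift clauses with test variables [Z * f] and [Z * f'], still known at time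
    [a]. In the product of increments the linear parts give the bracket exactly, and whatever
    contains a remainder is bounded by Cauchy-Schwarz. *)
Lemma jetc_mul_drift a b Z m : 0 <= a -> a <= b -> 0 <= m -> Fmeas F a Z ->
  (forall x, cabs (Z x) <= m) ->
  cabs (Cexp P (fun x => Z x * (f b x * f' b x - f a x * f' a x - (b - a)%:C * mulh f f' g g' h h' a x)))
    <= m * ((2 * c ^+ 2 + 3 * (c + c ^+ 2 * 2 ^+ n2 * K2)) * rate (b - a)).
Proof.
move=> a0 ab m0 FZ bZ; have [mj bj j3 j4] := J; have [mj' bj' j3' j4'] := J'.
have h0 : 0 <= b - a by rewrite subr_ge0.
have mZ := Fmeas_meas flt a0 FZ.
have [mf mg mh] := mj a a0; have [mf' mg' mh'] := mj' a a0.
have bf x : cabs (f a x) <= c by have [] := bj a x a0.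
have bf' x : cabs (f' a x) <= c by have [] := bj' a x a0.
have bg x i j : cabs (g a x i j) <= c by have [_ + _] := bj a x a0.
have bg' x i j : cabs (g' a x i j) <= c by have [_ + _] := bj' a x a0.
have bh x : cabs (h a x) <= c by have [] := bj a x a0.
have bh' x : cabs (h' a x) <= c by have [] := bj' a x a0.
pose D x := f b x - f a x; pose D' x := f' b x - f' a x.
pose l := lin (g a) a b; pose l' := lin (g' a) a b.
pose r := jrem a b f g; pose r' := jrem a b f' g'.
have LD : cL2 P D := jc_delta_L2 a0 ab J. have LD' : cL2 P D' := jc_delta_L2 a0 ab J'.
have Ll : cL2 P l := jc_lin_L2 a0 ab J. have Ll' : cL2 P l' := jc_lin_L2 a0 ab J'.
have Lr : cL2 P r := jc_rem_L2 a0 ab J. have Lr' : cL2 P r' := jc_rem_L2 a0 ab J'.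
have bZf x : cabs (Z x * f a x) <= m * c by rewrite cabsM ler_pM.
have bZf' x : cabs (Z x * f' a x) <= m * c by rewrite cabsM ler_pM.
have mc0 : 0 <= m * c by exact: mulr_ge0.
have FZf : Fmeas F a (fun x => Z x * f a x) by exact: cmeasM.
have FZf' : Fmeas F a (fun x => Z x * f' a x) by exact: cmeasM.
have e1 := j4' a b _ _ a0 ab mc0 FZf bZf; have e2 := j4 a b _ _ a0 ab mc0 FZf' bZf'.
have mh_ := Fmeas_meas flt a0 mh. have mh'_ := Fmeas_meas flt a0 mh'.
have Lh : cL2 P (fun x => (b - a)%:C * h a x) by apply: cL2Z; exact: cL2_bnd bh.
have Lh' : cL2 P (fun x => (b - a)%:C * h' a x) by apply: cL2Z; exact: cL2_bnd bh'.
pose X1 x := Z x * f a x * (f' b x - f' a x - (b - a)%:C * h' a x).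
pose X2 x := Z x * f' a x * (f b x - f a x - (b - a)%:C * h a x).
pose X3 x := Z x * (l x * r' x + r x * D' x).
pose X4 x := Z x * (l x * l' x).
pose X5 x := Z x * (- ((b - a) / N%:R)%:C * \tr (g a x *m g' a x)).
have i1 : cintg P X1.
  apply: (cintg_bndL2 (Fmeas_meas flt a0 FZf) bZf); exact: cL2B.
have i2 : cintg P X2.
  apply: (cintg_bndL2 (Fmeas_meas flt a0 FZf') bZf'); exact: cL2B.
have LlZ u : cL2 P u -> cL2 P (fun x => Z x * u x) by exact: cL2M_bnd.
have i3 : cintg P X3.
  rewrite /X3; under eq_fun do rewrite mulrDr !mulrA.
  by apply: cintgD; apply: cL2M => //; exact: LlZ.
have i4 : cintg P X4.
  by rewrite /X4; under eq_fun do rewrite mulrA; apply: cL2M => //; exact: LlZ.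
have i5 : cintg P X5.
  apply: (cintg_bndL2 mZ bZ); apply: cL2Z.
  apply: (cL2_bnd P (c := \sum_(i < N) \sum_(j < N) c * c)).
    under eq_fun do rewrite tr_mulE; apply: cmeas_sum => i _; apply: cmeas_sum => j _.
    by apply: cmeasM; [exact: (Fmeas_meas flt a0 (mg i j))|exact: (Fmeas_meas flt a0 (mg' j i))].
  move=> x; rewrite tr_mulE (le_trans (ler_cabs_sum _ _ _)) // ler_sum // => i _.
  rewrite (le_trans (ler_cabs_sum _ _ _)) // ler_sum // => j _.
  by rewrite cabsM; apply: ler_pM.
have E x : Z x * (f b x * f' b x - f a x * f' a x - (b - a)%:C * mulh f f' g g' h h' a x) =
    X1 x + X2 x + (X3 x + (X4 x - X5 x)).
  rewrite /X1 /X2 /X3 /X4 /X5 /mulh /r /r' /jrem -/l -/l' /D'.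
  have -> : ((b - a) / N%:R)%:C = (b - a)%:C * N%:R^-1 :> C.
    by rewrite rmorphM fmorphV rmorph_nat.
  move: (l x) (l' x) (\tr _) => u v w; ring.
(* No error at all here: the product of linear parts has exactly the bracket as its mean against
   [Z]. *)
have E45 : Cexp P (fun x => X4 x - X5 x) = 0.
  rewrite CexpB // /X4 /X5.
  pose c' := m + c; have c'0 : 0 <= c' by exact: addr_ge0.
  have mc' : m <= c' by rewrite lerDl.
  have cc' : c <= c' by rewrite lerDr.
  rewrite (@lin_cov (g a) (g' a) Z a b c') ?subrr // => [x i j|x i j|x].
  - exact: le_trans (bg x i j) cc'.
  - exact: le_trans (bg' x i j) cc'.
  - exact: le_trans (bZ x) mc'.
under eq_Cexp do rewrite E.
rewrite CexpD; [|exact: cintgD|by apply: cintgD => //; exact: cintgB].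
rewrite CexpD // CexpD //; last exact: cintgB.
rewrite E45 addr0.
have B3 : cabs (Cexp P X3) <= m * (3 * (c + c ^+ 2 * 2 ^+ n2 * K2) * rate (b - a)).
  pose B := c + c ^+ 2 * 2 ^+ n2 * K2.
  have A0 : 0 <= c ^+ 2 * 2 ^+ n2 * K2.
    by apply: mulr_ge0 K2_ge0; apply: mulr_ge0; [exact: sqr_ge0|exact: exprn_ge0].
  have B0 : 0 <= B by exact: addr_ge0.
  have ra0 := rate_ge0 h0.
  (* The products of second moments met below are of orders 3 and 4 in the step; this is their
     common square root. *)
  have rate2 : (b - a) ^+ 3 + (b - a) ^+ 4 <= rate (b - a) ^+ 2.
    rewrite /rate; move: (b - a) h0 => y y0; have s2 := sqr_sqrtr y0; have s0 := sqrtr_ge0 y.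
    move: (Num.sqrt y) s2 s0 => s <- s0.
    rewrite -subr_ge0 (_ : _ - _ = 2 * s ^+ 7); last by ring.
    by rewrite mulr_ge0 ?exprn_ge0.
  have CSl u v p q k : cL2 P u -> cL2 P v -> Ex P (fun x => cabs (u x) ^+ 2) <= p ->
      Ex P (fun x => cabs (v x) ^+ 2) <= q -> 0 <= k -> p * q <= (k * rate (b - a)) ^+ 2 ->
      intg P (fun x => cabs (u x) * cabs (v x)) /\
      Ex P (fun x => cabs (u x) * cabs (v x)) <= k * rate (b - a).
    move=> [mu_ iu] [mv_ iv] ep eq_ k0 pq.
    have mu' := cmeas_cabs mu_; have mv' := cmeas_cabs mv_.
    split; first exact: intgM.
    have := Ex_CS mu' mv' iu iv.
    have -> : (fun x => `|cabs (u x) * cabs (v x)|) = (fun x => cabs (u x) * cabs (v x)).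
      by apply/funext => x; rewrite ger0_norm ?mulr_ge0.
    move=> H; apply: (le_trans H); rewrite -sqrtrM; last by apply: Ex_ge0 => x; exact: sqr_ge0.
    rewrite -[leRHS]ger0_norm ?mulr_ge0 // -sqrtr_sqr ler_wsqrtr //.
    by apply: le_trans pq; apply: ler_pM => //; apply: Ex_ge0 => x; exact: sqr_ge0.
  have [k1 k2] : intg P (fun x => cabs (l x) * cabs (r' x)) /\
      Ex P (fun x => cabs (l x) * cabs (r' x)) <= B * rate (b - a).
    apply: (CSl l r' _ _ B Ll Lr' (jc_lin2 a0 ab J) (j3' a b a0 ab) B0).
    rewrite exprMn; apply: (@le_trans _ _ (B ^+ 2 * ((b - a) ^+ 3 + (b - a) ^+ 4))); last first.
      by rewrite ler_wpM2l ?sqr_ge0.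
    rewrite (_ : c ^+ 2 * 2 ^+ n2 * K2 * (b - a) * (c * (b - a) ^+ 2) =
      c ^+ 2 * 2 ^+ n2 * K2 * c * (b - a) ^+ 3); last by ring.
    apply: ler_pM; rewrite ?mulr_ge0 ?exprn_ge0 ?K2_ge0 //; last by rewrite lerDl exprn_ge0.
    by rewrite expr2; apply: ler_pM => //; rewrite /B ?lerDl ?lerDr.
  have [k3 k4] : intg P (fun x => cabs (r x) * cabs (D' x)) /\
      Ex P (fun x => cabs (r x) * cabs (D' x)) <= 2 * B * rate (b - a).
    have B20 : 0 <= 2 * B by exact: mulr_ge0.
    apply: (CSl r D' _ _ (2 * B) Lr LD' (j3 a b a0 ab) (jc_delta2 a0 ab J') B20).
    rewrite exprMn; apply: (@le_trans _ _ ((2 * B) ^+ 2 * ((b - a) ^+ 3 + (b - a) ^+ 4))); last first.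
      by rewrite ler_wpM2l ?sqr_ge0.
    rewrite (_ : c * (b - a) ^+ 2 * (2 * (c ^+ 2 * 2 ^+ n2 * K2 * (b - a)) + 2 * (c * (b - a) ^+ 2)) =
      2 * (c ^+ 2 * 2 ^+ n2 * K2 * c) * (b - a) ^+ 3 + 2 * (c * c) * (b - a) ^+ 4); last by ring.
    have cB : c <= B by rewrite lerDl.
    have AB : c ^+ 2 * 2 ^+ n2 * K2 <= B by rewrite lerDr.
    have BB : 2 * (B * B) <= (2 * B) ^+ 2.
      by rewrite (_ : (2 * B) ^+ 2 = 2 * (B * B) + 2 * (B * B)) ?lerDl ?mulr_ge0 //; ring.
    rewrite mulrDr; apply: lerD; (apply: ler_wpM2r; first exact: exprn_ge0).
      by apply: le_trans BB; rewrite ler_wpM2l //; apply: ler_pM.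
    by apply: le_trans BB; rewrite ler_wpM2l //; apply: ler_pM.
  apply: (le_trans (cabs_Cexp_le (Y := fun x => m * (cabs (l x) * cabs (r' x) + cabs (r x) * cabs (D' x))) i3 _ _)).
  - by apply: intgZ; exact: intgD.
  - move=> x; rewrite /X3 cabsM; apply: ler_pM => //.
    by rewrite (le_trans (ler_cabsD _ _)) // !cabsM.
  rewrite ExZ; last exact: intgD.
  rewrite ExD // ler_wpM2l // (le_trans (lerD k2 k4)) // -/B le_eqVlt; apply/orP; left; apply/eqP; ring.
rewrite (le_trans (ler_cabsD _ _)) //.
apply: (@le_trans _ _ ((m * c * (c * rate (b - a)) + m * c * (c * rate (b - a))) +
   m * (3 * (c + c ^+ 2 * 2 ^+ n2 * K2) * rate (b - a)))).
  by apply: lerD => //; rewrite (le_trans (ler_cabsD _ _)) // lerD.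
rewrite le_eqVlt; apply/orP; left; apply/eqP; ring.
Qed.

Lemma jetc_mul : jetc mulc (fun s x => f s x * f' s x) (mulg f f' g g') (mulh f f' g g' h h').
Proof.
have [mj bj j3 j4] := J; have [mj' bj' j3' j4'] := J'.
have A0 : 0 <= c ^+ 2 * 2 ^+ n2 * K2.
  by apply: mulr_ge0 K2_ge0; apply: mulr_ge0; [exact: sqr_ge0|exact: exprn_ge0].
have A4 : 0 <= c ^+ 4 * 8 ^+ n2 * K4.
  by apply: mulr_ge0 K4_ge0; apply: mulr_ge0; exact: exprn_ge0.
have c2 : 0 <= c ^+ 2 by exact: sqr_ge0.
have c3 : 0 <= c ^+ 3 by exact: exprn_ge0.
have nc : 0 <= (N * N)%:R * c ^+ 2 by exact: mulr_ge0.
have cc := c0.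
split=> [s s0|s x s0|a b a0 ab|a b Z m a0 ab m0 FZ bZ].
- have [m1 m2 m3] := mj s s0; have [m1' m2' m3'] := mj' s s0; split; first exact: cmeasM.
    move=> i j; rewrite /mulg; under eq_fun do rewrite mxaddE !mxscaleE.
    by apply: cmeasD; apply: cmeasM => //; [exact: m2'|exact: m2].
  apply: cmeasB; first by apply: cmeasD; exact: cmeasM.
  apply: cmeasM; first exact: cmeas_cst.
  under eq_fun do rewrite tr_mulE; apply: cmeas_sum => i _; apply: cmeas_sum => j _.
  by apply: cmeasM; [exact: m2|exact: m2'].
- have [m1 m2 m3] := bj s x s0; have [m1' m2' m3'] := bj' s x s0.
  have M2 z w : cabs z <= c -> cabs w <= c -> cabs (z * w) <= c ^+ 2.
    by move=> z1 w1; rewrite cabsM expr2; apply: ler_pM.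
  have l1 : c ^+ 2 <= mulc by rewrite /mulc; lra.
  have l2 : 2 * c ^+ 2 <= mulc by rewrite /mulc; lra.
  have l3 : 2 * c ^+ 2 + (N * N)%:R * c ^+ 2 <= mulc by rewrite /mulc; lra.
  split; first by apply: le_trans l1; exact: M2.
    move=> i j; apply: le_trans l2; rewrite mxaddE !mxscaleE (le_trans (ler_cabsD _ _)) //.
    by rewrite mulrDl mul1r lerD // M2.
  apply: le_trans l3; rewrite (le_trans (ler_cabsB _ _)) // lerD //.
    by rewrite (le_trans (ler_cabsD _ _)) // mulrDl mul1r lerD // M2.
  rewrite cabsM; have -> : cabs (N%:R^-1 : C) = N%:R^-1.
    by rewrite (_ : N%:R^-1 = (N%:R^-1)%:C :> C) ?cabs_real ?ger0_norm // fmorphV rmorph_nat.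
  apply: (@le_trans _ _ (1 * ((N * N)%:R * c ^+ 2))); last by rewrite mul1r.
  apply: ler_pM => //; first by rewrite invf_le1 ?ler1n ?ltr0n.
  rewrite tr_mulE (@le_trans _ _ (\sum_(i < N) \sum_(j < N) c ^+ 2)) //.
    rewrite (le_trans (ler_cabs_sum _ _ _)) // ler_sum // => i _.
    rewrite (le_trans (ler_cabs_sum _ _ _)) // ler_sum // => j _; exact: M2.
  by rewrite !sumr_const !card_ord -mulrnA mulr_natl.
- apply: (le_trans (jetc_mul_rem a0 ab)); rewrite ler_wpM2r ?sqr_ge0 // /mulc; lra.
- apply: (le_trans (jetc_mul_drift a0 ab m0 FZ bZ)); rewrite ler_wpM2l // ler_wpM2r.
    by [].
    by apply: rate_ge0; rewrite subr_ge0.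
  by rewrite /mulc; lra.
Qed.

End Two.

Lemma jet_common f g h f' g' h' : jet f g h -> jet f' g' h' ->
  exists2 c, 1 <= c & jetc c f g h /\ jetc c f' g' h'.
Proof.
move=> [c c1 J] [c' c1' J']; exists (c + c'); first by rewrite (le_trans c1) // lerDl (le_trans _ c1').
split; first by apply: jetc_mono J; rewrite lerDl (le_trans _ c1').
by apply: jetc_mono J'; rewrite lerDr (le_trans _ c1).
Qed.

Lemma jet_mul f g h f' g' h' : jet f g h -> jet f' g' h' ->
  jet (fun s x => f s x * f' s x) (mulg f f' g g') (mulh f f' g g' h h').
Proof.
move=> J J'; have [c c1 [j j']] := jet_common J J'; exists (1 + mulc c).
  rewrite lerDl /mulc; have c0 : 0 <= c by exact: le_trans c1.
  have h2 := K2_ge0; have h4 := K4_ge0.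
  by repeat (apply: addr_ge0 || apply: mulr_ge0 || apply: exprn_ge0 || assumption || done).
by apply: jetc_mono (jetc_mul c1 j j'); rewrite lerDr.
Qed.

Section Entry.
Variable U : R -> T -> M.
Hypothesis adU : adapted F U.
Hypothesis unU : forall s x, 0 <= s -> U s x \is unitarymx.
Hypothesis cU : continuous_paths U.
Hypothesis itoU : forall t, 0 <= t ->
  exists2 I : T -> M, is_ito_integral P F K t U I &
    {ae P, forall x, U t x = 1%:M + I x - 2^-1 *: time_integral U t x}.

(** The only place where the stochastic equation enters the calculus: everything else is generated
    from matrix entries by products, sums and conjugation. *)
Lemma jet_entry i j : jet (fun s x => U s x i j) (fun s x => delta_mx j i *m U s x)
  (fun s x => - 2^-1 * U s x i j).
Proof.
pose c : R := 2 + (8 * Cstep N + 2 * (N * N)%:R) + Num.sqrt (Cstep N).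
have C0 : 0 <= Cstep N :> R by exact: Cstep_ge0.
have s0' : 0 <= Num.sqrt (Cstep N) :> R by exact: sqrtr_ge0.
have n0 : 0 <= (N * N)%:R :> R by [].
exists c; first by rewrite /c; lra.
split=> [s s0|s x s0|a b a0 ab|a b Z m a0 ab m0 FZ bZ].
- split=> [|k l|]; [exact: U_Fmeas| |by apply: cmeasM; [exact: cmeas_cst|exact: U_Fmeas]].
  under eq_fun do rewrite mxE; apply: cmeas_sum => n _.
  by under eq_fun do rewrite mxE; apply: cmeasM; [exact: cmeas_cst|exact: U_Fmeas].
- have U1 k l := U_le1 unU x k l s0.
  have c2 : 1 <= c by rewrite /c; lra.
  split=> [|k l|]; first exact: le_trans c2.
    apply: le_trans c2; rewrite mxE (bigD1 i) //= mxE eqxx andbT big1 ?addr0 => [|n ni].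
      by case: (k == j); rewrite ?mul1r ?mul0r ?cabs0.
    by rewrite mxE (negbTE ni) andbF mul0r.
  apply: le_trans c2; rewrite cabsM cabsN.
  have -> : cabs (2^-1 : C) = 2^-1.
    by rewrite (_ : 2^-1 = (2^-1)%:C :> C) ?cabs_real ?ger0_norm // fmorphV rmorph_nat.
  by have := U1 i j; lra.
- have [ir er] := rem_sq N0 flt bm adU unU cU itoU a0 ab.
  have E : (fun x => cabs (U b x i j - U a x i j - lin (fun x => delta_mx j i *m U a x) a b x) ^+ 2) =
      (fun x => cabs (rem K U a b x i j) ^+ 2).
    by apply/funext => x; rewrite /lin -mulmxA tr_delta !mxsubE.
  have iE : intg P (fun x => cabs (rem K U a b x i j) ^+ 2).
    apply: intg_le ir => [|x]; last by rewrite ger0_norm ?sqr_ge0 // entry_le_sqnorm.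
    by apply: cmeas_cabs2; exact: (rem_meas flt bm adU i j a0 ab).
  rewrite E; apply: (@le_trans _ _ (Ex P (fun x => sqnorm (rem K U a b x)))).
    by apply: le_Ex => // x; exact: entry_le_sqnorm.
  apply: (le_trans er); rewrite ler_wpM2r ?sqr_ge0 // /c; lra.
- have h0 : 0 <= b - a by rewrite subr_ge0.
  have := dU_mean N0 flt bm adU unU cU itoU i j a0 ab m0 FZ bZ.
  have -> : (fun x => Z x * ((U b x - U a x) i j + ((b - a) / 2)%:C * U a x i j)) =
    (fun x => Z x * (U b x i j - U a x i j - (b - a)%:C * (- 2^-1 * U a x i j))).
    apply/funext => x; rewrite mxsubE; have -> : ((b - a) / 2)%:C = (b - a)%:C * 2^-1 :> C.
      by rewrite rmorphM fmorphV rmorph_nat.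
    by move: (U b x i j) (U a x i j) => u v; ring.
  move=> H; apply: (le_trans H); rewrite ler_wpM2l // sqrtrM // mulrCA.
  apply: ler_pM => //; first by apply: mulr_ge0 => //; exact: sqrtr_ge0.
    by rewrite /c; lra.
  by rewrite /rate lerDl sqr_ge0.
Qed.

End Entry.
End Jets.

(** * Approximate differential equations *)

Section EulerPairs.
Context {R : realType}.
Local Notation C := R[i].

(* A quantitative form of [f' = g] on [0, 1]. *)
Definition eulerc (c : R) (f g : R -> C) : Prop :=
  (forall s, 0 <= s <= 1 -> cabs (f s) <= c /\ cabs (g s) <= c) /\
  forall a b, 0 <= a -> a <= b -> b <= 1 ->
    cabs (f b - f a - (b - a)%:C * g a) <= c * ((b - a) * Num.sqrt (b - a)).

Definition euler f g := exists2 c : R, 0 <= c & eulerc c f g.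

Lemma euler_ext f g f' g' : (forall s, 0 <= s <= 1 -> f s = f' s) ->
  (forall s, 0 <= s <= 1 -> g s = g' s) -> euler f g -> euler f' g'.
Proof.
move=> Ef Eg [c c0 [h1 h2]]; exists c => //; split=> [s s1|a b a0 ab b1].
  by rewrite -Ef // -Eg //; exact: h1.
have [b0 a1] := (le_trans a0 ab, le_trans ab b1).
by rewrite -!Ef ?a0 ?b0 // -Eg ?a0 //; exact: h2.
Qed.

Lemma eulerc_mono c c' f g : c <= c' -> eulerc c f g -> eulerc c' f g.
Proof.
move=> cc [h1 h2]; split=> [s /h1[k1 k2]|a b a0 ab b1]; first by split; exact: le_trans cc.
apply: (le_trans (h2 a b a0 ab b1)); rewrite ler_wpM2r // mulr_ge0 ?subr_ge0 //.
Qed.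

Lemma euler_common f g f' g' : euler f g -> euler f' g' ->
  exists2 c, 0 <= c & eulerc c f g /\ eulerc c f' g'.
Proof.
move=> [c c0 J] [c' c0' J']; exists (c + c'); first exact: addr_ge0.
by split; [apply: eulerc_mono J|apply: eulerc_mono J']; rewrite ?lerDl ?lerDr.
Qed.

Lemma euler_cst (z : C) : euler (fun=> z) (fun=> 0).
Proof.
exists (cabs z) => //; split=> [s _|a b a0 ab b1]; first by rewrite cabs0.
by rewrite subrr mulr0 subr0 cabs0 mulr_ge0 // mulr_ge0 ?subr_ge0.
Qed.

Lemma euler_add f g f' g' : euler f g -> euler f' g' ->
  euler (fun s => f s + f' s) (fun s => g s + g' s).
Proof.
move=> J J'; have [c c0 [[h1 h2] [h1' h2']]] := euler_common J J'.
exists (c + c); first exact: addr_ge0.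
split=> [s s1|a b a0 ab b1].
  have [k1 k2] := h1 s s1; have [k1' k2'] := h1' s s1.
  by split; rewrite (le_trans (ler_cabsD _ _)) // lerD.
have -> : f b + f' b - (f a + f' a) - (b - a)%:C * (g a + g' a) =
  (f b - f a - (b - a)%:C * g a) + (f' b - f' a - (b - a)%:C * g' a) by ring.
by rewrite mulrDl (le_trans (ler_cabsD _ _)) // lerD // ?h2 ?h2'.
Qed.

Lemma euler_mul f g f' g' : euler f g -> euler f' g' ->
  euler (fun s => f s * f' s) (fun s => f s * g' s + f' s * g s).
Proof.
move=> J J'; have [c c0 [[h1 h2] [h1' h2']]] := euler_common J J'.
exists (6 * (c * c)); first by rewrite mulr_ge0 // mulr_ge0.
have cc0 : 0 <= c * c by exact: mulr_ge0.
split=> [s s1|a b a0 ab b1].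
  have [k1 k2] := h1 s s1; have [k1' k2'] := h1' s s1.
  have M z w : cabs z <= c -> cabs w <= c -> cabs (z * w) <= c * c by move=> *; rewrite cabsM ler_pM.
  split; first by rewrite (le_trans (M _ _ k1 k1')) // ler_peMl // ler1n.
  rewrite (le_trans (ler_cabsD _ _)) // (le_trans (lerD (M _ _ k1 k2') (M _ _ k1' k2))) //; lra.
set y := b - a; have y0 : 0 <= y by rewrite subr_ge0.
have y1 : y <= 1 by rewrite lerBlDr (le_trans b1) // lerDl.
have s0 := sqrtr_ge0 y; set sy := Num.sqrt y in s0 *.
have s2 : sy ^+ 2 = y by exact: sqr_sqrtr.
have sy1 : sy <= 1 by rewrite -sqrtr1 ler_wsqrtr.
have [k1 k2] : cabs (f a) <= c /\ cabs (g a) <= c by apply: h1; rewrite a0 (le_trans ab).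
have [k1' k2'] : cabs (f' a) <= c /\ cabs (g' a) <= c by apply: h1'; rewrite a0 (le_trans ab).
pose r := f b - f a - y%:C * g a; pose r' := f' b - f' a - y%:C * g' a.
have hr : cabs r <= c * (y * sy) by exact: h2.
have hr' : cabs r' <= c * (y * sy) by exact: h2'.
have ysy : y * sy <= y by rewrite ler_piMr.
have D z w : cabs z <= c * (y * sy) -> cabs w <= c -> cabs (y%:C * w + z) <= 2 * (c * y).
  move=> zr wc; rewrite (le_trans (ler_cabsD _ _)) // cabsM cabs_real ger0_norm //.
  have e1 : y * cabs w <= c * y by rewrite mulrC ler_wpM2r.
  have e2 : cabs z <= c * y by rewrite (le_trans zr) // ler_wpM2l.
  lra.
have -> : f b * f' b - f a * f' a - y%:C * (f a * g' a + f' a * g a) =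
   f a * r' + f' a * r + (y%:C * g a + r) * (y%:C * g' a + r') by rewrite /r /r'; ring.
have e1 : cabs (f a * r') <= c * c * (y * sy) by rewrite cabsM -mulrA ler_pM.
have e2 : cabs (f' a * r) <= c * c * (y * sy) by rewrite cabsM -mulrA ler_pM.
have e3 : cabs ((y%:C * g a + r) * (y%:C * g' a + r')) <= 4 * (c * c * (y * sy)).
  rewrite cabsM (le_trans (ler_pM _ _ (D _ _ hr k2) (D _ _ hr' k2'))) //.
  rewrite (_ : 2 * (c * y) * (2 * (c * y)) = 4 * (c * c * (y * y))); last by ring.
  rewrite ler_wpM2l // ler_wpM2l // ler_wpM2l // -[X in X <= _]s2 expr2 ler_piMl //.
rewrite (le_trans (ler_cabsD _ _)) // (le_trans (lerD (ler_cabsD _ _) (lexx _))) //.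
rewrite (le_trans (lerD (lerD e1 e2) e3)) // le_eqVlt; apply/orP; left; apply/eqP; ring.
Qed.

Lemma euler_scale (z : C) f g : euler f g -> euler (fun s => z * f s) (fun s => z * g s).
Proof.
move=> J; apply: euler_ext (euler_mul (euler_cst z) J) => s _ //.
by rewrite mulr0 addr0.
Qed.

Lemma euler_sum (I : Type) (r : seq I) (f g : I -> R -> C) : (forall i, euler (f i) (g i)) ->
  euler (fun s => \sum_(i <- r) f i s) (fun s => \sum_(i <- r) g i s).
Proof.
move=> H; elim: r => [|i r IH].
  by apply: euler_ext (euler_cst 0) => s _; rewrite big_nil.
by apply: euler_ext (euler_add (H i) IH) => s _; rewrite big_cons.
Qed.

Lemma euler_prod q (f g : 'I_q -> R -> C) : (forall i, euler (f i) (g i)) ->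
  euler (fun s => \prod_i f i s) (fun s => \sum_i g i s * \prod_(j | j != i) f j s).
Proof.
elim: q f g => [|q IH] f g H.
  by apply: euler_ext (euler_cst 1) => s _; rewrite big_ord0.
have H' i : euler (f (lift ord0 i)) (g (lift ord0 i)) by exact: H.
apply: euler_ext (euler_mul (H ord0) (IH _ _ H')) => s _; first by rewrite big_ord_recl.
rewrite big_ord_recl addrC; congr (_ + _).
  rewrite mulrC; congr (_ * _); rewrite [RHS]big_mkcond big_ord_recl /= mul1r.
  by apply: eq_bigr => i _.
rewrite mulr_sumr; apply: eq_bigr => i _; rewrite mulrCA; congr (_ * _).
rewrite [RHS]big_mkcond big_ord_recl /=; congr (_ * _).
by rewrite [LHS]big_mkcond; apply: eq_bigr => j _.
Qed.

(* Telescoping over [n] steps: the errors add up to [n * (s / n)^(3/2)]. *)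
Lemma mean_value_bound f g (phi Phi : R -> R) (s : R) : euler f g -> 0 <= s <= 1 ->
  (forall u, 0 <= u <= 1 -> cabs (g u) <= phi u) ->
  (forall a b, 0 <= a -> a <= b -> b <= 1 -> (b - a) * phi a <= Phi b - Phi a) ->
  cabs (f s) <= cabs (f 0) + (Phi s - Phi 0).
Proof.
move=> [c c0 [bf ef]] /andP[s0 s1] gphi PhiP; apply/ler_addgt0Pr => e e0.
(* The accumulated error is at most [c] times the square root of [1 / n], which this choice makes at
   most [e]. *)
pose n := (Num.truncn ((c / e) ^+ 2)).+1.
have nP : (c / e) ^+ 2 <= n%:R by rewrite ltW // truncnS_gt.
pose h := s / n%:R; have h0 : 0 <= h by rewrite divr_ge0.
have hn : h <= n%:R^-1 by rewrite /h ler_piMl // invr_ge0 ltW.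
have H k : (k <= n)%N -> cabs (f (k%:R * h)) <=
    cabs (f 0) + (Phi (k%:R * h) - Phi 0) + k%:R * (c * (h * Num.sqrt h)).
  elim: k => [_|k IH kn]; first by rewrite !mul0r subrr !addr0.
  have kh0 : 0 <= k%:R * h by exact: mulr_ge0.
  have khs : k%:R * h <= k.+1%:R * h by rewrite ler_wpM2r // ler_nat.
  have kh1 : k.+1%:R * h <= 1.
    apply: le_trans s1; rewrite /h mulrCA ler_piMr // ler_pdivrMr // mul1r ler_nat //.
  have hE : k.+1%:R * h - k%:R * h = h by rewrite -mulrBl -natrB // subSnn mul1r.
  have e1 := ef _ _ kh0 khs kh1; rewrite hE in e1.
  have e2 := gphi (k%:R * h); rewrite kh0 (le_trans khs kh1) in e2; have {}e2 := e2 isT.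
  have e3 := PhiP _ _ kh0 khs kh1; rewrite hE in e3.
  have e4 := IH (ltnW kn).
  have e5 : cabs (f (k.+1%:R * h)) <= cabs (f (k%:R * h)) + h * cabs (g (k%:R * h)) + c * (h * Num.sqrt h).
    have -> : f (k.+1%:R * h) = f (k%:R * h) + h%:C * g (k%:R * h) +
       (f (k.+1%:R * h) - f (k%:R * h) - h%:C * g (k%:R * h)) by ring.
    apply: (le_trans (ler_cabsD _ _)); apply: lerD => //.
    by apply: (le_trans (ler_cabsD _ _)); rewrite cabsM cabs_real ger0_norm.
  have e6 : h * cabs (g (k%:R * h)) <= h * phi (k%:R * h) by rewrite ler_wpM2l.
  have -> : k.+1%:R * (c * (h * Num.sqrt h)) = k%:R * (c * (h * Num.sqrt h)) + c * (h * Num.sqrt h).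
    by rewrite -[k.+1%:R]natr1 mulrDl mul1r.
  move: e3 e4 e5 e6; move: (cabs (f _)) (cabs (f _)) (cabs (f _)) (Phi _) (Phi _) (Phi _).
  move: (c * (h * _)) => u; move: (k%:R * u) (h * _) (h * _) => *; lra.
have sE : n%:R * h = s by rewrite /h mulrCA divff ?mulr1 // gt_eqF.
have := H n (leqnn _); rewrite sE => Hs; apply: (le_trans Hs); rewrite lerD2l.
have -> : n%:R * (c * (h * Num.sqrt h)) = c * (s * Num.sqrt h) by rewrite -[in RHS]sE; ring.
have sh : Num.sqrt h <= Num.sqrt (n%:R^-1) by rewrite ler_wsqrtr.
apply: (@le_trans _ _ (c * Num.sqrt (n%:R^-1))).
  rewrite ler_wpM2l // (le_trans _ sh) // ler_piMl //.
have sn0 : 0 < Num.sqrt n%:R :> R by rewrite sqrtr_gt0.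
rewrite sqrtrV ?ler0n // ler_pdivrMr // -ler_pdivrMl // mulrC.
by rewrite -[leLHS]ger0_norm ?divr_ge0 ?(ltW e0) // -sqrtr_sqr ler_wsqrtr.
Qed.

(* The family is infinite and only known to be bounded by [S0]: each pass through
   the equation halves the part of the bound that depends on [S0]. *)
Lemma gronwall (I : Type) (f g : I -> R -> C) (A delta S0 : R) : 0 < A -> 0 <= delta ->
  (forall i, euler (f i) (g i)) -> (forall i, f i 0 = 0) ->
  (forall i s, 0 <= s <= 1 -> cabs (f i s) <= S0) ->
  (forall s, 0 <= s <= 1 -> forall S, 0 <= S -> (forall j, cabs (f j s) <= S) ->
     forall i, cabs (g i s) <= A * S + delta) ->
  forall i s, 0 <= s <= 1 -> cabs (f i s) <= 2 * delta * expR (2 * A).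
Proof.
move=> A0 d0 ef f0 apriori H.
have [S1|S1] := ltP S0 0.
  by move=> i s s1; have := apriori i s s1; rewrite leNgt (lt_le_trans S1).
(* With the weight [expR (2 * A * s)], of rate twice [A], integrating [A * V n] costs a factor 1/2,
   so [V n.+1 = delta + V n / 2]; the fixed point is [2 * delta]. *)
pose V n : R := 2 * delta + S0 / 2 ^+ n.
have V0 n : 0 <= V n by rewrite addr_ge0 ?mulr_ge0 ?divr_ge0 ?exprn_ge0.
have valid n i s : 0 <= s <= 1 -> cabs (f i s) <= V n * expR (2 * A * s).
  elim: n i s => [|n IH] i s s01; have /andP[s0 s1] := s01.
    apply: (le_trans (apriori i s s01)); rewrite /V expr0 divr1.
    apply: (@le_trans _ _ (2 * delta + S0)); first by rewrite lerDr mulr_ge0.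
    rewrite ler_peMr ?addr_ge0 ?mulr_ge0 // -expR0 ler_expR.
    by apply: mulr_ge0 => //; rewrite mulr_ge0 // ltW.
  pose phi u := A * (V n * expR (2 * A * u)) + delta.
  pose Phi u := delta * u + V n / 2 * expR (2 * A * u).
  have := @mean_value_bound (f i) (g i) phi Phi s (ef i) s01.
  rewrite f0 cabs0 add0r => mv; apply: (le_trans (mv _ _)).
  - by move=> u u01; apply: H => // [|j]; [apply: mulr_ge0 => //; exact: expR_ge0|exact: IH].
  - move=> a b a0 ab b1; rewrite /phi /Phi.
    have e : expR (2 * A * a) * (1 + 2 * A * (b - a)) <= expR (2 * A * b).
      have -> : 2 * A * b = 2 * A * a + 2 * A * (b - a) by ring.
      by rewrite expRD ler_wpM2l ?expR_ge0 // expR_ge1Dx.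
    have vh : 0 <= V n / 2 by rewrite divr_ge0.
    have e' := ler_wpM2l vh e.
    have -> : (b - a) * (A * (V n * expR (2 * A * a)) + delta) =
      delta * b - delta * a + (V n / 2 * (expR (2 * A * a) * (1 + 2 * A * (b - a))) - V n / 2 * expR (2 * A * a)).
      by field.
    lra.
  - rewrite /Phi mulr0 add0r mulr0 expR0 mulr1.
    have eA : 1 <= expR (2 * A * s).
      by rewrite -expR0 ler_expR; apply: mulr_ge0 => //; rewrite mulr_ge0 // ltW.
    have -> : V n.+1 = delta + V n / 2 by rewrite /V exprS; field; rewrite expf_neq0.
    have e1 : delta * s <= delta * expR (2 * A * s) by rewrite ler_wpM2l // (le_trans s1).
    have e2 : 0 <= V n / 2 by rewrite divr_ge0.
    rewrite (mulrDl delta); move: e1 e2; move: (V n / 2) (delta * expR _) (delta * s) => v ? ?; move=> h1 h2.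
    have := ler_wpM2l h2 eA; move: h1; move: (v * expR _) => *; lra.
move=> i s s01; have /andP[s0 s1] := s01; apply/ler_addgt0Pr => e e0.
have es : expR (2 * A * s) <= expR (2 * A).
  by rewrite ler_expR ler_piMr // mulr_ge0 // ltW.
pose K := S0 * expR (2 * A) / e.
pose n := (Num.truncn K).+1.
have nK : K <= 2 ^+ n.
  apply: (@le_trans _ _ n%:R); first by rewrite ltW // truncnS_gt.
  by rewrite -natrX ler_nat ltnW // ltn_expl.
apply: (le_trans (valid n i s s01)).
apply: (@le_trans _ _ (V n * expR (2 * A))); first by rewrite ler_wpM2l.
rewrite /V mulrDl lerD2l mulrAC ler_pdivrMr ?exprn_gt0 //.
by rewrite (mulrC e) -ler_pdivrMr.
Qed.

End EulerPairs.

(** * Independent processes run at different speeds *)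

Section ProductJets.
Context {R : realType} d (T : measurableType d) (P : probability T R).
Variables (N q : nat).
Hypothesis N0 : (0 < N)%N.
Local Notation C := R[i].
Local Notation M := 'M[C]_N.
Variables (F : 'I_q -> R -> set (set T)) (K : 'I_q -> R -> T -> M).
Hypothesis flt : forall i, filtration (F i).
Hypothesis bm : forall i, uN_brownian P (F i) (K i).
Variable G : 'I_q -> set (set T).
Hypothesis Gsub : forall i, <<s G i>> `<=` measurable.
Hypothesis Gind : forall A : 'I_q -> set T, (forall i, <<s G i>> (A i)) ->
  P (\bigcap_i A i) = (\prod_(i < q) P (A i))%E.
Variable t : 'I_q -> R.
Hypothesis t0 : forall i, 0 <= t i.

Definition Gmeas i (Z : T -> C) := @cmeas R _ (g_sigma_algebraType (G i)) Z.

(** Two kinds of measurability are kept side by side: [F i] carries the calculus of the [i]-th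
    motion, while independence is assumed only of the sigma-algebras [G i], later those generated by
    the processes themselves. *)
Definition pjet i f g h := jet P (F i) (K i) f g h /\
  forall s, 0 <= s ->
    [/\ Gmeas i (f s), forall a b, Gmeas i (fun x => g s x a b) & Gmeas i (h s)].

Lemma pjet_ext i f g h f' g' h' : (forall s x, f s x = f' s x) -> (forall s x, g s x = g' s x) ->
  (forall s x, h s x = h' s x) -> pjet i f g h -> pjet i f' g' h'.
Proof.
move=> ef eg eh; have -> : f' = f by apply/funext => s; apply/funext.
have -> : g' = g by apply/funext => s; apply/funext.
by have -> : h' = h by apply/funext => s; apply/funext.
Qed.

Lemma pjet_cst i (z : C) : pjet i (fun _ _ => z) (fun _ _ => 0) (fun _ _ => 0).
Proof.
split; first exact: jet_cst.
by move=> s s0; split=> [|a b|]; try exact: cmeas_cst; under eq_fun do rewrite mxE; exact: cmeas_cst.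
Qed.

Lemma pjet_mul i f g h f' g' h' : pjet i f g h -> pjet i f' g' h' ->
  pjet i (fun s x => f s x * f' s x) (mulg f f' g g') (mulh f f' g g' h h').
Proof.
move=> [j1 m1] [j2 m2]; split; first exact: (jet_mul N0 (flt i) (bm i) j1 j2).
move=> s s0; have [k1 k2 k3] := m1 s s0; have [l1 l2 l3] := m2 s s0; split.
- exact: cmeasM.
- move=> a b; rewrite /mulg; under eq_fun do rewrite !mxE.
  by apply: cmeasD; apply: cmeasM => //; [exact: l2|exact: k2].
- rewrite /mulh; apply: cmeasB; first by apply: cmeasD; exact: cmeasM.
  apply: cmeasM; first exact: cmeas_cst.
  under eq_fun do rewrite tr_mulE.
  by apply: cmeas_sum => a _; apply: cmeas_sum => b _; apply: cmeasM; [exact: k2|exact: l2].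
Qed.

Lemma pjet_conj i f g h : pjet i f g h ->
  pjet i (fun s x => (f s x)^*%C) (fun s x => - (g s x) ^t*) (fun s x => (h s x)^*%C).
Proof.
move=> [j1 m1]; split; first exact: (jet_conj (flt i) (bm i) j1).
move=> s s0; have [k1 k2 k3] := m1 s s0; split; try exact: cmeas_conj.
move=> a b; under eq_fun do rewrite mxE tcE.
by apply: cmeasN; apply: cmeas_conj; exact: k2.
Qed.

Lemma pjet_bnd i f g h : pjet i f g h -> exists2 c : R, 0 <= c &
  forall s x, 0 <= s -> cabs (f s x) <= c /\ cabs (h s x) <= c.
Proof.
move=> [[c c1 [_ b _ _]] _]; exists c; first exact: le_trans c1.
by move=> s x s0; have [] := b s x s0.
Qed.

Lemma pjet_meas i f g h : pjet i f g h -> forall s, 0 <= s -> cmeas (f s) /\ cmeas (h s).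
Proof.
move=> [[c _ [m _ _ _]] _] s s0; have [m1 _ m3] := m s s0.
by split; exact: (Fmeas_meas (flt i) s0).
Qed.

(** The drift clause is tested against [Z = 1]. With the common parameter in [[0, 1]] steps are at
    most 1, and the square in [rate] is absorbed by the power 3/2. *)
Lemma pjet_euler i f g h : pjet i f g h ->
  euler (fun l => Cexp P (f (l * t i))) (fun l => (t i)%:C * Cexp P (h (l * t i))).
Proof.
move=> pj; have [c c1 [mj bj _ j4]] := proj1 pj.
have c0 : 0 <= c by exact: le_trans c1.
have ti := t0 i; pose k := t i * Num.sqrt (t i) + t i ^+ 2.
have k0 : 0 <= k by rewrite addr_ge0 ?mulr_ge0 ?sqr_ge0.
have B1 s : 0 <= s -> cintg P (f s) /\ cabs (Cexp P (f s)) <= c.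
  move=> s0; have i1 : cintg P (f s).
    apply: (@cintg_bnd _ _ _ _ _ c); first by have [] := pjet_meas pj s0.
    by move=> x; have [] := bj s x s0.
  by split=> //; apply: cabs_Cexp_cst => // x; have [] := bj s x s0.
have B2 s : 0 <= s -> cintg P (h s) /\ cabs (Cexp P (h s)) <= c.
  move=> s0; have i1 : cintg P (h s).
    apply: (@cintg_bnd _ _ _ _ _ c); first by have [] := pjet_meas pj s0.
    by move=> x; have [] := bj s x s0.
  by split=> //; apply: cabs_Cexp_cst => // x; have [] := bj s x s0.
exists (c * (1 + t i + k)).
  by apply: mulr_ge0 => //; apply: addr_ge0 => //; exact: addr_ge0.
split=> [s /andP[s0 _]|a b a0 ab b1].
  have st0 : 0 <= s * t i by exact: mulr_ge0.
  have [_ h1] := B1 _ st0; have [_ h2] := B2 _ st0; split.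
    by rewrite (le_trans h1) // ler_peMr // -addrA lerDl addr_ge0.
  rewrite cabsM cabs_real ger0_norm // mulrC ler_pM // (_ : 1 + _ + _ = t i + (1 + k)); last by ring.
  by rewrite lerDl addr_ge0.
have at0 : 0 <= a * t i by exact: mulr_ge0.
have abt : a * t i <= b * t i by rewrite ler_wpM2r.
have [[ia _] [ib _] [iha _]] := And3 (B1 _ at0) (B1 _ (le_trans at0 abt)) (B2 _ at0).
have F1 : Fmeas (F i) (a * t i) (fun=> 1 : C) by exact: cmeas_cst.
have b1' (x : T) : cabs (1 : C) <= 1 by rewrite cabs1.
have := j4 _ _ _ 1 at0 abt ler01 F1 b1'.
have -> : (fun x => 1 * (f (b * t i) x - f (a * t i) x - (b * t i - a * t i)%:C * h (a * t i) x)) =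
  (fun x => f (b * t i) x - f (a * t i) x - ((b - a) * t i)%:C * h (a * t i) x).
  by apply/funext => x; rewrite mul1r mulrBl.
rewrite CexpB; [|exact: cintgB|exact: cintgZ]; rewrite CexpB // CexpZ // mul1r => H.
rewrite (mulrA (b - a)%:C) -rmorphM; apply: (le_trans H); rewrite -mulrA ler_wpM2l // -mulrBl /rate.
set y := b - a; have y0 : 0 <= y by rewrite subr_ge0.
have y1 : y <= 1 by rewrite lerBlDr (le_trans b1) // lerDl.
rewrite sqrtrM // (_ : y * t i * _ = t i * Num.sqrt (t i) * (y * Num.sqrt y)); last by ring.
have e : (y * t i) ^+ 2 <= t i ^+ 2 * (y * Num.sqrt y).
  rewrite exprMn mulrC ler_wpM2l ?sqr_ge0 // expr2 ler_wpM2l //.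
  by rewrite -{1}(sqr_sqrtr y0) expr2 ler_piMl ?sqrtr_ge0 // -sqrtr1 ler_wsqrtr.
apply: (le_trans (lerD (lexx _) e)); rewrite -mulrDl -/k ler_wpM2r ?mulr_ge0 ?sqrtr_ge0 //.
by rewrite lerDr addr_ge0.
Qed.

(* Finite sums of products of jets of the single processes, each run at speed
   [t i], with time-dependent deterministic weights. [g i] is the gradient
   along the [i]-th noise. *)
Inductive qjet : (R -> T -> C) -> ('I_q -> R -> T -> M) -> (R -> T -> C) -> Prop :=
| qjet1 al al' f g h of euler al al' & (forall i, pjet i (f i) (g i) (h i)) :
    qjet (fun l x => al l * \prod_i f i (l * t i) x)
      (fun i l x => (al l * \prod_(j | j != i) f j (l * t j) x) *: g i (l * t i) x)
      (fun l x => al l * (\sum_i (t i)%:C * h i (l * t i) x * \prod_(j | j != i) f j (l * t j) x) +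
        al' l * \prod_i f i (l * t i) x)
| qjetD f g h f' g' h' of qjet f g h & qjet f' g' h' :
    qjet (fun l x => f l x + f' l x) (fun i l x => g i l x + g' i l x) (fun l x => h l x + h' l x).

Lemma qjet_ext f g h f' g' h' : (forall s x, f s x = f' s x) -> (forall i s x, g i s x = g' i s x) ->
  (forall s x, h s x = h' s x) -> qjet f g h -> qjet f' g' h'.
Proof.
move=> ef eg eh; have -> : f' = f by apply/funext => s; apply/funext.
have -> : g' = g by apply/funext => i; apply/funext => s; apply/funext.
by have -> : h' = h by apply/funext => s; apply/funext.
Qed.

Lemma cmeas_split i (Z : 'I_q -> T -> C) (W : T -> C) : (forall j, cmeas (Z j)) -> cmeas W ->
  cmeas (fun x => W x * \prod_(j | j != i) Z j x).
Proof. by move=> mZ mW; apply: cmeasM => //; exact: cmeas_prod. Qed.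

Lemma cabs_prod_le (Q : pred 'I_q) (z : 'I_q -> C) (c : R) : 1 <= c -> (forall i, cabs (z i) <= c) ->
  cabs (\prod_(i | Q i) z i) <= c ^+ q.
Proof.
move=> c1 H; rewrite cabs_prod; apply: (@le_trans _ _ (\prod_(i < q | Q i) c)).
  by apply: ler_prod => i _; rewrite cabs_ge0 H.
rewrite prodr_const ler_weXn2l // (leq_trans (max_card _)) // card_ord //.
Qed.

Lemma common_bound (f h : 'I_q -> R -> T -> C) :
  (forall i, exists2 c : R, 0 <= c & forall s x, 0 <= s -> cabs (f i s x) <= c /\ cabs (h i s x) <= c) ->
  exists2 c : R, 1 <= c & forall i s x, 0 <= s -> cabs (f i s x) <= c /\ cabs (h i s x) <= c.
Proof.
move=> H; have H' i : exists c : R, 0 <= c /\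
    forall s x, 0 <= s -> cabs (f i s x) <= c /\ cabs (h i s x) <= c.
  by have [c c0 cP] := H i; exists c.
have [c cP] := choice H'; exists (1 + \sum_i c i).
  by rewrite lerDl sumr_ge0 // => i _; have [] := cP i.
have ci i : c i <= 1 + \sum_i c i.
  rewrite (bigD1 i) //= addrCA lerDl addr_ge0 ?ler01 // sumr_ge0 // => j _.
  by have [] := cP j.
move=> i s x s0; have [_ h1] := cP i; have [k1 k2] := h1 s x s0.
by split; exact: le_trans (ci i).
Qed.

Lemma qjet_bnd f g h : qjet f g h -> exists2 c : R, 0 <= c &
  forall l, 0 <= l <= 1 -> [/\ cmeas (f l), cmeas (h l),
    forall x, cabs (f l x) <= c & forall x, cabs (h l x) <= c].
Proof.
elim=> {f g h} [al al' f g h [k k0 [alk _]] pj|f g h f' g' h' _ [c c0 H] _ [c' c0' H']].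
- have [c c1 bc] := common_bound (fun i => pjet_bnd (pj i)).
  have c0 : 0 <= c by exact: le_trans c1.
  pose m := k * (\sum_i t i * c * c ^+ q) + k * c ^+ q.
  have S0 : 0 <= \sum_i t i * c * c ^+ q by apply: sumr_ge0 => i _; rewrite !mulr_ge0 ?exprn_ge0.
  exists m; first by rewrite addr_ge0 // !mulr_ge0 ?exprn_ge0.
  move=> l l01; have /andP[l0 _] := l01; have lt i : 0 <= l * t i by exact: mulr_ge0.
  have [a1 a2] := alk l l01.
  have mf i : cmeas (f i (l * t i)) by have [] := pjet_meas (pj i) (lt i).
  have mh i : cmeas (h i (l * t i)) by have [] := pjet_meas (pj i) (lt i).
  have bf i x : cabs (f i (l * t i) x) <= c by have [] := bc i _ x (lt i).
  have bh i x : cabs (h i (l * t i) x) <= c by have [] := bc i _ x (lt i).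
  split.
  + by apply: cmeasM; [exact: cmeas_cst|exact: cmeas_prod].
  + apply: cmeasD; last by apply: cmeasM; [exact: cmeas_cst|exact: cmeas_prod].
    apply: cmeasM; first exact: cmeas_cst.
    by apply: cmeas_sum => i _; apply: cmeas_split => //; apply: cmeasM => //; exact: cmeas_cst.
  + move=> x; rewrite cabsM (le_trans (y := k * c ^+ q)) ?lerDr ?mulr_ge0 //.
    by apply: ler_pM => //; exact: cabs_prod_le.
  + move=> x; rewrite (le_trans (ler_cabsD _ _)) // lerD // cabsM ler_pM //; last exact: cabs_prod_le.
    rewrite (le_trans (ler_cabs_sum _ _ _)) // ler_sum // => i _.
    rewrite cabsM ler_pM //; last exact: cabs_prod_le.
    by rewrite cabsM cabs_real ger0_norm // ler_wpM2l.
- exists (c + c'); first exact: addr_ge0.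
  move=> l /[dup] /H[m1 m2 b1 b2] /H'[m1' m2' b1' b2']; split; [exact: cmeasD|exact: cmeasD|..] => x;
  by rewrite (le_trans (ler_cabsD _ _)) // lerD.
Qed.

Lemma qjet_cintg f g h l : qjet f g h -> 0 <= l <= 1 -> cintg P (f l) /\ cintg P (h l).
Proof.
move=> /qjet_bnd[c c0 H] /H[m1 m2 b1 b2].
by split; apply: (@cintg_bnd _ _ _ _ _ c).
Qed.

Lemma Cexp_prod_other (f : 'I_q -> T -> C) i (W : T -> C) :
  (forall j, Gmeas j (f j)) -> Gmeas i W -> (forall j, exists c, forall x, cabs (f j x) <= c) ->
  (exists c, forall x, cabs (W x) <= c) ->
  Cexp P (fun x => W x * \prod_(j | j != i) f j x) = Cexp P W * \prod_(j | j != i) Cexp P (f j).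
Proof.
move=> mf mW bf bW.
pose f' j := if j == i then W else f j.
have := @Cexp_prod_indep R d T P q G f' Gsub Gind.
have -> : (fun x => \prod_j f' j x) = (fun x => W x * \prod_(j | j != i) f j x).
  apply/funext => x; rewrite (bigD1 i) //= /f' eqxx; congr (_ * _).
  by apply: eq_bigr => j /negbTE ->.
rewrite (bigD1 i) //= /f' eqxx => ->.
- by congr (_ * _); apply: eq_bigr => j /negbTE ->.
- by move=> j; case: (boolP (j == i)) => [/eqP ->|_]; [exact: mW|exact: mf].
- by move=> j; case: (boolP (j == i)).
Qed.

(** Expectations of products factorise over the independent processes, so the single Euler equations
    combine by the ordinary product rule; no filtration common to all motions is formed. *)
Lemma qjet_euler f g h : qjet f g h ->
  euler (fun l => Cexp P (f l)) (fun l => Cexp P (h l)).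
Proof.
elim=> {f g h} [al al' f g h eal pj|f g h f' g' h' j IH j' IH']; last first.
  by apply: euler_ext (euler_add IH IH') => l l01;
    have [i1 i2] := qjet_cintg j l01; have [i1' i2'] := qjet_cintg j' l01; rewrite CexpD.
have [c c1 bc] := common_bound (fun i => pjet_bnd (pj i)).
apply: euler_ext (euler_mul eal (euler_prod (fun i => pjet_euler (pj i)))) => l l01;
  have /andP[l0 _] := l01; have lt i : 0 <= l * t i by exact: mulr_ge0.
all: have mf i : cmeas (f i (l * t i)) by have [] := pjet_meas (pj i) (lt i).
all: have mh i : cmeas (h i (l * t i)) by have [] := pjet_meas (pj i) (lt i).
all: have bf i x : cabs (f i (l * t i) x) <= c by have [] := bc i _ x (lt i).
all: have bh i x : cabs (h i (l * t i) x) <= c by have [] := bc i _ x (lt i).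
all: have Gf i : Gmeas i (f i (l * t i)) by have [_ /(_ _ (lt i))[]] := pj i.
all: have Gh i : Gmeas i (h i (l * t i)) by have [_ /(_ _ (lt i))[]] := pj i.
all: have bp (Q : pred 'I_q) x : cabs (\prod_(i | Q i) f i (l * t i) x) <= c ^+ q by exact: cabs_prod_le.
all: have ip : cintg P (fun x => \prod_i f i (l * t i) x)
  by apply: (@cintg_bnd _ _ _ _ _ (c ^+ q)) => //; exact: cmeas_prod.
all: have Ep : Cexp P (fun x => \prod_i f i (l * t i) x) = \prod_i Cexp P (f i (l * t i))
  by apply: (Cexp_prod_indep Gsub Gind) => // i; exists c.
  by rewrite CexpZ // Ep.
have is_ i : cintg P (fun x => (t i)%:C * h i (l * t i) x * \prod_(j | j != i) f j (l * t j) x).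
  apply: (@cintg_bnd _ _ _ _ _ (t i * c * c ^+ q)) => [|x].
    by apply: cmeas_split => //; apply: cmeasM => //; exact: cmeas_cst.
  rewrite cabsM ler_pM // cabsM cabs_real ger0_norm // ler_wpM2l //.
have iS : cintg P (fun x => \sum_i (t i)%:C * h i (l * t i) x * \prod_(j | j != i) f j (l * t j) x).
  by apply: cintg_sum => i _.
rewrite CexpD; [|exact: cintgZ|exact: cintgZ].
rewrite CexpZ // CexpZ // Ep Cexp_sum //; congr (_ * _ + _); last exact: mulrC.
apply: eq_bigr => i _.
under [in RHS]eq_Cexp do rewrite -mulrA.
rewrite CexpZ; last first.
  apply: (@cintg_bnd _ _ _ _ _ (c * c ^+ q)) => [|x]; first exact: cmeas_split.
  by rewrite cabsM ler_pM.
rewrite -mulrA; congr (_ * _); rewrite Cexp_prod_other //; [by move=> j; exists c|by exists c].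
Qed.

Lemma qjet_scale al al' f g h : euler al al' -> qjet f g h ->
  qjet (fun l x => al l * f l x) (fun i l x => al l *: g i l x)
    (fun l x => al l * h l x + al' l * f l x).
Proof.
move=> e; elim=> {f g h} [be be' f g h eb pj|f g h f' g' h' _ IH _ IH'].
- apply: qjet_ext (qjet1 (euler_mul e eb) pj) => [s x|i s x|s x] /=.
  + by rewrite mulrA.
  + by rewrite scalerA mulrA.
  + by ring.
- apply: qjet_ext (qjetD IH IH') => [s x|i s x|s x] /=; rewrite ?scalerDr //; ring.
Qed.

Lemma qjet_cst (z : C) : qjet (fun _ _ => z) (fun _ _ _ => 0) (fun _ _ => 0).
Proof.
apply: qjet_ext (qjet1 (euler_cst z) (fun i => pjet_cst i 1)) => [s x|i s x|s x] /=.
- by rewrite big1_eq mulr1.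
- by rewrite scaler0.
- by rewrite mul0r addr0 big1 ?mulr0 // => i _; rewrite mulr0 mul0r.
Qed.

Lemma qjet_sum (I : Type) (r : seq I) f g h : (forall k : I, qjet (f k) (g k) (h k)) ->
  qjet (fun l x => \sum_(k <- r) f k l x) (fun i l x => \sum_(k <- r) g k i l x)
    (fun l x => \sum_(k <- r) h k l x).
Proof.
move=> H; elim: r => [|k r IH].
  by apply: qjet_ext (qjet_cst 0) => [s x|i s x|s x]; rewrite big_nil.
by apply: qjet_ext (qjetD (H k) IH) => [s x|i s x|s x]; rewrite big_cons.
Qed.

(** The bracket of two gradients per unit of the common parameter; the weight [t i] is the speed of
    the [i]-th clock. *)
Definition qgam (g g' : 'I_q -> R -> T -> M) l x : C :=
  - (N%:R^-1 * \sum_i (t i)%:C * \tr (g i l x *m g' i l x)).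

Lemma qgamDl g g1 g2 l x :
  qgam (fun i l x => g1 i l x + g2 i l x) g l x = qgam g1 g l x + qgam g2 g l x.
Proof.
rewrite /qgam -opprD -mulrDr -big_split /=; congr (- (_ * _)).
by apply: eq_bigr => i _; rewrite mulmxDl mxtraceD mulrDr.
Qed.

Lemma qgamDr g g1 g2 l x :
  qgam g (fun i l x => g1 i l x + g2 i l x) l x = qgam g g1 l x + qgam g g2 l x.
Proof.
rewrite /qgam -opprD -mulrDr -big_split /=; congr (- (_ * _)).
by apply: eq_bigr => i _; rewrite mulmxDr mxtraceD mulrDr.
Qed.

(** Products are regrouped by index: [pjet_mul] supplies the bracket within each index, and distinct
    indices produce none because their factors stay separate. *)
Lemma qjet_mul f g h f' g' h' : qjet f g h -> qjet f' g' h' ->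
  qjet (fun l x => f l x * f' l x) (fun i l x => f l x *: g' i l x + f' l x *: g i l x)
    (fun l x => f l x * h' l x + f' l x * h l x + qgam g g' l x).
Proof.
move=> j; elim: j f' g' h' => {f g h} [al al' f g h e pj|f1 g1 h1 f2 g2 h2 _ IH1 _ IH2] f' g' h' j'; last first.
  apply: qjet_ext (qjetD (IH1 _ _ _ j') (IH2 _ _ _ j')) => [s x|i s x|s x] /=.
  - by rewrite mulrDl.
  - by rewrite scalerDl scalerDr addrACA.
  - rewrite qgamDl; ring.
elim: j' => {f' g' h'} [be be' f' g' h' e' pj'|f1 g1 h1 f2 g2 h2 _ IH1 _ IH2]; last first.
  apply: qjet_ext (qjetD IH1 IH2) => [s x|i s x|s x] /=.
  - by rewrite mulrDr.
  - by rewrite scalerDl scalerDr addrACA.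
  - rewrite qgamDr; ring.
apply: qjet_ext (qjet1 (euler_mul e e') (fun i => pjet_mul (pj i) (pj' i))) => [s x|i s x|s x] /=.
- by rewrite big_split mulrACA.
- rewrite /mulg !big_split /= scalerDr !scalerA; congr (_ *: _ + _ *: _).
    rewrite [in RHS](bigD1 i) //=; ring.
  rewrite [X in _ = be s * X * _](bigD1 i) //=; ring.
- rewrite !big_split /= /qgam /mulh.
  have -> : \sum_i (t i)%:C * (f i (s * t i) x * h' i (s * t i) x + f' i (s * t i) x * h i (s * t i) x -
       N%:R^-1 * \tr (g i (s * t i) x *m g' i (s * t i) x)) *
       \prod_(j | j != i) (f j (s * t j) x * f' j (s * t j) x) =
     (\prod_i f i (s * t i) x) * (\sum_i (t i)%:C * h' i (s * t i) x * \prod_(j | j != i) f' j (s * t j) x) +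
     (\prod_i f' i (s * t i) x) * (\sum_i (t i)%:C * h i (s * t i) x * \prod_(j | j != i) f j (s * t j) x) -
     N%:R^-1 * \sum_i (t i)%:C * ((\prod_(j | j != i) f j (s * t j) x) * (\prod_(j | j != i) f' j (s * t j) x) *
         \tr (g i (s * t i) x *m g' i (s * t i) x)).
    rewrite !mulr_sumr -sumrN -!big_split; apply: eq_bigr => i _ /=.
    rewrite big_split /= [X in _ = X * _ + _ - _](bigD1 i) //= [X in _ = _ + X * _ - _](bigD1 i) //=; ring.
  have -> : \sum_i (t i)%:C * \tr (((al s * \prod_(j | j != i) f j (s * t j) x) *: g i (s * t i) x) *m
       ((be s * \prod_(j | j != i) f' j (s * t j) x) *: g' i (s * t i) x)) =
     al s * be s * \sum_i (t i)%:C * ((\prod_(j | j != i) f j (s * t j) x) * (\prod_(j | j != i) f' j (s * t j) x) *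
         \tr (g i (s * t i) x *m g' i (s * t i) x)).
    rewrite mulr_sumr; apply: eq_bigr => i _.
    rewrite -scalemxAl -scalemxAr scalerA mxtraceZ; ring.
  ring.
Qed.

Lemma qjet_single i f g h : pjet i f g h ->
  qjet (fun l x => f (l * t i) x) (fun j l x => if j == i then g (l * t i) x else 0)
    (fun l x => (t i)%:C * h (l * t i) x).
Proof.
move=> pj.
pose f1 j := if j == i then f else (fun _ _ => 1).
pose g1 j := if j == i then g else (fun _ _ => 0).
pose h1 j := if j == i then h else (fun _ _ => 0).
have pj1 j : pjet j (f1 j) (g1 j) (h1 j).
  by rewrite /f1 /g1 /h1; case: eqP => [->|_]; [exact: pj|exact: pjet_cst].
have o k s x : \prod_(j | j != k) f1 j (s * t j) x = if k == i then 1 else f (s * t i) x.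
  case: eqP => [->|/eqP ki].
    by rewrite big1 // => j /negbTE ji; rewrite /f1 ji.
  rewrite (bigD1 i) 1?eq_sym //= big1 ?mulr1 => [|j /andP[_ /negbTE ji]]; last by rewrite /f1 ji.
  by rewrite /f1 eqxx.
apply: qjet_ext (qjet1 (euler_cst 1) pj1) => [s x|j s x|s x] /=.
- by rewrite mul1r (bigD1 i) //= o eqxx mulr1 /f1 eqxx.
- by rewrite mul1r o /g1; case: eqP => [->|_]; rewrite ?scale1r ?scaler0.
- rewrite mul0r addr0 mul1r (bigD1 i) //= o eqxx mulr1 big1 ?addr0 => [|j /negbTE ji].
    by rewrite /h1 eqxx.
  by rewrite /h1 ji mulr0 mul0r.
Qed.

End ProductJets.

(** * Words *)

Section WordSurgery.
Context {R : realType} (q : nat) (t : 'I_q -> R).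
Local Notation C := R[i].
Local Notation word := (word q).

Definition sgn (b : bool) : C := if b then 1 else -1.
(** From [dU = U dK] the noise sits to the right of a letter, and from the adjoint equation to the
    left of an inverse letter, with a minus sign; [lft] and [rgt] tell on which side of the cut the
    letter stays. *)
Definition lft (l : 'I_q * bool) : word := if l.2 then [:: l] else [::].
Definition rgt (l : 'I_q * bool) : word := if l.2 then [::] else [:: l].

(* The differential of the word in the direction [(D_i)] is the sum over the
   cuts [(l, (u, v))] of [sgn l.2 * u D_(l.1) v]. *)
Fixpoint cuts (w : word) : seq (('I_q * bool) * (word * word)) :=
  if w is l :: w' then
    (l, (lft l, rgt l ++ w')) :: [seq (c.1, (l :: c.2.1, c.2.2)) | c <- cuts w']
  else [::].

(* The quadratic variation terms within one word: weight, word enclosed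
   between the two cuts, outer word. *)
Fixpoint splits (w : word) : seq (C * (word * word)) :=
  if w is l :: w' then
    [seq ((t l.1)%:C * sgn l.2 * sgn c.1.2, (c.2.1 ++ rgt l, lft l ++ c.2.2)) |
      c <- [seq c <- cuts w' | c.1.1 == l.1]] ++
    [seq (p.1, (p.2.1, l :: p.2.2)) | p <- splits w']
  else [::].

Definition merges (w w' : word) : seq (C * word) :=
  [seq ((t c.1.1)%:C * sgn c.1.2 * sgn c'.1.2, c.2.2 ++ c.2.1 ++ c'.2.2 ++ c'.2.1) |
    c <- cuts w, c' <- [seq c' <- cuts w' | c'.1.1 == c.1.1]].

Definition decay (w : word) : R := \sum_(l <- w) t l.1 / 2.

Hypothesis t0 : forall i, 0 <= t i.

Definition tsum := \sum_i t i.

Lemma tsum_ge i : t i <= tsum.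
Proof. by rewrite /tsum (bigD1 i) //= lerDl sumr_ge0. Qed.

Lemma tsum_ge0 : 0 <= tsum.
Proof. exact: sumr_ge0. Qed.

Lemma cabs_sgn b : cabs (sgn b) = 1.
Proof. by case: b; rewrite /= ?cabsN cabs1. Qed.

Lemma cabs_weight i b b' : cabs ((t i)%:C * sgn b * sgn b') <= tsum.
Proof. by rewrite !cabsM !cabs_sgn !mulr1 cabs_real ger0_norm // tsum_ge. Qed.

Lemma size_cuts w : size (cuts w) = size w.
Proof. by elim: w => //= l w IH; rewrite size_map IH. Qed.

Lemma cuts_size w c : c \in cuts w -> (size c.2.1 + size c.2.2 = size w)%N.
Proof.
elim: w c => //= l w IH c; rewrite in_cons => /orP[/eqP -> /=|/mapP[e /IH <- ->] //].
by rewrite /lft /rgt; case: l.2.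
Qed.

(** Splitting conserves total length, so words of length at most [n] are closed under the drift.
    Merging adds lengths instead, which is what makes the estimates delicate. *)
Lemma splits_size w p : p \in splits w ->
  (size p.2.1 + size p.2.2 = size w)%N /\ cabs p.1 <= tsum.
Proof.
elim: w p => //= l w IH p; rewrite mem_cat => /orP[/mapP[c]|/mapP[e /IH[<- h] -> /=]]; last first.
  by rewrite addnS.
rewrite mem_filter => /andP[_ /cuts_size cs] -> /=; split; last exact: cabs_weight.
rewrite !size_cat -cs /lft /rgt; case: l.2 => /=; lia.
Qed.

Lemma size_splits w : (size (splits w) <= size w * size w)%N.
Proof.
elim: w => //= l w IH; rewrite size_cat !size_map size_filter.
have h := count_size (fun c => c.1.1 == l.1) (cuts w); rewrite size_cuts in h.
by rewrite (leq_trans (leq_add h IH)) // -mulSn leq_mul.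
Qed.

Lemma merges_size w w' p : p \in merges w w' ->
  (size p.2 = size w + size w')%N /\ cabs p.1 <= tsum.
Proof.
move=> /allpairsPdep[c [c' [/cuts_size cs]]]; rewrite mem_filter => /andP[_ /cuts_size cs'] -> /=.
split; last exact: cabs_weight.
by rewrite !size_cat -cs -cs' addnA (addnC (size c.2.2)) (addnC (size c'.2.2)).
Qed.

Lemma size_merges w w' : (size (merges w w') <= size w * size w')%N.
Proof.
rewrite /merges size_allpairs_dep -(size_cuts w).
elim: (cuts w) => [|c cs IH] //=; rewrite mulSn leq_add // size_filter.
by rewrite -(size_cuts w') count_size.
Qed.

Lemma decay_le w : 0 <= decay w <= tsum * (size w)%:R.
Proof.
rewrite /decay sumr_ge0 /= => [|l _]; last by rewrite divr_ge0.
elim: w => [|l w IH]; first by rewrite big_nil mulr0.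
rewrite big_cons /= -[(size w).+1%:R]natr1 mulrDr mulr1 addrC lerD //.
by rewrite (le_trans _ (tsum_ge l.1)) // ler_pdivrMr // ler_peMr // ler1n.
Qed.

End WordSurgery.

(** * Drift and brackets of traces of words *)

Section WordJets.
Context {R : realType} d (T : measurableType d) (P : probability T R).
Variables (N q : nat).
Hypothesis N0 : (0 < N)%N.
Local Notation C := R[i].
Local Notation M := 'M[C]_N.
Local Notation word := (word q).
Variables (F : 'I_q -> R -> set (set T)) (K U : 'I_q -> R -> T -> M).
Hypothesis flt : forall i, filtration (F i).
Hypothesis bm : forall i, uN_brownian P (F i) (K i).
Hypothesis adU : forall i, adapted (F i) (U i).
Hypothesis unU : forall i s x, 0 <= s -> U i s x \is unitarymx.
Hypothesis U0 : forall i x, U i 0 x = 1%:M.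
Hypothesis cU : forall i, continuous_paths (U i).
Hypothesis itoU : forall i s, 0 <= s ->
  exists2 I : T -> M, is_ito_integral P (F i) (K i) s (U i) I &
    {ae P, forall x, U i s x = 1%:M + I x - 2^-1 *: time_integral (U i) s x}.
Hypothesis indU : independent_processes P U.
Variable t : 'I_q -> R.
Hypothesis t0 : forall i, 0 <= t i.

Definition procG i : set (set T) := sigma_of (\bigcup_(s in `[0, +oo[) entries (U i s)).

Lemma procG_sub i : <<s procG i>> `<=` measurable.
Proof.
rewrite sigma_of_id; apply: sigma_of_sub => f [s /=]; rewrite in_itv /= andbT => s0 [a [b ->]].
apply: (Fmeas_meas (flt i) s0); apply: adapted_Fmeas => //; exact: adU.
Qed.

Lemma procG_ind (A : 'I_q -> set T) : (forall i, <<s procG i>> (A i)) ->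
  P (\bigcap_i A i) = (\prod_(i < q) P (A i))%E.
Proof. by move=> H; apply: indU => i; have := H i; rewrite sigma_of_id. Qed.

Lemma procG_entry i s a b : 0 <= s -> Gmeas procG i (fun x => U i s x a b).
Proof.
move=> s0; apply: sigma_of_cmeas_self; exists s; first by rewrite /= in_itv /= s0.
by exists a, b.
Qed.

Local Notation Pjet := (pjet P F K procG).
Local Notation Qjet := (qjet P F K procG t).

(** The adjoint stands in for the inverse: its entries are conjugates of entries of [U], to which
    [pjet_conj] applies. [wmx1] returns to [invmx] through unitarity. *)
Definition letter_mx l (a : 'I_q * bool) x : M :=
  if a.2 then U a.1 (l * t a.1) x else (U a.1 (l * t a.1) x) ^t*.

Definition wmx l (w : word) x : M := foldr (fun a A => letter_mx l a x *m A) 1%:M w.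

Lemma wmx_cat l w w' x : wmx l (w ++ w') x = wmx l w x *m wmx l w' x.
Proof. by elim: w => [|a w IH] /=; rewrite ?mul1mx // IH mulmxA. Qed.

Lemma wmx1 w x : wmx 1 w x = word_mx U t w x.
Proof.
rewrite /word_mx; elim: w => [|a w IH]; first by rewrite big_nil.
rewrite big_cons /= IH /letter_mx mul1r; case: a.2 => //.
by rewrite invmx_unitary // unU.
Qed.

Lemma letter_unitary l a x : 0 <= l -> letter_mx l a x \is unitarymx.
Proof.
move=> l0; rewrite /letter_mx; have u := unU a.1 x (mulr_ge0 l0 (t0 a.1)); case: a.2; first exact: u.
by rewrite trmxC_unitary; exact: u.
Qed.

Lemma wmx_unitary l w x : 0 <= l -> wmx l w x \is unitarymx.
Proof.
move=> l0; elim: w => [|a w IH] /=; last exact: mul_unitarymx (letter_unitary a x l0) IH.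
by apply/unitarymxP; rewrite mul1mx trmx1 map_mx1.
Qed.

Lemma wmx0 w x : wmx 0 w x = 1%:M.
Proof.
elim: w => //= a w ->; rewrite /letter_mx mul0r U0 mulmx1; case: a.2 => //.
by rewrite trmx1 map_mx1.
Qed.

Definition ntr l (w : word) x : C := N%:R^-1 * \tr (wmx l w x).

(** Gradients are matrices [g] standing for [D -> tr (g D)]; the elementary matrix turns the entry
    at [a], [b] of the word with [D] inserted at a cut into such a trace. *)
Definition wgrad i l (w : word) a b x : M :=
  \sum_(c <- cuts w | c.1.1 == i) sgn c.1.2 *: (wmx l c.2.2 x *m delta_mx b a *m wmx l c.2.1 x).

Definition wdrift l (w : word) a b x : C :=
  - (decay t w)%:C * wmx l w x a b -
  \sum_(p <- splits t w) p.1 * ntr l p.2.1 x * wmx l p.2.2 x a b.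
Lemma letter_pjet (a : 'I_q * bool) i j :
  Pjet a.1 (fun s x => (if a.2 then U a.1 s x else (U a.1 s x) ^t*) i j)
    (fun s x => sgn a.2 *: (if a.2 then delta_mx j i *m U a.1 s x else (U a.1 s x) ^t* *m delta_mx j i))
    (fun s x => - 2^-1 * (if a.2 then U a.1 s x else (U a.1 s x) ^t*) i j).
Proof.
have base k l : Pjet a.1 (fun s x => U a.1 s x k l) (fun s x => delta_mx l k *m U a.1 s x)
    (fun s x => - 2^-1 * U a.1 s x k l).
  split.
    have H := jet_entry N0 (flt a.1) (bm a.1) (@adU a.1) (@unU a.1) (@cU a.1) (@itoU a.1) k l.
    exact: H.
  move=> s s0; split; [exact: procG_entry| |by apply: cmeasM; [exact: cmeas_cst|exact: procG_entry]].
  move=> m n; under eq_fun do rewrite mxE; apply: cmeas_sum => o _.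
  by apply: cmeasM; [exact: cmeas_cst|exact: procG_entry].
case: a base => [a [|]] base /=.
  by apply: pjet_ext (base i j) => s x //; rewrite scale1r.
apply: pjet_ext (pjet_conj flt bm (base j i)) => s x.
- by rewrite tcE.
- rewrite scaleN1r tc_mul; congr (- (_ *m _)).
  by apply/matrixP => m n; rewrite tcE !mxE andbC; case: (_ && _); rewrite ?rmorph1 ?rmorph0.
- rewrite tcE (_ : - 2^-1 = (- 2^-1 : R)%:C :> C); last by rewrite rmorphN fmorphV rmorph_nat.
  by rewrite /=; case: (U _ _ _ _ _) => u v; apply: complex_ext; rewrite /=; ring.
Qed.

Lemma letter_qjet a i j : Qjet (fun l x => letter_mx l a x i j)
  (fun k l x => if k == a.1 then sgn a.2 *: (wmx l (rgt a) x *m delta_mx j i *m wmx l (lft a) x) else 0)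
  (fun l x => - (t a.1 / 2)%:C * letter_mx l a x i j).
Proof.
apply: qjet_ext (qjet_single t (letter_pjet a i j)) => [s x|k s x|s x] //.
- rewrite /rgt /lft /letter_mx; case: eqP => // _; congr (_ *: _).
  by case: a => a [|] /=; rewrite ?mul1mx ?mulmx1.
- rewrite /letter_mx mulrA; congr (_ * _).
  by rewrite rmorphM fmorphV rmorph_nat mulrN.
Qed.

Lemma mx_delta_sum (A : M) a b : \sum_c A a c *: (delta_mx b c : M) = (delta_mx b a : M) *m A.
Proof.
apply/matrixP => i j; rewrite summxE mxE (bigD1 j) //= big1 ?addr0 => [|c /negbTE cj].
  rewrite !mxE eqxx andbT (bigD1 a) //= big1 ?addr0 => [|c /negbTE ca].
    by rewrite !mxE eqxx andbT mulrC.
  by rewrite mxE ca andbF mul0r.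
by rewrite !mxE (eq_sym j) cj andbF mulr0.
Qed.

Lemma delta_mx_sum (A : M) a b : \sum_c A c b *: (delta_mx c a : M) = A *m (delta_mx b a : M).
Proof.
apply/matrixP => i j; rewrite summxE mxE (bigD1 i) //= big1 ?addr0 => [|c /negbTE ci].
  rewrite !mxE eqxx (bigD1 b) //= big1 ?addr0 => [|c /negbTE cb].
    by rewrite !mxE eqxx.
  by rewrite mxE cb mulr0.
by rewrite !mxE (eq_sym i) ci mulr0.
Qed.

(** Two elementary matrices inside a trace reconnect the strands: one closes into the trace of
    [D *m A], the other remains an open word. This is the algebra of splitting. *)
Lemma tr_delta2 (A B C' D : M) a b :
  \sum_c \tr (A *m (delta_mx c a : M) *m B *m (C' *m (delta_mx b c : M) *m D)) = \tr (D *m A) * (B *m C') a b.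
Proof.
rewrite [in RHS]/mxtrace mulr_suml; apply: eq_bigr => c _.
have -> : A *m (delta_mx c a : M) *m B *m (C' *m (delta_mx b c : M) *m D) =
    A *m ((delta_mx c a : M) *m (B *m C') *m (delta_mx b c : M)) *m D by rewrite !mulmxA.
have -> : (delta_mx c a : M) *m (B *m C') *m (delta_mx b c : M) = (B *m C') a b *: (delta_mx c c : M).
  move: (B *m C') => {B C'} B; apply/matrixP => i j; rewrite mxE (bigD1 b) //= big1 ?addr0 => [|k /negbTE kb].
    rewrite mxE (bigD1 a) //= big1 ?addr0 => [|k /negbTE ka]; last by rewrite mxE ka andbF mul0r.
    by rewrite !mxE !eqxx andbT; case: eqP => _; case: eqP => _; rewrite ?mul1r ?mul0r ?mulr1 ?mulr0.
  by rewrite [X in _ * X]mxE kb mulr0.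
rewrite -scalemxAr -scalemxAl mxtraceZ mulrC; congr (_ * _).
rewrite mxtrace_mulC mulmxA mxtrace_mulC.
by rewrite tr_delta.
Qed.

Lemma sum_scale_mid (s : C) (A B : M) (z : 'I_N -> C) (D : 'I_N -> M) :
  \sum_c z c *: (s *: (A *m D c *m B)) = s *: (A *m (\sum_c z c *: D c) *m B).
Proof.
rewrite mulmx_sumr mulmx_suml scaler_sumr; apply: eq_bigr => c _.
by rewrite -scalemxAr -scalemxAl !scalerA mulrC.
Qed.

Lemma wgrad_cons a l w x k i j :
  wgrad k l (a :: w) i j x = \sum_c (letter_mx l a x i c *: wgrad k l w c j x +
    wmx l w x c j *: (if k == a.1 then sgn a.2 *: (wmx l (rgt a) x *m delta_mx c i *m wmx l (lft a) x) else 0)).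
Proof.
rewrite big_split /= addrC /wgrad /= big_cons /= big_map /= (eq_sym a.1).
have L : \sum_c letter_mx l a x i c *: (\sum_(e <- cuts w | e.1.1 == k)
       sgn e.1.2 *: (wmx l e.2.2 x *m delta_mx j c *m wmx l e.2.1 x)) =
    \sum_(e <- cuts w | e.1.1 == k) sgn e.1.2 *: (wmx l e.2.2 x *m delta_mx j i *m (letter_mx l a x *m wmx l e.2.1 x)).
  under eq_bigr do rewrite scaler_sumr.
  rewrite exchange_big /=; apply: eq_bigr => e _.
  by rewrite sum_scale_mid mx_delta_sum !mulmxA.
rewrite L; case: eqP => _; last by rewrite [X in _ = X + _]big1 ?add0r // => c _; rewrite scaler0.
congr (_ + _).
by rewrite sum_scale_mid delta_mx_sum wmx_cat !mulmxA.
Qed.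

Lemma wmx_splits_cons a l w x i j :
  \sum_(c < N) \sum_k (t k)%:C * \tr ((if k == a.1 then sgn a.2 *: (wmx l (rgt a) x *m delta_mx c i *m wmx l (lft a) x) else 0) *m
      wgrad k l w c j x) =
  N%:R * \sum_(p <- [seq ((t a.1)%:C * sgn a.2 * sgn c.1.2, (c.2.1 ++ rgt a, lft a ++ c.2.2)) |
      c <- [seq c <- cuts w | c.1.1 == a.1]]) p.1 * ntr l p.2.1 x * wmx l p.2.2 x i j.
Proof.
have NN : N%:R != 0 :> C by rewrite pnatr_eq0 -lt0n.
rewrite big_map big_filter mulr_sumr exchange_big /= (bigD1 a.1) //= [X in _ + X]big1 ?addr0; last first.
  by move=> m /negbTE ma; rewrite big1 // => c _; rewrite ma mul0mx mxtrace0 mulr0.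
rewrite eqxx /wgrad.
under eq_bigr do rewrite mulmx_sumr raddf_sum /= mulr_sumr.
rewrite exchange_big /=; apply: eq_bigr => e _.
under eq_bigr do rewrite -scalemxAl -scalemxAr scalerA mxtraceZ mulrA.
rewrite -mulr_sumr tr_delta2 /ntr !wmx_cat; field; exact: NN.
Qed.

(** Induction on the word by the product rule for matrix entries. The drift of the new letter adds
    to [decay], and its brackets with the cuts of the tail are exactly the new entries of
    [splits]. *)
Lemma word_qjet w i j : Qjet (fun l x => wmx l w x i j) (fun k l x => wgrad k l w i j x)
  (fun l x => wdrift l w i j x).
Proof.
elim: w i j => [|a w IH] i j.
  apply: qjet_ext (qjet_cst P F K procG t _) => [s x|k s x|s x] /=; first reflexivity.
    by rewrite /wgrad /= big_nil.
  by rewrite /wdrift /= /decay !big_nil rmorph0 !oppr0 mul0r addr0.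
have H c := qjet_mul N0 flt bm (letter_qjet a i c) (IH c j).
apply: qjet_ext (qjet_sum (index_enum _) H) => [s x|k s x|s x] /=.
- by rewrite mxE.
- by rewrite wgrad_cons.
have NN : N%:R != 0 :> C by rewrite pnatr_eq0 -lt0n.
rewrite !big_split /= /qgam sumrN -mulr_sumr wmx_splits_cons mulKf // /wdrift /=.
rewrite big_cat /= [X in _ = _ - (_ + X)]big_map /= /decay big_cons -/(decay t w) rmorphD.
have e1 : \sum_c wmx s w x c j * (- (t a.1 / 2)%:C * letter_mx s a x i c) =
    - (t a.1 / 2)%:C * (letter_mx s a x *m wmx s w x) i j.
  by rewrite mxE mulr_sumr; apply: eq_bigr => c _; ring.
have e2 : \sum_c letter_mx s a x i c * wdrift s w c j x =
    - (decay t w)%:C * (letter_mx s a x *m wmx s w x) i j -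
    \sum_(p <- splits t w) p.1 * ntr s p.2.1 x * (letter_mx s a x *m wmx s p.2.2 x) i j.
  rewrite /wdrift; under eq_bigr do rewrite mulrBr mulr_sumr.
  rewrite sumrB exchange_big /=; congr (_ - _).
    by rewrite mxE mulr_sumr; apply: eq_bigr => c _; ring.
  by apply: eq_bigr => p _; rewrite mxE mulr_sumr; apply: eq_bigr => c _; ring.
rewrite e1 e2; ring.
Qed.

Definition tgrad l (w : word) k x : M :=
  N%:R^-1 *: \sum_(c <- cuts w | c.1.1 == k) sgn c.1.2 *: (wmx l c.2.2 x *m wmx l c.2.1 x).

Definition tdrift l (w : word) x : C :=
  - (decay t w)%:C * ntr l w x - \sum_(p <- splits t w) p.1 * ntr l p.2.1 x * ntr l p.2.2 x.

Lemma ntr_qjet w : Qjet (fun l x => ntr l w x) (fun k l x => tgrad l w k x) (fun l x => tdrift l w x).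
Proof.
have H := qjet_scale (euler_cst (N%:R^-1)) (qjet_sum (index_enum _) (fun i => word_qjet w i i)).
apply: qjet_ext H => [s x|k s x|s x] //=.
- rewrite /tgrad /wgrad; congr (_ *: _); rewrite exchange_big /=; apply: eq_bigr => c _.
  rewrite -scaler_sumr -mulmx_suml -mulmx_sumr; congr (_ *: _).
  have -> : \sum_i (delta_mx i i : M) = 1%:M.
    apply/matrixP => m n; rewrite summxE mxE (bigD1 m) //= big1 ?addr0 => [|c' /negbTE cm].
      by rewrite mxE eqxx eq_sym.
    by rewrite mxE eq_sym cm.
  by rewrite mulmx1.
- rewrite mul0r addr0 /wdrift /tdrift sumrB mulrBr; congr (_ - _).
    by rewrite -mulr_sumr mulrCA.
  rewrite exchange_big /= mulr_sumr; apply: eq_bigr => p _.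
  by rewrite -mulr_sumr mulrCA.
Qed.

(** Each normalised gradient brings [1 / N], the bracket another one, and the resulting trace is [N]
    times a normalised one: altogether [N^-2]. *)
Lemma tgrad_merges l w w' x :
  - (N%:R^-1 * \sum_k (t k)%:C * \tr (tgrad l w k x *m tgrad l w' k x)) =
  - (N%:R^-1 ^+ 2 * \sum_(p <- merges t w w') p.1 * ntr l p.2 x).
Proof.
congr (- _); rewrite expr2 -mulrA; congr (_ * _).
rewrite /merges big_allpairs_dep /= mulr_sumr.
transitivity (\sum_k \sum_(c <- cuts w | c.1.1 == k) \sum_(c' <- cuts w' | c'.1.1 == k)
   N%:R^-1 * ((t k)%:C * sgn c.1.2 * sgn c'.1.2 * ntr l (c.2.2 ++ c.2.1 ++ c'.2.2 ++ c'.2.1) x)).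
  apply: eq_bigr => k _; rewrite /tgrad -scalemxAl -scalemxAr scalerA mxtraceZ.
  rewrite mulmx_suml raddf_sum /= !mulr_sumr; apply: eq_bigr => c _.
  rewrite mulmx_sumr raddf_sum /= !mulr_sumr; apply: eq_bigr => c' _.
  rewrite -scalemxAl -scalemxAr scalerA mxtraceZ /ntr !wmx_cat !mulmxA; ring.
rewrite (exchange_big_dep predT) //=; apply: eq_bigr => c _.
rewrite (bigD1 c.1.1) ?eqxx //= [X in _ + X]big1 ?addr0; last by move=> k /andP[/eqP -> /eqP].
by rewrite big_filter mulr_sumr.
Qed.

Lemma ntr_le1 l w x : 0 <= l -> cabs (ntr l w x) <= 1.
Proof.
move=> l0; have u := wmx_unitary w x l0.
rewrite /ntr cabsM (_ : cabs (N%:R^-1) = N%:R^-1); last first.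
  by rewrite (_ : N%:R^-1 = (N%:R^-1)%:C :> C) ?cabs_real ?ger0_norm // fmorphV rmorph_nat.
rewrite mulrC ler_pdivrMr ?ltr0n // mul1r (le_trans (ler_cabs_sum _ _ _)) //.
rewrite (le_trans (ler_sum _ (fun i _ => unitary_entry i i u))) //.
by rewrite sumr_const card_ord.
Qed.

Lemma ntr0 w x : ntr 0 w x = 1.
Proof. by rewrite /ntr wmx0 mxtrace1 mulVf // pnatr_eq0 -lt0n. Qed.

Definition wflip (w : word) : word := rev [seq (a.1, ~~ a.2) | a <- w].

Lemma ntr_conj l w x : (ntr l w x)^*%C = ntr l (wflip w) x.
Proof.
have NR : N%:R^-1 = (N%:R^-1 : R)%:C :> C by rewrite fmorphV rmorph_nat.
rewrite /ntr rmorphM /= [X in X * _](_ : _ = N%:R^-1); last by rewrite NR; exact: conjc_real.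
rewrite -tr_tc; congr (_ * \tr _).
elim: w => [|a w IH]; first by rewrite trmx1 map_mx1.
rewrite /= tc_mul IH /wflip /= rev_cons -cats1 wmx_cat /= mulmx1; congr (_ *m _).
by rewrite /letter_mx /=; case: a.2; rewrite /= ?tcK.
Qed.

Lemma size_wflip w : size (wflip w) = size w.
Proof. by rewrite size_rev size_map. Qed.

End WordJets.

(** * The moment hierarchy *)

Section Lists.
Context {R : realType}.
Local Notation C := R[i].

Definition lsum (A : Type) (s : seq (C * A)) (Phi : A -> C) : C := \sum_(p <- s) p.1 * Phi p.2.

Lemma lsum_nil A (Phi : A -> C) : lsum [::] Phi = 0.
Proof. by rewrite /lsum big_nil. Qed.

Lemma lsum_cons A (p : C * A) s (Phi : A -> C) : lsum (p :: s) Phi = p.1 * Phi p.2 + lsum s Phi.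
Proof. by rewrite /lsum big_cons. Qed.

Lemma lsum_cat A (s s' : seq (C * A)) Phi : lsum (s ++ s') Phi = lsum s Phi + lsum s' Phi.
Proof. by rewrite /lsum big_cat. Qed.

Lemma lsum_map (I A : Type) (s : seq I) (f : I -> C * A) Phi :
  lsum (map f s) Phi = \sum_(i <- s) (f i).1 * Phi (f i).2.
Proof. by rewrite /lsum big_map. Qed.

Lemma lsum_mull A (z : C) (s : seq (C * A)) Phi : z * lsum s Phi = lsum s (fun W => z * Phi W).
Proof. by rewrite /lsum mulr_sumr; apply: eq_bigr => p _; rewrite mulrCA. Qed.

Lemma eq_lsum A (s : seq (C * A)) Phi Phi' : Phi =1 Phi' -> lsum s Phi = lsum s Phi'.
Proof. by move=> E; apply: eq_bigr => p _; rewrite E. Qed.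

Lemma lsum_add A (s : seq (C * A)) Phi Phi' :
  lsum s (fun W => Phi W + Phi' W) = lsum s Phi + lsum s Phi'.
Proof. by rewrite /lsum -big_split; apply: eq_bigr => p _; rewrite mulrDr. Qed.

End Lists.

Section Hierarchy.
Context {R : realType} (q : nat) (t : 'I_q -> R).
Local Notation C := R[i].
Local Notation word := (word q).

(** All ways to take one element out of a list, with multiplicity and keeping the rest in order;
    Wick sums and brackets both run over it. *)
Fixpoint sel (A : Type) (W : seq A) : seq (A * seq A) :=
  if W is w :: W' then (w, W') :: [seq (p.1, w :: p.2) | p <- sel W'] else [::].

Variables (a : word -> C) (m2 : word -> word -> C).

(* The expectation of [prod_(w <- W) y_w] has derivative [lsum (dlist W)] (linear
   part of the drift) plus [lsum (blist W)] (leading part of the brackets) plus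
   [N^-1] times [lsum (elist W)], all applied to the expectations of products.
   Here [a w] is [E[N^-1 Tr w]] and [m2 u v] is [E[y_u y_v]]. *)
Definition dterm (w : word) : seq (C * word) :=
  (- (decay t w)%:C, w) ::
  ([seq (- p.1 * a p.2.1, p.2.2) | p <- splits t w] ++
   [seq (- p.1 * a p.2.2, p.2.1) | p <- splits t w]).

Fixpoint dlist (W : seq word) : seq (C * seq word) :=
  if W is w :: W' then
    [seq (p.1, p.2 :: W') | p <- dterm w] ++ [seq (p.1, w :: p.2) | p <- dlist W']
  else [::].

Definition bterm (w u : word) : C := - lsum (merges t w u) a.

Fixpoint blist (W : seq word) : seq (C * seq word) :=
  if W is w :: W' then
    [seq (bterm w p.1, p.2) | p <- sel W'] ++ [seq (p.1, w :: p.2) | p <- blist W']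
  else [::].

Fixpoint elist (W : seq word) : seq (C * seq word) :=
  if W is w :: W' then
    [seq (- p.1, p.2.1 :: p.2.2 :: W') | p <- splits t w] ++
    [seq (p.1 * m2 p.2.1 p.2.2, W') | p <- splits t w] ++
    [seq (- p.1, p.2 :: s.2) | s <- sel W', p <- merges t w s.1] ++
    [seq (p.1, w :: p.2) | p <- elist W']
  else [::].

Lemma lsum_dlist w W Phi : lsum (dlist (w :: W)) Phi =
  lsum (dterm w) (fun u => Phi (u :: W)) + lsum (dlist W) (fun V => Phi (w :: V)).
Proof.
have -> : dlist (w :: W) = [seq (p.1, p.2 :: W) | p <- dterm w] ++ [seq (p.1, w :: p.2) | p <- dlist W] by [].
by rewrite lsum_cat 2!lsum_map.
Qed.

Lemma lsum_blist w W Phi : lsum (blist (w :: W)) Phi =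
  \sum_(s <- sel W) bterm w s.1 * Phi s.2 + lsum (blist W) (fun V => Phi (w :: V)).
Proof. by rewrite [blist _]/= lsum_cat 2!lsum_map. Qed.

Lemma lsum_elist w W Phi : lsum (elist (w :: W)) Phi =
  \sum_(p <- splits t w) - p.1 * Phi (p.2.1 :: p.2.2 :: W) +
  \sum_(p <- splits t w) p.1 * m2 p.2.1 p.2.2 * Phi W +
  \sum_(s <- sel W) \sum_(p <- merges t w s.1) - p.1 * Phi (p.2 :: s.2) +
  lsum (elist W) (fun V => Phi (w :: V)).
Proof.
rewrite [elist _]/= lsum_cat lsum_map lsum_cat lsum_map lsum_cat (lsum_map (elist W)) -!addrA.
by congr (_ + (_ + (_ + _))); rewrite /lsum big_allpairs_dep.
Qed.

End Hierarchy.

Arguments dterm {R q} t a w : simpl never.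

Section Moments.
Context {R : realType} d (T : measurableType d) (P : probability T R).
Variables (N q : nat).
Hypothesis N0 : (0 < N)%N.
Local Notation C := R[i].
Local Notation M := 'M[C]_N.
Local Notation word := (word q).
Variables (F : 'I_q -> R -> set (set T)) (K U : 'I_q -> R -> T -> M).
Hypothesis flt : forall i, filtration (F i).
Hypothesis bm : forall i, uN_brownian P (F i) (K i).
Hypothesis adU : forall i, adapted (F i) (U i).
Hypothesis unU : forall i s x, 0 <= s -> U i s x \is unitarymx.
Hypothesis U0 : forall i x, U i 0 x = 1%:M.
Hypothesis cU : forall i, continuous_paths (U i).
Hypothesis itoU : forall i s, 0 <= s ->
  exists2 I : T -> M, is_ito_integral P (F i) (K i) s (U i) I &
    {ae P, forall x, U i s x = 1%:M + I x - 2^-1 *: time_integral (U i) s x}.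
Hypothesis indU : independent_processes P U.
Variable t : 'I_q -> R.
Hypothesis t0 : forall i, 0 <= t i.

Local Notation Qjet := (qjet P F K (procG U) t).
Local Notation NC := (N%:R : C).

Let NN : NC != 0. Proof. by rewrite pnatr_eq0 -lt0n. Qed.

Definition nmean l w : C := Cexp P (ntr U t l w).
Definition fluct l w x : C := NC * (ntr U t l w x - nmean l w).
Definition pfluct l (W : seq word) x : C := \prod_(w <- W) fluct l w x.
Definition mom l W : C := Cexp P (pfluct l W).

Lemma pfluct_nil l x : pfluct l [::] x = 1.
Proof. by rewrite /pfluct big_nil. Qed.

Lemma pfluct_cons l w W x : pfluct l (w :: W) x = fluct l w x * pfluct l W x.
Proof. by rewrite /pfluct big_cons. Qed.

Let Nq w := ntr_qjet N0 flt bm adU unU cU itoU t w.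

Lemma procG_sub' i : <<s procG U i>> `<=` measurable.
Proof. exact: (procG_sub flt adU). Qed.

Lemma qeuler f g h : Qjet f g h -> euler (fun l => Cexp P (f l)) (fun l => Cexp P (h l)).
Proof.
move=> J; apply: (qjet_euler flt _ _ t0 J); first by move=> i; exact: procG_sub'.
by move=> A; exact: procG_ind.
Qed.

Lemma ntr_cintg l w : 0 <= l <= 1 -> cintg P (ntr U t l w).
Proof. by move=> l01; have [] := qjet_cintg flt t0 (Nq w) l01. Qed.

Lemma nmean_le1 l w : 0 <= l <= 1 -> cabs (nmean l w) <= 1.
Proof.
move=> l01; apply: cabs_Cexp_cst; first exact: ntr_cintg.
by move=> x; apply: ntr_le1 => //; case/andP: l01.
Qed.

Definition nmean' l w := Cexp P (tdrift U t l w).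

Lemma nmean_euler w : euler (fun l => nmean l w) (fun l => nmean' l w).
Proof. exact: qeuler (Nq w). Qed.

Lemma fluct_qjet w : Qjet (fun l x => fluct l w x) (fun k l x => NC *: tgrad U t l w k x)
  (fun l x => NC * (tdrift U t l w x - nmean' l w)).
Proof.
have J := qjetD (Nq w) (qjet_scale (euler_mul (euler_cst (-1)) (nmean_euler w)) (qjet_cst P F K (procG U) t 1)).
apply: qjet_ext (qjet_scale (euler_cst NC) J) => [s x|k s x|s x] /=.
- by rewrite mulr1 mulN1r.
- by rewrite scaler0 addr0.
- by rewrite !mulr0 mul0r !addr0 add0r mulr1 mulN1r.
Qed.

Lemma fluct_bnd w : exists2 c : R, 0 <= c & forall l, 0 <= l <= 1 ->
  cmeas (fluct l w) /\ forall x, cabs (fluct l w x) <= c.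
Proof.
have [c c0 H] := qjet_bnd flt t0 (fluct_qjet w); exists c => // l l01.
by have [? _ ? _] := H l l01.
Qed.

Lemma ntrE l w x : ntr U t l w x = nmean l w + NC^-1 * fluct l w x.
Proof. by rewrite /fluct mulKf // addrC subrK. Qed.

(** The factor [N] in each fluctuation cancels the [N^-2] of [tgrad_merges]. A merged trace then
    splits into its mean, of order one, and a fluctuation with weight [1 / N]. *)
Lemma fluct_gam w w' l x :
  qgam t (fun k l x => NC *: tgrad U t l w k x) (fun k l x => NC *: tgrad U t l w' k x) l x =
  - \sum_(p <- merges t w w') p.1 * (nmean l p.2 + NC^-1 * fluct l p.2 x).
Proof.
rewrite /qgam.
have -> : \sum_i (t i)%:C * \tr ((NC *: tgrad U t l w i x) *m (NC *: tgrad U t l w' i x)) =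
   NC ^+ 2 * \sum_i (t i)%:C * \tr (tgrad U t l w i x *m tgrad U t l w' i x).
  rewrite mulr_sumr; apply: eq_bigr => i _.
  by rewrite -scalemxAl -scalemxAr scalerA mxtraceZ expr2 mulrCA.
have H := tgrad_merges U t l w w' x.
rewrite mulrCA -mulrN H mulrN mulrA -exprMn divff // expr1n mul1r; congr (- _).
by apply: eq_bigr => p _; rewrite ntrE.
Qed.

Fixpoint pdrift l (W : seq word) x : C :=
  if W is w :: W' then
    fluct l w x * pdrift l W' x + pfluct l W' x * (NC * (tdrift U t l w x - nmean' l w)) -
    \sum_(s <- sel W') pfluct l s.2 x * \sum_(p <- merges t w s.1) p.1 * (nmean l p.2 + NC^-1 * fluct l p.2 x)
  else 0.

Lemma pfluct_qjet W : Qjet (fun l x => pfluct l W x)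
  (fun k l x => \sum_(s <- sel W) pfluct l s.2 x *: (NC *: tgrad U t l s.1 k x))
  (fun l x => pdrift l W x).
Proof.
elim: W => [|w W IH].
  apply: qjet_ext (qjet_cst P F K (procG U) t 1) => [s x|k s x|s x] //=.
    by rewrite pfluct_nil.
  by rewrite big_nil.
apply: qjet_ext (qjet_mul N0 flt bm (fluct_qjet w) IH) => [l x|k l x|l x] /=.
- by rewrite pfluct_cons.
- rewrite big_cons big_map /= addrC; congr (_ + _); rewrite scaler_sumr.
  by apply: eq_bigr => s _; rewrite pfluct_cons scalerA.
- congr (_ + _); rewrite -sumrN.
  transitivity (\sum_(s <- sel W) pfluct l s.2 x *
     qgam t (fun k l x => NC *: tgrad U t l w k x) (fun k l x => NC *: tgrad U t l s.1 k x) l x).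
    rewrite /qgam.
    under [in LHS]eq_bigr do rewrite mulmx_sumr raddf_sum mulr_sumr /=.
    rewrite exchange_big mulr_sumr -sumrN; apply: eq_bigr => s _ /=.
    rewrite mulrN mulrCA; congr (- (_ * _)); rewrite mulr_sumr; apply: eq_bigr => k _.
    by rewrite -scalemxAr mxtraceZ mulrCA.
  by apply: eq_bigr => s _; rewrite fluct_gam mulrN.
Qed.

Lemma pfluct_cintg l W : 0 <= l <= 1 -> cintg P (pfluct l W).
Proof. by move=> l01; have [] := qjet_cintg flt t0 (pfluct_qjet W) l01. Qed.

Lemma mom_nil l : mom l [::] = 1.
Proof. by rewrite /mom -[RHS](Cexp_cst P); apply: eq_Cexp => x; rewrite pfluct_nil. Qed.

Lemma mom1 l w : 0 <= l <= 1 -> mom l [:: w] = 0.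
Proof.
move=> l01; have i := ntr_cintg w l01.
rewrite /mom; transitivity (Cexp P (fluct l w)).
  by apply: eq_Cexp => x; rewrite /pfluct big_seq1.
rewrite CexpZ; last by apply: cintgB => //; exact: cintg_cst.
by rewrite CexpB ?Cexp_cst ?subrr ?mulr0 //; exact: cintg_cst.
Qed.

Lemma mom_perm l W W' : perm_eq W W' -> mom l W = mom l W'.
Proof. by move=> /(perm_big _) E; apply: eq_Cexp => x; rewrite /pfluct; apply: E. Qed.

(** Terms linear in a fluctuation have zero mean, so products of normalised traces factorise up to
    [N^-2]; the equations of the means close at that order. *)
Lemma nmean_mul l u w : 0 <= l <= 1 ->
  Cexp P (fun x => ntr U t l u x * ntr U t l w x) = nmean l u * nmean l w + NC^-1 ^+ 2 * mom l [:: u; w].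
Proof.
move=> l01; have [iu iw] := (pfluct_cintg [:: u] l01, pfluct_cintg [:: w] l01).
have iuw := pfluct_cintg [:: u; w] l01.
have -> : (fun x => ntr U t l u x * ntr U t l w x) = (fun x => nmean l u * nmean l w +
   (NC^-1 ^+ 2 * pfluct l [:: u; w] x + (NC^-1 * nmean l w * pfluct l [:: u] x + NC^-1 * nmean l u * pfluct l [:: w] x))).
  by apply/funext => x; rewrite !ntrE /pfluct big_cons !big_seq1; ring.
rewrite CexpD; [|exact: cintg_cst|by do !apply: cintgD; exact: cintgZ].
rewrite CexpD; [|exact: cintgZ|by apply: cintgD; exact: cintgZ].
rewrite CexpD; [|exact: cintgZ|exact: cintgZ].
rewrite Cexp_cst !CexpZ // -/(mom l [:: u]) -/(mom l [:: w]) !mom1 //.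
by rewrite !mulr0 !addr0.
Qed.

Lemma ntrM_cintg l u w : 0 <= l <= 1 -> cintg P (fun x => ntr U t l u x * ntr U t l w x).
Proof.
move=> l01; apply: (@cintg_bnd _ _ _ _ _ 1).
  by apply: cmeasM; exact: (cintg_meas (ntr_cintg _ l01)).
by move=> x; rewrite cabsM -[1]mulr1 ler_pM // ntr_le1 //; case/andP: l01.
Qed.

Lemma nmean'E l w : 0 <= l <= 1 -> nmean' l w = - (decay t w)%:C * nmean l w -
  \sum_(p <- splits t w) p.1 * (nmean l p.2.1 * nmean l p.2.2 + NC^-1 ^+ 2 * mom l [:: p.2.1; p.2.2]).
Proof.
move=> l01; rewrite /nmean' /tdrift.
have i2 (p : C * (word * word)) : cintg P (fun x => p.1 * ntr U t l p.2.1 x * ntr U t l p.2.2 x).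
  under eq_fun do rewrite -mulrA; apply: cintgZ; exact: ntrM_cintg.
rewrite CexpB; [|by apply: cintgZ; exact: ntr_cintg|by apply: cintg_sum].
rewrite CexpZ; last exact: ntr_cintg.
rewrite Cexp_sum //; congr (_ - _); apply: eq_bigr => p _.
under eq_Cexp do rewrite -mulrA.
by rewrite CexpZ ?nmean_mul //; exact: ntrM_cintg.
Qed.

Lemma nmean_euler' w : euler (fun l => nmean l w) (fun l => - (decay t w)%:C * nmean l w -
  \sum_(p <- splits t w) p.1 * (nmean l p.2.1 * nmean l p.2.2 + NC^-1 ^+ 2 * mom l [:: p.2.1; p.2.2])).
Proof. by apply: euler_ext (nmean_euler w) => // l l01; rewrite nmean'E. Qed.

(** Products of two normalised traces are expanded about their means. The constant terms cancel
    against [nmean'E], the linear ones form [dterm], and only the centred quadratic term keeps a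
    factor [1 / N]. *)
Lemma fluct_drift l w x : 0 <= l <= 1 -> NC * (tdrift U t l w x - nmean' l w) =
  lsum (dterm t (nmean l) w) (fun u => fluct l u x) -
  NC^-1 * \sum_(p <- splits t w) p.1 * (fluct l p.2.1 x * fluct l p.2.2 x - mom l [:: p.2.1; p.2.2]).
Proof.
move=> l01; rewrite nmean'E // /tdrift /dterm lsum_cons lsum_cat !lsum_map /= ntrE.
under eq_bigr do rewrite !ntrE.
set A := (X in _ - X - _); set B := (X in _ - (_ - X)); move: (fluct l w x) (nmean l w) (decay t w)%:C => y m c.
rewrite -[RHS]addrA; set D := (X in _ = _ + X).
have -> : NC * (- c * (m + NC^-1 * y) - A - (- c * m - B)) = - c * y + - NC * (A - B) by field; exact: NN.
congr (_ + _); rewrite /D /A /B -sumrB !mulr_sumr -sumrN -!big_split /=.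
by apply: eq_bigr => p _; field; exact: NN.
Qed.

(** Sorting the drift of a product by order in [N]: linear drift, mean part of the brackets, and all
    fluctuating corrections, which carry [1 / N] and are collected in [elist]. *)
Lemma pdriftE l W x : 0 <= l <= 1 -> pdrift l W x =
  lsum (dlist t (nmean l) W) (fun V => pfluct l V x) +
  lsum (blist t (nmean l) W) (fun V => pfluct l V x) +
  NC^-1 * lsum (elist t (fun u w => mom l [:: u; w]) W) (fun V => pfluct l V x).
Proof.
move=> l01; elim: W => [|w W IH]; first by rewrite /= !lsum_nil mulr0 !addr0.
rewrite (lsum_dlist t (nmean l) w) (lsum_blist t (nmean l) w) lsum_elist [pdrift _ _ _]/= fluct_drift // IH.
have E1 (s : seq (C * seq word)) : lsum s (fun V => pfluct l (w :: V) x) = fluct l w x * lsum s (fun V => pfluct l V x).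
  by rewrite lsum_mull; apply: eq_bigr => p _; rewrite pfluct_cons.
rewrite !E1.
have -> : lsum (dterm t (nmean l) w) (fun u => pfluct l (u :: W) x) =
    pfluct l W x * lsum (dterm t (nmean l) w) (fun u => fluct l u x).
  by rewrite lsum_mull; apply: eq_bigr => p _; rewrite pfluct_cons (mulrC (fluct _ _ _)).
have -> : \sum_(s <- sel W) \sum_(p <- merges t w s.1) - p.1 * pfluct l (p.2 :: s.2) x =
   - \sum_(s <- sel W) pfluct l s.2 x * \sum_(p <- merges t w s.1) p.1 * fluct l p.2 x.
  rewrite -sumrN; apply: eq_bigr => s _ /=.
  by rewrite mulr_sumr -sumrN; apply: eq_bigr => p _; rewrite pfluct_cons; ring.
have -> : \sum_(s <- sel W) bterm t (nmean l) w s.1 * pfluct l s.2 x =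
   - \sum_(s <- sel W) pfluct l s.2 x * \sum_(p <- merges t w s.1) p.1 * nmean l p.2.
  by rewrite -sumrN; apply: eq_bigr => s _; rewrite /bterm /lsum; ring.
have -> : \sum_(s <- sel W) pfluct l s.2 x * \sum_(p <- merges t w s.1) p.1 * (nmean l p.2 + NC^-1 * fluct l p.2 x) =
  \sum_(s <- sel W) pfluct l s.2 x * (\sum_(p <- merges t w s.1) p.1 * nmean l p.2) +
  NC^-1 * \sum_(s <- sel W) pfluct l s.2 x * \sum_(p <- merges t w s.1) p.1 * fluct l p.2 x.
  rewrite mulr_sumr -big_split; apply: eq_bigr => s _ /=; rewrite mulrCA -mulrDr; congr (_ * _).
  by rewrite mulr_sumr -big_split; apply: eq_bigr => p _ /=; ring.
have -> : \sum_(p <- splits t w) - p.1 * pfluct l (p.2.1 :: p.2.2 :: W) x =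
  - (pfluct l W x * \sum_(p <- splits t w) p.1 * (fluct l p.2.1 x * fluct l p.2.2 x)).
  by rewrite mulr_sumr -sumrN; apply: eq_bigr => p _; rewrite !pfluct_cons; ring.
have -> : \sum_(p <- splits t w) p.1 * mom l [:: p.2.1; p.2.2] * pfluct l W x =
  pfluct l W x * \sum_(p <- splits t w) p.1 * mom l [:: p.2.1; p.2.2].
  by rewrite mulr_sumr; apply: eq_bigr => p _; ring.
have -> : \sum_(p <- splits t w) p.1 * (fluct l p.2.1 x * fluct l p.2.2 x - mom l [:: p.2.1; p.2.2]) =
  \sum_(p <- splits t w) p.1 * (fluct l p.2.1 x * fluct l p.2.2 x) - \sum_(p <- splits t w) p.1 * mom l [:: p.2.1; p.2.2].
  by rewrite -sumrB; apply: eq_bigr => p _; ring.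
ring.
Qed.

Lemma mom_lsum l s : 0 <= l <= 1 -> cintg P (fun x => lsum s (fun V => pfluct l V x)) /\
  Cexp P (fun x => lsum s (fun V => pfluct l V x)) = lsum s (mom l).
Proof.
move=> l01; have i (p : C * seq word) : cintg P (fun x => p.1 * pfluct l p.2 x) by apply: cintgZ; exact: pfluct_cintg.
split; first exact: cintg_sum.
by rewrite Cexp_sum //; apply: eq_bigr => p _; rewrite CexpZ //; exact: pfluct_cintg.
Qed.

Lemma mom_euler W : euler (fun l => mom l W) (fun l =>
  lsum (dlist t (nmean l) W) (mom l) + lsum (blist t (nmean l) W) (mom l) +
  NC^-1 * lsum (elist t (fun u w => mom l [:: u; w]) W) (mom l)).
Proof.
apply: euler_ext (qeuler (pfluct_qjet W)) => // l l01.
under eq_Cexp do rewrite pdriftE //.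
have [i1 e1] := mom_lsum (dlist t (nmean l) W) l01.
have [i2 e2] := mom_lsum (blist t (nmean l) W) l01.
have [i3 e3] := mom_lsum (elist t (fun u w => mom l [:: u; w]) W) l01.
rewrite CexpD; [|exact: cintgD|exact: cintgZ].
by rewrite CexpD // CexpZ // e1 e2 e3.
Qed.

Lemma nmean0 w : nmean 0 w = 1.
Proof. by rewrite /nmean -[RHS](Cexp_cst P); apply: eq_Cexp => x; rewrite ntr0. Qed.

Lemma fluct0 w x : fluct 0 w x = 0.
Proof. by rewrite /fluct nmean0 ntr0 // subrr mulr0. Qed.

Lemma mom0 w W : mom 0 (w :: W) = 0.
Proof.
rewrite /mom -[RHS](Cexp_cst P); apply: eq_Cexp => x.
by rewrite pfluct_cons fluct0 mul0r.
Qed.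

Lemma fluct_conj l w x : 0 <= l <= 1 -> (fluct l w x)^*%C = fluct l (wflip w) x.
Proof.
move=> l01; have NR : NC = (N%:R : R)%:C by rewrite rmorph_nat.
have D (u v z : C) : (u * (v - z))^*%C = u^*%C * (v^*%C - z^*%C).
  by case: u v z => [u1 u2] [v1 v2] [z1 z2]; apply: complex_ext; rewrite /=; ring.
rewrite /fluct D ntr_conj /nmean -Cexp_conj; last exact: ntr_cintg.
have -> : Cexp P (fun x => (ntr U t l w x)^*%C) = Cexp P (ntr U t l (wflip w)).
  by apply: eq_Cexp => y; rewrite ntr_conj.
by congr (_ * _); rewrite NR; exact: conjc_real.
Qed.

Lemma fluct_small l w x : 0 <= l <= 1 -> N%:R^-1 * cabs (fluct l w x) <= 2.
Proof.
move=> l01; rewrite /fluct cabsM (_ : cabs NC = N%:R); last first.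
  by rewrite (_ : NC = (N%:R : R)%:C) ?cabs_real ?ger0_norm // rmorph_nat.
rewrite mulKf ?pnatr_eq0 -?lt0n // (le_trans (ler_cabsB _ _)) // -[2]/(1 + 1) lerD ?nmean_le1 //.
by apply: ntr_le1 => //; case/andP: l01.
Qed.

End Moments.

Section RealProducts.
Context {R : realType}.

(** With [X] the larger of 1 and all the factors, the product is at most a power of [X] with
    exponent at most [n], and [X ^+ n] is one of the summands. It trades mixed moments for even
    absolute ones. *)
Lemma prod_le_pow (I : Type) (s : seq I) (z : I -> R) n : (forall i, 0 <= z i) -> (size s <= n)%N ->
  \prod_(i <- s) z i <= 1 + \sum_(i <- s) z i ^+ n.
Proof.
move=> z0 sn.
have [X X1 [Xz Xn]] : exists2 X : R, 1 <= X & \prod_(i <- s) z i <= X ^+ size s /\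
    X ^+ n <= 1 + \sum_(i <- s) z i ^+ n.
  elim: s {sn} => [|i s [X X1 [Xz Xn]]].
    by exists 1 => //; rewrite !big_nil expr0 expr1n addr0.
  have X0 : 0 <= X by exact: le_trans X1.
  have p0 : 0 <= \prod_(j <- s) z j by apply: prodr_ge0.
  have s0 : 0 <= \sum_(j <- s) z j ^+ n by apply: sumr_ge0 => j _; exact: exprn_ge0.
  rewrite !big_cons; have [zX|Xzi] := leP (z i) X.
    exists X => //; split; first by rewrite exprS ler_pM.
    by apply: (le_trans Xn); rewrite lerD2l lerDr exprn_ge0.
  exists (z i); first by rewrite (le_trans X1) // ltW.
  split; last by rewrite addrCA lerDl addr_ge0.
  rewrite exprS ler_wpM2l // (le_trans Xz) // lerXn2r ?nnegrE ?(ltW Xzi) //.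
apply: (le_trans Xz); apply: le_trans Xn; exact: ler_weXn2l.
Qed.

End RealProducts.

(** * Domination by even absolute moments *)

Section MomentBounds.
Context {R : realType} d (T : measurableType d) (P : probability T R).
Variables (N q : nat).
Hypothesis N0 : (0 < N)%N.
Local Notation C := R[i].
Local Notation M := 'M[C]_N.
Local Notation word := (word q).
Variables (F : 'I_q -> R -> set (set T)) (K U : 'I_q -> R -> T -> M).
Hypothesis flt : forall i, filtration (F i).
Hypothesis bm : forall i, uN_brownian P (F i) (K i).
Hypothesis adU : forall i, adapted (F i) (U i).
Hypothesis unU : forall i s x, 0 <= s -> U i s x \is unitarymx.
Hypothesis U0 : forall i x, U i 0 x = 1%:M.
Hypothesis cU : forall i, continuous_paths (U i).
Hypothesis itoU : forall i s, 0 <= s ->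
  exists2 I : T -> M, is_ito_integral P (F i) (K i) s (U i) I &
    {ae P, forall x, U i s x = 1%:M + I x - 2^-1 *: time_integral (U i) s x}.
Hypothesis indU : independent_processes P U.
Variable t : 'I_q -> R.
Hypothesis t0 : forall i, 0 <= t i.

Local Notation NC := (N%:R : C).
Local Notation nmean := (nmean P U t).
Local Notation fluct := (fluct P U t).
Local Notation pfluct := (pfluct P U t).
Local Notation mom := (mom P U t).

Let cint l W : 0 <= l <= 1 -> cintg P (pfluct l W).
Proof. exact: (pfluct_cintg N0 flt bm adU unU cU itoU indU t0). Qed.

Let fb w := fluct_bnd N0 flt bm adU unU cU itoU indU t0 w.

(* The moment of this list is [E|y_w|^(2k)], as conjugating a trace flips the word. *)
Definition power_word k (w : word) : seq word := nseq k w ++ nseq k (wflip w).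

Definition pmom k l w : R := cabs (mom l (power_word k w)).

Lemma fluct_pow_intg l w k : 0 <= l <= 1 -> intg P (fun x => cabs (fluct l w x) ^+ k).
Proof.
move=> l01; have [c c0 H] := fb w; have [mf bf] := H l l01.
apply: (@intg_bnd _ _ _ _ _ (c ^+ k)) => [|x]; first by apply: measurable_funX; exact: cmeas_cabs.
by rewrite ger0_norm ?exprn_ge0 // lerXn2r ?nnegrE.
Qed.

Lemma pmomE k l w : 0 <= l <= 1 -> pmom k l w = Ex P (fun x => cabs (fluct l w x) ^+ (2 * k)).
Proof.
move=> l01; rewrite /pmom.
have -> : mom l (power_word k w) = (Ex P (fun x => cabs (fluct l w x) ^+ (2 * k)))%:C.
  have E x : pfluct l (power_word k w) x = (cabs (fluct l w x) ^+ (2 * k))%:C.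
    rewrite /pfluct big_cat !big_nseq -!/(iter _ _ _) -!Monoid.iteropE -!/(_ ^+ _) /=.
    rewrite -(fluct_conj N0 flt bm adU unU cU itoU t0 w x l01) -exprMn mul_conj_cabs.
    by rewrite exprM; exact/esym/(rmorphXn (real_complex R)).
  rewrite /mom /Cexp; apply: complex_ext => /=.
    by rewrite /Ex; congr (fine _); congr ('E_P[_])%E; apply/funext => x; rewrite E.
  rewrite (_ : (fun x => complex.Im (pfluct l (power_word k w) x)) = fun=> 0); first exact: Ex_cst.
  by apply/funext => x; rewrite E.
rewrite cabs_real ger0_norm //; apply: Ex_ge0 => x; exact: exprn_ge0.
Qed.

Definition ysum k l (W : seq word) x : R := 1 + \sum_(w <- W) cabs (fluct l w x) ^+ (2 * k).

Lemma ysum_intg k l W : 0 <= l <= 1 -> intg P (ysum k l W).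
Proof.
move=> l01; apply: intgD; first exact: intg_cst.
by apply: intg_sum => w _; exact: fluct_pow_intg.
Qed.

Lemma ysum_Ex k l W : 0 <= l <= 1 -> Ex P (ysum k l W) = 1 + \sum_(w <- W) pmom k l w.
Proof.
move=> l01; rewrite /ysum ExD; [|exact: intg_cst|by apply: intg_sum => w _; exact: fluct_pow_intg].
rewrite Ex_cst Ex_sum; last by move=> w _; exact: fluct_pow_intg.
by congr (_ + _); apply: eq_bigr => w _; rewrite pmomE.
Qed.

Lemma pfluct_ysum k l W x : (size W <= 2 * k)%N -> cabs (pfluct l W x) <= ysum k l W x.
Proof.
move=> sW; rewrite /pfluct cabs_prod /ysum.
exact: (@prod_le_pow _ _ W (fun w => cabs (fluct l w x)) (2 * k)).
Qed.

Lemma mom_le k l W : 0 <= l <= 1 -> (size W <= 2 * k)%N -> cabs (mom l W) <= 1 + \sum_(w <- W) pmom k l w.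
Proof.
move=> l01 sW; rewrite -ysum_Ex //; apply: cabs_Cexp_le; [exact: cint|exact: ysum_intg|].
by move=> x; exact: pfluct_ysum.
Qed.

Lemma fluct_leN l w x : 0 <= l <= 1 -> cabs (fluct l w x) <= 2 * N%:R.
Proof.
move=> l01; have := fluct_small N0 flt bm adU unU cU itoU t0 w x l01.
by rewrite ler_pdivrMl ?ltr0n // mulrC.
Qed.

(** This is how a merged word is handled: the weight [1 / N] and the trivial bound remove [m]
    altogether, whatever its length, and the rest is an ordinary mixed moment. *)
Lemma mom_extra_le k l m W : 0 <= l <= 1 -> (size W <= 2 * k)%N ->
  N%:R^-1 * cabs (mom l (m :: W)) <= 2 * (1 + \sum_(w <- W) pmom k l w).
Proof.
move=> l01 sW; rewrite ler_pdivrMl ?ltr0n // mulrA (mulrC N%:R) -ysum_Ex // -ExZ; last exact: ysum_intg.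
apply: cabs_Cexp_le; [exact: cint|by apply: intgZ; exact: ysum_intg|].
move=> x; rewrite pfluct_cons cabsM ler_pM //; [exact: fluct_leN|exact: pfluct_ysum].
Qed.

(** After [m] is removed by the trivial bound, a product of two separate expectations remains. It is
    bounded as if independent: one sample is frozen while the other is averaged. The strict bound on
    the size leaves room for the extra factor [o]. *)
Lemma mom_product_le k l m o W : 0 <= l <= 1 -> (size W < 2 * k)%N ->
  N%:R^-1 * cabs (mom l [:: m; o]) * cabs (mom l W) <= 2 * (1 + \sum_(w <- o :: W) pmom k l w).
Proof.
move=> l01 sW; have n0 : 0 < N%:R :> R by rewrite ltr0n.
have i1 : intg P (fun x => cabs (fluct l o x)) by exact: (fluct_pow_intg o 1 l01).
have e1 : N%:R^-1 * cabs (mom l [:: m; o]) <= 2 * Ex P (fun x => cabs (fluct l o x)).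
  rewrite ler_pdivrMl // mulrA (mulrC N%:R) -ExZ //.
  apply: cabs_Cexp_le; [exact: cint|exact: intgZ|move=> x].
  by rewrite pfluct_cons cabsM ler_pM ?fluct_leN // /pfluct big_seq1.
apply: (@le_trans _ _ (2 * Ex P (fun x => cabs (fluct l o x)) * cabs (mom l W))).
  by rewrite ler_wpM2r.
rewrite -mulrA ler_wpM2l // mulrC -ExZ // -ysum_Ex //.
pose Y x := (cabs (fluct l o x) ^+ (2 * k)) + (1 + \sum_(w <- W) pmom k l w).
have iY : intg P Y by apply: intgD; [exact: fluct_pow_intg|exact: intg_cst].
have -> : Ex P (ysum k l (o :: W)) = Ex P Y.
  rewrite ysum_Ex // /Y ExD; [|exact: fluct_pow_intg|exact: intg_cst].
  by rewrite Ex_cst -pmomE // big_cons addrCA.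
apply: le_Ex => // [|x]; first exact: intgZ.
rewrite /Y -(ysum_Ex k W l01) -[X in _ <= X + _](Ex_cst P) -ExD; [|exact: intg_cst|exact: ysum_intg].
rewrite mulrC -[leLHS]ger0_norm ?mulr_ge0 // -cabs_real rmorphM.
have -> : cabs ((cabs (fluct l o x))%:C * (cabs (mom l W))%:C) = cabs ((cabs (fluct l o x))%:C * mom l W).
  by rewrite !cabsM !cabs_real; congr (_ * _); exact: ger0_norm.
rewrite -CexpZ; last exact: cint.
apply: cabs_Cexp_le => [||x']; [by apply: cintgZ; exact: cint|by apply: intgD; [exact: intg_cst|exact: ysum_intg]|].
rewrite cabsM cabs_real ger0_norm // /pfluct cabs_prod.
have := @prod_le_pow R (option word) (None :: map Some W)
  (fun w => if w is Some w' then cabs (fluct l w' x') else cabs (fluct l o x)) (2 * k).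
rewrite !big_cons !big_map /ysum addrCA; apply; last by rewrite /= size_map.
by case.
Qed.

End MomentBounds.

(** * Combinatorics of the Wick sum *)

Section SelectionIdentities.
Context {R : realType} (q : nat) (t : 'I_q -> R).
Local Notation C := R[i].
Local Notation word := (word q).

Lemma size_sel (A : Type) (W : seq A) : size (sel W) = size W.
Proof. by elim: W => //= w W IH; rewrite size_map IH. Qed.

Lemma sel_cons (A : Type) (w : A) W (f : A * seq A -> C) :
  \sum_(s <- sel (w :: W)) f s = f (w, W) + \sum_(s <- sel W) f (s.1, w :: s.2).
Proof. by rewrite /= big_cons big_map. Qed.

(** Taking two elements out in succession is symmetric in the order of removal. *)
Lemma sel_sel (A : Type) (W : seq A) (f : A -> A -> seq A -> C) :
  \sum_(s <- sel W) \sum_(s' <- sel s.2) f s.1 s'.1 s'.2 =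
  \sum_(s <- sel W) \sum_(s' <- sel s.2) f s'.1 s.1 s'.2.
Proof.
elim: W f => [|w W IH] f; first by rewrite !big_nil.
rewrite !sel_cons /=.
under [X in _ + X = _]eq_bigr do rewrite big_cons big_map /=.
under [X in _ = _ + X]eq_bigr do rewrite big_cons big_map /=.
rewrite !big_split /= (IH (fun u u' V => f u u' (w :: V))).
by rewrite addrCA.
Qed.

Lemma lsum_sel_dlist (a : word -> C) (p : word -> C) (Phi : seq word -> C) (W : seq word) :
  lsum (dlist t a W) (fun V => \sum_(s <- sel V) p s.1 * Phi s.2) =
  \sum_(s <- sel W) (lsum (dterm t a s.1) p * Phi s.2 + p s.1 * lsum (dlist t a s.2) Phi).
Proof.
elim: W Phi => [|w W IH] Phi; first by rewrite lsum_nil big_nil.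
rewrite (lsum_dlist t a w W) sel_cons /=.
under eq_lsum do rewrite sel_cons.
under [X in _ + X]eq_lsum do rewrite sel_cons.
rewrite !lsum_add (IH (fun V => Phi (w :: V))) /= -lsum_mull.
under [in RHS]eq_bigr do rewrite (lsum_dlist t a w) mulrDr.
rewrite !big_split /=.
have -> : lsum (dterm t a w) (fun u => \sum_(s <- sel W) p s.1 * Phi (u :: s.2)) =
    \sum_(s <- sel W) p s.1 * lsum (dterm t a w) (fun u => Phi (u :: s.2)).
  rewrite /lsum; under eq_bigr do rewrite mulr_sumr.
  rewrite exchange_big; apply: eq_bigr => s _ /=; rewrite mulr_sumr.
  by apply: eq_bigr => u _; rewrite mulrCA.
have -> : lsum (dterm t a w) (fun u => p u * Phi W) = lsum (dterm t a w) p * Phi W.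
  by rewrite /lsum mulr_suml; apply: eq_bigr => u _; rewrite mulrA.
ring.
Qed.

(** A bracket removes two words and a selection a third; by [sel_sel] the selection may be made
    first. Only brackets within the rest survive, the other ones being left to the pair that
    contains the distinguished word. *)
Lemma lsum_sel_blist (a : word -> C) (p : word -> C) (Phi : seq word -> C) (W : seq word) :
  lsum (blist t a W) (fun V => \sum_(s <- sel V) p s.1 * Phi s.2) =
  \sum_(s <- sel W) p s.1 * lsum (blist t a s.2) Phi.
Proof.
elim: W Phi => [|w W IH] Phi; first by rewrite lsum_nil big_nil.
rewrite (lsum_blist t a w W) sel_cons /=.
under [X in _ + X]eq_lsum do rewrite sel_cons.
rewrite lsum_add (IH (fun V => Phi (w :: V))) /= -lsum_mull.
under [in RHS]eq_bigr do rewrite (lsum_blist t a w) mulrDr.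
rewrite big_split /=.
under [X in X + _ = _]eq_bigr do rewrite mulr_sumr.
rewrite (sel_sel W (fun u u' V => bterm t a w u * (p u' * Phi V))).
have -> : \sum_(s <- sel W) \sum_(s' <- sel s.2) bterm t a w s'.1 * (p s.1 * Phi s'.2) =
   \sum_(s <- sel W) p s.1 * \sum_(s' <- sel s.2) bterm t a w s'.1 * Phi s'.2.
  by apply: eq_bigr => s _; rewrite mulr_sumr; apply: eq_bigr => s' _; rewrite mulrCA.
ring.
Qed.

End SelectionIdentities.

Section ListBounds.
Context {R : realType} (q : nat) (t : 'I_q -> R).
Hypothesis t0 : forall i, 0 <= t i.
Local Notation C := R[i].
Local Notation word := (word q).

Definition short n : pred (seq word) := all (fun w => (size w <= n)%N).

Lemma sel_short n W s : short n W -> s \in sel W ->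
  [/\ (size s.1 <= n)%N, short n s.2, (size s.2).+1 = size W & perm_eq W (s.1 :: s.2)].
Proof.
elim: W s => //= w W IH s /andP[wn Wn]; rewrite in_cons => /orP[/eqP -> //|/mapP[s' /(IH s' Wn)[h1 h2 h3 h4] ->]].
split => //=; [by rewrite wn|by rewrite h3|].
apply: (perm_trans (y := w :: s'.1 :: s'.2)); first by rewrite perm_cons.
by rewrite -!(cat1s _ (_ :: _)) -!(cat1s _ s'.2) perm_catCA.
Qed.

Variable n : nat.
(** A splitting or merging has a coefficient of modulus at most [tsum t], and a word or a pair of
    words of length at most [n] has at most [n * n] of them. *)
Definition weight : R := tsum t * (n * n)%:R.

Lemma weight_ge0 : 0 <= weight.
Proof. by apply: mulr_ge0 => //; exact: tsum_ge0. Qed.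

Lemma lsum_const_bound (A : eqType) (s : seq (C * A)) (Phi : A -> C) (c B : R) : 0 <= c -> 0 <= B ->
  (forall p, p \in s -> cabs p.1 <= c /\ cabs (Phi p.2) <= B) ->
  cabs (lsum s Phi) <= c * (size s)%:R * B.
Proof.
move=> c0 B0 H; rewrite /lsum; apply: (le_trans (ler_cabs_sum _ _ _)).
apply: (@le_trans _ _ (\sum_(p <- s) c * B)).
  by rewrite big_seq [leRHS]big_seq ler_sum // => p /H[h1 h2]; rewrite cabsM ler_pM.
by rewrite big_const_seq count_predT iter_addr_0 -[leLHS]mulr_natr [leLHS]mulrAC.
Qed.

Lemma sum_const_bound (A : eqType) (s : seq A) (f : A -> C) (B : R) :
  (forall p, p \in s -> cabs (f p) <= B) -> cabs (\sum_(p <- s) f p) <= (size s)%:R * B.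
Proof.
move=> H; apply: (le_trans (ler_cabs_sum _ _ _)).
apply: (@le_trans _ _ (\sum_(p <- s) B)).
  by rewrite big_seq [leRHS]big_seq ler_sum.
by rewrite big_const_seq count_predT iter_addr_0 -[leLHS]mulr_natr [leLHS]mulrC.
Qed.

Lemma splits_bound w (f : word -> word -> C) (B : R) : (size w <= n)%N -> 0 <= B ->
  (forall m o, (size m <= n)%N -> (size o <= n)%N -> cabs (f m o) <= B) ->
  cabs (\sum_(p <- splits t w) p.1 * f p.2.1 p.2.2) <= weight * B.
Proof.
move=> wn B0 H.
have := @lsum_const_bound _ (splits t w) (fun p => f p.1 p.2) (tsum t) B (tsum_ge0 t0) B0.
rewrite /lsum /weight => /(_ _)/le_trans; apply => [p /(splits_size t0)[e c]|].
  by split => //; apply: H; apply: leq_trans wn; rewrite -e ?leq_addr ?leq_addl.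
rewrite ler_wpM2r // ler_wpM2l ?tsum_ge0 // ler_nat (leq_trans (size_splits t w)) //.
exact: leq_mul.
Qed.

Lemma splits_boundN w (f : word -> word -> C) (B : R) : (size w <= n)%N -> 0 <= B ->
  (forall m o, (size m <= n)%N -> (size o <= n)%N -> cabs (f m o) <= B) ->
  cabs (\sum_(p <- splits t w) - p.1 * f p.2.1 p.2.2) <= weight * B.
Proof.
move=> wn B0 H; under eq_bigr do rewrite mulNr.
by rewrite sumrN cabsN splits_bound.
Qed.

Lemma merges_bound w u (f : word -> C) (B : R) : (size w <= n)%N -> (size u <= n)%N -> 0 <= B ->
  (forall m, (size m <= 2 * n)%N -> cabs (f m) <= B) ->
  cabs (lsum (merges t w u) f) <= weight * B.
Proof.
move=> wn un B0 H.
apply: (@le_trans _ _ (tsum t * (size (merges t w u))%:R * B)).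
  apply: lsum_const_bound => [||p /(merges_size t0)[e c]] //; first exact: tsum_ge0.
  by split => //; apply: H; rewrite e mul2n -addnn leq_add.
rewrite ler_wpM2r // ler_wpM2l ?tsum_ge0 // ler_nat (leq_trans (size_merges t w u)) //.
exact: leq_mul.
Qed.

Lemma dterm_bound (a : word -> C) w (f : word -> C) (B : R) : (size w <= n)%N -> 0 <= B ->
  (forall m, (size m <= n)%N -> cabs (a m) <= 1) ->
  (forall m, (size m <= n)%N -> cabs (f m) <= B) ->
  cabs (lsum (dterm t a w) f) <= 3 * weight * B.
Proof.
move=> wn B0 a1 H; rewrite /dterm lsum_cons lsum_cat !lsum_map /=.
have e1 : cabs (- (decay t w)%:C * f w) <= weight * B.
  have /andP[d0 d1] := decay_le t0 w.
  rewrite cabsM cabsN cabs_real ger0_norm // ler_pM ?H // (le_trans d1) // ler_wpM2l ?tsum_ge0 // ler_nat.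
  by rewrite (leq_trans wn) //; case: (n) => // k; rewrite leq_pmulr.
have B1 z z' : cabs z <= 1 -> cabs z' <= B -> cabs (z * z') <= B.
  by move=> h1 h2; rewrite cabsM -[B]mul1r ler_pM.
have e2 : cabs (\sum_(p <- splits t w) - p.1 * a p.2.1 * f p.2.2) <= weight * B.
  under eq_bigr do rewrite -mulrA.
  by apply: (splits_boundN (f := fun m o => a m * f o)) => // m o mn on; apply: B1; [exact: a1|exact: H].
have e3 : cabs (\sum_(p <- splits t w) - p.1 * a p.2.2 * f p.2.1) <= weight * B.
  under eq_bigr do rewrite -mulrA.
  by apply: (splits_boundN (f := fun m o => a o * f m)) => // m o mn on; apply: B1; [exact: a1|exact: H].
apply: (le_trans (ler_cabsD _ _)); apply: (le_trans (lerD e1 (ler_cabsD _ _))).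
apply: (le_trans (lerD (lexx _) (lerD e2 e3))).
by rewrite le_eqVlt; apply/orP; left; apply/eqP; ring.
Qed.

Lemma dlist_bound (a : word -> C) W (Phi : seq word -> C) (B : R) : short n W -> 0 <= B ->
  (forall m, (size m <= n)%N -> cabs (a m) <= 1) ->
  (forall V, short n V -> size V = size W -> cabs (Phi V) <= B) ->
  cabs (lsum (dlist t a W) Phi) <= (size W)%:R * (3 * weight * B).
Proof.
move=> + B0 a1; elim: W Phi => [|w W IH] Phi; first by rewrite lsum_nil cabs0 mul0r.
move=> /= /andP[wn Wn] H; rewrite (lsum_dlist t a w W) -natr1 mulrDl mul1r addrC.
apply: (le_trans (ler_cabsD _ _)); apply: lerD.
  by apply: IH => // V Vn sV; apply: H; rewrite /= ?wn ?sV.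
by apply: dterm_bound => // m mn; apply: H; rewrite /= ?mn.
Qed.

Lemma bterm_bound (a : word -> C) w u (B : R) : (size w <= n)%N -> (size u <= n)%N -> 0 <= B ->
  (forall m, (size m <= 2 * n)%N -> cabs (a m) <= B) -> cabs (bterm t a w u) <= weight * B.
Proof. by move=> wn un B0 H; rewrite /bterm cabsN; exact: merges_bound. Qed.

Lemma blist_bound (a : word -> C) W (Phi : seq word -> C) (B : R) : short n W -> 0 <= B ->
  (forall m, (size m <= 2 * n)%N -> cabs (a m) <= 1) ->
  (forall V, short n V -> (size V <= size W)%N -> cabs (Phi V) <= B) ->
  cabs (lsum (blist t a W) Phi) <= (size W * size W)%:R * (weight * B).
Proof.
move=> + B0 a1; elim: W Phi => [|w W IH] Phi; first by rewrite lsum_nil cabs0 mul0r.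
move=> /= /andP[wn Wn] H; rewrite (lsum_blist t a w W).
have wB : 0 <= weight * B by rewrite mulr_ge0 // weight_ge0.
apply: (@le_trans _ _ ((size W)%:R * (weight * B) + (size W * size W)%:R * (weight * B))); last first.
  by rewrite -mulrDl -natrD ler_wpM2r // ler_nat; lia.
apply: (le_trans (ler_cabsD _ _)); apply: lerD.
  rewrite -(size_sel W); apply: sum_const_bound => s /(sel_short Wn)[h1 h2 h3 _].
  rewrite cabsM ler_pM //; last by apply: H => //; rewrite -h3 leqW // leqW.
  by rewrite -[weight]mulr1; apply: bterm_bound.
by apply: IH => // V Vn sV; apply: H; rewrite /= ?wn.
Qed.

(** The only list in which words longer than [n] occur, one at a time. [V'] is taken up to
    permutation because the recursion puts other words in front of the long one. *)
Lemma elist_bound (m2 : word -> word -> C) W (Phi : seq word -> C) (B : R) : short n W -> 0 <= B ->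
  (forall m V V', (size m <= 2 * n)%N -> short n V -> (size V <= size W)%N -> perm_eq V' (m :: V) -> cabs (Phi V') <= B) ->
  (forall m o V, (size m <= n)%N -> (size o <= n)%N -> short n V -> (size V < size W)%N ->
     cabs (m2 m o * Phi V) <= B) ->
  cabs (lsum (elist t m2 W) Phi) <= (size W * (size W + 2))%:R * (weight * B).
Proof.
move=> + B0; elim: W Phi => [|w W IH] Phi; first by rewrite lsum_nil cabs0 mul0r.
move=> /= /andP[wn Wn] H1 H2; rewrite lsum_elist.
have wB : 0 <= weight * B by rewrite mulr_ge0 // weight_ge0.
have n2 m : (size m <= n)%N -> (size m <= 2 * n)%N by move=> h; rewrite (leq_trans h) // leq_pmull.
apply: (@le_trans _ _ (weight * B + weight * B + (size W)%:R * (weight * B) +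
     (size W * (size W + 2))%:R * (weight * B))); last first.
  set z := weight * B in wB *.
  have -> : z + z + (size W)%:R * z + (size W * (size W + 2))%:R * z =
    (2 + size W + size W * (size W + 2))%:R * z by rewrite !natrD; ring.
  by rewrite ler_wpM2r // ler_nat; lia.
apply: (le_trans (ler_cabsD _ _)); apply: lerD; last first.
  apply: IH => // [m V V' mn Vn sV pV|m o V mn on Vn sV].
  - apply: (H1 m (w :: V)) => //; first by rewrite /= wn.
    apply: (perm_trans (y := w :: m :: V)); first by rewrite perm_cons.
    by rewrite -!(cat1s _ (_ :: _)) -!(cat1s _ V) perm_catCA.
  - by apply: H2 => //=; rewrite wn.
apply: (le_trans (ler_cabsD _ _)); apply: lerD.
  apply: (le_trans (ler_cabsD _ _)); apply: lerD.
    apply: (splits_boundN (f := fun m o => Phi (m :: o :: W))) => // m o mn on.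
    by apply: (H1 m (o :: W)) => //=; rewrite ?on //; exact: n2.
  under eq_bigr do rewrite -mulrA.
  by apply: (splits_bound (f := fun m o => m2 m o * Phi W)) => // m o mn on; apply: H2.
rewrite -(size_sel W); apply: sum_const_bound => s /(sel_short Wn)[h1 h2 h3 _].
under eq_bigr do rewrite mulNr.
rewrite sumrN cabsN; apply: (merges_bound (f := fun m => Phi (m :: s.2))) => // m mn.
by apply: (H1 m s.2) => //; rewrite -h3 leqW // leqW.
Qed.

Lemma dterm_diff (a a' : word -> C) w (f : word -> C) (e B : R) : (size w <= n)%N -> 0 <= B -> 0 <= e ->
  (forall m, (size m <= n)%N -> cabs (a m - a' m) <= e) ->
  (forall m, (size m <= n)%N -> cabs (f m) <= B) ->
  cabs (lsum (dterm t a w) f - lsum (dterm t a' w) f) <= 2 * weight * (e * B).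
Proof.
move=> wn B0 e0 ae H; rewrite /dterm !lsum_cons !lsum_cat !lsum_map /=.
have eB : 0 <= e * B by exact: mulr_ge0.
have -> : - (decay t w)%:C * f w + (\sum_(i <- splits t w) - i.1 * a i.2.1 * f i.2.2 +
      \sum_(i <- splits t w) - i.1 * a i.2.2 * f i.2.1) -
    (- (decay t w)%:C * f w + (\sum_(i <- splits t w) - i.1 * a' i.2.1 * f i.2.2 +
      \sum_(i <- splits t w) - i.1 * a' i.2.2 * f i.2.1)) =
    \sum_(i <- splits t w) - i.1 * ((a i.2.1 - a' i.2.1) * f i.2.2) +
    \sum_(i <- splits t w) - i.1 * ((a i.2.2 - a' i.2.2) * f i.2.1).
  rewrite opprD addrACA subrr add0r opprD addrACA -!sumrB.
  by congr (_ + _); apply: eq_bigr => p _; ring.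
rewrite -mulrA mulrDl mul1r; apply: (le_trans (ler_cabsD _ _)); apply: lerD.
  apply: (splits_boundN (f := fun m o => (a m - a' m) * f o)) => // m o mn on.
  by rewrite cabsM ler_pM ?ae ?H.
apply: (splits_boundN (f := fun m o => (a o - a' o) * f m)) => // m o mn on.
by rewrite cabsM ler_pM ?ae ?H.
Qed.

Lemma dlist_diff (a a' : word -> C) W (Phi : seq word -> C) (e B : R) : short n W -> 0 <= B -> 0 <= e ->
  (forall m, (size m <= n)%N -> cabs (a m - a' m) <= e) ->
  (forall V, short n V -> size V = size W -> cabs (Phi V) <= B) ->
  cabs (lsum (dlist t a W) Phi - lsum (dlist t a' W) Phi) <= (size W)%:R * (2 * weight * (e * B)).
Proof.
move=> + B0 e0 ae; elim: W Phi => [|w W IH] Phi; first by rewrite !lsum_nil subrr cabs0 mul0r.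
move=> /= /andP[wn Wn] H; rewrite (lsum_dlist t a w W) (lsum_dlist t a' w W) -natr1 mulrDl mul1r.
rewrite opprD addrACA addrC; apply: (le_trans (ler_cabsD _ _)); apply: lerD.
  by apply: IH => // V Vn sV; apply: H; rewrite /= ?wn ?sV.
by apply: dterm_diff => // m mn; apply: H; rewrite /= ?mn.
Qed.

Lemma blist_diff (a a' : word -> C) W (Phi : seq word -> C) (e B : R) : short n W -> 0 <= B -> 0 <= e ->
  (forall m, (size m <= 2 * n)%N -> cabs (a m - a' m) <= e) ->
  (forall V, short n V -> (size V <= size W)%N -> cabs (Phi V) <= B) ->
  cabs (lsum (blist t a W) Phi - lsum (blist t a' W) Phi) <= (size W * size W)%:R * (weight * (e * B)).
Proof.
move=> + B0 e0 ae; elim: W Phi => [|w W IH] Phi; first by rewrite !lsum_nil subrr cabs0 mul0r.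
move=> /= /andP[wn Wn] H; rewrite (lsum_blist t a w W) (lsum_blist t a' w W).
have wB : 0 <= weight * (e * B) by rewrite mulr_ge0 ?weight_ge0 // mulr_ge0.
apply: (@le_trans _ _ ((size W)%:R * (weight * (e * B)) + (size W * size W)%:R * (weight * (e * B)))); last first.
  by rewrite -mulrDl -natrD ler_wpM2r // ler_nat; lia.
rewrite opprD addrACA; apply: (le_trans (ler_cabsD _ _)); apply: lerD.
  rewrite -sumrB -(size_sel W); apply: sum_const_bound => s /(sel_short Wn)[h1 h2 h3 _].
  rewrite -mulrBl cabsM mulrA ler_pM //; last by apply: H => //; rewrite -h3 leqW // leqW.
  rewrite /bterm -opprD cabsN /lsum -sumrB.
  under eq_bigr do rewrite -mulrBr.
  exact: (merges_bound (f := fun m => a m - a' m)).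
by apply: IH => // V Vn sV; apply: H; rewrite /= ?wn.
Qed.

End ListBounds.

(** * The limit of the hierarchy *)

Local Ltac nonneg := repeat first [ assumption | exact: ler0n | exact: ler01 | exact: expR_ge0 | exact: sqr_ge0
  | apply: addr_ge0 | apply: mulr_ge0 | rewrite invr_ge0 ].

Section HierarchyLimit.
Context {R : realType} (q : nat) (t : 'I_q -> R).
Hypothesis t0 : forall i, 0 <= t i.
Local Notation C := R[i].
Local Notation word := (word q).

(* What the estimates use of [a l w = E[N^-1 Tr w]] and of
   [M l W = E[prod_(w <- W) y_w]]: bounds that depend on nothing else are uniform
   in [N]. *)
Record hierarchy (N : nat) (a : R -> word -> C) (M : R -> seq word -> C) : Prop := Hierarchy {
  hN : (0 < N)%N;
  ha_le1 : forall l w, 0 <= l <= 1 -> cabs (a l w) <= 1;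
  ha0 : forall w, a 0 w = 1;
  ha_euler : forall w, euler (a^~ w) (fun l => - (decay t w)%:C * a l w -
    \sum_(p <- splits t w) p.1 * (a l p.2.1 * a l p.2.2 + N%:R^-1 ^+ 2 * M l [:: p.2.1; p.2.2]));
  hM_nil : forall l, M l [::] = 1;
  hM0 : forall w W, M 0 (w :: W) = 0;
  hM_euler : forall W, euler (M^~ W) (fun l =>
    lsum (dlist t (a l) W) (M l) + lsum (blist t (a l) W) (M l) +
    N%:R^-1 * lsum (elist t (fun u w => M l [:: u; w]) W) (M l));
  hM_perm : forall l W W', perm_eq W W' -> M l W = M l W';
  hM_apriori : forall m, exists2 c : R, 0 <= c &
    forall l W, 0 <= l <= 1 -> (size W <= m)%N -> cabs (M l W) <= c;
  hM_le : forall k l W, 0 <= l <= 1 -> (size W <= 2 * k)%N ->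
    cabs (M l W) <= 1 + \sum_(w <- W) cabs (M l (power_word k w));
  hM_extra : forall k l m W, 0 <= l <= 1 -> (size W <= 2 * k)%N ->
    N%:R^-1 * cabs (M l (m :: W)) <= 2 * (1 + \sum_(w <- W) cabs (M l (power_word k w)));
  hM_prod : forall k l m o W, 0 <= l <= 1 -> (size W < 2 * k)%N ->
    N%:R^-1 * cabs (M l [:: m; o]) * cabs (M l W) <=
      2 * (1 + \sum_(w <- o :: W) cabs (M l (power_word k w)))
}.

Lemma cabs_invn N : cabs (N%:R^-1 : C) = N%:R^-1.
Proof. by rewrite (_ : N%:R^-1 = (N%:R^-1)%:C :> C) ?cabs_real ?ger0_norm // fmorphV rmorph_nat. Qed.

Lemma euler_sub (f g f' g' : R -> C) : euler f g -> euler f' g' ->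
  euler (fun s => f s - f' s) (fun s => g s - g' s).
Proof.
by move=> J J'; apply: euler_ext (euler_add J (euler_scale (-1) J')) => s _; rewrite mulN1r.
Qed.

Lemma sum_power_le n k l (M : R -> seq word -> C) W (S : R) : 0 <= S ->
  (forall w, (size w <= n)%N -> cabs (M l (power_word k w)) <= S) -> short n W ->
  forall m, (size W <= m)%N -> 1 + \sum_(w <- W) cabs (M l (power_word k w)) <= 1 + m%:R * S.
Proof.
move=> S0 H Wn m Wm; rewrite lerD2l (@le_trans _ _ ((size W)%:R * S)) //; last by rewrite ler_wpM2r // ler_nat.
elim: W Wn {Wm} => [|w W IH] /=; first by rewrite big_nil mul0r.
by move=> /andP[wn Wn]; rewrite big_cons -natr1 mulrDl mul1r addrC lerD ?IH ?H.
Qed.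

Lemma power_word_short n k (w : word) : (size w <= n)%N ->
  short n (power_word k w) && (size (power_word k w) == 2 * k)%N.
Proof.
move=> wn; rewrite /power_word size_cat !size_nseq addnn mul2n eqxx andbT /short all_cat.
by rewrite !all_nseq size_wflip wn !orbT.
Qed.

(** Gronwall for lists of exactly [m] words of length at most [n]. Shorter lists produced by
    brackets, and corrections containing a long word, are bounded by the even absolute moments,
    which are moments of power words and hence members of the same family. *)
Lemma mom_unif_even n k : exists2 B : R, 0 <= B & forall N a M, hierarchy N a M ->
  forall l W, 0 <= l <= 1 -> short n W -> (size W <= 2 * k.+1)%N -> cabs (M l W) <= B.
Proof.
pose D := weight t n; pose m := (2 * k.+1)%N.
have D0 : 0 <= D by exact: weight_ge0.
pose ka : R := m%:R * (3 * D) + (m * m)%:R * D + (m * (m + 2))%:R * (2 * D).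
have ka0 : 0 <= ka by rewrite /ka; nonneg.
pose A := ka * m%:R + 1.
have A0 : 0 < A by rewrite ltr_wpDl //; nonneg.
pose E := 2 * ka * expR (2 * A).
have E0 : 0 <= E by rewrite /E; nonneg.
exists (1 + m%:R * E); first by nonneg.
move=> N a M h l W l01 Wn Wm.
have n0 : 0 < N%:R :> R by rewrite ltr0n (hN h).
apply: (le_trans (hM_le h l01 Wm)).
apply: (sum_power_le E0 _ Wn) => // w wn.
(* Exactly [m], the size of the power words: that is all that the domination needs, and it excludes
   the empty list, whose moment does not vanish at time 0. *)
pose I := {V : seq word | short n V && (size V == m)}.
have [c c0 cP] := hM_apriori h m.
have pI : short n (power_word k.+1 w) && (size (power_word k.+1 w) == m) := power_word_short k.+1 wn.
apply: (@gronwall R I (fun i s => M s (val i)) _ A ka c A0 ka0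
  (fun i => hM_euler h (val i)) _ _ _ (exist _ (power_word k.+1 w) pI) l l01).
- by case=> -[|v V] //= _; exact: (hM0 h).
- by move=> [V VI] s s1; have /andP[Vn /eqP Vm] := VI; apply: cP => //=; rewrite Vm.
move=> {l l01 W Wn Wm w wn pI} l l01 S S0 HS [W WI] /=; have /andP[Wn /eqP Wm] := WI.
have pS w : (size w <= n)%N -> cabs (M l (power_word k.+1 w)) <= S.
  move=> wn; have pI : short n (power_word k.+1 w) && (size (power_word k.+1 w) == m) := power_word_short k.+1 wn.
  exact: (HS (exist _ (power_word k.+1 w) pI)).
pose B := 1 + m%:R * S; have B0 : 0 <= B by rewrite /B; nonneg.
have sS V : short n V -> (size V <= m)%N -> 1 + \sum_(w <- V) cabs (M l (power_word k.+1 w)) <= B.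
  by move=> Vn Vm; exact: (sum_power_le S0 pS Vn Vm).
have mS V : short n V -> (size V <= m)%N -> cabs (M l V) <= B.
  by move=> Vn Vm; apply: (le_trans (hM_le h l01 Vm)); exact: sS.
have e1 : cabs (lsum (dlist t (a l) W) (M l)) <= m%:R * (3 * D * B).
  rewrite -Wm; apply: dlist_bound => // [w _|V Vn sV]; first exact: (ha_le1 h).
  by apply: mS => //; rewrite sV Wm.
have e2 : cabs (lsum (blist t (a l) W) (M l)) <= (m * m)%:R * (D * B).
  rewrite -Wm; apply: blist_bound => // [w _|V Vn sV]; first exact: (ha_le1 h).
  by apply: mS => //; rewrite (leq_trans sV) ?Wm.
(* The factor [N] in this bound is cancelled by the weight of [elist] in the equation; the 2 is the
   one of [hM_extra] and [hM_prod]. *)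
have e3 : cabs (lsum (elist t (fun u w => M l [:: u; w]) W) (M l)) <= (m * (m + 2))%:R * (D * (N%:R * (2 * B))).
  rewrite -Wm; apply: elist_bound => //; first by have n0w := ltW n0; nonneg.
    move=> u V V' _ Vn sV /(hM_perm h l) ->; rewrite -ler_pdivrMl //.
    have Vm : (size V <= m)%N by rewrite (leq_trans sV) ?Wm.
    by apply: (le_trans (hM_extra h u l01 Vm)); rewrite ler_wpM2l // sS.
  move=> u o V _ on Vn sV; rewrite cabsM -ler_pdivrMl // mulrA.
  have Vm : (size V < m)%N by rewrite (leq_trans sV) ?Wm.
  apply: (le_trans (hM_prod h u o l01 Vm)); rewrite ler_wpM2l // sS //=.
  by rewrite on.
apply: (le_trans (ler_cabsD _ _)); apply: (le_trans (lerD (ler_cabsD _ _) (lexx _))).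
rewrite cabsM cabs_invn.
have e4 : N%:R^-1 * cabs (lsum (elist t (fun u w => M l [:: u; w]) W) (M l)) <= (m * (m + 2))%:R * (2 * D) * B.
  rewrite ler_pdivrMl //; apply: (le_trans e3); rewrite le_eqVlt; apply/orP; left; apply/eqP; ring.
apply: (le_trans (lerD (lerD e1 e2) e4)).
have -> : m%:R * (3 * D * B) + (m * m)%:R * (D * B) + (m * (m + 2))%:R * (2 * D) * B = ka * m%:R * S + ka.
  rewrite /ka /B; ring.
by rewrite lerD2r ler_wpM2r // /A lerDl.
Qed.

Lemma mom_unif n m : exists2 B : R, 0 <= B & forall N a M, hierarchy N a M ->
  forall l W, 0 <= l <= 1 -> short n W -> (size W <= m)%N -> cabs (M l W) <= B.
Proof.
have [B B0 H] := mom_unif_even n m; exists B => // N a M h l W l01 Wn Wm.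
by apply: (H N a M h) => //; rewrite (leq_trans Wm) // mul2n -addnn leqW // leq_addr.
Qed.

Lemma decay_bound n w (z : C) (B : R) : (size w <= n)%N -> cabs z <= B ->
  cabs (- (decay t w)%:C * z) <= weight t n * B.
Proof.
move=> wn zB; have /andP[d0 d1] := decay_le t0 w.
rewrite cabsM cabsN cabs_real ger0_norm // ler_pM // (le_trans d1) // ler_wpM2l ?tsum_ge0 // ler_nat.
by rewrite (leq_trans wn) //; case: (n) => // k; rewrite leq_pmulr.
Qed.

(** In the equations of the means the moments enter with weight [N^-2] and are already bounded
    uniformly, so the difference of two solutions has a defect of that order. The a priori bound is
    2 since means have modulus at most 1. *)
Lemma nmean_cauchy n : exists2 B : R, 0 <= B & forall N a M N' a' M',
  hierarchy N a M -> hierarchy N' a' M' ->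
  forall l w, 0 <= l <= 1 -> (size w <= n)%N ->
  cabs (a l w - a' l w) <= B * (N%:R^-1 ^+ 2 + N'%:R^-1 ^+ 2).
Proof.
have [B B0 HB] := mom_unif n 2.
pose D := weight t n; have D0 : 0 <= D by exact: weight_ge0.
pose A := 3 * D + 1; have A0 : 0 < A by rewrite ltr_wpDl //; nonneg.
exists (2 * (D * B) * expR (2 * A)); first by nonneg.
move=> N a M N' a' M' h h' l w l01 wn.
pose e : R := N%:R^-1 ^+ 2 + N'%:R^-1 ^+ 2; have e0 : 0 <= e by rewrite addr_ge0 ?sqr_ge0.
have -> : 2 * (D * B) * expR (2 * A) * (N%:R^-1 ^+ 2 + N'%:R^-1 ^+ 2) = 2 * (D * B * e) * expR (2 * A).
  by rewrite /e; ring.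
pose I := {w : word | (size w <= n)%N}.
have de0 : 0 <= D * B * e by nonneg.
apply: (@gronwall R I (fun i s => a s (val i) - a' s (val i)) _ A (D * B * e) 2 A0 de0
  (fun i => euler_sub (ha_euler h (val i)) (ha_euler h' (val i))) _ _ _ (exist _ w wn) l l01).
- by move=> i; rewrite (ha0 h) (ha0 h') subrr.
- by move=> i s s1; rewrite (le_trans (ler_cabsB _ _)) // -[2]/(1 + 1) lerD ?(ha_le1 h) ?(ha_le1 h').
move=> {l l01 w wn} l l01 S S0 HS [w wn] /=.
have HS' m : (size m <= n)%N -> cabs (a l m - a' l m) <= S by move=> mn; exact: (HS (exist _ m mn)).
have -> : - (decay t w)%:C * a l w - (\sum_(p <- splits t w) p.1 * (a l p.2.1 * a l p.2.2 + N%:R^-1 ^+ 2 * M l [:: p.2.1; p.2.2])) -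
   (- (decay t w)%:C * a' l w - \sum_(p <- splits t w) p.1 * (a' l p.2.1 * a' l p.2.2 + N'%:R^-1 ^+ 2 * M' l [:: p.2.1; p.2.2])) =
   - (decay t w)%:C * (a l w - a' l w) -
   \sum_(p <- splits t w) p.1 * ((a l p.2.1 - a' l p.2.1) * a l p.2.2 + a' l p.2.1 * (a l p.2.2 - a' l p.2.2) +
      (N%:R^-1 ^+ 2 * M l [:: p.2.1; p.2.2] - N'%:R^-1 ^+ 2 * M' l [:: p.2.1; p.2.2])).
  rewrite mulrBr opprD addrACA opprK; congr (_ + _).
  by rewrite addrC -sumrB -sumrN; apply: eq_bigr => p _; ring.
apply: (le_trans (ler_cabsB _ _)).
apply: (@le_trans _ _ (D * S + D * (2 * S + B * e))).
  apply: lerD; first by apply: decay_bound => //; exact: HS'.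
  apply: (splits_bound t0 (f := fun m o => (a l m - a' l m) * a l o + a' l m * (a l o - a' l o) +
      (N%:R^-1 ^+ 2 * M l [:: m; o] - N'%:R^-1 ^+ 2 * M' l [:: m; o]))) => //.
    by nonneg.
  move=> m o mn on; apply: (le_trans (ler_cabsD _ _)); apply: lerD.
    apply: (le_trans (ler_cabsD _ _)); rewrite (_ : 2 * S = S + S); last by ring.
    apply: lerD; rewrite cabsM.
      by rewrite -[S]mulr1 ler_pM ?HS' ?(ha_le1 h).
    by rewrite -[S]mul1r ler_pM ?HS' ?(ha_le1 h').
  rewrite (le_trans (ler_cabsB _ _)) // /e mulrDr lerD //.
    by rewrite cabsM cabsX cabs_invn mulrC ler_wpM2r ?sqr_ge0 // (HB N a M h) //= mn on.
  by rewrite cabsM cabsX cabs_invn mulrC ler_wpM2r ?sqr_ge0 // (HB N' a' M' h') //= mn on.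
have -> : D * S + D * (2 * S + B * e) = 3 * D * S + D * B * e by ring.
by rewrite lerD2r ler_wpM2r // /A lerDl.
Qed.

Lemma nmean_cauchy1 n : exists2 B : R, 0 <= B & forall N a M N' a' M',
  hierarchy N a M -> hierarchy N' a' M' ->
  forall l w, 0 <= l <= 1 -> (size w <= n)%N ->
  cabs (a l w - a' l w) <= B * (N%:R^-1 + N'%:R^-1).
Proof.
have [B B0 H] := nmean_cauchy n; exists B => // N a M N' a' M' h h' l w l01 wn.
apply: (le_trans (H _ _ _ _ _ _ h h' l w l01 wn)); rewrite ler_wpM2l //.
have i1 (k : nat) : (0 < k)%N -> (k%:R^-1 : R) ^+ 2 <= k%:R^-1.
  by move=> k0; rewrite expr2 ler_piMl // invf_le1 ?ltr0n // ler1n.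
by rewrite lerD ?i1 ?(hN h) ?(hN h').
Qed.

(** Longer words no longer matter: [mom_unif] is available at every length and is applied at
    [2 * n]. The two spare places in the list serve the splitting, which adds a word, and the pairs
    of the centring term. *)
Lemma elist_small n m : exists2 B : R, 0 <= B & forall N a M, hierarchy N a M ->
  forall l W, 0 <= l <= 1 -> short n W -> (size W <= m)%N ->
  cabs (lsum (elist t (fun u w => M l [:: u; w]) W) (M l)) <= B.
Proof.
have [B B0 HB] := mom_unif (2 * n) (m + 2).
pose B' := B + B * B; have B'0 : 0 <= B' by rewrite /B'; nonneg.
have D0 : 0 <= weight t n by exact: weight_ge0.
exists ((m * (m + 2))%:R * (weight t n * B')); first by nonneg.
have n2 k : (k <= n)%N -> (k <= 2 * n)%N by move=> h; rewrite (leq_trans h) // leq_pmull.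
have sh V : short n V -> short (2 * n) V by apply: sub_all => w; exact: n2.
move=> N a M h l W l01 Wn Wm.
apply: (@le_trans _ _ ((size W * (size W + 2))%:R * (weight t n * B'))); last first.
  by apply: ler_wpM2r; [nonneg|rewrite ler_nat leq_mul // leq_add2r].
apply: elist_bound => // [u V V' un Vn sV pV|u o V un on Vn sV].
  apply: (@le_trans _ _ B); last by rewrite lerDl mulr_ge0.
  rewrite (hM_perm h l pV); apply: (HB N a M h) => //=; first by rewrite un sh.
  by rewrite addn2 ltnS leqW // (leq_trans sV).
apply: (@le_trans _ _ (B * B)); last by rewrite lerDr.
rewrite cabsM ler_pM // (HB N a M h) //=; first by rewrite !n2.
- by rewrite addn2.
- exact: sh.
- by rewrite (leq_trans (ltnW sV)) // (leq_trans Wm) // leq_addr.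
Qed.

(** Besides the two corrections of order [1 / N], the coefficients differ through the means; these
    are compared at length [2 * n], as they occur at merged words. *)
Lemma mom_cauchy n m : exists2 B : R, 0 <= B & forall N a M N' a' M',
  hierarchy N a M -> hierarchy N' a' M' ->
  forall l W, 0 <= l <= 1 -> short n W -> (size W <= m)%N ->
  cabs (M l W - M' l W) <= B * (N%:R^-1 + N'%:R^-1).
Proof.
have [B B0 HB] := mom_unif n m.
have [E E0 HE] := elist_small n m.
have [G G0 HG] := nmean_cauchy1 (2 * n).
pose D := weight t n; have D0 : 0 <= D by exact: weight_ge0.
pose ka : R := m%:R * (3 * D) + (m * m)%:R * D.
have ka0 : 0 <= ka by rewrite /ka; nonneg.
pose A := ka + 1; have A0 : 0 < A by rewrite ltr_wpDl.
pose de := m%:R * (2 * D * (G * B)) + (m * m)%:R * (D * (G * B)) + E.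
have de0 : 0 <= de by rewrite /de; nonneg.
exists (2 * de * expR (2 * A)); first by nonneg.
move=> N a M N' a' M' h h' l W l01 Wn Wm.
pose e : R := N%:R^-1 + N'%:R^-1; have e0 : 0 <= e by rewrite addr_ge0.
have -> : 2 * de * expR (2 * A) * (N%:R^-1 + N'%:R^-1) = 2 * (de * e) * expR (2 * A) by rewrite /e; ring.
pose I := {W : seq word | short n W && (size W <= m)%N}.
have dee0 : 0 <= de * e by exact: mulr_ge0.
have WI : short n W && (size W <= m)%N by rewrite Wn.
apply: (@gronwall R I (fun i s => M s (val i) - M' s (val i)) _ A (de * e) (B + B) A0 dee0
  (fun i => euler_sub (hM_euler h (val i)) (hM_euler h' (val i))) _ _ _ (exist _ W WI) l l01).
- by case=> -[|v V] _ /=; rewrite ?(hM_nil h) ?(hM_nil h') ?(hM0 h) ?(hM0 h') subrr.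
- move=> [V /andP[Vn Vm]] s s1 /=.
  by rewrite (le_trans (ler_cabsB _ _)) // lerD ?(HB _ _ _ h) ?(HB _ _ _ h').
move=> {l l01 W Wn Wm WI} l l01 S S0 HS [W /andP[Wn Wm]] /=.
have HS' V : short n V -> (size V <= m)%N -> cabs (M l V - M' l V) <= S.
  by move=> Vn Vm; have VI : short n V && (size V <= m)%N by [rewrite Vn]; exact: (HS (exist _ V VI)).
have n2 k : (k <= n)%N -> (k <= 2 * n)%N by move=> k0; rewrite (leq_trans k0) // leq_pmull.
have sm : (size W)%:R <= m%:R :> R by rewrite ler_nat.
have smm : (size W * size W)%:R <= (m * m)%:R :> R by rewrite ler_nat leq_mul.
have lB (s : seq (C * seq word)) : lsum s (M l) - lsum s (M' l) = lsum s (fun V => M l V - M' l V).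
  by rewrite /lsum -sumrB; apply: eq_bigr => p _; rewrite mulrBr.
have e1 : cabs (lsum (dlist t (a l) W) (M l) - lsum (dlist t (a' l) W) (M' l)) <=
    m%:R * (3 * D * S) + m%:R * (2 * D * (G * e * B)).
  have -> : lsum (dlist t (a l) W) (M l) - lsum (dlist t (a' l) W) (M' l) =
    lsum (dlist t (a l) W) (fun V => M l V - M' l V) +
    (lsum (dlist t (a l) W) (M' l) - lsum (dlist t (a' l) W) (M' l)) by rewrite -lB; ring.
  apply: (le_trans (ler_cabsD _ _)); apply: lerD.
    apply: (@le_trans _ _ ((size W)%:R * (3 * D * S))); last by rewrite ler_wpM2r //; nonneg.
    apply: dlist_bound => // [w _|V Vn sV]; first exact: (ha_le1 h).
    by apply: HS' => //; rewrite sV.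
  apply: (@le_trans _ _ ((size W)%:R * (2 * D * (G * e * B)))); last by rewrite ler_wpM2r //; nonneg.
  apply: dlist_diff => // [|w wn|V Vn sV]; first exact: mulr_ge0.
    by apply: (HG _ _ _ _ _ _ h h') => //; exact: n2.
  by apply: (HB _ _ _ h') => //; rewrite sV.
have e2 : cabs (lsum (blist t (a l) W) (M l) - lsum (blist t (a' l) W) (M' l)) <=
    (m * m)%:R * (D * S) + (m * m)%:R * (D * (G * e * B)).
  have -> : lsum (blist t (a l) W) (M l) - lsum (blist t (a' l) W) (M' l) =
    lsum (blist t (a l) W) (fun V => M l V - M' l V) +
    (lsum (blist t (a l) W) (M' l) - lsum (blist t (a' l) W) (M' l)) by rewrite -lB; ring.
  apply: (le_trans (ler_cabsD _ _)); apply: lerD.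
    apply: (@le_trans _ _ ((size W * size W)%:R * (D * S))); last by rewrite ler_wpM2r //; nonneg.
    apply: blist_bound => // [w _|V Vn sV]; first exact: (ha_le1 h).
    by apply: HS' => //; rewrite (leq_trans sV).
  apply: (@le_trans _ _ ((size W * size W)%:R * (D * (G * e * B)))); last by rewrite ler_wpM2r //; nonneg.
  apply: blist_diff => // [|w wn|V Vn sV]; first exact: mulr_ge0.
    by apply: (HG _ _ _ _ _ _ h h').
  by apply: (HB _ _ _ h') => //; rewrite (leq_trans sV).
have e3 : cabs (N%:R^-1 * lsum (elist t (fun u w => M l [:: u; w]) W) (M l) -
     N'%:R^-1 * lsum (elist t (fun u w => M' l [:: u; w]) W) (M' l)) <= E * e.
  apply: (le_trans (ler_cabsB _ _)); rewrite /e mulrDr; apply: lerD; rewrite cabsM cabs_invn mulrC ler_wpM2r //.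
    exact: (HE _ _ _ h).
  exact: (HE _ _ _ h').
have -> : lsum (dlist t (a l) W) (M l) + lsum (blist t (a l) W) (M l) +
    N%:R^-1 * lsum (elist t (fun u w => M l [:: u; w]) W) (M l) -
    (lsum (dlist t (a' l) W) (M' l) + lsum (blist t (a' l) W) (M' l) +
    N'%:R^-1 * lsum (elist t (fun u w => M' l [:: u; w]) W) (M' l)) =
   (lsum (dlist t (a l) W) (M l) - lsum (dlist t (a' l) W) (M' l)) +
   (lsum (blist t (a l) W) (M l) - lsum (blist t (a' l) W) (M' l)) +
   (N%:R^-1 * lsum (elist t (fun u w => M l [:: u; w]) W) (M l) -
     N'%:R^-1 * lsum (elist t (fun u w => M' l [:: u; w]) W) (M' l)) by ring.
apply: (le_trans (ler_cabsD _ _)); apply: (le_trans (lerD (ler_cabsD _ _) (lexx _))).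
apply: (le_trans (lerD (lerD e1 e2) e3)).
have -> : m%:R * (3 * D * S) + m%:R * (2 * D * (G * e * B)) +
   ((m * m)%:R * (D * S) + (m * m)%:R * (D * (G * e * B))) + E * e = ka * S + de * e.
  by rewrite /ka /de; ring.
by rewrite lerD2r ler_wpM2r // /A lerDl.
Qed.

(* The defect in Wick's recursion. *)
Definition stein (M : seq word -> C) (w : word) (W : seq word) : C :=
  M (w :: W) - \sum_(s <- sel W) M [:: w; s.1] * M s.2.

(** The contribution of [elist] to the derivative of [stein]: that of the full moment minus the
    Leibniz terms of the products. *)
Definition stein_err (M : seq word -> C) w W : C :=
  lsum (elist t (fun u v => M [:: u; v]) (w :: W)) M -
  \sum_(s <- sel W) (M [:: w; s.1] * lsum (elist t (fun u v => M [:: u; v]) s.2) M +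
     M s.2 * lsum (elist t (fun u v => M [:: u; v]) [:: w; s.1]) M).

(** To leading order the Wick sum obeys the same linear equation as the moment. Brackets of [w] with
    another word appear on both sides and cancel, brackets within the rest match by
    [lsum_sel_blist], and the linear drift recombines by [lsum_sel_dlist]. *)
Lemma stein_euler N a M w W : hierarchy N a M -> euler (fun l => stein (M l) w W) (fun l =>
  lsum (dterm t (a l) w) (fun v => stein (M l) v W) +
  lsum (dlist t (a l) W) (fun V => stein (M l) w V) +
  lsum (blist t (a l) W) (fun V => stein (M l) w V) + N%:R^-1 * stein_err (M l) w W).
Proof.
move=> h.
have E2 := euler_sub (hM_euler h (w :: W))
  (euler_sum (sel W) (fun s => euler_mul (hM_euler h [:: w; s.1]) (hM_euler h s.2))).
apply: euler_ext E2 => // l l01; rewrite /stein /stein_err.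
set e := fun u v => M l [:: u; v].
(* Leading part of the equation for a pair; its last term is the bracket that cancels against the
   one of [w] in the full moment. *)
have pair u : lsum (dlist t (a l) [:: w; u]) (M l) + lsum (blist t (a l) [:: w; u]) (M l) =
    lsum (dterm t (a l) w) (fun v => M l [:: v; u]) + lsum (dterm t (a l) u) (fun v => M l [:: w; v]) + bterm t (a l) w u.
  rewrite (lsum_dlist t (a l) w [:: u]) (lsum_dlist t (a l) u [::]) (lsum_blist t (a l) w [:: u]).
  rewrite (lsum_blist t (a l) u [::]) /= big_seq1 !big_nil /= !lsum_nil (hM_nil h); ring.
rewrite (lsum_dlist t (a l) w W) (lsum_blist t (a l) w W).
under [X in _ - X = _]eq_bigr do rewrite pair.
have LB (A : Type) (s : seq (C * A)) (f g : A -> C) : lsum s (fun V => f V - g V) = lsum s f - lsum s g.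
  by rewrite /lsum -sumrB; apply: eq_bigr => p _; rewrite mulrBr.
rewrite !LB (lsum_sel_dlist t (a l) (fun u => M l [:: w; u]) (M l)) (lsum_sel_blist t (a l) (fun u => M l [:: w; u]) (M l)).
have -> : lsum (dterm t (a l) w) (fun v => \sum_(s <- sel W) M l [:: v; s.1] * M l s.2) =
   \sum_(s <- sel W) lsum (dterm t (a l) w) (fun v => M l [:: v; s.1]) * M l s.2.
  rewrite /lsum; under eq_bigr do rewrite mulr_sumr.
  rewrite exchange_big; apply: eq_bigr => s _ /=; rewrite mulr_suml.
  by apply: eq_bigr => p _; rewrite mulrA.
have -> : \sum_(s <- sel W) (M l [:: w; s.1] * (lsum (dlist t (a l) s.2) (M l) + lsum (blist t (a l) s.2) (M l) +
       N%:R^-1 * lsum (elist t e s.2) (M l)) + M l s.2 *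
      (lsum (dterm t (a l) w) (fun v => M l [:: v; s.1]) + lsum (dterm t (a l) s.1) (fun v => M l [:: w; v]) +
       bterm t (a l) w s.1 + N%:R^-1 * lsum (elist t e [:: w; s.1]) (M l))) =
   \sum_(s <- sel W) (lsum (dterm t (a l) s.1) (fun v => M l [:: w; v]) * M l s.2 + M l [:: w; s.1] * lsum (dlist t (a l) s.2) (M l)) +
   \sum_(s <- sel W) M l [:: w; s.1] * lsum (blist t (a l) s.2) (M l) +
   \sum_(s <- sel W) lsum (dterm t (a l) w) (fun v => M l [:: v; s.1]) * M l s.2 +
   \sum_(s <- sel W) bterm t (a l) w s.1 * M l s.2 +
   N%:R^-1 * \sum_(s <- sel W) (M l [:: w; s.1] * lsum (elist t e s.2) (M l) + M l s.2 * lsum (elist t e [:: w; s.1]) (M l)).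
  by rewrite mulr_sumr -!big_split; apply: eq_bigr => s _ /=; ring.
ring.
Qed.

(** Each term of the defect contains a nonempty moment, so it vanishes at time 0. Its equation is
    linear in itself with a source of order [1 / N], and Gronwall preserves that order. *)
Lemma stein_small n m : exists2 B : R, 0 <= B & forall N a M, hierarchy N a M ->
  forall l w W, 0 <= l <= 1 -> (size w <= n)%N -> short n W -> (size W <= m)%N ->
  cabs (stein (M l) w W) <= B * N%:R^-1.
Proof.
have [B B0 HB] := mom_unif n (m + 2).
have [E E0 HE] := elist_small n (m + 2).
pose D := weight t n; have D0 : 0 <= D by exact: weight_ge0.
pose ka : R := 3 * D + m%:R * (3 * D) + (m * m)%:R * D.
have ka0 : 0 <= ka by rewrite /ka; nonneg.
pose A := ka + 1; have A0 : 0 < A by rewrite ltr_wpDl.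
pose de := E + m%:R * (B * E + B * E).
have BE0 : 0 <= B * E by exact: mulr_ge0.
have de0 : 0 <= de by rewrite /de; nonneg.
exists (2 * de * expR (2 * A)); first by nonneg.
move=> N a M h l w W l01 wn Wn Wm.
have -> : 2 * de * expR (2 * A) / N%:R = 2 * (de / N%:R) * expR (2 * A) by ring.
pose I := {p : word * seq word | [&& (size p.1 <= n)%N, short n p.2 & (size p.2 <= m)%N]}.
have dee0 : 0 <= de / N%:R by exact: mulr_ge0.
have WI : [&& (size (w, W).1 <= n)%N, short n (w, W).2 & (size (w, W).2 <= m)%N] by rewrite /= wn Wn.
have m2 k : (k <= m)%N -> (k <= m + 2)%N by move=> k0; rewrite (leq_trans k0) // leq_addr.
have selb l' v V : 0 <= l' <= 1 -> (size v <= n)%N -> short n V -> (size V <= m)%N ->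
    forall s, s \in sel V -> [/\ cabs (M l' [:: v; s.1]) <= B, cabs (M l' s.2) <= B,
      short n [:: v; s.1] & short n s.2 && (size s.2 <= m)%N].
  move=> l1 vn Vn Vm s /(sel_short Vn)[h1 h2 h3 _].
  have s2m : (size s.2 <= m)%N by rewrite (leq_trans _ Vm) // -h3.
  split; rewrite ?h2 //=; last by rewrite vn h1.
    by apply: (HB _ _ _ h) => //=; rewrite ?vn ?h1 // addn2.
  by apply: (HB _ _ _ h) => //; exact: m2.
apply: (@gronwall R I (fun i s => stein (M s) (val i).1 (val i).2) _ A (de / N%:R) (B + m%:R * (B * B)) A0 dee0
  (fun i => stein_euler (val i).1 (val i).2 h) _ _ _ (exist _ (w, W) WI) l l01).
- move=> [[v V] /= _]; rewrite /stein (hM0 h) big1 ?subr0 // => s _.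
  by rewrite (hM0 h) mul0r.
- move=> [[v V] /= /and3P[vn Vn Vm]] s s1; rewrite /stein.
  apply: (le_trans (ler_cabsB _ _)); apply: lerD.
    apply: (HB _ _ _ h) => //=; first by rewrite vn.
    by rewrite addn2 ltnS leqW.
  apply: (@le_trans _ _ ((size (sel V))%:R * (B * B))); last by rewrite size_sel ler_wpM2r ?mulr_ge0 // ler_nat.
  apply: sum_const_bound => p /(selb s v V s1 vn Vn Vm)[h1 h2 _ _].
  by rewrite cabsM ler_pM.
move=> {l l01 w wn W Wn Wm WI} l l01 S S0 HS [[w W] /= /and3P[wn Wn Wm]].
have HS' v V : (size v <= n)%N -> short n V -> (size V <= m)%N -> cabs (stein (M l) v V) <= S.
  move=> vn Vn Vm.
  have VI : [&& (size (v, V).1 <= n)%N, short n (v, V).2 & (size (v, V).2 <= m)%N] by rewrite /= vn Vn.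
  exact: (HS (exist _ (v, V) VI)).
have sm : (size W)%:R <= m%:R :> R by rewrite ler_nat.
have smm : (size W * size W)%:R <= (m * m)%:R :> R by rewrite ler_nat leq_mul.
have e0 : cabs (lsum (dterm t (a l) w) (fun v => stein (M l) v W)) <= 3 * D * S.
  by apply: dterm_bound => // [v _|v vn]; [exact: (ha_le1 h)|exact: HS'].
have e1 : cabs (lsum (dlist t (a l) W) (fun V => stein (M l) w V)) <= m%:R * (3 * D * S).
  apply: (@le_trans _ _ ((size W)%:R * (3 * D * S))); last by rewrite ler_wpM2r //; nonneg.
  apply: dlist_bound => // [v _|V Vn sV]; first exact: (ha_le1 h).
  by apply: HS' => //; rewrite sV.
have e2 : cabs (lsum (blist t (a l) W) (fun V => stein (M l) w V)) <= (m * m)%:R * (D * S).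
  apply: (@le_trans _ _ ((size W * size W)%:R * (D * S))); last by rewrite ler_wpM2r //; nonneg.
  apply: blist_bound => // [v _|V Vn sV]; first exact: (ha_le1 h).
  by apply: HS' => //; rewrite (leq_trans sV).
have e3 : cabs (N%:R^-1 * stein_err (M l) w W) <= de / N%:R.
  rewrite cabsM cabs_invn mulrC ler_wpM2r // /stein_err.
  apply: (le_trans (ler_cabsB _ _)); apply: lerD.
    apply: (HE _ _ _ h) => //=; first by rewrite wn.
    by rewrite addn2 ltnS leqW.
  apply: (@le_trans _ _ ((size (sel W))%:R * (B * E + B * E))); last first.
    by rewrite size_sel ler_wpM2r ?addr_ge0 // ler_nat.
  apply: sum_const_bound => s /(selb l w W l01 wn Wn Wm)[h1 h2 h3 /andP[h4 h5]].
  apply: (le_trans (ler_cabsD _ _)); apply: lerD; rewrite cabsM ler_pM //.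
    by apply: (HE _ _ _ h) => //; exact: m2.
  by apply: (HE _ _ _ h) => //=; rewrite addn2.
apply: (le_trans (ler_cabsD _ _)); apply: (le_trans (lerD (ler_cabsD _ _) (lexx _))).
apply: (le_trans (lerD (lerD (ler_cabsD _ _) (lexx _)) (lexx _))).
apply: (le_trans (lerD (lerD (lerD e0 e1) e2) e3)).
have -> : 3 * D * S + m%:R * (3 * D * S) + (m * m)%:R * (D * S) = ka * S by rewrite /ka; ring.
by rewrite lerD2r ler_wpM2r // /A lerDl.
Qed.

End HierarchyLimit.

Section BrownianHierarchy.
Context {R : realType} d (T : measurableType d) (P : probability T R).
Variables (N q : nat) (U : 'I_q -> R -> T -> 'M[R[i]]_N) (t : 'I_q -> R).
Local Notation C := R[i].
Hypothesis N0 : (0 < N)%N.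
Hypothesis ubm : forall i, unitary_brownian P (U i).
Hypothesis indU : independent_processes P U.
Hypothesis t0 : forall i, 0 <= t i.

(** Choice gathers the filtrations and driving motions, given separately for each index, into
    families. The convergence of moments rests on these facts alone. *)
Lemma brownian_hierarchy :
  [/\ hierarchy t N (nmean P U t) (mom P U t),
      forall w, cmeas (fluct P U t 1 w) /\ exists c, forall x, cabs (fluct P U t 1 w x) <= c,
      forall w x, (fluct P U t 1 w x)^*%C = fluct P U t 1 (wflip w) x,
      forall w, mom P U t 1 [:: w] = 0 &
      forall w x, word_mx U t w x = wmx U t 1 w x /\ cintg P (ntr U t 1 w)].
Proof.
have H i : exists FK : (R -> set (set T)) * (R -> T -> 'M[C]_N),
    [/\ filtration FK.1, uN_brownian P FK.1 FK.2 & adapted FK.1 (U i)] /\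
    [/\ forall s x, 0 <= s -> U i s x \is unitarymx, forall x, U i 0 x = 1%:M,
        continuous_paths (U i) & forall s, 0 <= s ->
          exists2 I : T -> 'M[C]_N, is_ito_integral P FK.1 FK.2 s (U i) I &
            {ae P, forall x, U i s x = 1%:M + I x - 2^-1 *: time_integral (U i) s x}].
  by have [F [K FK]] := ubm i; exists (F, K).
have [FK FKP] := choice H.
pose F i := (FK i).1; pose K i := (FK i).2.
have flt i : filtration (F i) by have [[]] := FKP i.
have bm i : uN_brownian P (F i) (K i) by have [[]] := FKP i.
have adU i : adapted (F i) (U i) by have [[]] := FKP i.
have unU i s x : 0 <= s -> U i s x \is unitarymx by have [_ [+ _ _ _]] := FKP i; apply.
have U0 i x : U i 0 x = 1%:M by have [_ [_ + _ _]] := FKP i; apply.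
have cU i : continuous_paths (U i) by have [_ []] := FKP i.
have itoU i s : 0 <= s -> exists2 I : T -> 'M[C]_N, is_ito_integral P (F i) (K i) s (U i) I &
    {ae P, forall x, U i s x = 1%:M + I x - 2^-1 *: time_integral (U i) s x}.
  by have [_ [_ _ _ +]] := FKP i; apply.
have l1 : 0 <= (1 : R) <= 1 by rewrite ler01 lexx.
have fb := fluct_bnd N0 flt bm adU unU cU itoU indU t0.
split.
- split => //.
  + exact: (nmean_le1 N0 flt bm adU unU cU itoU t0).
  + exact: (nmean0 P N0 U0).
  + exact: (nmean_euler' N0 flt bm adU unU cU itoU indU t0).
  + exact: mom_nil.
  + exact: (mom0 P N0 U0).
  + exact: (mom_euler N0 flt bm adU unU cU itoU indU t0).
  + by move=> l W W' WW; exact: mom_perm.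
  + move=> m; exists ((1 + 2 * N%:R) ^+ m); first by rewrite exprn_ge0 // addr_ge0 // mulr_ge0.
    move=> l W l01 Wm; apply: cabs_Cexp_cst; first exact: (pfluct_cintg N0 flt bm adU unU cU itoU indU t0).
    move=> x; apply: (@le_trans _ _ ((1 + 2 * N%:R) ^+ size W)); last first.
      by rewrite ler_weXn2l // lerDl mulr_ge0.
    elim: W {Wm} => [|w W IH]; first by rewrite pfluct_nil cabs1 expr0.
    rewrite pfluct_cons cabsM exprS ler_pM // (le_trans (fluct_leN N0 flt bm adU unU cU itoU t0 w x l01)) //.
    by rewrite lerDr.
  + exact: (mom_le N0 flt bm adU unU cU itoU indU t0).
  + exact: (mom_extra_le N0 flt bm adU unU cU itoU indU t0).
  + exact: (mom_product_le N0 flt bm adU unU cU itoU indU t0).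
- move=> w; have [c c0 cP] := fb w; have [h1 h2] := cP 1 l1.
  by split=> //; exists c.
- by move=> w x; rewrite (fluct_conj N0 flt bm adU unU cU itoU t0).
- by move=> w; rewrite (mom1 N0 flt bm adU unU cU itoU t0).
- move=> w x; rewrite (wmx1 unU) => [|i]; last exact: t0.
  split => //; exact: (ntr_cintg N0 flt bm adU unU cU itoU t0).
Qed.

End BrownianHierarchy.

Section Tensor.
Context {R : realType} (A : Type) (J : finType) (v : J -> A) (c : J -> R[i]).
Local Notation C := R[i].

(* If [Phi W] is the expectation of [prod_(w <- W) y_w], this is the [p]-th moment
   of [sum_j c j * y_(v j)]. *)
Fixpoint tens p (Phi : seq A -> C) : C :=
  if p is p'.+1 then \sum_j c j * tens p' (fun W => Phi (v j :: W)) else Phi [::].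

Lemma eq_tens p Phi Phi' : Phi =1 Phi' -> tens p Phi = tens p Phi'.
Proof. by move=> /funext ->. Qed.

Lemma tens_add p Phi Phi' : tens p (fun W => Phi W + Phi' W) = tens p Phi + tens p Phi'.
Proof.
elim: p Phi Phi' => //= p IH Phi Phi'.
by rewrite -big_split; apply: eq_bigr => j _; rewrite IH mulrDr.
Qed.

Lemma tens_scale p (z : C) Phi : tens p (fun W => z * Phi W) = z * tens p Phi.
Proof.
elim: p Phi => //= p IH Phi; rewrite mulr_sumr; apply: eq_bigr => j _.
by rewrite (IH (fun W => Phi (v j :: W))) mulrCA.
Qed.

Lemma tens_prod p (y : A -> C) : tens p (fun W => \prod_(w <- W) y w) = (\sum_j c j * y (v j)) ^+ p.
Proof.
elim: p => [|p IH] /=; first by rewrite big_nil.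
rewrite exprS mulr_suml -IH; apply: eq_bigr => j _; rewrite -mulrA; congr (_ * _).
by rewrite -tens_scale; apply: eq_tens => W; rewrite big_cons.
Qed.

(** By symmetry in the summation indices, each of the [p] positions of the selected element
    contributes the same product. This is the origin of the factor in the Gaussian moment
    recursion. *)
Lemma tens_sel p (a : A -> C) (B : seq A -> C) :
  tens p (fun W => \sum_(s <- sel W) a s.1 * B s.2) =
  p%:R * (\sum_j c j * a (v j)) * tens p.-1 B.
Proof.
elim: p B => [|p IH] B; first by rewrite /= big_nil !mul0r.
have E j : tens p (fun W => \sum_(s <- sel (v j :: W)) a s.1 * B s.2) =
    a (v j) * tens p B + p%:R * (\sum_j c j * a (v j)) * tens p.-1 (fun W => B (v j :: W)).
  rewrite -(IH (fun W => B (v j :: W))) -tens_scale -tens_add; apply: eq_tens => W.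
  by rewrite sel_cons.
rewrite [tens p.+1 _]/=; under eq_bigr do rewrite E mulrDr.
rewrite big_split /= -natr1 mulrDl mul1r mulrDl addrC; congr (_ + _).
  case: (p) => [|p']; first by rewrite !mul0r big1 // => j _; rewrite mul0r mulr0.
  by rewrite /= [RHS]mulr_sumr; apply: eq_bigr => j _; rewrite mulrCA.
by rewrite mulr_suml; apply: eq_bigr => j _; rewrite mulrA.
Qed.

Lemma tens_Cexp d (T : measurableType d) (P : probability T R) p (Phi : seq A -> T -> C) :
  (forall W, cintg P (Phi W)) -> cintg P (fun x => tens p (fun W => Phi W x)) /\
  Cexp P (fun x => tens p (fun W => Phi W x)) = tens p (fun W => Cexp P (Phi W)).
Proof.
elim: p Phi => [|p IH] Phi iPhi /=; first by split.
have IHj j := IH (fun W => Phi (v j :: W)) (fun W => iPhi (v j :: W)).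
have i j : cintg P (fun x => c j * tens p (fun W => Phi (v j :: W) x)).
  by apply: cintgZ; have [] := IHj j.
split; first exact: cintg_sum.
by rewrite Cexp_sum //; apply: eq_bigr => j _; have [ij ej] := IHj j; rewrite CexpZ // ej.
Qed.

End Tensor.

(** * Complex limits with rates *)

Section ComplexLimits.
Context {R : realType}.
Local Notation C := R[i].

Lemma invn_cvg0 : (n%:R^-1 : R) @[n --> \oo] --> 0.
Proof.
apply/cvgrPdist_lt => e e0; exists (Num.bound e^-1) => // n /= ne.
have n0 : 0 < n%:R :> R.
  by rewrite ltr0n (leq_trans _ ne) // -(ltr_nat R) (lt_trans _ (archi_boundP _)) ?invr_ge0 ?invr_gt0 // ltW.
rewrite sub0r normrN ger0_norm ?invr_ge0 ?(ltW n0) // -[e]invrK ltf_pV2 ?posrE ?invr_gt0 //.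
by rewrite (lt_le_trans (archi_boundP _)) ?ler_nat // invr_ge0 ltW.
Qed.

Lemma cvg_rate (u : nat -> R) (l B : R) (r : nat -> R) : r n @[n --> \oo] --> 0 ->
  (forall n, (0 < n)%N -> `|u n - l| <= B * r n) -> u n @[n --> \oo] --> l.
Proof.
move=> r0 H; have Br0 : B * r n @[n --> \oo] --> 0.
  by rewrite -[0](mulr0 B); apply: cvgM => //; exact: cvg_cst.
apply/cvgrPdist_lt => e e0; have /cvgrPdist_lt/(_ e e0)[n0 _ n0P] := Br0.
exists n0.+1 => // n /= nn; have := n0P n (ltnW nn); rewrite sub0r normrN => h.
rewrite distrC (le_lt_trans (H n _)) ?(leq_trans _ nn) // (le_lt_trans _ h) //; exact: ler_norm.
Qed.

(** The limit is explicit, the supremum of the lower bounds [u n - B * r n], each of which lies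
    below every [u m + B * r m]. Index 0 is left out throughout. *)
Lemma cauchy_rate (u : nat -> R) (B : R) (r : nat -> R) :
  (forall n m, (0 < n)%N -> (0 < m)%N -> `|u n - u m| <= B * (r n + r m)) ->
  exists l : R, forall n, (0 < n)%N -> `|u n - l| <= B * r n.
Proof.
move=> H; pose E : set R := [set u n.+1 - B * r n.+1 | n in setT].
have ubE m : ubound E (u m.+1 + B * r m.+1).
  move=> _ [n _ <-]; have := H n.+1 m.+1 isT isT; rewrite ler_norml => /andP[_].
  by rewrite mulrDr; move: (B * _) (B * _) => x y; lra.
have hE : has_sup E.
  by split; [exists (u 1%N - B * r 1%N), 0%N|exists (u 1%N + B * r 1%N); exact: ubE].
exists (sup E) => -[//|n] _; rewrite ler_norml; apply/andP; split.
  have : sup E <= u n.+1 + B * r n.+1 by apply: ge_sup => //; case: hE.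
  lra.
have : u n.+1 - B * r n.+1 <= sup E by apply: sup_upper_bound => //; exists n.
lra.
Qed.

Lemma ccauchy_rate (u : nat -> C) (B : R) (r : nat -> R) :
  (forall n m, (0 < n)%N -> (0 < m)%N -> cabs (u n - u m) <= B * (r n + r m)) ->
  exists l : C, forall n, (0 < n)%N -> cabs (u n - l) <= 2 * B * r n.
Proof.
move=> H.
have [|l1 H1] := @cauchy_rate (fun n => complex.Re (u n)) B r.
  by move=> n m n0 m0; rewrite -ReB; exact: le_trans (ler_Re_cabs _) (H n m n0 m0).
have [|l2 H2] := @cauchy_rate (fun n => complex.Im (u n)) B r.
  by move=> n m n0 m0; rewrite -ImB; exact: le_trans (ler_Im_cabs _) (H n m n0 m0).
exists (l1 +i* l2) => n n0; apply: (le_trans (ler_cabs_ReIm _)).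
rewrite ReB ImB (_ : 2 * B * r n = B * r n + B * r n); last by ring.
exact: lerD (H1 n n0) (H2 n n0).
Qed.

Definition ccvg (u : nat -> C) (l : C) : Prop := cabs (u n - l) @[n --> \oo] --> (0 : R).

Lemma ccvg_rate (u : nat -> C) l (B : R) (r : nat -> R) : r n @[n --> \oo] --> 0 ->
  (forall n, (0 < n)%N -> cabs (u n - l) <= B * r n) -> ccvg u l.
Proof.
move=> r0 H; apply: (cvg_rate r0) => n n0; rewrite subr0 ger0_norm //; exact: H.
Qed.

Lemma ccvg_Re u l : ccvg u l -> complex.Re (u n) @[n --> \oo] --> complex.Re l.
Proof.
move=> H; apply: (@cvg_rate _ _ 1 (fun n => cabs (u n - l))) => // n _.
by rewrite mul1r -ReB ler_Re_cabs.
Qed.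

Lemma ccvg_Im u l : ccvg u l -> complex.Im (u n) @[n --> \oo] --> complex.Im l.
Proof.
move=> H; apply: (@cvg_rate _ _ 1 (fun n => cabs (u n - l))) => // n _.
by rewrite mul1r -ImB ler_Im_cabs.
Qed.

Lemma clim_eq u l : ccvg u l -> clim u = l.
Proof.
move=> H; rewrite /clim; apply: complex_ext => /=; apply: cvg_lim => //.
  exact: ccvg_Re.
exact: ccvg_Im.
Qed.

Lemma ccvg_unique u l l' : ccvg u l -> ccvg u l' -> l = l'.
Proof. by move=> /clim_eq <- /clim_eq <-. Qed.

Lemma ccvg_eq u u' l : (forall n, (0 < n)%N -> u n = u' n) -> ccvg u l -> ccvg u' l.
Proof.
move=> E H; apply: (@ccvg_rate _ _ 1 (fun n => cabs (u n - l))) => // n n0.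
by rewrite mul1r -E.
Qed.

Lemma ccvg_cst z : ccvg (fun=> z) z.
Proof. by rewrite /ccvg; under eq_fun do rewrite subrr cabs0; exact: cvg_cst. Qed.

Lemma ccvg_dominated (u : nat -> C) l (r : nat -> R) : r n @[n --> \oo] --> 0 ->
  (forall n, cabs (u n - l) <= r n) -> ccvg u l.
Proof. by move=> r0 H; apply: (@ccvg_rate _ _ 1 r) => // n _; rewrite mul1r. Qed.

Lemma ccvgD u l u' l' : ccvg u l -> ccvg u' l' -> ccvg (fun n => u n + u' n) (l + l').
Proof.
move=> H H'; apply: (@ccvg_dominated _ _ (fun n => cabs (u n - l) + cabs (u' n - l'))).
  by rewrite -[0]addr0; exact: cvgD.
by move=> n; rewrite opprD addrACA ler_cabsD.
Qed.

Lemma ccvgZ z u l : ccvg u l -> ccvg (fun n => z * u n) (z * l).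
Proof.
move=> H; apply: (@ccvg_dominated _ _ (fun n => cabs z * cabs (u n - l))).
  by rewrite -[0](mulr0 (cabs z)); apply: cvgM => //; exact: cvg_cst.
by move=> n; rewrite -mulrBr cabsM.
Qed.

Lemma ccvgM u l u' l' : ccvg u l -> ccvg u' l' -> ccvg (fun n => u n * u' n) (l * l').
Proof.
move=> H H'; apply: (@ccvg_dominated _ _ (fun n => cabs (u n - l) * cabs (u' n - l') +
    (cabs (u n - l) * cabs l' + cabs l * cabs (u' n - l')))).
  have -> : 0 = 0 * 0 + (0 * cabs l' + cabs l * 0) :> R by rewrite !mul0r mulr0 !addr0.
  apply: cvgD; first exact: cvgM.
  by apply: cvgD; apply: cvgM => //; exact: cvg_cst.
move=> n; have -> : u n * u' n - l * l' = (u n - l) * (u' n - l') + ((u n - l) * l' + l * (u' n - l')) by ring.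
by rewrite -!cabsM (le_trans (ler_cabsD _ _)) // lerD2l ler_cabsD.
Qed.

Lemma ccvg_sum (I : Type) (s : seq I) (u : I -> nat -> C) (l : I -> C) :
  (forall i, ccvg (u i) (l i)) -> ccvg (fun n => \sum_(i <- s) u i n) (\sum_(i <- s) l i).
Proof.
move=> H; elim: s => [|i s IH].
  by rewrite big_nil; under eq_fun do rewrite big_nil; exact: ccvg_cst.
by rewrite big_cons; under eq_fun do rewrite big_cons; exact: ccvgD.
Qed.

Lemma tens_ccvg (A : Type) (J : finType) (v : J -> A) (c : J -> C) p (u : nat -> seq A -> C) (l : seq A -> C) :
  (forall W, ccvg (u^~ W) (l W)) -> ccvg (fun n => tens v c p (u n)) (tens v c p l).
Proof.
elim: p u l => [|p IH] u l H /=; first exact: H.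
apply: ccvg_sum => j; apply: ccvgZ.
by apply: (IH (fun n W => u n (v j :: W)) (fun W => l (v j :: W))) => W; exact: H.
Qed.

End ComplexLimits.

Unset Implicit Arguments.

(** * Limit moments and the covariance kernel *)

Section FluctuationLimit.
Context {R : realType} (q : nat) (t : 'I_q -> R).
Hypothesis t0 : forall i, 0 <= t i.
Variables (d : nat -> measure_display) (T : forall N, measurableType (d N))
    (P : forall N, probability (T N) R) (U : forall N, 'I_q -> R -> T N -> 'M[R[i]]_N).
Hypothesis ubm : forall N i, unitary_brownian (P N) (@U N i).
Hypothesis indU : forall N, independent_processes (P N) (@U N).
Local Notation C := R[i].
Local Notation word := (word q).

Let a N := nmean (P N) (@U N) t 1.
Let M N := mom (P N) (@U N) t 1.
Let y N := fluct (P N) (@U N) t 1.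

Let facts N (N0 : (0 < N)%N) := brownian_hierarchy N0 (ubm N) (indU N) t0.

Let hier N : (0 < N)%N -> hierarchy t N (nmean (P N) (@U N) t) (mom (P N) (@U N) t).
Proof. by move=> N0; have [] := facts N N0. Qed.

Let l1 : 0 <= (1 : R) <= 1. Proof. by rewrite ler01 lexx. Qed.

Definition max_size (W : seq word) := foldr (fun w n => maxn (size w) n) 0%N W.

Lemma short_max_size W : short (max_size W) W.
Proof.
elim: W => //= w W IH; rewrite leq_maxl /=; apply: sub_all IH => u uW.
by rewrite (leq_trans uW) // leq_maxr.
Qed.

Lemma mom_limit : exists m : seq word -> C, forall W, ccvg (fun N => M N W) (m W).
Proof.
have H0 W : exists l, ccvg (fun N => M N W) l; last by have [m mP] := choice H0; exists m.
have [B B0 H] := mom_cauchy t0 (max_size W) (size W).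
have [|l Hl] := @ccauchy_rate R (fun N => M N W) B (fun N => N%:R^-1).
  by move=> N N' N0 N0'; apply: (H _ _ _ _ _ _ (hier N N0) (hier N' N0')) => //; exact: short_max_size.
by exists l; apply: ccvg_rate Hl; exact: invn_cvg0.
Qed.

Lemma nmean_limit : exists phi : word -> C, forall w, exists B, forall N, (0 < N)%N ->
  cabs (a N w - phi w) <= B * N%:R^-1 ^+ 2.
Proof.
have H0 w : exists l, exists B, forall N, (0 < N)%N -> cabs (a N w - l) <= B * N%:R^-1 ^+ 2; last first.
  by have [phi phiP] := choice H0; exists phi.
have [B B0 H] := nmean_cauchy t0 (size w).
have [|l Hl] := @ccauchy_rate R (fun N => a N w) B (fun N => N%:R^-1 ^+ 2).
  by move=> N N' N0 N0'; exact: (H _ _ _ _ _ _ (hier N N0) (hier N' N0')).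
by exists l, (2 * B).
Qed.

Lemma y_zero N w x : N = 0%N -> y N w x = 0.
Proof. by move=> N0; have NZ : N%:R = 0 :> C; [rewrite N0|rewrite /y /fluct NZ mul0r]. Qed.

Lemma y_meas N w : cmeas (y N w) /\ exists c, forall x, cabs (y N w x) <= c.
Proof.
have [N0|N0] := posnP N; last by have [_ + _ _ _] := facts N N0; apply.
have -> : y N w = fun=> 0 by apply/funext => x; exact: y_zero.
by split; [exact: cmeas_cst|exists 0 => x; rewrite cabs0].
Qed.

Lemma y_cintg N w : cintg (P N) (y N w).
Proof. by have [m [c b]] := y_meas N w; exact: cintg_bnd m b. Qed.

Lemma word_trE N w x : (0 < N)%N -> word_tr U t w x = y N w x + N%:R * a N w.
Proof.
move=> N0; have [_ _ _ _ /(_ w x)[E _]] := facts N N0.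
have NN : N%:R != 0 :> C by rewrite pnatr_eq0 -lt0n.
by rewrite /word_tr E /y /fluct mulrBr subrK /ntr mulVKf.
Qed.

Lemma y_mean N w : (0 < N)%N -> Cexp (P N) (y N w) = 0.
Proof.
move=> N0; have [_ _ _ /(_ w) + _] := facts N N0; rewrite /mom => <-.
by apply: eq_Cexp => x; rewrite /pfluct big_seq1.
Qed.

Lemma word_tr_mean N w : (0 < N)%N -> Cexp (P N) (fun x => word_tr U t w x) = N%:R * a N w.
Proof.
move=> N0; transitivity (Cexp (P N) (fun x => y N w x + N%:R * a N w)).
  by apply: eq_Cexp => x; rewrite word_trE.
by rewrite CexpD ?Cexp_cst ?y_mean ?add0r //; [exact: y_cintg|exact: cintg_cst].
Qed.

Lemma phi1E phi : (forall w, exists B, forall N, (0 < N)%N -> cabs (a N w - phi w) <= B * N%:R^-1 ^+ 2) ->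
  phi1 P U t = phi.
Proof.
move=> H; apply/funext => w; have [B HB] := H w; apply: clim_eq.
apply: (@ccvg_eq R (fun N => a N w)).
  by move=> N N0; rewrite word_tr_mean // mulKf // pnatr_eq0 -lt0n.
apply: ccvg_rate HB; rewrite -[0](mulr0 0); under eq_fun do rewrite expr2.
by apply: cvgM; exact: invn_cvg0.
Qed.

Variable m : seq word -> C.
Hypothesis mP : forall W, ccvg (fun N => M N W) (m W).

Lemma m_nil : m [::] = 1.
Proof.
apply: (ccvg_unique (mP [::])); apply: (@ccvg_eq R (fun=> 1)); last exact: ccvg_cst.
by move=> N N0; rewrite /M (hM_nil (hier N N0)).
Qed.

Lemma m_single w : m [:: w] = 0.
Proof.
apply: (ccvg_unique (mP [:: w])); apply: (@ccvg_eq R (fun=> 0)); last exact: ccvg_cst.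
by move=> N N0; have [_ _ _ /(_ w) + _] := facts N N0; rewrite /M => ->.
Qed.

(** [stein] converges to the defect of the limit moments, and by [stein_small] it converges to 0. *)
Lemma m_wick w W : m (w :: W) = \sum_(s <- sel W) m [:: w; s.1] * m s.2.
Proof.
have [B B0 H] := stein_small t0 (max_size (w :: W)) (size W).
have /= /andP[wn Wn] := short_max_size (w :: W).
have L : ccvg (fun N => stein (M N) w W) (m (w :: W) + -1 * \sum_(s <- sel W) m [:: w; s.1] * m s.2).
  rewrite /stein; under eq_fun do rewrite -mulN1r.
  by apply: ccvgD => //; apply: ccvgZ; apply: ccvg_sum => s; exact: ccvgM.
have L0 : ccvg (fun N => stein (M N) w W) 0.
  apply: (@ccvg_rate R _ _ B (fun N => N%:R^-1)); first exact: invn_cvg0.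
  by move=> N N0; rewrite subr0; apply: (H _ _ _ (hier N N0)).
by have := ccvg_unique L L0; rewrite mulN1r => /eqP; rewrite subr_eq0 => /eqP.
Qed.

Lemma phi2E w w' : phi2 P U t w w' = m [:: w; w'].
Proof.
apply: clim_eq; apply: (@ccvg_eq R (fun N => M N [:: w; w'])); last exact: mP.
move=> N N0; rewrite /Ccov !word_tr_mean //.
have [mw [c bw]] := y_meas N w; have [mw' [c' bw']] := y_meas N w'.
have ip : cintg (P N) (fun x => y N w x * y N w' x).
  apply: (@cintg_bnd _ _ _ _ _ (c * c')); first exact: cmeasM.
  by move=> x; rewrite cabsM ler_pM.
have -> : Cexp (P N) (fun x => word_tr U t w x * word_tr U t w' x) =
   Cexp (P N) (fun x => y N w x * y N w' x + (N%:R * a N w' * y N w x + (N%:R * a N w * y N w' x + N%:R * a N w * (N%:R * a N w')))).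
  by apply: eq_Cexp => x; rewrite !word_trE //; ring.
have [i1 i2] := (y_cintg N w, y_cintg N w').
have ic := cintg_cst (P N) (N%:R * a N w * (N%:R * a N w')).
have Z z w0 : Cexp (P N) (fun x => z * y N w0 x) = 0.
  by rewrite CexpZ; [rewrite (y_mean N w0 N0) mulr0|exact: y_cintg].
rewrite CexpD //; last by apply: cintgD; [exact: cintgZ|by apply: cintgD => //; exact: cintgZ].
rewrite CexpD; [|exact: cintgZ|by apply: cintgD => //; exact: cintgZ].
rewrite CexpD //; last exact: cintgZ.
rewrite !Z Cexp_cst !add0r addrK.
by apply: eq_Cexp => x; rewrite /pfluct big_cons big_seq1.
Qed.

Local Notation rindex := (word * bool)%type.

Definition yr N (j : rindex) x : R := if j.2 then complex.Re (y N j.1 x) else complex.Im (y N j.1 x).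

(* [Re z = (z + z^* ) / 2] and [Im z = (z - z^* ) / 2i], where conjugating a
   trace means flipping the word. *)
Definition rcoef (j b : bool) : C := if j then 2^-1 else if b then - 'i / 2 else 'i / 2.
Definition rword (w : word) (b : bool) := if b then w else wflip w.

Lemma yr_meas N j : measurable_fun setT (yr N j) /\ exists c, forall x, `|yr N j x| <= c.
Proof.
have [[m1 m2] [c b]] := y_meas N j.1; rewrite /yr; case: j.2; split=> //; exists c => x.
  exact: le_trans (ler_Re_cabs _) (b x).
exact: le_trans (ler_Im_cabs _) (b x).
Qed.

Lemma y_conj N w x : (y N w x)^*%C = y N (wflip w) x.
Proof.
have [N0|N0] := posnP N; last by have [_ _ + _ _] := facts N N0; apply.
by rewrite !y_zero //; apply: complex_ext; rewrite /= ?oppr0.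
Qed.

Lemma half_C : (2^-1 : C) = (2^-1 : R)%:C.
Proof. by rewrite fmorphV rmorph_nat. Qed.

Lemma yrE N j x : (yr N j x)%:C = \sum_(b : bool) rcoef j.2 b * y N (rword j.1 b) x.
Proof.
rewrite big_bool /= -y_conj /yr /rcoef half_C; case: (y N j.1 x) => u v.
by case: j.2; apply: complex_ext; rewrite /=; field.
Qed.

Lemma M_prod N W : (0 < N)%N -> cintg (P N) (fun x => \prod_(w <- W) y N w x) /\
  Cexp (P N) (fun x => \prod_(w <- W) y N w x) = M N W.
Proof.
move=> N0; split=> //.
have [c bc] : exists c, forall x, cabs (\prod_(w <- W) y N w x) <= c.
  elim: W => [|w W [c bc]]; first by exists 1 => x; rewrite big_nil cabs1.
  have [_ [c' bc']] := y_meas N w; exists (c' * c) => x.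
  by rewrite big_cons cabsM ler_pM.
by apply: cintg_bnd bc; apply: cmeas_prod => w _; have [] := y_meas N w.
Qed.

Section Combination.
Variables (I : finType) (g : I -> rindex) (l : I -> R).

Definition zr N x : R := \sum_i l i * yr N (g i) x.

Let cc (p : I * bool) : C := (l p.1)%:C * rcoef (g p.1).2 p.2.
Let vv (p : I * bool) := rword (g p.1).1 p.2.
Let tau p : C := tens vv cc p m.

Lemma zrE N x : (zr N x)%:C = \sum_p cc p * y N (vv p) x.
Proof.
rewrite /zr rmorph_sum -(pair_bigA _ (fun i b => cc (i, b) * y N (vv (i, b)) x)) /=.
apply: eq_bigr => i _; have -> : (l i * yr N (g i) x)%:C = (l i)%:C * (yr N (g i) x)%:C by rewrite rmorphM.
by rewrite yrE mulr_sumr; apply: eq_bigr => b _; rewrite mulrA.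
Qed.

Lemma zr_meas N : measurable_fun setT (zr N) /\ exists c, forall x, `|zr N x| <= c.
Proof.
split.
  by apply: measurable_sum => i; apply: measurable_funM => //; have [] := yr_meas N (g i).
have H i : exists c, forall x, `|yr N (g i) x| <= c by have [] := yr_meas N (g i).
have [c cP] := choice H; exists (\sum_i `|l i| * c i) => x.
rewrite (le_trans (ler_norm_sum _ _ _)) // ler_sum // => i _.
by rewrite normrM ler_wpM2l.
Qed.

Lemma zr_intg N k : intg (P N) (fun x => zr N x ^+ k).
Proof.
have [mz [c bz]] := zr_meas N; apply: (@intg_bnd _ _ _ _ _ (c ^+ k)); first exact: measurable_funX.
by move=> x; rewrite normrX lerXn2r ?nnegrE // (le_trans _ (bz x)).
Qed.

Lemma Cexp_real N (f : T N -> R) : Cexp (P N) (fun x => (f x)%:C) = (Ex (P N) f)%:C.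
Proof. by apply: complex_ext => //=; exact: Ex_cst. Qed.

Lemma zr_moment N p : (0 < N)%N -> (Ex (P N) (fun x => zr N x ^+ p))%:C = tens vv cc p (M N).
Proof.
move=> N0; rewrite -Cexp_real.
have [_ E] := @tens_Cexp R _ _ vv cc _ _ (P N) p (fun W x => \prod_(w <- W) y N w x) (fun W => (M_prod N W N0).1).
rewrite (_ : M N = fun W => Cexp (P N) (fun x => \prod_(w <- W) y N w x)); last first.
  by apply/funext => W; rewrite (M_prod N W N0).2.
rewrite -E; apply: eq_Cexp => x; rewrite tens_prod -zrE.
exact: rmorphXn (real_complex R) _ _.
Qed.

Lemma tau_cvg p : ccvg (fun N => (Ex (P N) (fun x => zr N x ^+ p))%:C) (tau p).
Proof.
apply: (@ccvg_eq R (fun N => tens vv cc p (M N))); last exact: tens_ccvg.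
by move=> N N0; rewrite zr_moment.
Qed.

Lemma tau_real p : tau p = (complex.Re (tau p))%:C.
Proof.
have /cvg_lim L := ccvg_Im (tau_cvg p).
by apply: complex_ext => //=; rewrite -L //; apply: cvg_lim => //; exact: cvg_cst.
Qed.

Lemma mom_cvg p : Ex (P N) (fun x => zr N x ^+ p) @[N --> \oo] --> complex.Re (tau p).
Proof. exact: (ccvg_Re (tau_cvg p)). Qed.

(** Wick's recursion applied to the first factor; by [tens_sel] the sum over partners is [p + 1]
    equal pairings, each leaving [p] factors. *)
Lemma tau_rec p : tau p.+2 = p.+1%:R * tau 2 * tau p.
Proof.
have E p' : tau p'.+1 = \sum_j cc j * tens vv cc p' (fun W => \sum_(s <- sel W) m [:: vv j; s.1] * m s.2).
  by apply: eq_bigr => j _; congr (_ * _); apply: eq_tens => W; rewrite m_wick.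
rewrite E; transitivity (\sum_j cc j * (p.+1%:R * (\sum_k cc k * m [:: vv j; vv k]) * tau p)).
  by apply: eq_bigr => j _; congr (_ * _); rewrite (tens_sel vv cc p.+1 (fun u => m [:: vv j; u]) m).
have -> : tau 2 = \sum_j cc j * \sum_k cc k * m [:: vv j; vv k] by [].
rewrite mulr_sumr mulr_suml; apply: eq_bigr => j _; rewrite /tau; ring.
Qed.

Lemma charfun_cvg :
  let v := complex.Re (tau 2) in
  [/\ 0 <= v, Ex (P N) (fun x => zr N x ^+ 2) @[N --> \oo] --> v,
      Ex (P N) (fun x => cos (zr N x)) @[N --> \oo] --> expR (- v / 2) &
      Ex (P N) (fun x => sin (zr N x)) @[N --> \oo] --> 0].
Proof.
set v := complex.Re (tau 2) => /=.
have v0 : 0 <= v.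
  have cv := mom_cvg 2; rewrite -/v in cv; rewrite -(cvg_lim _ cv) //; apply: limr_ge.
    by apply/cvg_ex; exists v.
  by apply: nearW => N; apply: Ex_ge0 => x; exact: sqr_ge0.
have [||k|h1 h2] := @charfun_of_moments R v (fun k => complex.Re (tau k)) d T P zr _ _ _ v0 zr_intg mom_cvg.
- by rewrite /tau /= m_nil.
- by rewrite /tau /= big1 // => j _; rewrite m_single mulr0.
- rewrite tau_rec (tau_real 2) (tau_real k) -(rmorph_nat (real_complex R)) -!rmorphM /=.
  by rewrite -/v.
by split => //; exact: mom_cvg.
Qed.

(** The limit covariance of two real coordinates, obtained by writing each of them as a combination
    of a trace and its flip; [kap] is its real part. *)
Definition kapC (j j' : rindex) : C :=
  \sum_(b : bool) \sum_(b' : bool) rcoef j.2 b * rcoef j'.2 b' * m [:: rword j.1 b; rword j'.1 b'].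
Definition kap j j' : R := complex.Re (kapC j j').

Lemma tau2E : complex.Re (tau 2) = \sum_i \sum_i' l i * l i' * kap (g i) (g i').
Proof.
have -> : tau 2 = \sum_i \sum_i' (l i * l i')%:C * kapC (g i) (g i').
  rewrite /tau /= -(pair_bigA _ (fun i b => cc (i, b) * \sum_j cc j * m [:: vv (i, b); vv j])) /=.
  apply: eq_bigr => i _.
  under eq_bigr do rewrite -(pair_bigA _ (fun i' b' => cc (i', b') * m [:: vv (i, _); vv (i', b')])) mulr_sumr.
  rewrite exchange_big; apply: eq_bigr => i' _; rewrite /kapC mulr_sumr; apply: eq_bigr => b _.
  rewrite !mulr_sumr; apply: eq_bigr => b' _.
  have -> : (l i * l i')%:C = (l i)%:C * (l i')%:C by rewrite rmorphM.
  rewrite /cc /vv /=; ring.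
rewrite Re_sum; apply: eq_bigr => i _; rewrite Re_sum; apply: eq_bigr => i' _.
by rewrite ReM /= mul0r subr0.
Qed.

End Combination.

Lemma yrM_cintg N j j' : intg (P N) (fun x => yr N j x * yr N j' x).
Proof.
have [mj [c bj]] := yr_meas N j; have [mj' [c' bj']] := yr_meas N j'.
apply: (@intg_bnd _ _ _ _ _ (c * c')); first exact: measurable_funM.
by move=> x; rewrite normrM ler_pM.
Qed.

Lemma kap_cvg j j' : Ex (P N) (fun x => yr N j x * yr N j' x) @[N --> \oo] --> kap j j'.
Proof.
apply: (@ccvg_Re _ (fun N => (Ex (P N) (fun x => yr N j x * yr N j' x))%:C)).
apply: (@ccvg_eq R (fun N => \sum_(b : bool) \sum_(b' : bool) rcoef j.2 b * rcoef j'.2 b' *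
   M N [:: rword j.1 b; rword j'.1 b'])); last first.
  by apply: ccvg_sum => b; apply: ccvg_sum => b'; apply: ccvgZ.
move=> N N0; rewrite -Cexp_real.
have E x : (yr N j x * yr N j' x)%:C = \sum_(b : bool) \sum_(b' : bool) rcoef j.2 b * rcoef j'.2 b' *
    \prod_(w <- [:: rword j.1 b; rword j'.1 b']) y N w x.
  have -> : (yr N j x * yr N j' x)%:C = (yr N j x)%:C * (yr N j' x)%:C by rewrite rmorphM.
  rewrite !yrE mulr_suml; apply: eq_bigr => b _; rewrite mulr_sumr; apply: eq_bigr => b' _.
  rewrite big_cons big_seq1; ring.
under eq_Cexp do rewrite E.
have i2 b b' := cintgZ (rcoef j.2 b * rcoef j'.2 b') (M_prod N [:: rword j.1 b; rword j'.1 b'] N0).1.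
rewrite Cexp_sum => [|b _]; last by apply: cintg_sum => b' _; exact: i2.
apply: eq_bigr => b _; rewrite Cexp_sum => [|b' _]; last exact: i2.
by apply: eq_bigr => b' _; rewrite CexpZ ?(M_prod N _ N0).2 //; exact: (M_prod N _ N0).1.
Qed.

Lemma kap_sym j j' : kap j j' = kap j' j.
Proof.
have /cvg_lim <- // := kap_cvg j j'; have /cvg_lim <- // := kap_cvg j' j.
by congr (lim (_ @ \oo)); apply/funext => N; apply: eq_Ex => x; rewrite mulrC.
Qed.

(** For each [N] the form is the expectation of a square, and nonnegativity survives the limit. It
    is what permits the Cholesky construction of the field. *)
Lemma kap_psd (s : seq (R * rindex)) :
  0 <= \sum_(p <- s) \sum_(p' <- s) p.1 * p'.1 * kap p.2 p'.2.
Proof.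
have cv : \sum_(p <- s) \sum_(p' <- s) p.1 * p'.1 * Ex (P N) (fun x => yr N p.2 x * yr N p'.2 x)
    @[N --> \oo] --> \sum_(p <- s) \sum_(p' <- s) p.1 * p'.1 * kap p.2 p'.2.
  apply: cvg_sumR => p; apply: cvg_sumR => p'; apply: cvgM; first exact: cvg_cst.
  exact: kap_cvg.
rewrite -(cvg_lim _ cv) //; apply: limr_ge; first by apply/cvg_ex; eexists; exact: cv.
apply: nearW => N.
have iZ (p p' : R * rindex) := intgZ (p.1 * p'.1) (yrM_cintg N p.2 p'.2).
have -> : \sum_(p <- s) \sum_(p' <- s) p.1 * p'.1 * Ex (P N) (fun x => yr N p.2 x * yr N p'.2 x) =
    Ex (P N) (fun x => \sum_(p <- s) \sum_(p' <- s) p.1 * p'.1 * (yr N p.2 x * yr N p'.2 x)).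
  rewrite Ex_sum => [|p _]; last by apply: intg_sum => p' _.
  apply: eq_bigr => p _; rewrite Ex_sum //; apply: eq_bigr => p' _.
  by rewrite ExZ //; exact: yrM_cintg.
apply: Ex_ge0 => x.
have -> : \sum_(p <- s) \sum_(p' <- s) p.1 * p'.1 * (yr N p.2 x * yr N p'.2 x) = (\sum_(p <- s) p.1 * yr N p.2 x) ^+ 2.
  rewrite expr2 mulr_suml; apply: eq_bigr => p _; rewrite mulr_sumr; apply: eq_bigr => p' _; ring.
exact: sqr_ge0.
Qed.

Lemma m_pair w w' : m [:: w; w'] =
  (kap (w, true) (w', true) - kap (w, false) (w', false)) +i*
  (kap (w, true) (w', false) + kap (w, false) (w', true)).
Proof.
have E N : (0 < N)%N -> M N [:: w; w'] =
  (Ex (P N) (fun x => yr N (w, true) x * yr N (w', true) x) - Ex (P N) (fun x => yr N (w, false) x * yr N (w', false) x)) +i*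
  (Ex (P N) (fun x => yr N (w, true) x * yr N (w', false) x) + Ex (P N) (fun x => yr N (w, false) x * yr N (w', true) x)).
  move=> N0; rewrite -(M_prod N _ N0).2 CexpE -/(Ex _ _) -/(Ex _ _); apply: complex_ext => /=.
    rewrite -ExB; [|exact: yrM_cintg..]; apply: eq_Ex => x.
    by rewrite big_cons big_seq1 ReM.
  rewrite -ExD; [|exact: yrM_cintg..]; apply: eq_Ex => x.
  by rewrite big_cons big_seq1 ImM.
have cR := ccvg_Re (mP [:: w; w']); have cI := ccvg_Im (mP [:: w; w']).
have ev : \forall N \near \oo, (0 < N)%N by exists 1%N.
apply: complex_ext => /=.
  have /cvg_lim <- // := cR; apply: cvg_lim => //.
  apply: cvg_trans (cvgB (kap_cvg (w, true) (w', true)) (kap_cvg (w, false) (w', false))).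
  by apply: near_eq_cvg; apply: filterS ev => N N0; rewrite E.
have /cvg_lim <- // := cI; apply: cvg_lim => //.
apply: cvg_trans (cvgD (kap_cvg (w, true) (w', false)) (kap_cvg (w, false) (w', true))).
by apply: near_eq_cvg; apply: filterS ev => N N0; rewrite E.
Qed.
End FluctuationLimit.

Section FluctuationSummary.
Context {R : realType} (q : nat) (t : 'I_q -> R).
Hypothesis t0 : forall i, 0 <= t i.
Variables (d : nat -> measure_display) (T : forall N, measurableType (d N))
    (P : forall N, probability (T N) R) (U : forall N, 'I_q -> R -> T N -> 'M[R[i]]_N).
Hypothesis ubm : forall N i, unitary_brownian (P N) (U N i).
Hypothesis indU : forall N, independent_processes (P N) (U N).
Local Notation C := R[i].
Local Notation word := (word q).

(** All that the construction of the field and the final convergence require. The bias [de] is kept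
    apart from [Y] because the limits of cosines and sines are computed for exactly centred
    variables. *)
Lemma fluctuation_limit :
  exists (k : word * bool -> word * bool -> R) (Y : forall N, word * bool -> T N -> R) (de : nat -> word -> C),
  [/\ forall j j', k j j' = k j' j,
      forall s : seq (R * (word * bool)), 0 <= \sum_(p <- s) \sum_(p' <- s) p.1 * p'.1 * k p.2 p'.2 &
      forall w w', phi2 P U t w w' =
        (k (w, true) (w', true) - k (w, false) (w', false)) +i* (k (w, true) (w', false) + k (w, false) (w', true))] /\
  [/\ forall N j, measurable_fun setT (Y N j) /\ exists c, forall x, `|Y N j x| <= c,
      forall j, Ex (P N) (fun x => Y N j x * Y N j x) @[N --> \oo] --> k j j,
      forall (I : finType) (g : I -> word * bool) (l : I -> R),
        let v := \sum_i \sum_i' l i * l i' * k (g i) (g i') in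
        0 <= v /\ Ex (P N) (fun x => cos (\sum_i l i * Y N (g i) x)) @[N --> \oo] --> expR (- v / 2) /\
        Ex (P N) (fun x => sin (\sum_i l i * Y N (g i) x)) @[N --> \oo] --> 0,
      forall w, ccvg (fun N => de N w) 0 &
      forall N w x, word_tr U t w x - N%:R * phi1 P U t w = (Y N (w, true) x +i* Y N (w, false) x) + de N w].
Proof.
have [m mP] := mom_limit q t t0 d T P U ubm indU.
have [phi phiP] := nmean_limit q t t0 d T P U ubm indU.
have phiE := phi1E q t t0 d T P U ubm indU phi phiP.
exists (kap q m), (yr q t d T P U), (fun N w => N%:R * (nmean (P N) (U N) t 1 w - phi w)).
split; split.
- exact: (kap_sym q t t0 d T P U ubm indU m mP).
- exact: (kap_psd q t t0 d T P U ubm indU m mP).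
- move=> w w'; rewrite (phi2E q t t0 d T P U ubm indU m mP).
  exact: (m_pair q t t0 d T P U ubm indU m mP).
- exact: (yr_meas q t t0 d T P U ubm indU).
- by move=> j; exact: (kap_cvg q t t0 d T P U ubm indU m mP).
- move=> I g l v; have [] := charfun_cvg q t t0 d T P U ubm indU m mP I g l.
  by rewrite tau2E.
- move=> w; have [B HB] := phiP w.
  apply: (@ccvg_rate R _ _ B (fun N => N%:R^-1)); first exact: invn_cvg0.
  move=> N N0; rewrite subr0 cabsM (_ : cabs (N%:R : C) = N%:R); last first.
    by rewrite (_ : N%:R = (N%:R : R)%:C :> C) ?cabs_real ?ger0_norm // rmorph_nat.
  have n0 : 0 < N%:R :> R by rewrite ltr0n.
  rewrite -ler_pdivlMl //; apply: (le_trans (HB N N0)).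
  by rewrite expr2 mulrCA.
(* At [N = 0] the trace is an empty sum and the factors [N] vanish, so the identity still holds. *)
- case=> [|N] w x.
    rewrite /word_tr /mxtrace big_ord0 !mul0r subr0 addr0 /yr /=.
    by rewrite !y_zero.
  rewrite (word_trE q t t0 d T P U ubm indU _ _ _ (ltn0Sn N)) phiE mulrBr addrA; congr (_ + _ - _).
  by rewrite /yr /=; case: (fluct _ _ _ _ _ _).
Qed.

End FluctuationSummary.
Set Implicit Arguments.

(** * The Gaussian field *)

Section Cholesky.
Context {R : realType}.

Definition psd (k : nat -> nat -> R) : Prop := (forall i j, k i j = k j i) /\
  forall s : seq (R * nat), 0 <= \sum_(p <- s) \sum_(p' <- s) p.1 * p'.1 * k p.2 p'.2.

(** The kernel may be degenerate, the empty word having no fluctuation; a zero pivot then yields a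
    zero column, which [psd_zero] justifies. *)
Definition chol_col (k : nat -> nat -> R) n i : R :=
  if k n n == 0 then 0 else k i n / Num.sqrt (k n n).

Definition schur k n i j : R := k i j - chol_col k n i * chol_col k n j.

Lemma psd_diag k n : psd k -> 0 <= k n n.
Proof. by move=> [_ /(_ [:: (1, n)])]; rewrite !big_seq1 /= !mul1r. Qed.

Lemma psd_cons k (s : seq (R * nat)) r n : (forall i j, k i j = k j i) ->
  \sum_(p <- (r, n) :: s) \sum_(p' <- (r, n) :: s) p.1 * p'.1 * k p.2 p'.2 =
  r ^+ 2 * k n n + 2 * r * (\sum_(p <- s) p.1 * k p.2 n) +
  \sum_(p <- s) \sum_(p' <- s) p.1 * p'.1 * k p.2 p'.2.
Proof.
move=> sk; rewrite !big_cons /=; under [X in _ + X = _]eq_bigr do rewrite big_cons /=.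
rewrite big_split /=.
have -> : \sum_(p <- s) r * p.1 * k n p.2 = r * \sum_(p <- s) p.1 * k p.2 n.
  by rewrite mulr_sumr; apply: eq_bigr => p _; rewrite mulrA sk.
have -> : \sum_(p <- s) p.1 * r * k p.2 n = r * \sum_(p <- s) p.1 * k p.2 n.
  by rewrite mulr_sumr; apply: eq_bigr => p _; rewrite mulrA (mulrC p.1).
ring.
Qed.

Lemma psd_zero k n i : psd k -> k n n = 0 -> k i n = 0.
Proof.
move=> [sk pk] kn; apply/eqP; case: (boolP (k i n == 0)) => // ki.
(* A vector on which the form would equal -1 if the off-diagonal entry were nonzero while the pivot
   vanishes. *)
have := pk [:: (- (k i i + 1) / (2 * k i n), n); (1, i)].
rewrite psd_cons // !big_seq1 /= !mul1r kn mulr0 add0r.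
have -> : 2 * (- (k i i + 1) / (2 * k i n)) * k i n + k i i = -1 by field.
by rewrite ler0N1.
Qed.

Lemma schur_zero k n i : psd k -> schur k n i n = 0.
Proof.
move=> pk; have := psd_diag n pk; rewrite /schur /chol_col; case: eqP => [/(psd_zero i pk) ->|/eqP kn] k0.
  by rewrite mul0r subr0.
have s0 : Num.sqrt (k n n) != 0 by rewrite sqrtr_eq0 -ltNge lt0r kn.
have -> : k n n / Num.sqrt (k n n) = Num.sqrt (k n n) by rewrite -{1}(sqr_sqrtr k0) expr2 mulfK.
by rewrite divfK // subrr.
Qed.

(** Completing the square: the reduced form is the original one evaluated with the optimal
    coefficient at [n], minus the pairing with that column over the pivot. *)
Lemma schur_psd k n : psd k -> psd (schur k n).
Proof.
move=> pk; have [sk qk] := pk; split=> [i j|s]; first by rewrite /schur sk mulrC.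
have E : \sum_(p <- s) \sum_(p' <- s) p.1 * p'.1 * schur k n p.2 p'.2 =
    \sum_(p <- s) \sum_(p' <- s) p.1 * p'.1 * k p.2 p'.2 - (\sum_(p <- s) p.1 * chol_col k n p.2) ^+ 2.
  rewrite expr2 mulr_suml -sumrB; apply: eq_bigr => p _; rewrite mulr_sumr -sumrB.
  by apply: eq_bigr => p' _; rewrite /schur; ring.
rewrite E; have k0 := psd_diag n pk; rewrite /chol_col; case: eqP => [_|/eqP kn].
  by rewrite [X in _ - X ^+ 2]big1 ?expr0n ?subr0 // => p _; rewrite mulr0.
set B := \sum_(p <- s) p.1 * k p.2 n.
have -> : \sum_(p <- s) p.1 * (k p.2 n / Num.sqrt (k n n)) = B / Num.sqrt (k n n).
  by rewrite /B mulr_suml; apply: eq_bigr => p _; rewrite mulrA.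
have -> : (B / Num.sqrt (k n n)) ^+ 2 = B ^+ 2 / k n n by rewrite exprMn exprVn sqr_sqrtr.
have := qk ((- B / k n n, n) :: s); rewrite psd_cons // -/B.
by congr (_ <= _); field.
Qed.

Fixpoint residual (k : nat -> nat -> R) n := if n is n'.+1 then schur (residual k n') n' else k.

Definition chol k i l : R := chol_col (residual k l) l i.

Lemma residual_psd k n : psd k -> psd (residual k n).
Proof. by move=> pk; elim: n => //= n; exact: schur_psd. Qed.

Lemma residual_zero k n i j : psd k -> (j < n)%N -> residual k n i j = 0.
Proof.
move=> pk; elim: n i j => //= n IH i j; rewrite ltnS leq_eqVlt => /orP[/eqP ->|jn].
  exact: schur_zero (residual_psd n pk).
have [sk _] := residual_psd n pk.
by rewrite /schur /chol_col IH // (sk j n) (IH n j jn) mul0r if_same mulr0 subr0.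
Qed.

Lemma chol_upper k i l : psd k -> (i < l)%N -> chol k i l = 0.
Proof.
move=> pk il; have [sk _] := residual_psd l pk.
by rewrite /chol /chol_col (sk i l) (residual_zero l pk il) mul0r if_same.
Qed.

(** The residual after [m] eliminations is [k] minus the first [m] products, and it vanishes in
    every column already eliminated. *)
Lemma cholE k n i j : psd k -> (j < n)%N -> k i j = \sum_(l < n) chol k i l * chol k j l.
Proof.
move=> pk jn; suff H m : residual k m i j = k i j - \sum_(l < m) chol k i l * chol k j l.
  by have := residual_zero i pk jn; rewrite H => /eqP; rewrite subr_eq0 => /eqP.
by elim: m => [|m IH]; rewrite ?big_ord0 ?subr0 // big_ord_recr /= opprD addrA -IH.
Qed.

End Cholesky.

(** * A Gaussian sequence from Brownian increments *)

Section GaussianSequence.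
Context {R : realType} d (T : measurableType d) (P : probability T R).
Local Notation C := R[i].
Local Notation M := 'M[C]_1.
Variables (F : R -> set (set T)) (K : R -> T -> M).
Hypothesis flt : filtration F.
Hypothesis bm : uN_brownian P F K.

(** For [N = 1] the skew-Hermitian matrices are the imaginary numbers with their usual norm, so each
    unit increment is [i] times a standard normal variable. *)
Definition xi n x : R := complex.Im ((K n.+1%:R x - K n%:R x) ord0 ord0).

Lemma xi_gauss n : gaussian_law P (xi n) 0 1.
Proof.
have n0 : 0 <= n%:R :> R by [].
have nn : n%:R < n.+1%:R :> R by rewrite ltr_nat.
have [_ _ _ _ /(_ _ _ n0 nn)[_ g]] := bm.
pose X : M := const_mx (0 +i* 1).
have innerE (D : M) : uN_inner X D = complex.Im (D ord0 ord0).
  rewrite /uN_inner /mxtrace big_ord1 mxE big_ord1 mxE; case: (D _ _) => u v /=; ring.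
have sX : skew_hermitian X.
  apply/matrixP => i j; rewrite tcE !mxE; apply: complex_ext; rewrite /=; ring.
have E : (fun x => uN_inner X (K n.+1%:R x - K n%:R x)) = xi n.
  by apply/funext => x; exact: innerE.
have V : uN_inner X X = 1 by rewrite innerE mxE.
by have := g X sX; rewrite E V -natrB // subSnn mulr1 sqrtr1.
Qed.

Definition cis (r : R) : C := cos r +i* sin r.

Lemma cisD a b : cis (a + b) = cis a * cis b.
Proof. by apply: complex_ext; rewrite /= ?cosD ?sinD; ring. Qed.

Lemma cabs_cis r : cabs (cis r) = 1.
Proof. by rewrite cabsE /= cos2Dsin2 sqrtr1. Qed.

Lemma cis_meas d' (T' : measurableType d') (f : T' -> R) : measurable_fun setT f -> cmeas (fun x => cis (f x)).
Proof.
move=> mf; split => /=; apply: measurableT_comp => //; apply: continuous_measurable_fun.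
  exact: continuous_cos.
exact: continuous_sin.
Qed.

Lemma xi_Fmeas n c : Fmeas F n.+1%:R (fun x => cis (c * xi n x)).
Proof.
apply: cis_meas; apply: measurable_funM; first exact: measurable_cst.
have [] : Fmeas F n.+1%:R (fun x => (K n.+1%:R x - K n%:R x) ord0 ord0); last by [].
under eq_fun do rewrite !mxE; apply: cmeasB; first exact: (K_Fmeas flt bm).
by apply: (Fmeas_mono flt _ _ (K_Fmeas flt bm _ _ _)) => //; rewrite ler_nat.
Qed.

(** The partial sum is known at time [n] and the next increment is independent of that past. Complex
    exponentials make the factorisation multiplicative and the induction immediate. *)
Lemma xi_charfun n (l : nat -> R) :
  Cexp P (fun x => cis (\sum_(k < n) l k * xi k x)) = (expR (- (\sum_(k < n) l k ^+ 2) / 2))%:C.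
Proof.
pose Z n x := cis (\sum_(k < n) l k * xi k x).
have ZF m : Fmeas F m%:R (Z m).
  elim: m => [|m IH]; first by rewrite /Z; under eq_fun do rewrite big_ord0; exact: cmeas_cst.
  rewrite /Z; under eq_fun do rewrite big_ord_recr /= cisD.
  apply: cmeasM; last exact: xi_Fmeas.
  by apply: (Fmeas_mono flt _ _ IH) => //; rewrite ler_nat.
elim: n => [|n IH].
  under eq_Cexp do rewrite big_ord0; rewrite Cexp_cst big_ord0 oppr0 mul0r expR0.
  by apply: complex_ext; rewrite /= ?cos0 ?sin0.
have n0 : 0 <= n%:R :> R by [].
have nn : n%:R < n.+1%:R :> R by rewrite ltr_nat.
have [_ _ _ _ /(_ _ _ n0 nn)[ind _]] := bm.
pose W x := cis (l n * xi n x).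
under eq_Cexp do rewrite big_ord_recr /= cisD.
pose D := entries (fun x => K n.+1%:R x - K n%:R x).
have mW : @cmeas R _ (g_sigma_algebraType (sigma_of D)) W.
  apply: cis_meas; apply: measurable_funM; first exact: measurable_cst.
  have [] : @cmeas R _ (g_sigma_algebraType (sigma_of D)) (fun x => (K n.+1%:R x - K n%:R x) ord0 ord0); last by [].
  by apply: sigma_of_cmeas_self; exists ord0, ord0.
have sD : <<s sigma_of D>> `<=` measurable.
  by rewrite sigma_of_id; apply: sigma_of_sub => f [i [j ->]]; apply: (dK_meas flt bm) => //; exact: ltW.
have mZ := Fmeas_meas flt n0 (ZF n).
have mW' : cmeas W by apply: cmeas_sub sD _ mW.
rewrite (Cexp_indep (F_sub flt n0) sD _ (ZF n) mW).
- rewrite IH; have [c s] := gaussian_charfun (l n) ler01 (xi_gauss n).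
  have -> : Cexp P W = (expR (- (l n) ^+ 2 / 2))%:C.
    by rewrite CexpE; apply: complex_ext => /=; [rewrite -/(Ex _ _) c mulr1|rewrite -/(Ex _ _) s].
  rewrite big_ord_recr /= -rmorphM -expRD; congr (expR _)%:C; ring.
- by move=> A B; rewrite F_id // sigma_of_id; exact: ind.
- by apply: (@cintg_bnd _ _ _ _ _ 1) => // x; rewrite cabs_cis.
- by apply: (@cintg_bnd _ _ _ _ _ 1) => // x; rewrite cabs_cis.
- apply: (@intg_bnd _ _ _ _ _ 1) => [|x]; first by apply: measurable_funM; exact: cmeas_cabs.
  by rewrite !cabs_cis mulr1 normr1.
Qed.

Lemma xi_sum_gauss n (l : nat -> R) :
  gaussian_law P (fun x => \sum_(k < n) l k * xi k x) 0 (Num.sqrt (\sum_(k < n) l k ^+ 2)).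
Proof.
have s0 : 0 <= \sum_(k < n) l k ^+ 2 by apply: sumr_ge0 => k _; exact: sqr_ge0.
have mxi k : measurable_fun setT (xi k) by have [] := xi_gauss k.
have mS : measurable_fun setT (fun x => \sum_(k < n) l k * xi k x).
  by apply: measurable_sum => k; apply: measurable_funM.
have E c : Cexp P (fun x => cis (c * \sum_(k < n) l k * xi k x)) =
    (expR (- (c * Num.sqrt (\sum_(k < n) l k ^+ 2)) ^+ 2 / 2))%:C.
  rewrite exprMn sqr_sqrtr // mulr_sumr.
  have -> : \sum_(k < n) c ^+ 2 * l k ^+ 2 = \sum_(k < n) (c * l k) ^+ 2 by apply: eq_bigr => k _; rewrite exprMn.
  rewrite -(xi_charfun n (fun k => c * l k)); apply: eq_Cexp => x; congr cis; rewrite mulr_sumr.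
  by apply: eq_bigr => k _; rewrite mulrA.
apply: gaussian_of_charfun => //.
- apply: (@intg_le _ _ _ _ _ (fun x => 2 ^+ size (index_enum 'I_n) * \sum_(k < n) (l k * xi k x) ^+ 2)).
  + exact: measurable_funX.
  + by move=> x; rewrite ger0_norm ?sqr_ge0 // sum_pow2.
  + apply: intgZ; apply: intg_sum => k _; under eq_fun do rewrite exprMn.
    apply: intgZ; exact: (gaussian_intgX (xi_gauss k) 2).
- by move=> c; have := congr1 (@complex.Re R) (E c); rewrite CexpE.
- by move=> c; have := congr1 (@complex.Im R) (E c); rewrite CexpE.
Qed.

Variable k : nat -> nat -> R.
Hypothesis pk : psd k.

(** Triangularity makes each coordinate a finite sum, so the whole infinite field is defined without
    any series. *)
Definition gfield i x : R := \sum_(l < i.+1) chol k i l * xi l x.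

Lemma gfield_widen n i x : (i < n)%N -> gfield i x = \sum_(l < n) chol k i l * xi l x.
Proof.
move=> ni; rewrite /gfield (big_ord_widen n (fun l => chol k i l * xi l x)) // big_mkcond.
by apply: eq_bigr => l _; case: ifPn => //; rewrite -leqNgt => il; rewrite chol_upper // mul0r.
Qed.

Lemma gfield_gauss (I : finType) (g : I -> nat) (c : I -> R) :
  let v := \sum_a \sum_b c a * c b * k (g a) (g b) in
  0 <= v /\ gaussian_law P (fun x => \sum_a c a * gfield (g a) x) 0 (Num.sqrt v).
Proof.
pose n := (\sum_a (g a).+1)%N.
have gn a : (g a < n)%N by rewrite /n (bigD1 a) //= leq_addr.
have E x : \sum_a c a * gfield (g a) x = \sum_(l < n) (\sum_a c a * chol k (g a) l) * xi l x.
  transitivity (\sum_a \sum_(l < n) c a * chol k (g a) l * xi l x).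
    by apply: eq_bigr => a _; rewrite (gfield_widen _ (gn a)) mulr_sumr; apply: eq_bigr => l _; rewrite mulrA.
  by rewrite exchange_big; apply: eq_bigr => l _; rewrite mulr_suml.
have V : \sum_a \sum_b c a * c b * k (g a) (g b) = \sum_(l < n) (\sum_a c a * chol k (g a) l) ^+ 2.
  transitivity (\sum_a \sum_b \sum_(l < n) (c a * chol k (g a) l) * (c b * chol k (g b) l)).
    apply: eq_bigr => a _; apply: eq_bigr => b _; rewrite (cholE (g a) pk (gn b)) mulr_sumr.
    by apply: eq_bigr => l _; ring.
  under eq_bigr do rewrite exchange_big.
  rewrite exchange_big; apply: eq_bigr => l _ /=; rewrite expr2 mulr_suml.
  by apply: eq_bigr => a _; rewrite mulr_sumr.
move=> v; rewrite /v V; split; first by apply: sumr_ge0 => l _; exact: sqr_ge0.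
rewrite (_ : (fun x => _) = (fun x => \sum_(l < n) (\sum_a c a * chol k (g a) l) * xi l x)); last exact/funext.
exact: (xi_sum_gauss n (fun l => \sum_a c a * chol k (g a) l)).
Qed.

Lemma gfield_meas i : measurable_fun setT (gfield i) /\ intg P (fun x => gfield i x ^+ 2).
Proof.
have [v0 g] := gfield_gauss (fun _ : unit => i) (fun=> 1).
have E : (fun x => \sum_(a : unit) 1 * gfield i x) = gfield i.
  by apply/funext => x; rewrite (big_pred1 tt) ?mul1r // => -[].
rewrite E in g; split; first by have [] := g.
exact: (gaussian_intgX g 2).
Qed.

Lemma gfield_mean i : Ex P (gfield i) = 0.
Proof.
have [v0 g] := gfield_gauss (fun _ : unit => i) (fun=> 1).
have E : (fun x => \sum_(a : unit) 1 * gfield i x) = gfield i.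
  by apply/funext => x; rewrite (big_pred1 tt) ?mul1r // => -[].
by rewrite E in g; exact: (gaussian_mean g).
Qed.

(** Polarisation from the variances of combinations with coefficients 0 and 1. *)
Lemma gfield_cov i j : intg P (fun x => gfield i x * gfield j x) /\
  Ex P (fun x => gfield i x * gfield j x) = k i j.
Proof.
have [mi ii] := gfield_meas i; have [mj ij] := gfield_meas j.
have iij : intg P (fun x => gfield i x * gfield j x) by exact: intgM.
split=> //.
have V (a b : nat) (r s : R) : Ex P (fun x => (r * gfield a x + s * gfield b x) ^+ 2) =
   r * r * k a a + r * s * k a b + (s * r * k b a + s * s * k b b).
  have [v0 g] := gfield_gauss (fun c : bool => if c then a else b) (fun c => if c then r else s).
  have := gaussian_var g; rewrite sqr_sqrtr // !big_bool /= => <-.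
  by apply: eq_Ex => x; rewrite big_bool.
have e1 := V i j 1 1; have e2 := V i j 1 0; have e3 := V i j 0 1.
have sk : k j i = k i j by have [-> _] := pk.
have e4 : Ex P (fun x => (1 * gfield i x + 1 * gfield j x) ^+ 2) =
   Ex P (fun x => gfield i x ^+ 2) + (2 * Ex P (fun x => gfield i x * gfield j x) + Ex P (fun x => gfield j x ^+ 2)).
  rewrite -ExZ // -ExD //; last exact: intgZ.
  rewrite -ExD //; last by apply: intgD => //; exact: intgZ.
  by apply: eq_Ex => x; ring.
have e5 : Ex P (fun x => gfield i x ^+ 2) = k i i.
  transitivity (Ex P (fun x => (1 * gfield i x + 0 * gfield j x) ^+ 2)); last by rewrite e2; ring.
  by apply: eq_Ex => x; ring.
have e6 : Ex P (fun x => gfield j x ^+ 2) = k j j.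
  transitivity (Ex P (fun x => (0 * gfield i x + 1 * gfield j x) ^+ 2)); last by rewrite e3; ring.
  by apply: eq_Ex => x; ring.
move: e1; rewrite e4 e5 e6 sk; move: (Ex P _) => z; lra.
Qed.

End GaussianSequence.

Section FinalLemmas.
Context {R : realType}.

(** A deterministic shift separates by the addition formulas, with coefficients tending to 1 and
    0. *)
Lemma trig_shift_cvg (d : nat -> measure_display) (T : forall N, measurableType (d N))
    (P : forall N, probability (T N) R) (Z : forall N, T N -> R) (e : nat -> R) (v : R) :
  (forall N, measurable_fun setT (Z N)) -> e N @[N --> \oo] --> 0 ->
  Ex (P N) (fun x => cos (Z N x)) @[N --> \oo] --> v ->
  Ex (P N) (fun x => sin (Z N x)) @[N --> \oo] --> 0 ->
  Ex (P N) (fun x => cos (Z N x + e N)) @[N --> \oo] --> v /\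
  Ex (P N) (fun x => sin (Z N x + e N)) @[N --> \oo] --> 0.
Proof.
move=> mZ e0 cc cs.
have ce : cos (e N) @[N --> \oo] --> (1 : R).
  by rewrite -cos0; apply: (@continuous_cvg _ _ _ (nbhs \oo)) => //; exact: continuous_cos.
have se : sin (e N) @[N --> \oo] --> (0 : R).
  by rewrite -[X in _ --> X]sin0; apply: (@continuous_cvg _ _ _ (nbhs \oo)) => //; exact: continuous_sin.
have ic N : intg (P N) (fun x => cos (Z N x)).
  apply: (@intg_bnd _ _ _ _ _ 1) => [|x]; last by rewrite ler_norml cos_geN1 cos_le1.
  by apply: measurableT_comp => //; apply: continuous_measurable_fun; exact: continuous_cos.
have is_ N : intg (P N) (fun x => sin (Z N x)).
  apply: (@intg_bnd _ _ _ _ _ 1) => [|x]; last by rewrite ler_norml sin_geN1 sin_le1.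
  by apply: measurableT_comp => //; apply: continuous_measurable_fun; exact: continuous_sin.
split.
  have -> : (fun N => Ex (P N) (fun x => cos (Z N x + e N))) =
     (fun N => cos (e N) * Ex (P N) (fun x => cos (Z N x)) + - sin (e N) * Ex (P N) (fun x => sin (Z N x))).
    apply/funext => N; rewrite -ExZ // -ExZ // -ExD; [|exact: intgZ..].
    by apply: eq_Ex => x; rewrite cosD; ring.
  have -> : v = 1 * v + - 0 * 0 by rewrite mul1r mulr0 addr0.
  by apply: cvgD; apply: cvgM => //; exact: cvgN.
have -> : (fun N => Ex (P N) (fun x => sin (Z N x + e N))) =
   (fun N => cos (e N) * Ex (P N) (fun x => sin (Z N x)) + sin (e N) * Ex (P N) (fun x => cos (Z N x))).
  apply/funext => N; rewrite -ExZ // -ExZ // -ExD; [|exact: intgZ..].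
  by apply: eq_Ex => x; rewrite sinD; ring.
have -> : 0 = 1 * 0 + 0 * v :> R by rewrite mulr0 mul0r addr0.
by apply: cvgD; apply: cvgM.
Qed.

Lemma lincomb_cvg0 (I : finType) (l : I -> R) (e : I -> nat -> R) :
  (forall i, e i N @[N --> \oo] --> 0) -> (\sum_i l i * e i N) @[N --> \oo] --> (0 : R).
Proof.
move=> H; have : (\sum_i l i * e i N) @[N --> \oo] --> \sum_(i : I) l i * 0.
  by apply: cvg_sumR => i; apply: cvgM; [exact: cvg_cst|exact: H].
by rewrite [X in _ --> X]big1 // => i _; rewrite mulr0.
Qed.

(** The Cholesky elimination runs over [nat], so the countable index set is coded by [pickle];
    numbers that code nothing get zero rows and columns, harmless for positivity. *)
Definition nat_kernel (J : countType) (k : J -> J -> R) (i j : nat) : R :=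
  if unpickle i is Some a then if unpickle j is Some b then k a b else 0 else 0.

Lemma nat_kernelE (J : countType) (k : J -> J -> R) a b : nat_kernel k (pickle a) (pickle b) = k a b.
Proof. by rewrite /nat_kernel !pickleK. Qed.

Lemma nat_kernel_psd (J : countType) (k : J -> J -> R) : (forall a b, k a b = k b a) ->
  (forall s : seq (R * J), 0 <= \sum_(p <- s) \sum_(p' <- s) p.1 * p'.1 * k p.2 p'.2) ->
  psd (nat_kernel k).
Proof.
move=> sk pk; split=> [i j|s].
  by rewrite /nat_kernel; case: unpickle => [a|]; case: unpickle => [b|].
pose dec (p : R * nat) : option (R * J) := omap (fun j => (p.1, j)) (unpickle p.2).
have E (f : R * J -> R) (s' : seq (R * nat)) : \sum_(p <- pmap dec s') f p = \sum_(p <- s') oapp f 0 (dec p).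
  elim: s' => [|p s' IH]; first by rewrite !big_nil.
  by rewrite big_cons /=; case: (dec p) => [p'|] /=; rewrite ?big_cons IH ?add0r.
have := pk (pmap dec s); rewrite E; congr (_ <= _); apply: eq_bigr => p _.
rewrite /dec /nat_kernel; case: (unpickle p.2) => [a|] /=; last by rewrite big1 // => p' _; rewrite mulr0.
by rewrite E; apply: eq_bigr => p' _; rewrite /dec; case: (unpickle p'.2) => [b|] /=; rewrite ?mulr0.
Qed.

Lemma expectation_Ex d (T : measurableType d) (P : probability T R) (f : T -> R) :
  intg P f -> ('E_P[f])%E = (Ex P f)%:E.
Proof.
move=> i; rewrite /Ex fineK // unlock; exact: integrable_fin_num.
Qed.

End FinalLemmas.

Unset Implicit Arguments.
Set Strict Implicit.
Set Printing Implicit Defensive.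

Theorem proposition3 (R : realType) (q : nat) (q_gt0 : (0 < q)%N)
    (t : 'I_q -> R) (t_ge0 : forall i, 0 <= t i)
    (d : nat -> measure_display) (T : forall N, measurableType (d N))
    (P : forall N, probability (T N) R)
    (U : forall N, 'I_q -> R -> T N -> 'M[R[i]]_N)
    (U_bm : forall N i, unitary_brownian (P N) (U N i))
    (U_indep : forall N, independent_processes (P N) (U N)) :
  exists (d' : measure_display) (T' : measurableType d')
      (Q : probability T' R) (Phi : word q -> T' -> R[i]),
    [/\ centered_gaussian_field Q Phi,
        forall w w', Ccov Q (Phi w) (Phi w') = phi2 P U t w w' /\
          Cexp Q (fun x => Phi w x * Phi w' x) = phi2 P U t w w' &
        fdd_cvg P
          (fun N w x => word_tr U t w x - N%:R * phi1 P U t w) Q Phi].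

Proof.
(* The source of randomness for the limit: since [q] is positive, the space of index 1 carries a
   driving Brownian motion. *)
have [F [K [[flt bm _] _]]] := U_bm 1%N (Ordinal q_gt0).
have [k [Y [de [[ks kp kphi] [Ym Yvar Ychar de0 XE]]]]] := fluctuation_limit q t t_ge0 d T P U U_bm U_indep.
pose kn := nat_kernel k; have pkn : psd kn by exact: nat_kernel_psd.
pose G (j : word q * bool) := gfield K kn (pickle j).
have Gcov j j' : intg (P 1%N) (fun x => G j x * G j' x) /\ Ex (P 1%N) (fun x => G j x * G j' x) = k j j'.
  by have [h1 h2] := gfield_cov flt bm pkn (pickle j) (pickle j'); rewrite /kn nat_kernelE in h2.
have Gmeas j : measurable_fun setT (G j) /\ intg (P 1%N) (fun x => G j x ^+ 2).
  exact: (gfield_meas flt bm pkn).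
have Ggauss (I : finType) (g : I -> word q * bool) (l : I -> R) :
   let v := \sum_i \sum_i' l i * l i' * k (g i) (g i') in
   0 <= v /\ gaussian_law (P 1%N) (fun x => \sum_i l i * G (g i) x) 0 (Num.sqrt v).
  have := gfield_gauss flt bm pkn (fun i => pickle (g i)) l.
  have -> : \sum_a \sum_b l a * l b * kn (pickle (g a)) (pickle (g b)) = \sum_i \sum_i' l i * l i' * k (g i) (g i').
    by apply: eq_bigr => i _; apply: eq_bigr => i' _; rewrite /kn nat_kernelE.
  by [].
exists (d 1%N), (T 1%N), (P 1%N), (fun w x => G (w, true) x +i* G (w, false) x); split.
- move=> n w c.
  (* The real part of [c * z] is [Re c * Re z - Im c * Im z]. *)
  pose l (a : 'I_n * bool) := if a.2 then complex.Re (c a.1) else - complex.Im (c a.1).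
  have [v0 g] := Ggauss _ (fun a : 'I_n * bool => (w a.1, a.2)) l.
  exists (Num.sqrt (\sum_i \sum_i' l i * l i' * k (w i.1, i.2) (w i'.1, i'.2))); first exact: sqrtr_ge0.
  rewrite (_ : (fun x => complex.Re _) = (fun x => \sum_a l a * G (w a.1, a.2) x)) //; apply/funext => x.
  rewrite Re_sum -(pair_bigA _ (fun i b => l (i, b) * G (w i, b) x)) /=; apply: eq_bigr => i _.
  by rewrite big_bool /l /= ReM /= mulNr.
- move=> w w'.
  have EG : Cexp (P 1%N) (fun x => (G (w, true) x +i* G (w, false) x) * (G (w', true) x +i* G (w', false) x)) = phi2 P U t w w'.
    rewrite kphi CexpE -/(Ex _ _) -/(Ex _ _) -!(Gcov _ _).2 -ExB ?(Gcov _ _).1 // -ExD ?(Gcov _ _).1 //.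
  split=> //; rewrite /Ccov EG.
  have E0 u : Cexp (P 1%N) (fun x => G (u, true) x +i* G (u, false) x) = 0.
    rewrite CexpE -/(Ex _ _) -/(Ex _ _); apply: complex_ext => /=; exact: (gfield_mean flt bm pkn).
  by rewrite !E0 mulr0 subr0.
move=> n w f cf [Mf fM].
pose I := ('I_n * bool)%type.
pose f' (v : I -> R) := f (\row_i v (i, true), \row_i v (i, false)).
have uf : box_unif f' by exact: continuous_box_unif.
have fM' v : `|f' v| <= Mf by exact: fM.
(* The deterministic bias in each real coordinate; it tends to 0 and is absorbed by
   [trig_shift_cvg]. *)
pose dr (a : I) N : R := if a.2 then complex.Re (de N (w a.1)) else complex.Im (de N (w a.1)).
pose X N (x : T N) (a : I) : R := Y N (w a.1, a.2) x + dr a N.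
pose Z (x : T 1%N) (a : I) : R := G (w a.1, a.2) x.
have dr0 a : dr a N @[N --> \oo] --> 0.
  by rewrite /dr; case: a.2; [exact: (ccvg_Re (de0 (w a.1)))|exact: (ccvg_Im (de0 (w a.1)))].
have mX N a : measurable_fun setT (fun x => X N x a).
  by apply: measurable_funD => //; have [] := Ym N (w a.1, a.2).
have mZ a : measurable_fun setT (fun x => Z x a) by exact: (Gmeas _).1.
have iY N j : intg (P N) (Y N j) /\ intg (P N) (fun x => Y N j x ^+ 2).
  have [mY [c bY]] := Ym N j; split; first exact: intg_bnd bY.
  apply: (@intg_bnd _ _ _ _ _ (c ^+ 2)) => [|x]; first exact: measurable_funX.
  by rewrite normrX lerXn2r ?nnegrE // (le_trans _ (bY x)).
have X2 N a x : X N x a ^+ 2 <= 2 * Y N (w a.1, a.2) x ^+ 2 + 2 * dr a N ^+ 2.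
  rewrite -subr_ge0 (_ : _ - _ = (Y N (w a.1, a.2) x - dr a N) ^+ 2) ?sqr_ge0 //; rewrite /X; ring.
have iB N a : intg (P N) (fun x => 2 * Y N (w a.1, a.2) x ^+ 2 + 2 * dr a N ^+ 2).
  by apply: intgD; [apply: intgZ; exact: (iY _ _).2|exact: intg_cst].
have iX2 N a : intg (P N) (fun x => X N x a ^+ 2).
  apply: intg_le (iB N a) => [|x]; first exact: measurable_funX.
  by rewrite ger0_norm ?sqr_ge0.
have k0 j : 0 <= k j j by rewrite -(Gcov j j).2; apply: Ex_ge0 => x; rewrite -expr2 sqr_ge0.
(* A square of [X] is at most twice that of [Y] plus twice that of the bias; eventually the variance
   of [Y] is within 1 of its limit and the bias is below 1. Summation makes the bound common to all
   coordinates. *)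
pose Kb : R := \sum_(a : I) (2 * (k (w a.1, a.2) (w a.1, a.2) + 1) + 2).
have Kba a : 2 * (k (w a.1, a.2) (w a.1, a.2) + 1) + 2 <= Kb.
  rewrite /Kb (bigD1 a) //= lerDl sumr_ge0 // => b _.
  by rewrite addr_ge0 // mulr_ge0 // addr_ge0.
have XKb : \forall N \near \oo, forall a, Ex (P N) (fun x => X N x a ^+ 2) <= Kb.
  apply: filter_forall => a; have /cvgrPdist_lt/(_ 1 ltr01) := Yvar (w a.1, a.2).
  have /cvgrPdist_lt/(_ 1 ltr01) := dr0 a; apply: filterS2 => N h1 h2.
  apply: le_trans (Kba a); apply: (le_trans (le_Ex (iX2 N a) (iB N a) (X2 N a))).
  rewrite ExD; [|by apply: intgZ; exact: (iY _ _).2|exact: intg_cst].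
  rewrite ExZ; last exact: (iY _ _).2.
  rewrite Ex_cst; apply: lerD.
    rewrite ler_wpM2l //; move: h2; rewrite ltr_norml => /andP[+ _].
    rewrite (_ : Ex (P N) (fun x => Y N (w a.1, a.2) x ^+ 2) = Ex (P N) (fun x => Y N (w a.1, a.2) x * Y N (w a.1, a.2) x)).
      by move: (Ex _ _) (k _ _) => u v; lra.
    by apply: eq_Ex => x; rewrite expr2.
  by move: h1; rewrite sub0r normrN ltr_norml; move: (dr a N) => u /andP[u1 u2]; nra.
have ZKb a : Ex (P 1%N) (fun x => Z x a ^+ 2) <= Kb.
  apply: le_trans (Kba a); under eq_Ex do rewrite expr2.
  rewrite (Gcov _ _).2; have := k0 (w a.1, a.2); move: (k _ _) => u; lra.
have trigE (l : I -> R) : [/\ Ex (P N) (fun x => cos (dotp l (X N x))) @[N --> \oo] --> Ex (P 1%N) (fun x => cos (dotp l (Z x))) &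
    Ex (P N) (fun x => sin (dotp l (X N x))) @[N --> \oo] --> Ex (P 1%N) (fun x => sin (dotp l (Z x)))].
  have [v0 [c1 s1]] := Ychar I (fun a => (w a.1, a.2)) l.
  have [_ g] := Ggauss I (fun a => (w a.1, a.2)) l.
  have [c2 s2] := gaussian_charfun 1 (sqrtr_ge0 _) g.
  rewrite mul1r sqr_sqrtr // in c2.
  have -> : Ex (P 1%N) (fun x => cos (dotp l (Z x))) = expR (- (\sum_i \sum_i' l i * l i' * k (w i.1, i.2) (w i'.1, i'.2)) / 2).
    by rewrite -c2; apply: eq_Ex => x; rewrite mul1r.
  have -> : Ex (P 1%N) (fun x => sin (dotp l (Z x))) = 0 by rewrite -s2; apply: eq_Ex => x; rewrite mul1r.
  have XY N x : dotp l (X N x) = \sum_i l i * Y N (w i.1, i.2) x + \sum_i l i * dr i N.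
    by rewrite /dotp -big_split; apply: eq_bigr => i _; rewrite /X mulrDr.
  have e0 := lincomb_cvg0 l dr0.
  have mY N : measurable_fun setT (fun x => \sum_i l i * Y N (w i.1, i.2) x).
    by apply: measurable_sum => i; apply: measurable_funM => //; have [] := Ym N (w i.1, i.2).
  have [t1 t2] := trig_shift_cvg mY e0 c1 s1.
  split.
    rewrite (_ : (fun N => _) = (fun N => Ex (P N) (fun x => cos (\sum_i l i * Y N (w i.1, i.2) x + \sum_i l i * dr i N)))) //.
    by apply/funext => N; apply: eq_Ex => x; rewrite XY.
  rewrite (_ : (fun N => _) = (fun N => Ex (P N) (fun x => sin (\sum_i l i * Y N (w i.1, i.2) x + \sum_i l i * dr i N)))) //.
  by apply/funext => N; apply: eq_Ex => x; rewrite XY.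
have mf N : measurable_fun setT (fun x => f' (X N x)) by exact: (box_unif_meas (mX N) fM' uf).
have mfZ : measurable_fun setT (fun x => f' (Z x)) by exact: (box_unif_meas mZ fM' uf).
have iZ2 a : intg (P 1%N) (fun x => Z x a ^+ 2) by exact: (Gmeas _).2.
have := weak_cvg_of_charfun mX mZ iX2 iZ2 XKb ZKb (fun l => (trigE l).1)
  (fun l => (trigE l).2) fM' uf mf mfZ.
have EX N : ('E_(P N)[fun x => f (\row_i complex.Re (word_tr U t (w i) x - N%:R * phi1 P U t (w i))%R,
     \row_i complex.Im (word_tr U t (w i) x - N%:R * phi1 P U t (w i))%R)])%E = (Ex (P N) (fun x => f' (X N x)))%:E.
  rewrite -expectation_Ex; last by apply: (@intg_bnd _ _ _ _ _ Mf).
  congr ('E_(P N)[_])%E; apply/funext => x; congr (f (_, _)); apply/matrixP => i j; rewrite !mxE XE /X /dr /=.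
    by rewrite ReD.
  by rewrite ImD.
have EZ : ('E_(P 1%N)[fun x => f (\row_i complex.Re (G (w i, true) x +i* G (w i, false) x),
     \row_i complex.Im (G (w i, true) x +i* G (w i, false) x))])%E = (Ex (P 1%N) (fun x => f' (Z x)))%:E.
  by rewrite -expectation_Ex //; apply: (@intg_bnd _ _ _ _ _ Mf).
move=> H; rewrite EZ (_ : (fun N => _) = EFin \o (fun N => Ex (P N) (fun x => f' (X N x)))).
  by apply: cvg_EFin => //; exact: nearW.
by apply/funext => N; rewrite /= -EX.
Qed.
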